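(* Suppose that $d=6$, $k=1$, and $\hat W=(\hat W_1,\dots,\hat W_d)$ is $\mathbb{R}^d$-valued space-time white noise on $\mathbb{R}_+\times\mathbb{R}$. For $j=1,\dots,d$, let $\sigma_j:\mathbb{R}\times\mathbb{R}\to\mathbb{R}$ be continuous functions such that for all $T\in\mathbb{R}_+$ there are $0<c_T<C_T<\infty$ with $c_T\le\sigma_j(t,x)\le C_T$ for all $(t,x)\in[0,T]\times\mathbb{R}$, and suppose that, for each $j$, the Fourier transform $\mu_j=\mathcal{F}_{s,y}\sigma_j$ is a measure on $\mathbb{R}\times\mathbb{R}$ with compact support and finite total variation. Then points are polar for the ($\mathbb{R}^d$-valued, continuous) mild solution $(\hat v(t,x))$ of the stochastic heat equation with nonconstant deterministic coefficients $$\frac{\partial}{\partial t}\hat v_j(t,x)=\frac{\partial^2}{\partial x^2}\hat v_j(t,x)+\sigma_j(t,x)\dot{\hat W}_j(t,x),\quad j=1,\dots,d,\qquad\hat v(0,x)=0,\ x\in\mathbb{R};$$ that is, for all $z\in\mathbb{R}^6$, $P\{\exists(t,x)\in\,]0,\infty[\,\times\mathbb{R}:\hat v(t,x)=z\}=0$.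
   Context: Space-time white noise: centered Gaussian with $E(\hat W_\ell(\varphi)\hat W_j(\psi))=\delta_{\ell,j}\int_{\mathbb{R}_+}dr\int_{\mathbb{R}}dy\,\varphi(r,y)\psi(r,y)$. Mild solution: $\hat v_j(t,x)=\int_0^t\int_{\mathbb{R}}G(t-s,x-y)\sigma_j(s,y)\,\hat W_j(ds,dy)$ (Wiener integral), with $G(t,x)=(4\pi t)^{-1/2}e^{-x^2/(4t)}$; the version with continuous sample paths is used. $\mathcal{F}_{s,y}$ is the Fourier transform in $(s,y)\in\mathbb{R}\times\mathbb{R}$, $\mathcal{F}_{s,y}\varphi(\tau,\xi)=\int\int e^{-i\tau s-i\xi y}\varphi(s,y)\,ds\,dy$, extended to tempered distributions. *)

(* Defs.v *)
From HB Require Import structures.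
From mathcomp Require Import all_boot all_order all_algebra.
From mathcomp Require Import complex.
From mathcomp Require Import all_classical all_reals all_analysis.

Set Implicit Arguments.
Unset Strict Implicit.
Unset Printing Implicit Defensive.

Import Order.TTheory GRing.Theory Num.Theory.
Import numFieldNormedType.Exports.

Local Open Scope classical_set_scope.
Local Open Scope ring_scope.

(* Points of R * R are (time, space) = (s, y), or (tau, xi) on the Fourier
   side. *)

(* R * R with the measurable structure on which the product of two Lebesgue
   measures is defined. *)
Notation plane R := (measurableTypeR R * measurableTypeR R)%type.

Definition leb2 (R : realType) : {measure set (plane R) -> \bar R} :=
  (@lebesgue_measure R \x @lebesgue_measure R)%E.

Definition d_time (R : realType) (f : R * R -> R) : R * R -> R :=
  fun z => derive1 (fun s => f (s, z.2)) z.1.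

Definition d_space (R : realType) (f : R * R -> R) : R * R -> R :=
  fun z => derive1 (fun y => f (z.1, y)) z.2.

(* A word of booleans is a mixed partial derivative: [true] is d/ds and
   [false] is d/dy. *)
Definition partial (R : realType) (w : seq bool) (f : R * R -> R)
  : R * R -> R :=
  foldr (fun b g => if b then d_time g else d_space g) f w.

Definition smooth (R : realType) (f : R * R -> R) : Prop :=
  forall w : seq bool,
    continuous (partial w f) /\
    forall z : R * R,
      derivable (fun s : R => partial w f (s, z.2)) z.1 1 /\
      derivable (fun y : R => partial w f (z.1, y)) z.2 1.

Definition schwartz_real (R : realType) (f : R * R -> R) : Prop :=
  smooth f /\
  forall (a b : nat) (w : seq bool), exists M : R, forall z : R * R,
    `|z.1 ^+ a * z.2 ^+ b * partial w f z| <= M.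

Definition seminorm_real (R : realType) (N : nat) (f : R * R -> R) : R :=
  sup [set r | exists (a b : nat) (w : seq bool) (z : R * R),
    [/\ (a <= N)%N, (b <= N)%N, (size w <= N)%N &
        r = `|z.1 ^+ a * z.2 ^+ b * partial w f z|]].

Definition re_fun (R : realType) (f : R * R -> R[i]) : R * R -> R :=
  fun z => complex.Re (f z).

Definition im_fun (R : realType) (f : R * R -> R[i]) : R * R -> R :=
  fun z => complex.Im (f z).

Definition schwartz (R : realType) (f : R * R -> R[i]) : Prop :=
  schwartz_real (re_fun f) /\ schwartz_real (im_fun f).

Definition seminorm (R : realType) (N : nat) (f : R * R -> R[i]) : R :=
  seminorm_real N (re_fun f) + seminorm_real N (im_fun f).

(* The values of [T] outside of the Schwartz space are irrelevant. *)
Definition tempered_distribution (R : realType)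
    (T : (R * R -> R[i]) -> R[i]) : Prop :=
  (forall (a : R[i]) (f g : R * R -> R[i]), schwartz f -> schwartz g ->
     T (fun z => a * f z + g z) = a * T f + T g) /\
  (exists (C : R) (N : nat), forall f : R * R -> R[i], schwartz f ->
     Normc.normc (T f) <= C * seminorm N f).

Definition integral_leb2 (R : realType) (f : R * R -> R[i]) : R[i] :=
  Complex (\int[@leb2 R]_z re_fun f z) (\int[@leb2 R]_z im_fun f z).

Definition expi (R : realType) (theta : R) : R[i] :=
  Complex (cos theta) (sin theta).

Definition fourier (R : realType) (f : R * R -> R[i]) : R * R -> R[i] :=
  fun zeta => integral_leb2
    (fun z => expi (- (zeta.1 * z.1) - zeta.2 * z.2) * f z).

(* Extension to tempered distributions by duality: <F T, f> = <T, F f>. *)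
Definition fourier_distribution (R : realType)
    (T : (R * R -> R[i]) -> R[i]) : (R * R -> R[i]) -> R[i] :=
  fun f => T (fourier f).

Definition distribution_of_fun (R : realType) (sigma : R * R -> R)
  : (R * R -> R[i]) -> R[i] :=
  fun f => integral_leb2 (fun z => real_complex R (sigma z) * f z).

(* The first conjunct makes every integral in [distribution_of_fun] an
   absolutely convergent one. *)
Definition tempered_fun (R : realType) (sigma : R * R -> R) : Prop :=
  (forall f : R * R -> R, schwartz_real f ->
     (@leb2 R).-integrable setT (EFin \o (fun z => sigma z * f z))) /\
  tempered_distribution (distribution_of_fun sigma).

Record complex_measure (R : realType) := ComplexMeasure {
  re_charge : {charge set (plane R) -> \bar R} ;
  im_charge : {charge set (plane R) -> \bar R} }.

Definition cm_val (R : realType) (mu : complex_measure R) (A : set (plane R))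
  : R[i] :=
  Complex (fine (re_charge mu A)) (fine (im_charge mu A)).

Definition cm_total_variation (R : realType) (mu : complex_measure R)
    (A : set (plane R)) : \bar R :=
  ereal_sup [set r | exists (n : nat) (B : 'I_n -> set (plane R)),
    [/\ forall i, measurable (B i), forall i, B i `<=` A, trivIset setT B &
        r = (\sum_(i < n) Normc.normc (cm_val mu (B i)))%:E]].

Definition compactly_supported (R : realType) (mu : complex_measure R)
  : Prop :=
  exists2 K : set (R * R), compact K &
    forall A : set (plane R), measurable A -> A `&` K = set0 ->
      cm_val mu A = 0.

(* Integral against the positive part minus integral against the negative
   part; the value does not depend on the Hahn decomposition chosen. *)
Definition charge_integral (R : realType)
    (nu : {charge set (plane R) -> \bar R}) (f : R * R -> R) : R :=
  let P := cid (Hahn_decomposition nu) in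
  let N := cid (svalP P) in
  \int[jordan_pos (svalP N)]_z f z - \int[jordan_neg (svalP N)]_z f z.

Definition distribution_of_measure (R : realType) (mu : complex_measure R)
  : (R * R -> R[i]) -> R[i] :=
  fun f => Complex
    (charge_integral (re_charge mu) (re_fun f) -
     charge_integral (im_charge mu) (im_fun f))
    (charge_integral (re_charge mu) (im_fun f) +
     charge_integral (im_charge mu) (re_fun f)).

Definition is_fourier_transform (R : realType) (sigma : R * R -> R)
    (mu : complex_measure R) : Prop :=
  tempered_fun sigma /\
  forall f : R * R -> R[i], schwartz f ->
    fourier_distribution (distribution_of_fun sigma) f =
    distribution_of_measure mu f.

Definition halfplane (R : realType) : set (plane R) := [set z | 0 <= z.1].

Definition square_integrable (R : realType) (phi : R * R -> R) : Prop :=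
  measurable_fun (@halfplane R) phi /\
  (@leb2 R).-integrable (@halfplane R) (EFin \o (fun z => phi z ^+ 2)).

(* Variance 0 is allowed but treated apart: [normal_prob 0 0] is not a Dirac
   mass. *)
Definition centered_gaussian (R : realType) (d : measure_display)
    (Omega : measurableType d) (P : probability Omega R) (X : Omega -> R)
  : Prop :=
  measurable_fun setT X /\
  ({ae P, forall omega, X omega = 0} \/
   exists2 s : R, 0 < s & forall A : set R, measurable A ->
     P (X @^-1` A) = normal_prob 0 s A).

(* [W j phi] is the Wiener integral of phi in L^2(R_+ x R) with respect to the
   j-th component of the noise, so that (W j phi) is an isonormal process;
   [W j phi] is unconstrained when phi is not square integrable. *)
Definition white_noise (R : realType) (d : measure_display)
    (Omega : measurableType d) (P : probability Omega R) (n : nat)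
    (W : 'I_n -> (R * R -> R) -> {RV P >-> R}) : Prop :=
  (forall (m : nat) (j : 'I_m -> 'I_n) (phi : 'I_m -> R * R -> R)
      (a : 'I_m -> R),
     (forall i, square_integrable (phi i)) ->
     centered_gaussian P
       (fun omega => \sum_(i < m) a i * W (j i) (phi i) omega)) /\
  (forall (l j : 'I_n) (phi psi : R * R -> R),
     square_integrable phi -> square_integrable psi ->
     ('E_P[fun omega => (W l phi omega * W j psi omega)%R] =
      ((l == j)%:R)%:E *
        \int[@leb2 R]_(z in @halfplane R) (phi z * psi z)%:E)%E).

(* Equal to 0 for t <= 0. *)
Definition heat_kernel (R : realType) (t x : R) : R :=
  (Num.sqrt (4 * pi * t))^-1 * expR (- (x ^+ 2 / (4 * t))).

Definition mild_integrand (R : realType) (sigma : R * R -> R) (t x : R)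
  : R * R -> R :=
  fun z => if (0 <= z.1 <= t) then
             heat_kernel (t - z.1) (x - z.2) * sigma z
           else 0.

(* v is the version with continuous sample paths of the mild solution; v omega
   is only constrained on R_+ x R. *)
Definition continuous_mild_solution (R : realType) (d : measure_display)
    (Omega : measurableType d) (P : probability Omega R) (n : nat)
    (W : 'I_n -> (R * R -> R) -> {RV P >-> R})
    (sigma : 'I_n -> R * R -> R) (v : Omega -> R * R -> 'rV[R]_n) : Prop :=
  (forall (t x : R) (j : 'I_n), 0 <= t ->
     measurable_fun setT (fun omega => v omega (t, x) ord0 j) /\
     {ae P, forall omega,
        v omega (t, x) ord0 j = W j (mild_integrand (sigma j) t x) omega}) /\
  (forall omega, {within [set z : R * R | 0 <= z.1], continuous (v omega)}).

(* Main.v *)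
(** The argument is Lévy's proof that planar Brownian paths have measure zero, in
    the form used by Mueller and Tribe for the random string in the critical
    dimension 6.

    For constant coefficients, let [U] be the stationary solution pinned at the
    origin: it is invariant under (t, x) -> (r^4 t, r^2 x) up to the factor r. In
    dimension 6 the 64 subboxes of half the scale therefore have ranges whose
    expected volumes add up to that of the whole box, so that the ranges of two
    subboxes overlap in a set of measure zero. Two subboxes that are reflections
    of each other in time have, conditionally on the past, independent ranges
    with the same law, and the overlap becomes the integral of a squared
    probability. So the range of [U] is negligible, and its neighbourhoods have
    small volume.

    The solution with coefficients sigma looks like sigma(p) U near p, with an
    error whose moments are negligible at small scales because sigma is uniformly
    continuous on compact sets. To reach a fixed target z, test the noise against
    a function h supported at early times. The resulting standard normal vector
    xi in R^6 is independent of the field v - xi g, where g(p) is the correlation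
    of v(p) and h; since the law of xi is absolutely continuous, v misses z almost
    surely as soon as {c : v + c g hits z} is almost surely negligible. Divide the
    box into the 64^m subboxes of scale r = 2^-m. In each of them the vectors c
    for which z is hit have expected volume r^6 = 64^-m times a quantity that
    tends to 0, by the result for U: the coefficient g is bounded below, and it is
    almost constant in a subbox because h lives far from it.

    Ranges are replaced by closures of the values on a countable grid, and suprema
    over a box are controlled by chaining with moments of order 12. *)
Require Import Defs.
From HB Require Import structures.
From mathcomp Require Import all_boot all_order all_algebra.
From mathcomp Require Import complex.
From mathcomp Require Import all_classical all_reals all_analysis.
From mathcomp Require Import measurable_realfun.
From mathcomp Require Import ring lra zify.
Set Implicit Arguments.
Unset Strict Implicit.
Unset Printing Implicit Defensive.
Import Order.TTheory GRing.Theory Num.Theory.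
Import numFieldNormedType.Exports.
Import HBNNSimple.
Local Open Scope classical_set_scope.
Local Open Scope ring_scope.

(** * Changes of variables *)

Section integration.
Context d (T : measurableType d) (R : realType).
Local Open Scope ereal_scope.

(** A box has 2^4 * 2^2 = 64 subboxes of half the scale, and each carries 2^-6 of the expected
    volume: subdividing alone gains nothing, and all of the gain must come from the negligible range
    of the string. The conditional independence behind this rests on the covariance identity
    [ip_reflection]: correlations across the corner time are those of the parts driven by the noise
    before it. Hence the string after the corner and its reflection before it have jointly the law
    of a common past field plus two independent copies of a future field. Laws of Gaussian fields
    are identified by their covariances, through characteristic functions, and conditioning on the
    past becomes Fubini on a product of probability spaces. The string has to be pinned because a
    single heat kernel is not square integrable over the infinite past, while differences of kernels
    are. In the comparison with the solution, the event of a large error is paid for by a volume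
    bound [sqrt B <= tau * B + 1 / (4 * tau)], linear in twelfth powers of increments and hence in
    twelfth moments after integration. *)

Lemma ge0_integral_density (mu nu : {measure set T -> \bar R}) (g : T -> R)
    (f : T -> \bar R) :
  measurable_fun setT g -> (forall x, 0 <= g x)%R ->
  (forall A, measurable A -> nu A = \int[mu]_(x in A) (g x)%:E) ->
  measurable_fun setT f -> (forall x, 0 <= f x) ->
  \int[nu]_x f x = \int[mu]_x (f x * (g x)%:E).
Proof.
move=> mg g0 nuE mf f0.
have nnE (h : {nnsfun T >-> R}) :
    \int[nu]_x (h x)%:E = \int[mu]_x ((h x)%:E * (g x)%:E).
  under [LHS]eq_integral do rewrite fimfunE -fsumEFin//.
  rewrite [LHS]ge0_integral_fsum//; last 2 first.
  - by move=> r; exact/measurable_EFinP/measurableT_comp.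
  - by move=> n x _; rewrite EFinM nnfun_muleindic_ge0.
  under [RHS]eq_integral.
    move=> x xD; rewrite fimfunE -fsumEFin// ge0_mule_fsuml; last first.
      by move=> r; rewrite EFinM nnfun_muleindic_ge0.
    over.
  rewrite [RHS]ge0_integral_fsum//; last 2 first.
  - move=> r; apply: emeasurable_funM; last exact/measurable_EFinP.
    by apply/measurable_EFinP; do 2 apply/measurableT_comp => //.
  - move=> n x _; rewrite mule_ge0 ?lee_fin//.
    by rewrite -lee_fin EFinM nnfun_muleindic_ge0.
  apply: eq_fsbigr => r _.
  rewrite integralZl_indic_nnsfun//= integral_indic//= setIT nuE//.
  have -> : \int[mu]_x ((r * \1_(h @^-1` [set r]) x)%:E * (g x)%:E) =
     \int[mu]_x (r%:E * ((g \_ (h @^-1` [set r])) x)%:E).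
    apply: eq_integral => x _; rewrite -!EFinM patchE indicE; case: ifPn => _.
      by rewrite mulr1.
    by rewrite !mulr0 mul0r.
  have [r0|r0] := leP 0%R r.
    rewrite ge0_integralZl//.
    - rewrite [in LHS]integral_mkcond; congr (_ * _); apply: eq_integral => x _.
      by rewrite !patchE; case: ifP.
    - by apply/measurable_EFinP/(measurable_restrictT _ _).1 => //; exact: measurable_funTS.
    - by move=> x _; rewrite lee_fin patchE; case: ifP.
  have -> : h @^-1` [set r] = set0.
    by apply/seteqP; split => // x /= hx; move: r0; rewrite -hx ltNge fun_ge0.
  rewrite integral_set0 mule0 integral0_eq// => x _.
  by rewrite patchE memNset// mule0.
pose f_ := nnsfun_approx measurableT mf.
transitivity (limn (fun n => \int[nu]_x (f_ n x)%:E)).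
  rewrite -monotone_convergence//=.
  - apply: eq_integral => ? /[!inE] xD; apply/esym/cvg_lim => //=.
    exact: cvg_nnsfun_approx.
  - by move=> n; exact/measurable_EFinP/measurable_funTS.
  - by move=> n ? _; rewrite lee_fin.
  - by move=> ? _ ? ? mn; rewrite lee_fin; exact/lefP/nd_nnsfun_approx.
transitivity (limn (fun n => \int[mu]_x ((f_ n x)%:E * (g x)%:E))).
  by apply: congr_lim; apply/funext => n /=; exact: nnE.
rewrite -monotone_convergence//=.
- apply: eq_integral => x _; apply/cvg_lim => //=.
  apply: cvgeMr => //; exact: cvg_nnsfun_approx.
- by move=> n; apply: emeasurable_funM; apply/measurable_EFinP => //; exact/measurable_funTS.
- by move=> n ? _; rewrite mule_ge0// lee_fin.
- move=> x _ m n mn; rewrite lee_wpmul2r ?lee_fin//.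
  exact/lefP/nd_nnsfun_approx.
Qed.

End integration.

Definition push_measure d d' (T1 : measurableType d) (T2 : measurableType d')
    (R : realType) (m : {measure set T1 -> \bar R}) (f : T1 -> T2)
    (mf : measurable_fun setT f) : {measure set T2 -> \bar R} :=
  measure_function_pushforward__canonical__measure_function_Measure m mf.

Section affine.
Context (R : realType).
Local Notation leb := (@lebesgue_measure R).
Local Open Scope ereal_scope.

Lemma measurable_affine (a b : R) :
  measurable_fun setT ((fun x => a * x + b)%R : measurableTypeR R -> measurableTypeR R).
Proof. by apply: measurable_funD => //; apply: measurable_funM. Qed.

(** Both sides are measures that agree on half-open intervals; for [a < 0] the preimage is half-open
    on the other side and has the same length. *)
Lemma lebesgue_measure_affine (a b : R) (A : set (measurableTypeR R)) :
  a != 0%R -> measurable A ->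
  leb A = (`|a|%R)%:E * leb ((fun x => a * x + b)%R @^-1` A).
Proof.
move=> a0 mA.
pose m : {measure set (measurableTypeR R) -> \bar R} :=
  mscale (NngNum (normr_ge0 a)) (push_measure leb (measurable_affine a b)).
suff: leb A = m A by [].
apply: lebesgue_measure_unique => //= _ [[u v]] _ <-.
rewrite /m /mscale/= /pushforward; set phi := fun x : R => (a * x + b)%R.
have [ap|an] : (0 < a \/ a < 0)%R.
- by move: a0; rewrite neq_lt => /orP[|]; [right|left].
- have -> : phi @^-1` `]u, v]%classic = `]((u - b) / a)%R, ((v - b) / a)%R]%classic.
    apply/seteqP; split => x /=; rewrite !in_itv/= ltr_pdivrMr// ler_pdivlMr// ltrBlDr lerBrDr mulrC//.
  rewrite !lebesgue_measure_itv/= !lte_fin ltr_pM2r ?invr_gt0// ltrD2r.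
  case: ifP => _; last by rewrite mule0.
  by rewrite gtr0_norm// -!EFinD -EFinM; congr EFin; field; rewrite gt_eqF.
- have -> : phi @^-1` `]u, v]%classic = `[((v - b) / a)%R, ((u - b) / a)%R[%classic.
    apply/seteqP; split => x /=; rewrite !in_itv/= ltr_ndivlMr// ler_ndivrMr// ltrBlDr lerBrDr mulrC andbC//.
  rewrite !lebesgue_measure_itv/= !lte_fin ltr_nM2r ?invr_lt0// ltrD2r.
  case: ifP => _; last by rewrite mule0.
  by rewrite ltr0_norm// -!EFinD -EFinM; congr EFin; field; rewrite lt_eqF.
Qed.

Lemma ge0_integral_affine (a b : R) (f : measurableTypeR R -> \bar R) : a != 0%R ->
  measurable_fun setT f -> (forall x, 0 <= f x) ->
  \int[leb]_x f x = (`|a|%R)%:E * \int[leb]_x f (a * x + b)%R.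
Proof.
move=> a0 mf f0.
have E := ge0_integral_pushforward (measurable_affine a b) leb measurableT mf (fun x _ => f0 x).
rewrite preimage_setT in E; rewrite -E.
transitivity (\int[mscale (NngNum (normr_ge0 a)) (push_measure leb (measurable_affine a b))]_x f x);
  last by rewrite ge0_integral_mscale.
by apply: eq_measure_integral => /= A mA _; exact: lebesgue_measure_affine.
Qed.

End affine.

(* [dilation mu phi c]: the change of variables [phi] multiplies [mu] by [c] *)
Definition dilation d (T : measurableType d) (R : realType)
    (mu : {measure set T -> \bar R}) (phi : T -> T) (c : R) :=
  [/\ (0 <= c), measurable_fun setT phi &
   forall f : T -> \bar R, measurable_fun setT f -> (forall x, 0 <= f x)%E ->
    (\int[mu]_x f x = c%:E * \int[mu]_x f (phi x))%E].

Lemma dilation_lebesgue (R : realType) (a b : R) : a != 0 ->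
  dilation (@lebesgue_measure R) (fun x => a * x + b) `|a|.
Proof.
move=> a0; split=> //; first exact: measurable_affine.
by move=> f mf f0; exact: ge0_integral_affine.
Qed.

Lemma dilation_prod d1 d2 (T1 : measurableType d1) (T2 : measurableType d2)
    (R : realType) (m1 : {sigma_finite_measure set T1 -> \bar R})
    (m2 : {sigma_finite_measure set T2 -> \bar R}) p1 p2 c1 c2 :
  dilation m1 p1 c1 -> dilation m2 p2 c2 ->
  dilation (m1 \x m2)%E (fun z => (p1 z.1, p2 z.2)) (c1 * c2).
Proof.
move=> [c10 mp1 E1] [c20 mp2 E2].
have mpp : measurable_fun setT (fun z : T1 * T2 => (p1 z.1, p2 z.2)).
  apply: measurable_fun_pair.
    exact: (measurableT_comp mp1 measurable_fst).
  exact: (measurableT_comp mp2 measurable_snd).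
split; [exact: mulr_ge0|exact: mpp|move=> f mf f0].
have mfpp := measurableT_comp mf mpp.
rewrite (fubini_tonelli1 f mf f0) E1//; last first.
  - by move=> x; exact: integral_ge0.
  - exact: measurable_fun_fubini_tonelli_F.
rewrite EFinM -muleA (fubini_tonelli1 (f \o _) mfpp (fun=> f0 _)); congr (_ * _)%E.
rewrite -ge0_integralZl//; last 2 first.
- by apply: (measurable_fun_fubini_tonelli_F (f \o _) mfpp) => z; exact: f0.
- by move=> x _; apply: integral_ge0 => y _; exact: f0.
apply: eq_integral => x _; rewrite /fubini_F E2//.
exact: (measurableT_comp mf (pair1_measurable _)).
Qed.

(** * Gaussian laws *)

Section gauss.
Context (R : realType).
Local Notation leb := (@lebesgue_measure R).
Local Notation phi := (normal_pdf (0 : R) 1).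

Lemma cvg_integral_itv (h : R -> R) :
  leb.-integrable setT (EFin \o h) ->
  (\int[leb]_(x in `[(- n%:R)%R, n%:R]) (h x)%:E)%E @[n --> \oo] -->
    (\int[leb]_x (h x)%:E)%E.
Proof.
move=> ih.
have -> : (fun n => \int[leb]_(x in `[(- n%:R)%R, n%:R]) (h x)%:E)%E =
   (fun n => \int[leb]_x ((fun n x => ((EFin \o h) \_ `[(- n%:R)%R, n%:R]) x) n x))%E.
  by apply/funext => n; rewrite integral_mkcond.
have mh := measurable_int _ ih.
apply: (@dominated_cvg _ _ _ leb setT measurableT _ _ (abse \o (EFin \o h))) => //.
- move=> n; apply/(measurable_restrictT _ _).1 => //.
  exact: measurable_funTS.
- move=> x _; apply: cvg_near_cst.
  near=> n; rewrite patchE mem_set//= in_itv/= -ler_norml.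
  by near: n; exact: nbhs_infty_ger.
- exact: integrable_abse.
- move=> n x _; rewrite patchE; case: ifP => //= _.
  by rewrite normr0 lee_fin.
Unshelve. all: by end_near. Qed.

Lemma normal_pdf01E x : phi x = normal_peak (1:R) * expR (- (x ^+ 2 / 2)).
Proof.
by rewrite /normal_pdf oner_eq0 /normal_fun subr0 expr1n mulr2n mulNr.
Qed.

(** The density of variance 2 exceeds that of variance 1 by the factor [expR (x^2 / 4)], up to a
    constant, and this factor absorbs the powers of [x] that occur below. It serves as an integrable
    majorant. *)
Lemma pdf_domination : exists2 C : R, 0 <= C &
  forall x, `|x| * phi x <= C * normal_pdf 0 (Num.sqrt 2) x /\
            x ^+ 12 * phi x <= C * normal_pdf 0 (Num.sqrt 2) x /\
            x ^+ 2 * phi x <= C * normal_pdf 0 (Num.sqrt 2) x.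
Proof.
have s20 : Num.sqrt 2 != 0 :> R by rewrite gt_eqF ?sqrtr_gt0.
(* With [u = x^2 / 4], the bound [expR u >= 1 + u^6 / 6!] gives [x^12 <= 4^6 * 720 * expR u]; the
   remaining [4 + 1] takes care of [|x|] and [x^2]. *)
pose K : R := 4^+6 * 720 + 4 + 1.
pose c := normal_peak (1:R) / normal_peak (Num.sqrt 2).
have p0 : 0 < normal_peak (Num.sqrt 2 : R) by exact: normal_peak_gt0.
have q0 : 0 < normal_peak (1 : R) by rewrite normal_peak_gt0 ?oner_neq0.
exists (K * c); first by rewrite mulr_ge0 ?divr_ge0 ?ltW// /K; lra.
move=> x.
have E : K * c * normal_pdf 0 (Num.sqrt 2) x =
   (K * expR (x ^+ 2 / 4)) * (normal_peak 1 * expR (- (x ^+ 2 / 2))).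
  rewrite /normal_pdf (negbTE s20) /normal_fun subr0 sqr_sqrtr ?ler0n//.
  have -> : - x ^+ 2 / (2 *+ 2) = x ^+ 2 / 4 + - (x ^+ 2 / 2) by rewrite mulr2n; field.
  by rewrite expRD /c; field; rewrite gt_eqF.
rewrite E normal_pdf01E.
have f0 : 0 < normal_peak 1 * expR (- (x ^+ 2 / 2)) by rewrite mulr_gt0 ?expR_gt0.
have y0 : 0 <= x ^+ 2 / 4 by rewrite divr_ge0 ?sqr_ge0.
have e1 : 1 + x ^+ 2 / 4 <= expR (x ^+ 2 / 4) by exact: expR_ge1Dx.
have e6 : 1 + (x ^+ 2 / 4) ^+ 6 / 720 <= expR (x ^+ 2 / 4).
  by have := expR_ge1Dxn 5 y0.
have x1 : `|x| <= 1 + x ^+ 2.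
  rewrite -(real_normK (num_real x)).
  have := sqr_ge0 (`|x| - 1); rewrite sqrrB expr1n mulr1.
  by have := normr_ge0 x; nra.
split; [|split]; rewrite ler_pM2r//.
- by rewrite /K; nra.
- have -> : x ^+ 12 = 4 ^+ 6 * ((x ^+ 2 / 4) ^+ 6).
    by rewrite expr_div_n -exprM; field.
  have : 0 <= (x ^+ 2 / 4) ^+ 6 by rewrite exprn_ge0.
  by move: e6; set u := _ ^+ 6; set w := expR _; rewrite /K; nra.
- by rewrite /K; nra.
Qed.

Lemma measurable_phi : measurable_fun setT phi.
Proof. exact: measurable_normal_pdf. Qed.

Lemma integrable_dom (f : R -> R) : measurable_fun setT f ->
  (exists C, forall x, `|f x| <= C * normal_pdf 0 (Num.sqrt 2) x) ->
  leb.-integrable setT (EFin \o f).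
Proof.
move=> mf [C fC].
apply: (@le_integrable _ _ _ leb setT measurableT (EFin \o f)
   (EFin \o (fun x => C * normal_pdf 0 (Num.sqrt 2) x))) => //.
- exact/measurable_EFinP.
- move=> x _ /=; rewrite lee_fin (le_trans (fC x))// ler_norm//.
- have -> : (EFin \o (fun x => C * normal_pdf 0 (Num.sqrt 2) x)) =
     (fun x => C%:E * (normal_pdf 0 (Num.sqrt 2) x)%:E)%E by apply/funext.
  by apply: integrableZl => //; exact: integrable_normal_pdf.
Qed.

Lemma integrable_bounded_phi (f : R -> R) : measurable_fun setT f ->
  (forall x, `|f x| <= 1) -> leb.-integrable setT (EFin \o (fun x => f x * phi x)).
Proof.
move=> mf f1.
apply: (@le_integrable _ _ _ leb setT measurableT _ (EFin \o phi)) => //.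
- apply/measurable_EFinP; apply: measurable_funM => //; exact: measurable_phi.
- move=> x _ /=; rewrite lee_fin normrM [`|phi x|]ger0_norm ?normal_pdf_ge0//.
  by rewrite ler_piMl// normal_pdf_ge0.
- exact: integrable_normal_pdf.
Qed.

Lemma measurable_cosM (t : R) : measurable_fun setT (fun x : R => cos (t * x)).
Proof.
apply: measurableT_comp; last exact: measurable_funM.
by apply: continuous_measurable_fun => ?; exact: continuous_cos.
Qed.

Lemma measurable_sinM (t : R) : measurable_fun setT (fun x : R => sin (t * x)).
Proof.
apply: measurableT_comp; last exact: measurable_funM.
by apply: continuous_measurable_fun => ?; exact: continuous_sin.
Qed.

Let F (t : R) := \int[leb]_x (cos (t * x) * phi x).

Lemma is_derive_phi (x : R) : is_derive x 1 phi (- x * phi x).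
Proof.
have -> : phi = (fun x => normal_peak (1:R) * expR (- (x ^+ 2 / 2))).
  by apply/funext => y; rewrite normal_pdf01E.
apply: is_derive_eq.
by rewrite /GRing.scale/=; field.
Qed.

(** The integrand is the derivative of [sin (t * x) * phi x], which vanishes at both ends of the
    line. This integration by parts yields the differential equation of the characteristic
    function. *)
Lemma gauss_parts (t : R) :
  (\int[leb]_x ((t * cos (t * x) - x * sin (t * x)) * phi x)%:E = 0)%E.
Proof.
pose H x := sin (t * x) * phi x.
pose h x := (t * cos (t * x) - x * sin (t * x)) * phi x.
have dH (x : R) : is_derive x 1 H (h x).
  have := is_derive_phi x => dphi.
  rewrite /H; apply: is_derive_eq.
  by rewrite /GRing.scale/= /h; ring.
have [C C0 Cx] := pdf_domination.
have ih : leb.-integrable setT (EFin \o h).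
  have -> : EFin \o h = ((EFin \o (fun x => t * cos (t * x) * phi x)%R) \-
      (EFin \o (fun x => x * sin (t * x) * phi x)%R))%E.
    by apply/funext => x /=; rewrite -EFinB /h mulrBl.
  apply: integrableB => //.
    have -> : (EFin \o (fun x => t * cos (t * x) * phi x)) =
      (fun x => t%:E * (EFin \o (fun x => cos (t * x) * phi x)%R) x)%E.
      by apply/funext => x /=; rewrite -EFinM mulrA.
    apply: integrableZl => //; apply: integrable_bounded_phi.
      exact: measurable_cosM.
    by move=> x; exact: cos_max.
  apply: integrable_dom.
    apply: measurable_funM; last exact: measurable_phi.
    by apply: measurable_funM => //; exact: measurable_sinM.
  exists C => x; have [+ _] := Cx x; apply: le_trans.
  rewrite !normrM [`|phi x|]ger0_norm ?normal_pdf_ge0//.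
  by rewrite ler_wpM2r ?normal_pdf_ge0// ler_piMr ?sin_max.
have ch : continuous h.
  move=> x; apply: cvgM; last by apply: continuous_normal_pdf; exact: oner_neq0.
  have ct : (fun x : R => t * x) x @[x --> x] --> t * x.
    by apply: cvgM; [exact: cvg_cst|exact: cvg_id].
  apply: cvgB; apply: cvgM; [exact: cvg_cst| |exact: cvg_id|].
    by apply: (cvg_comp _ _ ct); exact: continuous_cos.
  by apply: (cvg_comp _ _ ct); exact: continuous_sin.
have E n : (\int[leb]_(x in `[(- n.+1%:R)%R, n.+1%:R]) (h x)%:E = (H n.+1%:R)%:E - (H (- n.+1%:R)%R)%:E)%E.
  apply: continuous_FTC2.
  - by rewrite gtrN.
  - exact: continuous_subspaceT.
  - have cH x : H x @[x --> x] --> H x.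
      by apply: differentiable_continuous; apply/derivable1_diffP; apply: ex_derive.
    split.
    + by move=> x _; apply: ex_derive.
    + by apply: cvg_at_right_filter; exact: cH.
    + by apply: cvg_at_left_filter; exact: cH.
  - by move=> x _; rewrite derive1E; apply: derive_val.
have L1 := cvg_integral_itv ih.
have L1' : (\int[leb]_(x in `[(- n.+1%:R)%R, n.+1%:R]) (h x)%:E)%E @[n --> \oo] -->
    (\int[leb]_x (h x)%:E)%E.
  by rewrite -(cvg_shiftS (fun n => (\int[leb]_(x in `[(- n%:R)%R, n%:R]) (h x)%:E)%E)) in L1.
have L2 : (\int[leb]_(x in `[(- n.+1%:R)%R, n.+1%:R]) (h x)%:E)%E @[n --> \oo] --> 0%:E.
  under eq_fun do rewrite E -EFinB.
  apply: cvg_EFin; first by near=> n.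
  (* The bound on [|x| * phi x] makes the boundary terms decay like [1 / n]. *)
  pose D : R := 2 * C * normal_peak (Num.sqrt 2).
  apply: (@squeeze_cvgr _ _ _ _ (fun n => - (D * n.+1%:R^-1)) (fun n => D * n.+1%:R^-1)).
  - near=> n; rewrite -ler_norml /= /H /D.
    have En : phi (- n.+1%:R) = phi n.+1%:R by rewrite !normal_pdf01E sqrrN.
    have [b1 _] := Cx n.+1%:R.
    have b2 : phi n.+1%:R <= C * normal_peak (Num.sqrt 2) * n.+1%:R^-1.
      rewrite ler_pdivlMr ?ltr0n// mulrC.
      rewrite -[X in X * _]ger0_norm// (le_trans b1)// ler_wpM2l//.
      by apply: normal_pdf_ub; rewrite gt_eqF ?sqrtr_gt0.
    have p0 := normal_pdf_ge0 0 1 (n.+1%:R : R).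
    rewrite En mulrN sinN mulNr opprK -mulrDl normrM (ger0_norm p0).
    have s1 : `|sin (t * n.+1%:R) + sin (t * n.+1%:R)| <= 2.
      by rewrite (le_trans (ler_normD _ _))// -[2]/(1 + 1) lerD ?sin_max.
    rewrite (le_trans (ler_wpM2r p0 s1))// -!mulrA ler_pM2l// mulrA//.
  - rewrite -oppr0; apply: cvgN; rewrite -[X in _ --> X](mulr0 D).
    by apply: cvgM; [exact: cvg_cst|exact: cvg_harmonic].
  - rewrite -[X in _ --> X](mulr0 D).
    by apply: cvgM; [exact: cvg_cst|exact: cvg_harmonic].
exact: (cvg_unique _ L1' L2).
Unshelve. all: by end_near. Qed.

(** Differentiation under the integral and [gauss_parts] give [F' = - t F], so
    [F t * expR (t^2 / 2)] is constant, equal to [F 0 = 1]. *)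
Lemma normal_cf t : \int[leb]_x (cos (t * x) * phi x) = expR (- (t ^+ 2 / 2)).
Proof.
have [C C0 Cx] := pdf_domination.
have icos (s : R) : leb.-integrable setT (EFin \o (fun x => cos (s * x) * phi x)).
  apply: integrable_bounded_phi; first exact: measurable_cosM.
  by move=> x; exact: cos_max.
have isin (s : R) : leb.-integrable setT (EFin \o (fun x => x * sin (s * x) * phi x)).
  apply: integrable_dom.
    apply: measurable_funM; last exact: measurable_phi.
    by apply: measurable_funM => //; exact: measurable_sinM.
  exists C => x; have [+ _] := Cx x; apply: le_trans.
  rewrite !normrM [`|phi x|]ger0_norm ?normal_pdf_ge0//.
  by rewrite ler_wpM2r ?normal_pdf_ge0// ler_piMr ?sin_max.
have dc (s x : R) : is_derive s 1 (fun s => cos (s * x) * phi x) (- (x * sin (s * x) * phi x)).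
  apply: is_derive_eq.
  by rewrite /GRing.scale/=; ring.
have dF (s : R) : is_derive s 1 F (- s * F s).
  have I : (`](s - 1), (s + 1)[%classic : set R) s by rewrite /= in_itv/=; lra.
  pose G x := C * normal_pdf 0 (Num.sqrt 2) (x : R).
  have D1 (y x : R) : partial1of2 (fun s x => cos (s * x) * phi x) y x = - (x * sin (y * x) * phi x).
    by rewrite partial1of2E; apply: derive_val.
  have iG : leb.-integrable setT (EFin \o G).
    have -> : EFin \o G = (fun x => C%:E * (normal_pdf 0 (Num.sqrt 2) x)%:E)%E by apply/funext.
    by apply: integrableZl => //; exact: integrable_normal_pdf.
  have G0 y : 0 <= G y by rewrite mulr_ge0// normal_pdf_ge0.
  have Gub (x y : R) : `](s - 1), (s + 1)[%classic x -> setT y ->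
      `|partial1of2 (fun s x => cos (s * x) * phi x) x y| <= G y.
    move=> _ _; rewrite D1 normrN; have [+ _] := Cx y; apply: le_trans.
    rewrite !normrM [`|phi y|]ger0_norm ?normal_pdf_ge0//.
    by rewrite ler_wpM2r ?normal_pdf_ge0// ler_piMr ?sin_max.
  have der (x y : R) : `](s - 1), (s + 1)[%classic x -> setT y ->
     derivable ((fun s x => cos (s * x) * phi x) ^~ y) x 1.
    by move=> _ _; apply: ex_derive.
  have d1 := @derivable_under_integral R _ _ leb _ setT measurableT s (s-1) (s+1) I (fun x _ => icos x) der G G0 iG Gub.
  have d2 := @differentiation_under_integral R _ _ leb _ setT measurableT s (s-1) (s+1) I (fun x _ => icos x) der G G0 iG Gub.
  apply: DeriveDef; first exact: d1.
  rewrite -derive1E d2.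
  under eq_Rintegral do rewrite D1.
  have := gauss_parts s.
  have -> : (\int[leb]_x ((s * cos (s * x) - x * sin (s * x)) * phi x)%:E =
     \int[leb]_x ((s%:E * (cos (s * x) * phi x)%:E) - (x * sin (s * x) * phi x)%:E))%E.
    by apply: eq_integral => x _; rewrite -EFinM -EFinB; congr EFin; ring.
  have isc : leb.-integrable setT (fun x => s%:E * (cos (s * x) * phi x)%:E)%E.
    by apply: integrableZl => //; exact: icos.
  rewrite (integralB measurableT isc (isin s)) (integralZl measurableT (icos s)).
  have fc : (\int[leb]_x (cos (s * x) * phi x)%:E)%E \is a fin_num.
    by apply: integrable_fin_num => //; exact: icos.
  have fs : (\int[leb]_x (x * sin (s * x) * phi x)%:E)%E \is a fin_num.
    by apply: integrable_fin_num => //; exact: isin.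
  move=> /eqP; rewrite sube_eq ?add0e; last 2 first.
  - by rewrite fin_numM.
  - by rewrite fin_num_adde_defl.
  move=> /eqP E.
  have -> : \int[leb]_x (- (x * sin (s * x) * phi x)) = - \int[leb]_x (x * sin (s * x) * phi x).
    under eq_Rintegral do rewrite -mulN1r.
    by rewrite (RintegralZl _ measurableT (isin s)) mulN1r.
  by rewrite /F /Rintegral -E fineM ?mulNr.
pose g s := F s * expR (s ^+ 2 / 2).
have dg (s : R) : is_derive s 1 g 0.
  have := dF s => dFs; rewrite /g.
  apply: is_derive_eq.
  by rewrite /GRing.scale/=; field.
have := is_derive_0_is_cst t 0 dg; rewrite /g expr0n/= mul0r expR0 mulr1.
have -> : F 0 = 1.
  rewrite /F /Rintegral; under eq_integral do rewrite mul0r cos0 mul1r.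
  by rewrite integral_normal_pdf.
by move=> E; rewrite -/(F t) expRN -[LHS](mulfK (lt0r_neq0 (expR_gt0 (t ^+ 2 / 2)))) E mul1r.
Qed.

End gauss.

Section centered_gaussian.
Context (R : realType).
Local Notation leb := (@lebesgue_measure R).
Local Notation phi := (normal_pdf (0 : R) 1).

(** The variance [gauss_moment 2], which is 1, is carried as the symbol [kappa]; the factors [kappa]
    in the normalisations below come from here. *)
Definition gauss_moment (k : nat) : R := \int[leb]_x (x ^+ k * phi x).
Local Notation kappa := (gauss_moment 2).

Lemma integrable_moment2 : leb.-integrable setT (EFin \o (fun x => x ^+ 2 * phi x)).
Proof.
have [C C0 Cx] := @pdf_domination R.
apply: integrable_dom.
  by apply: measurable_funM; [exact: measurable_funX|exact: measurable_phi].
exists C => x; have [_ [_]] := Cx x; apply: le_trans.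
by rewrite ger0_norm// mulr_ge0 ?sqr_ge0 ?normal_pdf_ge0.
Qed.

Lemma integrable_moment12 : leb.-integrable setT (EFin \o (fun x => x ^+ 12 * phi x)).
Proof.
have [C C0 Cx] := @pdf_domination R.
apply: integrable_dom.
  by apply: measurable_funM; [exact: measurable_funX|exact: measurable_phi].
exists C => x; have [_ [+ _]] := Cx x; apply: le_trans.
by rewrite ger0_norm// mulr_ge0 ?exprn_even_ge0 ?normal_pdf_ge0.
Qed.

Lemma gauss_moment2_gt0 : 0 < kappa.
Proof.
have f0 (x : R) : 0 <= x ^+ 2 * phi x by rewrite mulr_ge0 ?sqr_ge0 ?normal_pdf_ge0.
have mf : measurable_fun setT (fun x : R => x ^+ 2 * phi x).
  by apply: measurable_funM; [exact: measurable_funX|exact: measurable_phi].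
pose c := normal_peak (1:R) * expR (- (4 / 2)).
have c0 : 0 < c by rewrite mulr_gt0 ?expR_gt0 ?normal_peak_gt0 ?oner_neq0.
rewrite -lte_fin /gauss_moment /Rintegral fineK; last first.
  by apply: integrable_fin_num => //; exact: integrable_moment2.
apply: (@lt_le_trans _ _ c%:E); first by rewrite lte_fin.
apply: (@le_trans _ _ (\int[leb]_(x in `[1%R, 2%R]) c%:E)%E).
  rewrite integral_cst//= lebesgue_measure_itv/= lte_fin ltr1n.
  by rewrite -EFinB -EFinM lee_fin; lra.
apply: (@le_trans _ _ (\int[leb]_(x in `[1%R, 2%R]) (x ^+ 2 * phi x)%:E)%E).
  apply: ge0_le_integral => //=.
  - by move=> x _; rewrite lee_fin ltW.
  - by apply/measurable_EFinP; exact: measurable_funTS.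
  - move=> x; rewrite in_itv/= => /andP[x1 x2]; rewrite lee_fin /c normal_pdf01E.
    rewrite mulrCA ler_pM2l ?normal_peak_gt0 ?oner_neq0//.
    rewrite -[leLHS]mul1r ler_pM ?expR_ge0//.
      by rewrite expr_ge1//; lra.
    by rewrite ler_expR; nra.
apply: ge0_subset_integral => //=.
  exact/measurable_EFinP.
by move=> x _; rewrite lee_fin.
Qed.

Lemma integral_phi : (\int[leb]_x (phi x)%:E = 1)%E.
Proof. exact: integral_normal_pdf. Qed.

(** By the symmetry [x -> - x]; adding 1 keeps both integrands nonnegative, as the change of
    variables requires. *)
Lemma integral_sin_phi (s : R) : \int[leb]_z (sin (s * z) * phi z) = 0.
Proof.
have i2 : leb.-integrable setT (EFin \o (fun z => sin (s * z) * phi z)).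
  apply: integrable_bounded_phi => //; first exact: measurable_sinM.
  by move=> x; exact: sin_max.
have s1 (x : R) : 0 <= 1 + sin (s * x) by have := sin_geN1 (s * x); lra.
have : (\int[leb]_z ((1 + sin (s * z)) * phi z)%:E = \int[leb]_z ((1 - sin (s * z)) * phi z)%:E)%E.
  rewrite (@ge0_integral_affine _ (-1) 0) ?oppr_eq0 ?oner_eq0//; last 2 first.
  - apply/measurable_EFinP; apply: measurable_funM; last exact: measurable_phi.
    by apply: measurable_funD => //; exact: measurable_sinM.
  - by move=> x; rewrite lee_fin mulr_ge0 ?normal_pdf_ge0.
  rewrite normrN normr1 mul1e; apply: eq_integral => x _.
  by rewrite addr0 mulN1r mulrN sinN !normal_pdf01E sqrrN.
have E (b : R) : (\int[leb]_z ((1 + b * sin (s * z)) * phi z)%:E =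
    1 + b%:E * \int[leb]_z (sin (s * z) * phi z)%:E)%E.
  transitivity (\int[leb]_z ((phi z)%:E + b%:E * (sin (s * z) * phi z)%:E))%E.
    by apply: eq_integral => z _; rewrite -EFinM -EFinD; congr EFin; ring.
  have ib : leb.-integrable setT (fun z => b%:E * (sin (s * z) * phi z)%:E)%E.
    by apply: integrableZl => //; exact: i2.
  rewrite (integralD measurableT (integrable_normal_pdf _ _) ib).
  by rewrite integral_phi (integralZl measurableT i2).
have := E 1; under eq_integral do rewrite mul1r; move=> ->.
have := E (-1); under eq_integral do rewrite mulN1r; move=> ->.
have f2 : (\int[leb]_z (sin (s * z) * phi z)%:E)%E \is a fin_num.
  by apply: integrable_fin_num => //; exact: i2.
rewrite /Rintegral -(fineK f2); set u := fine _.
by rewrite mul1e -EFinM -!EFinD => /eqP; rewrite eqe => /eqP /=; lra.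
Qed.

Section variable.
Context d (T : measurableType d) (P : probability T R).
Variable X : T -> R.
Hypothesis gX : centered_gaussian P X.

Let mX : measurable_fun setT X. Proof. by case: gX. Qed.

(** [X] is distributed as [s] times a standard normal variable; allowing [s = 0] merges the two
    cases of [centered_gaussian]. *)
Lemma cg_law : exists2 s : R, 0 <= s & forall f : R -> \bar R,
  measurable_fun setT f -> (forall x, 0 <= f x)%E ->
  (\int[P]_w f (X w) = \int[leb]_z (f (s * z)%R * (phi z)%:E))%E.
Proof.
case: gX => _ [X0|[s s0 sE]].
  exists 0 => // f mf f0.
  transitivity (f 0).
    transitivity (\int[P]_w (cst (f 0%R) w))%E.
      apply: ge0_ae_eq_integral => //.
      - exact: measurableT_comp.
      - by move=> x _; exact: f0.
      - by apply: filterS X0 => w /= -> _.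
    by rewrite integral_cst//= probability_setT mule1.
  under eq_integral do rewrite mul0r.
  rewrite ge0_integralZl ?integral_phi ?mule1//.
    by apply/measurable_EFinP; exact: measurable_phi.
  by move=> x _; rewrite lee_fin normal_pdf_ge0.
exists s; first exact: ltW.
move=> f mf f0.
have sn0 : s != 0 by rewrite gt_eqF.
pose mX' : @measurable_fun _ _ T (measurableTypeR R) setT X := mX.
transitivity (\int[push_measure P mX']_y f y)%E.
  by rewrite (ge0_integral_pushforward mX').
transitivity (\int[leb]_y (f y * (normal_pdf 0 s y)%:E))%E.
  apply: (@ge0_integral_density _ (measurableTypeR R)) => //.
  - exact: measurable_normal_pdf.
  by move=> x; exact: normal_pdf_ge0.
rewrite (ge0_integral_affine 0 sn0); last 2 first.
- apply: emeasurable_funM => //; apply/measurable_EFinP; exact: measurable_normal_pdf.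
- by move=> x; rewrite mule_ge0// lee_fin normal_pdf_ge0.
rewrite -ge0_integralZl//; last 2 first.
- apply: emeasurable_funM.
    by apply: measurableT_comp => //; exact: measurable_affine.
  apply/measurable_EFinP; apply: measurableT_comp; first exact: measurable_normal_pdf.
  exact: measurable_affine.
- by move=> x _; rewrite mule_ge0// lee_fin normal_pdf_ge0.
apply: eq_integral => x _; rewrite addr0 muleCA; congr (_ * _)%E.
rewrite -EFinM; congr EFin.
rewrite /normal_pdf (negbTE sn0) oner_eq0 /normal_fun !subr0 /normal_peak.
have Ex (y : R) : - (s * y) ^+ 2 / (s ^+ 2 *+ 2) = - y ^+ 2 / (1 ^+ 2 *+ 2).
  rewrite expr1n exprMn -(mulr_natr (s ^+ 2)) -mulrN -mulf_div divff ?mul1r//.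
  by rewrite expf_neq0.
rewrite Ex.
rewrite mulrA; congr (_ * _).
rewrite gtr0_norm// -mulrnAr sqrtrM ?sqr_ge0// sqrtr_sqr gtr0_norm// expr1n mul1r.
by rewrite invfM mulrA divff// mul1r.
Qed.

Lemma cg_variance : exists2 s : R, 0 <= s &
  (\int[P]_w (X w ^+ 2)%:E)%E = (s ^+ 2 * kappa)%:E /\
  forall f : R -> \bar R,
  measurable_fun setT f -> (forall x, 0 <= f x)%E ->
  (\int[P]_w f (X w) = \int[leb]_z (f (s * z)%R * (phi z)%:E))%E.
Proof.
have [s s0 sE] := cg_law; exists s => //; split => //.
rewrite (sE (fun x => (x ^+ 2)%:E)); last 2 first.
- by apply/measurable_EFinP; exact: measurable_funX.
- by move=> x; rewrite lee_fin sqr_ge0.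
transitivity (\int[leb]_z ((s ^+ 2)%:E * (z ^+ 2 * phi z)%:E))%E.
  by apply: eq_integral => z _; rewrite -!EFinM exprMn; congr EFin; ring.
rewrite integralZl//; last exact: integrable_moment2.
rewrite [RHS]EFinM; congr (_ * _)%E; rewrite /gauss_moment /Rintegral fineK//.
by apply: integrable_fin_num => //; exact: integrable_moment2.
Qed.

Lemma cg_moment12 :
  (\int[P]_w (X w ^+ 12)%:E = (gauss_moment 12 / kappa ^+ 6 *
     (fine (\int[P]_w (X w ^+ 2)%:E)) ^+ 6)%:E)%E.
Proof.
have [s s0 [-> sE]] := cg_variance; rewrite /=.
rewrite (sE (fun x => (x ^+ 12)%:E)); last 2 first.
- by apply/measurable_EFinP; exact: measurable_funX.
- by move=> x; rewrite lee_fin exprn_even_ge0.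
transitivity (\int[leb]_z ((s ^+ 12)%:E * (z ^+ 12 * phi z)%:E))%E.
  by apply: eq_integral => z _; rewrite -!EFinM exprMn; congr EFin; ring.
rewrite integralZl//; last exact: integrable_moment12.
have -> : gauss_moment 12 / kappa ^+ 6 * (s ^+ 2 * kappa) ^+ 6 = s ^+ 12 * gauss_moment 12.
  by rewrite exprMn -exprM; field; rewrite gt_eqF// gauss_moment2_gt0.
rewrite [RHS]EFinM; congr (_ * _)%E; rewrite /gauss_moment /Rintegral fineK//.
by apply: integrable_fin_num => //; exact: integrable_moment12.
Qed.

Lemma bounded_integrableP (f : T -> R) C : measurable_fun setT f ->
  (forall x, `|f x| <= C) -> P.-integrable setT (EFin \o f).
Proof.
move=> mf fC.
apply: (@le_integrable _ _ _ P setT measurableT _ (EFin \o cst C)) => //.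
- exact/measurable_EFinP.
- by move=> x _ /=; rewrite lee_fin (le_trans (fC x))// ler_norm.
- by apply: finite_measure_integrable_cst.
Qed.

Lemma cg_bounded (s : R) :
  (forall f : R -> \bar R,
  measurable_fun setT f -> (forall x, 0 <= f x)%E ->
  (\int[P]_w f (X w) = \int[leb]_z (f (s * z)%R * (phi z)%:E))%E) ->
  forall f : R -> R, measurable_fun setT f -> (forall x, `|f x| <= 1) ->
  \int[P]_w f (X w) = \int[leb]_z (f (s * z) * phi z).
Proof.
move=> sE f mf f1.
have m1 : measurable_fun setT (fun x => (1 + f x)%:E).
  by apply/measurable_EFinP; exact: measurable_funD.
have g1 x : (0 <= (1 + f x)%:E)%E.
  by rewrite lee_fin; have := f1 x; rewrite ler_norml => /andP[]; lra.
have := sE _ m1 g1.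
have i1 : P.-integrable setT (EFin \o (fun w => f (X w))).
  by apply: (bounded_integrableP (C := 1)) => //; exact: measurableT_comp.
have i2 : leb.-integrable setT (EFin \o (fun z => f (s * z) * phi z)).
  apply: integrable_bounded_phi => //.
  by apply: (measurableT_comp mf); exact: measurable_funM.
have -> : (\int[P]_w (1 + f (X w))%:E = 1 + \int[P]_w (f (X w))%:E)%E.
  under eq_integral do rewrite EFinD.
  rewrite integralD//; last exact: finite_measure_integrable_cst.
  by rewrite integral_cst//= probability_setT mule1.
have -> : (\int[leb]_z ((1 + f (s * z)%R)%:E * (phi z)%:E) = 1 + \int[leb]_z (f (s * z)%R * phi z)%:E)%E.
  transitivity (\int[leb]_z ((phi z)%:E + (f (s * z)%R * phi z)%:E))%E.
    by apply: eq_integral => z _; rewrite -EFinM -EFinD mulrDl mul1r.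
  by rewrite integralD// ?integral_phi//; exact: integrable_normal_pdf.
have f2 : (\int[leb]_z (f (s * z)%R * phi z)%:E)%E \is a fin_num.
  by apply: integrable_fin_num => //; exact: i2.
move=> /(congr1 (fun x => x - 1)%E); rewrite ![(1 + _)%E]addeC !addeK//.
by rewrite /Rintegral => ->.
Qed.

(** The real form of [E exp (i (c + X)) = exp (i c) * e]. Carrying the phase [c] keeps
    characteristic functions real and still multiplicative for independent sums. *)
Lemma cg_cf c : let e := expR (- (fine (\int[P]_w (X w ^+ 2)%:E)%E / (2 * kappa))) in
  \int[P]_w cos (c + X w) = cos c * e /\ \int[P]_w sin (c + X w) = sin c * e.
Proof.
have k0 := gauss_moment2_gt0.
have [s s0 [-> sE] /=] := cg_variance.
have -> : - (s ^+ 2 * kappa / (2 * kappa)) = - (s ^+ 2 / 2).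
  by field; rewrite gt_eqF.
have mcos : measurable_fun setT (@cos R).
  by apply: continuous_measurable_fun => ?; exact: continuous_cos.
have msin : measurable_fun setT (@sin R).
  by apply: continuous_measurable_fun => ?; exact: continuous_sin.
have Ec : \int[P]_w cos (X w) = expR (- (s ^+ 2 / 2)).
  by rewrite (cg_bounded sE)//; [exact: normal_cf|move=> x; exact: cos_max].
have Es : \int[P]_w sin (X w) = 0.
  rewrite (cg_bounded sE)//; last by move=> x; exact: sin_max.
  exact: integral_sin_phi.
have ic : P.-integrable setT (EFin \o (fun w => cos (X w))).
  by apply: (bounded_integrableP (C := 1)) => [|x]; [exact: measurableT_comp|exact: cos_max].
have is_ : P.-integrable setT (EFin \o (fun w => sin (X w))).
  by apply: (bounded_integrableP (C := 1)) => [|x]; [exact: measurableT_comp|exact: sin_max].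
have L (a b : R) : \int[P]_w (a * cos (X w) + b * sin (X w)) = a * expR (- (s ^+ 2 / 2)).
  have ia : P.-integrable setT (EFin \o (fun w => a * cos (X w))).
    apply: (bounded_integrableP (C := `|a|)) => [|x].
      by apply: measurable_funM => //; exact: measurableT_comp.
    by rewrite normrM ler_piMr// cos_max.
  have ib : P.-integrable setT (EFin \o (fun w => b * sin (X w))).
    apply: (bounded_integrableP (C := `|b|)) => [|x].
      by apply: measurable_funM => //; exact: measurableT_comp.
    by rewrite normrM ler_piMr// sin_max.
  by rewrite RintegralD// !RintegralZl// Ec Es mulr0 addr0.
split.
  under eq_Rintegral do rewrite cosD -mulNr.
  exact: L.
under eq_Rintegral do rewrite sinD addrC.
rewrite -(L (sin c) (cos c)); apply: eq_Rintegral => w _; by rewrite addrC.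
Qed.

End variable.
End centered_gaussian.

(** * Laws of families of random variables *)

Section smoothing.
Context (R : realType).
Local Notation leb := (@lebesgue_measure R).
Local Notation phi := (normal_pdf (0 : R) 1).
Local Notation peak := (normal_peak (1 : R)).

Lemma measurable_cosR : measurable_fun setT (@cos R).
Proof. by apply: continuous_measurable_fun => ?; exact: continuous_cos. Qed.

Lemma integral_cos_phi (y : R) :
  (\int[leb]_z ((1 + cos (y * z)) * phi z)%:E)%E = (1 + expR (- (y ^+ 2 / 2)))%:E.
Proof.
have i1 : leb.-integrable setT (EFin \o (fun x => cos (y * x) * phi x)).
  apply: integrable_bounded_phi; first exact: measurable_cosM.
  by move=> x; exact: cos_max.
transitivity (\int[leb]_z ((phi z)%:E + (cos (y * z) * phi z)%:E))%E.
  by apply: eq_integral => z _; rewrite -EFinD mulrDl mul1r.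
rewrite (integralD measurableT (integrable_normal_pdf _ _) i1) integral_phi.
by rewrite -normal_cf /Rintegral EFinD fineK// integrable_fin_num.
Qed.

Lemma measurable_indic_comp d (T : measurableType d) (f : T -> R) (A : set R) :
  measurable A -> measurable_fun setT f -> measurable_fun setT (fun x => \1_A (f x) : R).
Proof.
move=> mA mf; rewrite (_ : (fun _ => _) = \1_(f @^-1` A)).
  by apply: measurable_indic; rewrite -[X in measurable X]setTI; exact: mf.
by apply/funext => x; rewrite !indicE.
Qed.

Section one.
Context d (T : measurableType d) (P : probability T R).
Variables (X k : T -> R).
Hypothesis mX : measurable_fun setT X.
Hypothesis mk : measurable_fun setT k.
Hypothesis k0 : forall w, 0 <= k w.
Hypothesis k2 : forall w, k w <= 2.

Let C (t c : R) := \int[P]_w (cos (c + t * X w) * k w).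

Let mP (f : T * R -> R) : measurable_fun setT f ->
  measurable_fun setT (fun z : T * R => k z.1 * f z).
Proof.
by move=> mf; apply: measurable_funM => //; exact: (measurableT_comp mk measurable_fst).
Qed.

Let mXk : measurable_fun setT (fun z : T * R => X z.1).
Proof. exact: (measurableT_comp mX measurable_fst). Qed.

Let CE t c : (\int[P]_w (k w * (1 + cos (c + t * X w)))%:E)%E = (C 0 0 + C t c)%:E.
Proof.
have ib a b : P.-integrable setT (EFin \o (fun w => cos (b + a * X w) * k w)).
  apply: (@bounded_integrableP R _ _ P _ 2) => [|w].
    apply: measurable_funM => //; apply: (measurableT_comp measurable_cosR).
    by apply: measurable_funD => //; exact: measurable_funM.
  rewrite normrM -[2]mul1r ler_pM//; first exact: cos_max.
  by rewrite ger0_norm.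
rewrite EFinD /C /Rintegral !fineK; last 2 first.
- by apply: integrable_fin_num => //; exact: ib.
- by apply: integrable_fin_num => //; exact: ib.
rewrite -(integralD measurableT (ib 0 0) (ib t c)).
apply: eq_integral => w _; rewrite /= -EFinD mul0r addr0 cos0; congr EFin; ring.
Qed.

(** A Gaussian function of [X] is a superposition of cosines, as [expR (- (y^2 / 2))] is the
    integral of [cos (y * z)] against the normal law; so its [k]-weighted mean is a functional of
    [C]. The summand 1 keeps the integrand nonnegative for Tonelli. *)
Lemma smoothing_kernel (c eps : R) :
  (\int[P]_w (k w * expR (- (((c - X w) / eps) ^+ 2 / 2)))%:E)%E =
  (\int[leb]_z ((C 0 0 + C (- (z / eps)) (z * c / eps)) * phi z)%:E - (C 0 0)%:E)%E.
Proof.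
pose g (v : T * R) := (k v.1 * ((1 + cos ((c - X v.1) / eps * v.2)) * phi v.2))%:E.
have mg : measurable_fun setT g.
  apply/measurable_EFinP; apply: mP; apply: measurable_funM.
    apply: measurable_funD => //; apply: (measurableT_comp measurable_cosR).
    apply: measurable_funM; last exact: measurable_snd.
    by apply: measurable_funM => //; apply: measurable_funB.
  exact: (measurableT_comp (@measurable_phi R) measurable_snd).
have g0 v : (0 <= g v)%E.
  by rewrite lee_fin !mulr_ge0 ?normal_pdf_ge0.
have := @fubini_tonelli _ _ _ (measurableTypeR R) R P leb g mg g0.
have me : measurable_fun setT (fun w => expR (- (((c - X w) / eps) ^+ 2 / 2))).
  apply: measurableT_comp => //; apply: measurableT_comp => //.
  apply: measurable_funM => //; apply: measurable_funX.
  by apply: measurable_funM => //; exact: measurable_funB.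
have ik : P.-integrable setT (EFin \o k).
  by apply: (@bounded_integrableP R _ _ P _ 2) => // w; rewrite ger0_norm.
have ike : P.-integrable setT (EFin \o (fun w => k w * expR (- (((c - X w) / eps) ^+ 2 / 2)))).
  apply: (@bounded_integrableP R _ _ P _ 2) => [|w].
    exact: measurable_funM.
  rewrite normrM -[2]mulr1 ler_pM// ?ger0_norm ?expR_ge0//.
  by rewrite -[leRHS]expR0 ler_expR oppr_le0 divr_ge0// sqr_ge0.
have -> : (\int[P]_x \int[leb]_y g (x, y) = (C 0 0)%:E +
   \int[P]_w (k w * expR (- (((c - X w) / eps) ^+ 2 / 2)))%:E)%E.
  have -> : ((C 0 0)%:E = \int[P]_w (k w)%:E)%E.
    rewrite /C /Rintegral fineK; last first.
      apply: integrable_fin_num => //.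
      by under eq_fun do rewrite mul0r addr0 cos0 mul1r.
    by apply: eq_integral => w _; rewrite mul0r addr0 cos0 mul1r.
  rewrite -integralD//; apply: eq_integral => w _.
  transitivity ((k w)%:E * \int[leb]_y ((1 + cos ((c - X w) / eps * y)) * phi y)%:E)%E.
    rewrite -ge0_integralZl//; [|by move=> x _;
      rewrite lee_fin mulr_ge0 ?normal_pdf_ge0//;
      have := cos_geN1 ((c - X w) / eps * x); lra|by rewrite lee_fin].
    apply/measurable_EFinP; apply: measurable_funM; last exact: measurable_phi.
    by apply: measurable_funD => //; exact: measurable_cosM.
  by rewrite integral_cos_phi -EFinM -EFinD mulrDr mulr1.
move=> E; rewrite [X in (X - _)%E](_ : _ = \int[leb]_y \int[P]_x g (x, y))%E; last first.
  apply: eq_integral => z _; rewrite /g /=.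
  under eq_integral do rewrite mulrA EFinM.
  rewrite ge0_integralZr//=; last 3 first.
  - apply/measurable_EFinP; apply: measurable_funM => //.
    apply: measurable_funD => //; apply: (measurableT_comp measurable_cosR).
    apply: measurable_funM => //; apply: measurable_funM => //.
    exact: measurable_funB.
  - by move=> w _; rewrite lee_fin mulr_ge0.
  - by rewrite lee_fin normal_pdf_ge0.
  rewrite EFinM -CE; congr (_ * _)%E.
  by apply: eq_integral => w _; congr (k w * (1 + cos _))%:E; ring.
by rewrite -E [X in (X - _)%E]addeC addeK.
Qed.

(** The mean of [h] at [X] plus an independent normal perturbation of size [eps] is an integral of
    Gaussian kernels in [X], hence determined by [C]. *)
Lemma smoothing_integral (h : R -> R) (eps : R) : measurable_fun setT h ->
  (forall x, 0 <= h x) -> 0 < eps ->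
  (\int[P]_w \int[leb]_z (k w * (h (X w + eps * z) * phi z))%:E =
  \int[leb]_c ((h c * (eps^-1 * peak))%:E *
   (\int[leb]_z ((C 0 0 + C (- (z / eps)) (z * c / eps)) * phi z)%:E - (C 0 0)%:E)))%E.
Proof.
move=> mh h0 e0.
have en0 : eps != 0 by rewrite gt_eqF.
pose g (v : T * R) := (k v.1 * (h v.2 * (eps^-1 * (peak * expR (- (((v.2 - X v.1) / eps) ^+ 2 / 2))))))%:E.
have mg : measurable_fun setT g.
  apply/measurable_EFinP; apply: mP; apply: measurable_funM.
    exact: (measurableT_comp mh measurable_snd).
  apply: measurable_funM => //; apply: measurable_funM => //.
  apply: measurableT_comp => //; apply: measurableT_comp => //.
  apply: measurable_funM => //; apply: measurable_funX.
  apply: measurable_funM => //; apply: measurable_funB => //.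
have p0 : 0 <= peak by exact: normal_peak_ge0.
have g0 v : (0 <= g v)%E.
  by rewrite lee_fin !mulr_ge0 ?expR_ge0 ?invr_ge0// ltW.
have := @fubini_tonelli _ _ _ (measurableTypeR R) R P leb g mg g0.
have -> : (\int[P]_x \int[leb]_y g (x, y) =
    \int[P]_w \int[leb]_z (k w * (h (X w + eps * z) * phi z))%:E)%E.
  apply: eq_integral => w _.
  rewrite (@ge0_integral_affine _ eps (X w) _ en0); last 2 first.
  - exact: (measurableT_comp mg (pair1_measurable w)).
  - by move=> x; exact: g0.
  rewrite gtr0_norm// -ge0_integralZl//; last 2 first.
  - have mg1 : @measurable_fun _ _ (measurableTypeR R) _ setT (fun y => g (w, y)).
      exact: (measurableT_comp mg (pair1_measurable w)).
    exact: (measurableT_comp mg1 (measurable_affine eps (X w))).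
  - by rewrite lee_fin ltW.
  apply: eq_integral => z _; rewrite /g /= -EFinM normal_pdf01E.
  rewrite -addrA subrr addr0 [eps * z]mulrC mulfK//.
  by rewrite [X w + _]addrC; congr EFin; field.
move=> ->; apply: eq_integral => c _.
rewrite -smoothing_kernel -ge0_integralZl//; last 3 first.
- apply/measurable_EFinP; apply: measurable_funM => //.
  apply: measurableT_comp => //; apply: measurableT_comp => //.
  apply: measurable_funM => //; apply: measurable_funX.
  by apply: measurable_funM => //; exact: measurable_funB.
- by move=> w _; rewrite lee_fin mulr_ge0// expR_ge0.
- by rewrite lee_fin !mulr_ge0// invr_ge0 ltW.
by apply: eq_integral => w _; rewrite /g /= -EFinM; congr EFin; ring.
Qed.

(** The threshold is shifted by [u = 1 / (n + 1)] and the perturbation has size [u^2]: being of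
    smaller order, it cannot undo the shift, so the indicators converge at every point, even where
    [X = a]. *)
Lemma smoothing_limit (a : R) :
  (\int[P]_w \int[leb]_z (k w * (\1_(`]a + n.+1%:R^-1, +oo[) (X w + (n.+1%:R^-1 ^+ 2) * z) * phi z))%:E)%E
   @[n --> \oo] --> (\int[P]_w (k w * \1_(`]a, +oo[) (X w))%:E)%E.
Proof.
pose F (n : nat) (v : T * R) := (k v.1 * (\1_(`]a + n.+1%:R^-1, +oo[) (X v.1 + (n.+1%:R^-1 ^+ 2) * v.2) * phi v.2))%:E.
pose G (v : T * R) := (k v.1 * (\1_(`]a, +oo[) (X v.1) * phi v.2))%:E.
have mphi2 : measurable_fun setT (fun v : T * R => phi v.2).
  exact: (measurableT_comp (@measurable_phi R) measurable_snd).
have mF n : measurable_fun setT (F n).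
  apply/measurable_EFinP; apply: mP; apply: measurable_funM => //.
  apply: measurable_indic_comp => //.
  by apply: measurable_funD => //; apply: measurable_funM => //.
have mG : measurable_fun setT G.
  apply/measurable_EFinP; apply: mP; apply: measurable_funM => //.
  exact: measurable_indic_comp.
have F0 n v : (0 <= F n v)%E by rewrite lee_fin !mulr_ge0 ?normal_pdf_ge0.
have G0 v : (0 <= G v)%E by rewrite lee_fin !mulr_ge0 ?normal_pdf_ge0.
pose D (v : T * R) := (2 * phi v.2)%:E.
have D0 v : (0 <= D v)%E by rewrite lee_fin mulr_ge0 ?normal_pdf_ge0.
have mD : measurable_fun setT D by apply/measurable_EFinP; exact: measurable_funM.
have ED : (\int[(P \x leb)%E]_v D v = 2%:E)%E.
  rewrite fubini_tonelli1// /fubini_F /D.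
  transitivity (\int[P]_x (cst 2%:E x))%E.
    apply: eq_integral => x _ /=.
    under eq_integral do rewrite EFinM.
    rewrite ge0_integralZl ?integral_phi ?mule1//.
      by apply/measurable_EFinP; exact: measurable_phi.
    by move=> z _; rewrite lee_fin normal_pdf_ge0.
  by rewrite integral_cst//= probability_setT mule1.
have L : (\int[(P \x leb)%E]_v F n v)%E @[n --> \oo] --> (\int[(P \x leb)%E]_v G v)%E.
  apply: (@dominated_cvg _ _ _ (P \x leb)%E setT measurableT _ _ D) => //.
  - move=> -[w z] _; rewrite /F /G /=.
    apply: cvg_near_cst.
    have z10 : 0 < 1 + `|z| by rewrite ltr_pwDl.
    have e'0 : 0 < 1 / (1 + `|z|) by rewrite divr_gt0.
    pose e' := PosNum e'0.
    have [ax|xa] := ltP a (X w).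
      have e0 : 0 < (X w - a) / (1 + `|z|) by rewrite divr_gt0// subr_gt0.
      pose e := PosNum e0.
      near=> n; congr (k w * (_ * phi z))%:E.
      rewrite !indicE !mem_set//= in_itv/= andbT//.
      have n1 : n.+1%:R^-1 < e%:num by near: n; exact: near_infty_natSinv_lt.
      move: n1; rewrite /= ltr_pdivlMr// => n1.
      have n2 : n.+1%:R^-1 <= 1 :> R by rewrite invf_le1// ler1n.
      have n3 : 0 < n.+1%:R^-1 :> R by rewrite invr_gt0.
      have z1 : - `|z| <= z by rewrite lerNl -normrN ler_norm.
      have z2 := normr_ge0 z.
      set u := n.+1%:R^-1 in n1 n2 n3 *.
      have u1 : u * u <= u by nra.
      have u2 : (u * u) * - `|z| <= (u * u) * z by apply: ler_wpM2l => //; nra.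
      have u3 : (u * u) * `|z| <= u * `|z| by apply: ler_wpM2r.
      by rewrite expr2; lra.
    near=> n; congr (k w * (_ * phi z))%:E.
    rewrite !indicE !memNset//= in_itv/= andbT; apply/negP; rewrite -leNgt//.
    have n1 : n.+1%:R^-1 < e'%:num by near: n; exact: near_infty_natSinv_lt.
    move: n1; rewrite /= ltr_pdivlMr// => n1.
    have n3 : 0 < n.+1%:R^-1 :> R by rewrite invr_gt0.
    have z1 := ler_norm z.
    have z2 := normr_ge0 z.
    by set u := n.+1%:R^-1 in n1 n3 *; nra.
  - apply/integrableP; split => //.
    by under eq_integral do rewrite gee0_abs//; rewrite ED ltry.
  - move=> n v _; rewrite gee0_abs// lee_fin.
    rewrite ler_pM ?mulr_ge0 ?normal_pdf_ge0//.
    by rewrite ler_piMl ?normal_pdf_ge0// indicE; case: (_ \in _).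
have -> : (\int[P]_w (k w * \1_(`]a, +oo[) (X w))%:E = \int[(P \x leb)%E]_v G v)%E.
  rewrite fubini_tonelli1// /fubini_F; apply: eq_integral => w _.
  rewrite /G /=; under eq_integral do rewrite mulrA EFinM.
  rewrite ge0_integralZl ?integral_phi ?mule1//.
    by apply/measurable_EFinP; exact: measurable_phi.
  by move=> z _; rewrite lee_fin normal_pdf_ge0.
  by rewrite lee_fin mulr_ge0.
apply: cvg_trans L; apply: near_eq_cvg; near=> n.
rewrite fubini_tonelli1//.
exact: mF.
Unshelve. all: by end_near. Qed.

End one.
End smoothing.

Section path_law.
Context (R : realType).

Section half_line.
Context d (T : measurableType d) (P : probability T R).
Context d' (T' : measurableType d') (P' : probability T' R).
Variables (X k : T -> R) (X' k' : T' -> R).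
Hypotheses (mX : measurable_fun setT X) (mk : measurable_fun setT k).
Hypotheses (mX' : measurable_fun setT X') (mk' : measurable_fun setT k').
Hypotheses (k0 : forall w, 0 <= k w) (k2 : forall w, k w <= 2).
Hypotheses (k0' : forall w, 0 <= k' w) (k2' : forall w, k' w <= 2).

Lemma half_line_unique (a : R) :
  (forall t c, \int[P]_w (cos (c + t * X w) * k w) = \int[P']_w (cos (c + t * X' w) * k' w)) ->
  \int[P]_w (k w * \1_(`]a, +oo[) (X w)) = \int[P']_w (k' w * \1_(`]a, +oo[) (X' w)).
Proof.
move=> E; rewrite /Rintegral; congr fine.
have L := @smoothing_limit _ _ _ P _ _ mX mk k0 k2 a.
have L' := @smoothing_limit _ _ _ P' _ _ mX' mk' k0' k2' a.
apply: (cvg_unique _ L) => //.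
apply: cvg_trans L'; apply: near_eq_cvg; near=> n.
have mh : measurable_fun setT (\1_(`]a + n.+1%:R^-1, +oo[) : R -> R).
  exact: measurable_indic.
have h0 x : 0 <= (\1_(`]a + n.+1%:R^-1, +oo[) x : R) by [].
have e0 : 0 < n.+1%:R^-1 ^+ 2 :> R by rewrite exprn_gt0// invr_gt0.
rewrite (@smoothing_integral _ _ _ P _ _ mX mk k0 k2 _ _ mh h0 e0).
rewrite (@smoothing_integral _ _ _ P' _ _ mX' mk' k0' k2' _ _ mh h0 e0).
apply: eq_integral => c _; rewrite E; congr (_ * (_ - _))%E.
by apply: eq_integral => z _; rewrite E.
Unshelve. all: by end_near. Qed.

End half_line.

(** Finite intersections of half-spaces: a pi-system generating the product sigma-algebra on
    [K -> R], for an index set of any size. *)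
Definition half_spaces (K : Type) : set (set (K -> R)) :=
  [set A | exists l : seq (R * K), A = [set u | all (fun p => p.1 < u p.2) l]].

Definition paths (K : Type) := g_sigma_algebraType (@half_spaces K).

Lemma half_spaces_setI K : setI_closed (@half_spaces K).
Proof.
move=> _ _ [l ->] [l' ->]; exists (l ++ l').
by apply/seteqP; split => u /=; rewrite all_cat => /andP.
Qed.

Lemma measurable_coord K (k : K) : measurable_fun setT (fun u : paths K => u k).
Proof.
apply: (@measurability _ _ _ _ _ _ (@RGenOInfty.G R)); first exact: RGenOInfty.measurableE.
move=> _ [_ [a ->] <-].
rewrite setTI; apply: sub_sigma_algebra; exists [:: (a, k)].
by apply/seteqP; split => u /=; rewrite in_itv/= !andbT.
Qed.

Lemma measurable_paths K d (T : measurableType d) (f : T -> paths K) :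
  (forall k, measurable_fun setT (fun x => f x k)) -> measurable_fun setT f.
Proof.
move=> mf; apply: (@measurability _ _ _ (paths K) _ _ (@half_spaces K)) => //.
move=> _ [_ [l ->] <-]; rewrite setTI; elim: l => [|[a k] l IH].
  by rewrite (_ : _ @^-1` _ = setT)//; apply/seteqP; split.
rewrite (_ : _ @^-1` _ = (fun x => f x k) @^-1` `]a, +oo[ `&`
   (f @^-1` [set u | all (fun p => p.1 < u p.2) l])).
  apply: measurableI => //.
  by rewrite -[X in measurable X]setTI; exact: mf.
by apply/seteqP; split => x /=; rewrite in_itv/= andbT => /andP.
Qed.

Section uniqueness.
Context d (T : measurableType d) (P : probability T R).
Context d' (T' : measurableType d') (P' : probability T' R).
Variable K : Type.
Variables (X : T -> K -> R) (X' : T' -> K -> R).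
Hypothesis mX : forall k, measurable_fun setT (fun w => X w k).
Hypothesis mX' : forall k, measurable_fun setT (fun w => X' w k).

Definition lin (s : seq (R * K)) (u : K -> R) := \sum_(p <- s) p.1 * u p.2.

Let mlin d0 (T0 : measurableType d0) (Y : T0 -> K -> R)
  (mY : forall k, measurable_fun setT (fun w => Y w k)) s :
  measurable_fun setT (fun w => lin s (Y w)).
Proof. by apply: measurable_sum => p; exact: measurable_funM. Qed.

Let mcyl d0 (T0 : measurableType d0) (Y : T0 -> K -> R)
  (mY : forall k, measurable_fun setT (fun w => Y w k)) l :
  measurable_fun setT (fun w => (all (fun p => p.1 < Y w p.2) l)%:R : R).
Proof.
elim: l => [|[a k] l IH]; first exact: measurable_cst.
rewrite (_ : (fun _ => _) = (fun w => \1_(`]a, +oo[) (Y w k) *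
   (all (fun p => p.1 < Y w p.2) l)%:R)).
  by apply: measurable_funM => //; apply: measurable_indic_comp.
apply/funext => w /=; rewrite indicE.
have -> : (Y w k \in `]a, +oo[%classic) = (a < Y w k).
  by apply/idP/idP; rewrite inE/= in_itv/= andbT.
by case: (a < _) => /=; rewrite ?mul1r ?mul0r.
Qed.

Let bint d0 (T0 : measurableType d0) (P0 : probability T0 R) (Y : T0 -> K -> R)
  (mY : forall k, measurable_fun setT (fun w => Y w k)) l s c :
  P0.-integrable setT (EFin \o (fun w =>
    (all (fun p => p.1 < Y w p.2) l)%:R * cos (c + lin s (Y w)))).
Proof.
apply: (@bounded_integrableP R _ _ P0 _ 1) => [|w].
  apply: measurable_funM; first exact: mcyl.
  by apply: (measurableT_comp (@measurable_cosR R)); apply: measurable_funD => //; exact: mlin.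
by case: (all _ _); rewrite ?mul1r ?mul0r ?normr0// cos_max.
Qed.

(** By induction on the number of half-spaces. The indicators already treated, times [1 + cos], form
    a weight with values in [0, 2], and [half_line_unique] adds one more half-space; products of
    cosines are turned into sums to return to the induction hypothesis. *)
Lemma law_unique :
  (forall s c, \int[P]_w cos (c + lin s (X w)) = \int[P']_w cos (c + lin s (X' w))) ->
  forall A : set (paths K), measurable A -> P (X @^-1` A) = P' (X' @^-1` A).
Proof.
move=> E.
have claim l : forall s c,
   \int[P]_w ((all (fun p => p.1 < X w p.2) l)%:R * cos (c + lin s (X w))) =
   \int[P']_w ((all (fun p => p.1 < X' w p.2) l)%:R * cos (c + lin s (X' w))).
  elim: l => [|[a k] l IH] s c.
    rewrite [LHS](_ : _ = \int[P]_w cos (c + lin s (X w))); last first.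
      by apply: eq_Rintegral => w _; rewrite mul1r.
    rewrite [RHS](_ : _ = \int[P']_w cos (c + lin s (X' w))); last first.
      by apply: eq_Rintegral => w _; rewrite mul1r.
    exact: E.
  have step s' c' :
     \int[P]_w ((all (fun p => p.1 < X w p.2) l)%:R * (1 + cos (c' + lin s' (X w))) * \1_(`]a, +oo[) (X w k)) =
     \int[P']_w ((all (fun p => p.1 < X' w p.2) l)%:R * (1 + cos (c' + lin s' (X' w))) * \1_(`]a, +oo[) (X' w k)).
    have mk0 d0 (T0 : measurableType d0) (Y : T0 -> K -> R)
       (mY : forall k, measurable_fun setT (fun w => Y w k)) : measurable_fun setT
       (fun w => (all (fun p => p.1 < Y w p.2) l)%:R * (1 + cos (c' + lin s' (Y w)))).
      apply: measurable_funM; first exact: mcyl.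
      apply: measurable_funD => //; apply: (measurableT_comp (@measurable_cosR R)).
      by apply: measurable_funD => //; exact: mlin.
    have k0 (u : K -> R) : 0 <= (all (fun p => p.1 < u p.2) l)%:R * (1 + cos (c' + lin s' u)).
      by rewrite mulr_ge0// ler0n.
    have k2 (u : K -> R) : (all (fun p => p.1 < u p.2) l)%:R * (1 + cos (c' + lin s' u)) <= 2.
      have := cos_geN1 (c' + lin s' u); have := cos_le1 (c' + lin s' u).
      by case: (all _ _); rewrite ?mul1r ?mul0r//; lra.
    apply: (@half_line_unique _ _ P _ _ P' (fun w => X w k) _ (fun w => X' w k)) => //.
    - exact: mk0.
    - exact: mk0.
    move=> t b.
    have expand d0 (T0 : measurableType d0) (P0 : probability T0 R) (Y : T0 -> K -> R)
        (mY : forall k, measurable_fun setT (fun w => Y w k)) :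
      \int[P0]_w (cos (b + t * Y w k) * ((all (fun p => p.1 < Y w p.2) l)%:R * (1 + cos (c' + lin s' (Y w))))) =
      \int[P0]_w ((all (fun p => p.1 < Y w p.2) l)%:R * cos (b + lin [:: (t, k)] (Y w))) +
      2^-1 * (\int[P0]_w ((all (fun p => p.1 < Y w p.2) l)%:R * cos ((b + c') + lin ((t, k) :: s') (Y w)))) +
      2^-1 * (\int[P0]_w ((all (fun p => p.1 < Y w p.2) l)%:R * cos ((b - c') + lin ((t, k) :: [seq (- p.1, p.2) | p <- s']) (Y w)))).
      have i1 := bint P0 mY l [:: (t, k)] b.
      have i2 := bint P0 mY l ((t, k) :: s') (b + c').
      have i3 := bint P0 mY l ((t, k) :: [seq (- p.1, p.2) | p <- s']) (b - c').
      rewrite -(RintegralZl _ measurableT i2) -(RintegralZl _ measurableT i3).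
      have i2' := integrableZl measurableT 2^-1 i2.
      have i3' := integrableZl measurableT 2^-1 i3.
      rewrite -(RintegralD measurableT i1 i2') -RintegralD//; last first.
        exact: (integrableD measurableT i1 i2').
      apply: eq_Rintegral => w _ /=.
      have Em : lin [seq (- p.1, p.2) | p <- s'] (Y w) = - lin s' (Y w).
        by rewrite /lin big_map -sumrN; apply: eq_bigr => p _; rewrite mulNr.
      have Ec x : lin ((t, k) :: x) (Y w) = t * Y w k + lin x (Y w).
        by rewrite /lin big_cons.
      rewrite !Ec Em (_ : lin [::] (Y w) = 0) ?addr0; last by rewrite /lin big_nil.
      have -> : b + c' + (t * Y w k + lin s' (Y w)) = (b + t * Y w k) + (c' + lin s' (Y w)) by ring.
      have -> : b - c' + (t * Y w k - lin s' (Y w)) = (b + t * Y w k) - (c' + lin s' (Y w)) by ring.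
      move: (b + t * Y w k) (c' + lin s' (Y w)) => u v.
      by rewrite cosD cosB; field.
    by rewrite (expand _ _ P X mX) (expand _ _ P' X' mX') !IH.
  (* The empty combination with phase 0 gives twice the indicator; half of it removes the 1 from
     [1 + cos]. *)
  have split1 d0 (T0 : measurableType d0) (P0 : probability T0 R) (Y : T0 -> K -> R)
        (mY : forall k, measurable_fun setT (fun w => Y w k)) :
     \int[P0]_w ((all (fun p => p.1 < Y w p.2) ((a, k) :: l))%:R * cos (c + lin s (Y w))) =
     \int[P0]_w ((all (fun p => p.1 < Y w p.2) l)%:R * (1 + cos (c + lin s (Y w))) * \1_(`]a, +oo[) (Y w k)) -
     2^-1 * \int[P0]_w ((all (fun p => p.1 < Y w p.2) l)%:R * (1 + cos (0 + lin [::] (Y w))) * \1_(`]a, +oo[) (Y w k)).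
    have ii s' c' : P0.-integrable setT (EFin \o (fun w =>
      ((all (fun p => p.1 < Y w p.2) l)%:R * (1 + cos (c' + lin s' (Y w))) * \1_(`]a, +oo[) (Y w k)))).
      apply: (@bounded_integrableP R _ _ P0 _ 2) => [|w].
        apply: measurable_funM; last exact: measurable_indic_comp.
        apply: measurable_funM; first exact: mcyl.
        apply: measurable_funD => //; apply: (measurableT_comp (@measurable_cosR R)).
        by apply: measurable_funD => //; exact: mlin.
      rewrite ger0_norm; last by rewrite !mulr_ge0// ler0n.
      have := cos_geN1 (c' + lin s' (Y w)); have := cos_le1 (c' + lin s' (Y w)).
      by rewrite indicE; case: (all _ _); case: (_ \in _); rewrite ?mul1r ?mul0r ?mulr1 ?mulr0//; lra.
    rewrite -(RintegralZl _ measurableT (ii _ _)) -RintegralB//; last first.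
      exact: (integrableZl measurableT 2^-1 (ii [::] 0)).
    apply: eq_Rintegral => w _ /=.
    rewrite (_ : lin [::] (Y w) = 0) ?addr0 ?cos0; last by rewrite /lin big_nil.
    have -> : \1_(`]a, +oo[) (Y w k) = ((a < Y w k)%R : bool)%:R :> R.
      rewrite indicE; congr (_%:R); congr nat_of_bool.
      by apply/idP/idP; rewrite inE/= in_itv/= andbT.
    by case: (a < _) => /=; case: (all _ _) => /=; field.
  by rewrite (split1 _ _ P X mX) (split1 _ _ P' X' mX') !step.
have mXp := measurable_paths mX; have mXp' := measurable_paths mX'.
move=> A mA.
have pE d0 (T0 : measurableType d0) (P0 : probability T0 R) (Y : T0 -> K -> R)
   (mY : forall k, measurable_fun setT (fun w => Y w k)) l :
   P0 (Y @^-1` [set u | all (fun p => p.1 < u p.2) l]) =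
   (\int[P0]_w ((all (fun p => p.1 < Y w p.2) l)%:R * cos (0 + lin [::] (Y w))))%:E.
  have mA0 : measurable (Y @^-1` [set u | all (fun p => p.1 < u p.2) l]).
    rewrite -[X in measurable X]setTI; apply: (measurable_paths mY) => //.
    by apply: sub_sigma_algebra; exists l.
  rewrite -[X in P0 X]setIT -integral_indic// /Rintegral fineK; last first.
    by apply: integrable_fin_num => //; exact: bint.
  apply: eq_integral => w _; congr EFin.
  rewrite (_ : lin [::] (Y w) = 0) ?addr0 ?cos0 ?mulr1; last by rewrite /lin big_nil.
  rewrite indicE; congr (_%:R); congr nat_of_bool.
  by apply/idP/idP; rewrite inE.
apply: (@measure_unique _ R (paths K) (@half_spaces K) (fun=> setT) erefl (@half_spaces_setI K)
  _ _ (push_measure P mXp) (push_measure P' mXp')) => //.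
- by move=> _; exists [::]; apply/seteqP; split.
- by apply/seteqP; split => // u _; exists 0%N.
- by move=> _ [l ->]; rewrite /= /pushforward !pE// claim.
- by move=> _; rewrite /= /pushforward preimage_setT probability_setT ltry.
Qed.

End uniqueness.
End path_law.

(** * Measures on six-dimensional space *)

Section cf.
Context (R : realType).

(* [e] is the value of the characteristic function of the centred variable [f] *)
Definition has_cf d (T : measurableType d) (m : {measure set T -> \bar R})
    (f : T -> R) (e : R) :=
  measurable_fun setT f /\ forall c,
  \int[m]_w cos (c + f w) = cos c * e /\ \int[m]_w sin (c + f w) = sin c * e.

Definition is_prob d (T : measurableType d) (m : {measure set T -> \bar R}) :=
  m setT = 1%E.

Section prodm.
Context d1 d2 (T1 : measurableType d1) (T2 : measurableType d2)
    (m1 : {sigma_finite_measure set T1 -> \bar R})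
    (m2 : {sigma_finite_measure set T2 -> \bar R}).

Lemma prodm_sigma_finite : sigma_finite setT (product_measure1 m1 m2).
Proof.
have /sigma_finiteP[F [TF ndF oF]] := sigma_finiteT m1.
have /sigma_finiteP[G [TG ndG oG]] := sigma_finiteT m2.
exists (fun n => F n `*` G n).
  apply/seteqP; split => // -[x y] _.
  have [i _ Fi] : (\bigcup_i F i) x by rewrite -TF.
  have [j _ Gj] : (\bigcup_i G i) y by rewrite -TG.
  exists (maxn i j) => //; split => /=.
    by move: x Fi; apply/subsetPset/ndF; rewrite leq_maxl.
  by move: y Gj; apply/subsetPset/ndG; rewrite leq_maxr.
move=> k; have [mFk Fk] := oF k; have [mGk Gk] := oG k.
split; first exact: measurableX.
by rewrite product_measure1E// lte_mul_pinfty// ge0_fin_numE.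
Qed.

(** The product measure packed with its sigma-finiteness, so that products can be iterated. *)
Definition prodm : {sigma_finite_measure set (T1 * T2)%type -> \bar R} :=
  HB.pack_for {sigma_finite_measure set (T1 * T2)%type -> \bar R} (product_measure1 m1 m2)
    (Measure_isSigmaFinite.Build _ _ _ (product_measure1 m1 m2 : {measure set _ -> \bar R})
      prodm_sigma_finite).

Lemma prodmE : prodm = (m1 \x m2)%E :> (set _ -> \bar R).
Proof. by []. Qed.

Lemma prodmX A B a b : measurable A -> measurable B -> m1 A = a%:E -> m2 B = b%:E ->
  prodm (A `*` B) = (a * b)%:E.
Proof. move=> mA mB ea eb; apply: etrans (product_measure1E m1 m2 mA mB) _.
by rewrite EFinM; congr (_ * _)%E. Qed.

Lemma dilation_prodm f g a b : dilation m1 f a -> dilation m2 g b ->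
  dilation prodm (fun z => (f z.1, g z.2)) (a * b).
Proof. exact: dilation_prod. Qed.

End prodm.

Lemma is_prob_prod d1 d2 (T1 : measurableType d1) (T2 : measurableType d2)
    (m1 : {sigma_finite_measure set T1 -> \bar R})
    (m2 : {sigma_finite_measure set T2 -> \bar R}) :
  is_prob m1 -> is_prob m2 -> is_prob (prodm m1 m2).
Proof.
move=> E1 E2; have := product_measure1E m1 m2 measurableT measurableT.
by rewrite setXTT E1 E2 mule1.
Qed.

Lemma measurable_sinR : measurable_fun setT (@sin R).
Proof. by apply: continuous_measurable_fun => ?; exact: continuous_sin. Qed.

Lemma is_prob_bounded_integrable d (T : measurableType d)
    (m : {measure set T -> \bar R}) (f : T -> R) C : is_prob m ->
  measurable_fun setT f -> (forall x, `|f x| <= C) -> m.-integrable setT (EFin \o f).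
Proof.
move=> m1 mf fC.
apply: (@le_integrable _ _ _ m setT measurableT _ (EFin \o cst C)) => //.
- exact/measurable_EFinP.
- by move=> x _ /=; rewrite lee_fin (le_trans (fC x))// ler_norm.
- apply/integrableP; split; first by apply/measurable_EFinP; exact: measurable_cst.
  under eq_integral do rewrite /=.
  by rewrite integral_cst// m1 mule1 ltry.
Qed.

(** Integrating out the second coordinate with the phase [c + f1 z.1] produces the factor [e2]; the
    first coordinate then gives [e1]. *)
Lemma has_cf_prod d1 d2 (T1 : measurableType d1) (T2 : measurableType d2)
    (m1 : {sigma_finite_measure set T1 -> \bar R})
    (m2 : {sigma_finite_measure set T2 -> \bar R}) f1 f2 e1 e2 :
  is_prob m1 -> is_prob m2 -> has_cf m1 f1 e1 -> has_cf m2 f2 e2 ->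
  has_cf (prodm m1 m2) (fun z => f1 z.1 + f2 z.2) (e1 * e2).
Proof.
move=> p1 p2 [mf1 E1] [mf2 E2].
have mf : measurable_fun setT (fun z : T1 * T2 => f1 z.1 + f2 z.2).
  apply: measurable_funD.
    exact: (measurableT_comp mf1 measurable_fst).
  exact: (measurableT_comp mf2 measurable_snd).
split => // c.
have main (g : R -> R) : measurable_fun setT g -> (forall x, `|g x| <= 1) ->
    (forall c, \int[m1]_w g (c + f1 w) = g c * e1) ->
    (forall c, \int[m2]_w g (c + f2 w) = g c * e2) ->
    \int[(m1 \x m2)%E]_z g (c + (f1 z.1 + f2 z.2)) = g c * (e1 * e2).
  move=> mg g1 G1 G2.
  have mgf : measurable_fun setT (fun z : T1 * T2 => g (c + (f1 z.1 + f2 z.2))).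
    by apply: (measurableT_comp mg); exact: measurable_funD.
  have ig : (m1 \x m2)%E.-integrable setT (EFin \o (fun z => g (c + (f1 z.1 + f2 z.2)))).
    by apply: (@is_prob_bounded_integrable _ _ _ _ 1) => //; exact: is_prob_prod.
  have i2 a : m2.-integrable setT (EFin \o (fun w => g (a + f2 w))).
    apply: (@is_prob_bounded_integrable _ _ _ _ 1) => //.
    by apply: (measurableT_comp mg); exact: measurable_funD.
  have i1 a : m1.-integrable setT (EFin \o (fun w => g (a + f1 w))).
    apply: (@is_prob_bounded_integrable _ _ _ _ 1) => //.
    by apply: (measurableT_comp mg); exact: measurable_funD.
  rewrite /Rintegral -(integral12_prod_meas1 ig) /fubini_F.
  transitivity (fine (\int[m1]_x (e2%:E * (g (c + f1 x))%:E))%E).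
    congr fine; apply: eq_integral => x _ /=.
    rewrite -EFinM [e2 * _]mulrC -G2 /Rintegral fineK; last first.
      by apply: integrable_fin_num => //; exact: i2.
    by apply: eq_integral => y _; rewrite addrA.
  rewrite (integralZl measurableT (i1 c)) fineM//; last first.
    by apply: integrable_fin_num => //; exact: i1.
  by have := G1 c; rewrite /Rintegral /= => ->; ring.
split; apply: main.
- exact: measurable_cosR.
- exact: cos_max.
- by move=> a; have [] := E1 a.
- by move=> a; have [] := E2 a.
- exact: measurable_sinR.
- exact: sin_max.
- by move=> a; have [] := E1 a.
- by move=> a; have [] := E2 a.
Qed.

(** The sections of a null set are [l2]-null, hence [m2]-null, outside an [l1]-null set, which is
    also [m1]-null. *)
Lemma null_dominates_prod d1 d2 (T1 : measurableType d1) (T2 : measurableType d2)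
    (m1 l1 : {sigma_finite_measure set T1 -> \bar R})
    (m2 l2 : {sigma_finite_measure set T2 -> \bar R}) :
  (forall A, measurable A -> l1 A = 0%E -> m1 A = 0%E) ->
  (forall A, measurable A -> l2 A = 0%E -> m2 A = 0%E) ->
  forall A, measurable A -> prodm l1 l2 A = 0%E -> prodm m1 m2 A = 0%E.
Proof.
move=> d1_ d2_ A mA.
have ms2 : measurable_fun setT (l2 \o xsection A) by exact: measurable_fun_xsection.
rewrite !prodmE /product_measure1 => E0.
have {}E0 : (\int[l1]_x `|(l2 \o xsection A) x| = 0)%E.
  by rewrite -[RHS]E0; apply: eq_integral => x _; rewrite gee0_abs.
have [B [mB B0 AB]] := (ae_eq_integral_abs l1 measurableT ms2).1 E0.
have ae0 : ae_eq m1 setT (m2 \o xsection A) (cst 0%E).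
  exists B; split => //; first exact: d1_.
  move=> x /= nx; apply: AB => /= /(_ I) E; apply: nx => _.
  apply: d2_ => //; exact: measurable_xsection.
transitivity (\int[m1]_x cst 0 x)%E; last by rewrite integral0.
apply: ge0_ae_eq_integral => //; exact: measurable_fun_xsection.
Qed.

End cf.


Section R6.
Context (R : realType).
Local Notation mR := (measurableTypeR R).

Notation space3 := (mR * (mR * mR))%type.
Notation space6 := (space3 * space3)%type.

Local Notation leb := (@lebesgue_measure R).
Local Notation n01 := (@normal_prob R 0 1).

Definition leb3 : {sigma_finite_measure set space3 -> \bar R} := prodm leb (prodm leb leb).
Definition leb6 : {sigma_finite_measure set space6 -> \bar R} := prodm leb3 leb3.

Definition normal3 : {sigma_finite_measure set space3 -> \bar R} := prodm n01 (prodm n01 n01).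
Definition normal6 : {sigma_finite_measure set space6 -> \bar R} := prodm normal3 normal3.

Definition coord6 (z : space6) (j : 'I_6) : R :=
  match nat_of_ord j with
  | 0 => z.1.1 | 1 => z.1.2.1 | 2 => z.1.2.2
  | 3 => z.2.1 | 4 => z.2.2.1 | _ => z.2.2.2
  end.

Definition vec6 (f : 'I_6 -> R) : space6 :=
  ((f (inord 0), (f (inord 1), f (inord 2))), (f (inord 3), (f (inord 4), f (inord 5)))).

Lemma coord_vec6 f j : coord6 (vec6 f) j = f j.
Proof.
case: j => -[|[|[|[|[|[|//]]]]]] i; rewrite /coord6 /=; congr f; apply/val_inj;
  by rewrite /= inordK.
Qed.

Lemma measurable_coord6 j : measurable_fun setT (fun z : space6 => coord6 z j).
Proof.
have m3 : [/\ measurable_fun setT (fun z : space3 => z.1),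
   measurable_fun setT (fun z : space3 => z.2.1) &
   measurable_fun setT (fun z : space3 => z.2.2)].
  split; first exact: measurable_fst.
    exact: (measurableT_comp measurable_fst measurable_snd).
  exact: (measurableT_comp measurable_snd measurable_snd).
have [m30 m31 m32] := m3.
have f3 : measurable_fun setT (fun z : space6 => z.1) by exact: measurable_fst.
have s3 : measurable_fun setT (fun z : space6 => z.2) by exact: measurable_snd.
case: j => -[|[|[|[|[|[|//]]]]]] i; rewrite /coord6 /=.
- exact: (measurableT_comp m30 f3).
- exact: (measurableT_comp m31 f3).
- exact: (measurableT_comp m32 f3).
- exact: (measurableT_comp m30 s3).
- exact: (measurableT_comp m31 s3).
- exact: (measurableT_comp m32 s3).
Qed.

Lemma measurable_vec6 d (T : measurableType d) (f : T -> 'I_6 -> R) :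
  (forall j, measurable_fun setT (fun w => f w j)) ->
  measurable_fun setT (fun w => vec6 (f w)).
Proof.
move=> mf.
have m3 i j k : measurable_fun setT (fun w => (f w i, (f w j, f w k)) : space3).
  exact: (measurable_fun_pair (mf _) (measurable_fun_pair (mf _) (mf _))).
exact: (measurable_fun_pair (m3 _ _ _) (m3 _ _ _)).
Qed.

Lemma dilation_leb6 (a b : 'I_6 -> R) : (forall j, a j != 0) ->
  dilation leb6 (fun z => vec6 (fun j => a j * coord6 z j + b j)) (\prod_j `|a j|).
Proof.
move=> a0.
have D j := @dilation_lebesgue R (a j) (b j) (a0 j).
have D3 i j k : dilation leb3 (fun z : space3 => (a i * z.1 + b i, (a j * z.2.1 + b j,
    a k * z.2.2 + b k))) (`|a i| * (`|a j| * `|a k|)).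
  have D2 := dilation_prodm (D j) (D k).
  exact: (dilation_prodm (D i) D2).
have := dilation_prodm (D3 (inord 0) (inord 1) (inord 2)) (D3 (inord 3) (inord 4) (inord 5)).
rewrite (_ : \prod_j _ = `|a (inord 0)| * (`|a (inord 1)| * `|a (inord 2)|) *
  (`|a (inord 3)| * (`|a (inord 4)| * `|a (inord 5)|))); last first.
  rewrite !big_ord_recl big_ord0 mulr1 /= !mulrA.
  by do !congr (_ * _); congr (`|a _|); apply/val_inj; rewrite /= inordK.
by congr (dilation _ _ _); apply/funext => z; rewrite /vec6 /coord6 !inordK.
Qed.

Lemma leb6_cube (rho : R) : 0 <= rho ->
  leb6 [set z | forall j, `|coord6 z j| <= rho] = ((2 * rho) ^+ 6)%:E.
Proof.
move=> r0; pose I := `[- rho, rho]%classic : set mR.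
have mI : measurable I by exact: measurable_itv.
have LI : leb I = (2 * rho)%:E.
  rewrite lebesgue_measure_itv/= lte_fin; case: ltP => [_|h0].
    by rewrite -EFinB; congr EFin; ring.
  have h : (rho : R) <= - rho := h0.
  have h2 : rho = 0 by move: (r0) (h); clear; lra.
  by rewrite h2 mulr0.
have mII : measurable (I `*` I) by exact: measurableX.
have LII := prodmX mI mI LI LI.
have L3 := prodmX mI mII LI LII.
have m3 : measurable (I `*` (I `*` I)) by exact: measurableX.
have -> : [set z | forall j, `|coord6 z j| <= rho] = (I `*` (I `*` I)) `*` (I `*` (I `*` I)).
  apply/seteqP; split => z /=; rewrite /I /= !in_itv/= -!ler_norml.
    move=> h; have := h (@Ordinal 6 0 isT); have := h (@Ordinal 6 1 isT); have := h (@Ordinal 6 2 isT).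
    by have := h (@Ordinal 6 3 isT); have := h (@Ordinal 6 4 isT); have := h (@Ordinal 6 5 isT).
  by move=> [[h0 [h1 h2]] [h3 [h4 h5]]] [] [|[|[|[|[|[|//]]]]]].
by rewrite (prodmX m3 m3 L3 L3); congr EFin; ring.
Qed.

Lemma normal6_null_dominates A : measurable A -> leb6 A = 0%E -> normal6 A = 0%E.
Proof.
have N B : measurable B -> leb B = 0%E -> n01 B = 0%E.
  by move=> mB; have /null_content_dominatesP := @normal_prob_dominates R 0 1; exact.
have N3 B : measurable B -> leb3 B = 0%E -> normal3 B = 0%E.
  exact: (null_dominates_prod N (null_dominates_prod N N)).
exact: (null_dominates_prod N3 N3).
Qed.

Lemma is_prob_normal6 : is_prob normal6.
Proof.
have N : is_prob n01 by exact: probability_setT.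
have N3 : is_prob normal3 by exact: (is_prob_prod N (is_prob_prod N N)).
exact: (is_prob_prod N3 N3).
Qed.

Lemma has_cf_normal (t : R) : has_cf n01 (fun x => t * x) (expR (- (t ^+ 2 / 2))).
Proof.
have gid : centered_gaussian n01 (fun x : mR => x : R).
  by split; [exact: measurable_id|right; exists 1].
have sE (f : R -> \bar R) : measurable_fun setT f -> (forall x, 0 <= f x)%E ->
   (\int[n01]_w f w = \int[leb]_z (f (1 * z)%R * (normal_pdf 0 1 z)%:E))%E.
  move=> mf f0; rewrite (@ge0_integral_density _ mR R leb n01 (normal_pdf 0 1))//.
  - by apply: eq_integral => x _; rewrite mul1r.
  - exact: measurable_normal_pdf.
  - by move=> x; exact: normal_pdf_ge0.
split; first exact: measurable_funM.
have mct c : measurable_fun setT (fun x : R => c + t * x).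
  by apply: measurable_funD => //; exact: measurable_funM.
have i1 : leb.-integrable setT (EFin \o (fun z => cos (t * z) * normal_pdf 0 1 z)).
  by apply: integrable_bounded_phi; [exact: measurable_cosM|move=> x; exact: cos_max].
have i2 : leb.-integrable setT (EFin \o (fun z => sin (t * z) * normal_pdf 0 1 z)).
  by apply: integrable_bounded_phi; [exact: measurable_sinM|move=> x; exact: sin_max].
have L (a b : R) : \int[leb]_z (a * (cos (t * z) * normal_pdf 0 1 z) +
   b * (sin (t * z) * normal_pdf 0 1 z)) = a * expR (- (t ^+ 2 / 2)).
  have i1' := integrableZl measurableT a i1; have i2' := integrableZl measurableT b i2.
  rewrite (RintegralD measurableT i1' i2') (RintegralZl _ measurableT i1).
  by rewrite (RintegralZl _ measurableT i2) normal_cf integral_sin_phi mulr0 addr0.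
move=> c; split.
  rewrite (cg_bounded gid sE (f := fun x => cos (c + t * x)))//.
  - rewrite -(L (cos c) (- sin c)); apply: eq_Rintegral => z _.
    by rewrite mul1r cosD; ring.
  - exact: (measurableT_comp (@measurable_cosR R) (mct c)).
  - by move=> x; exact: cos_max.
rewrite (cg_bounded gid sE (f := fun x => sin (c + t * x)))//.
- rewrite -(L (sin c) (cos c)); apply: eq_Rintegral => z _.
  by rewrite mul1r sinD; ring.
- exact: (measurableT_comp (@measurable_sinR R) (mct c)).
- by move=> x; exact: sin_max.
Qed.

Lemma has_cf_normal6 (a : 'I_6 -> R) :
  has_cf normal6 (fun z => \sum_j a j * coord6 z j) (expR (- ((\sum_j a j ^+ 2) / 2))).
Proof.
have H j := has_cf_normal (a j).
have N : is_prob n01 by exact: probability_setT.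
have N2 : is_prob (prodm n01 n01) by exact: is_prob_prod.
have N3 : is_prob normal3 by exact: (is_prob_prod N N2).
have H3 i j k : has_cf normal3 (fun z : space3 => a i * z.1 + (a j * z.2.1 + a k * z.2.2))
   (expR (- (a i ^+ 2 / 2)) * (expR (- (a j ^+ 2 / 2)) * expR (- (a k ^+ 2 / 2)))).
  exact: (has_cf_prod N N2 (H i) (has_cf_prod N N (H j) (H k))).
have := has_cf_prod N3 N3 (H3 (inord 0) (inord 1) (inord 2)) (H3 (inord 3) (inord 4) (inord 5)).
have ord6 (F : 'I_6 -> R) : \sum_j F j = F (inord 0) + (F (inord 1) + F (inord 2)) +
   (F (inord 3) + (F (inord 4) + F (inord 5))).
  rewrite !big_ord_recl big_ord0 addr0 /= !addrA.
  by do !congr (_ + _); congr (F _); apply/val_inj; rewrite /= inordK.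
have <- : expR (- ((\sum_j a j ^+ 2) / 2)) =
    expR (- (a (inord 0) ^+ 2 / 2)) *
     (expR (- (a (inord 1) ^+ 2 / 2)) * expR (- (a (inord 2) ^+ 2 / 2))) *
     (expR (- (a (inord 3) ^+ 2 / 2)) *
      (expR (- (a (inord 4) ^+ 2 / 2)) * expR (- (a (inord 5) ^+ 2 / 2)))).
  by rewrite (ord6 (fun j => a j ^+ 2)) !mulrDl !opprD !expRD.
congr (has_cf _ _ _); apply/funext => z.
by rewrite ord6 /coord6 !inordK.
Qed.

End R6.

#[global] Opaque leb6 normal6.

(** * Dyadic grids and chaining *)

(* [(n, (i, j))] stands for the point [(i / 16 ^ n, j / 4 ^ n)] of the unit square. *)
Definition grid := (nat * (nat * nat))%type.

Definition in_grid (q : grid) : bool := (q.2.1 <= 16 ^ q.1)%N && (q.2.2 <= 4 ^ q.1)%N.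

Definition grid0 : grid := (0, (0, 0))%N.

(** All points of level 0 have the root [grid0] as parent. The factors 16 = 2^4 and 4 = 2^2 are the
    parabolic scaling of time and space. *)
Definition parent (q : grid) : grid :=
  if q.1 is n.+1 then (n, (q.2.1 %/ 16, q.2.2 %/ 4))%N else grid0.

Lemma in_grid_parent q : in_grid q -> in_grid (parent q).
Proof.
case: q => [[|n] [i j]] //=; rewrite /in_grid/= !expnS => /andP[hi hj].
apply/andP; split; first by have := leq_div2r 16 hi; rewrite mulKn.
by have := leq_div2r 4 hj; rewrite mulKn.
Qed.

Section chaining.
Context (R : realType).

Definition grid_pos (q : grid) : R * R :=
  (q.2.1%:R / 16 ^+ q.1, q.2.2%:R / 4 ^+ q.1).

(** The induction step is the nonnegativity of [(a - b) * (a^n - b^n)]. *)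
Lemma exp_convex (a b p q : R) n : 0 <= a -> 0 <= b -> 0 <= p -> 0 <= q -> p + q = 1 ->
  (p * a + q * b) ^+ n <= p * a ^+ n + q * b ^+ n.
Proof.
move=> a0 b0 p0 q0 pq; elim: n => [|n IH]; first by rewrite !expr0; lra.
have k0 : 0 <= p * a + q * b by rewrite addr_ge0// mulr_ge0.
rewrite exprS; apply: (le_trans (ler_wpM2l k0 IH)).
rewrite -subr_ge0.
have -> : p * a ^+ n.+1 + q * b ^+ n.+1 - (p * a + q * b) * (p * a ^+ n + q * b ^+ n) =
   p * q * ((a - b) * (a ^+ n - b ^+ n)).
  by have -> : q = 1 - p by [lra]; rewrite !exprS; ring.
apply: mulr_ge0; first exact: mulr_ge0.
have [ab|ab] := leP a b.
  by rewrite -mulrNN mulr_ge0// ?opprB subr_ge0// lerXn2r.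
by apply: mulr_ge0; rewrite subr_ge0; [exact: ltW|rewrite lerXn2r ?nnegrE// ltW].
Qed.

(* [cw] and [cr] come from the convexity of [x ^ 12] with the weights 1/4 and
   3/4; the chain has a finite expectation because [64 * cr < 4096]. *)
Definition cw : R := 4 ^+ 11.
Definition cr : R := (4 / 3) ^+ 11.

Lemma cw_gt0 : 0 < cw. Proof. by rewrite exprn_gt0. Qed.
Lemma cr_gt0 : 0 < cr. Proof. by rewrite exprn_gt0// divr_gt0. Qed.
Lemma cr_le32 : cr <= 32. Proof. by rewrite /cr expr_div_n ler_pdivrMr ?exprn_gt0//; lra. Qed.
Lemma cr_le_cw : cr <= cw. Proof. by rewrite lerXn2r ?nnegrE//; lra. Qed.

Lemma exp12D (d y : R) : 0 <= d -> 0 <= y ->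
  (d + y) ^+ 12 <= cw * d ^+ 12 + cr * y ^+ 12.
Proof.
move=> d0 y0.
have -> : d + y = 4^-1 * (4 * d) + (3 / 4) * (4 / 3 * y) by field.
apply: le_trans (exp_convex 12 _ _ _ _ _) _; [lra|lra|lra|lra|lra|].
by rewrite !exprMn /cw /cr le_eqVlt; apply/orP; left; apply/eqP; field.
Qed.

Lemma exp12_sum (d : nat -> R) n : (forall m, 0 <= d m) ->
  (\sum_(m < n) d m) ^+ 12 <= \sum_(m < n) cw * cr ^+ m * d m ^+ 12.
Proof.
elim: n d => [|n IH] d d0; first by rewrite !big_ord0 expr0n.
rewrite !big_ord_recl /=.
apply: le_trans (exp12D (d0 _) _) _; first by apply: sumr_ge0 => *; exact: d0.
rewrite expr0 mulr1 lerD2l.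
apply: le_trans (ler_wpM2l (ltW cr_gt0) (IH (fun m => d m.+1) _)) _; first by move=> m; exact: d0.
by rewrite mulr_sumr; apply: ler_sum => m _; rewrite /bump/= add1n [cr ^+ _.+1]exprS; rewrite le_eqVlt; apply/orP; left; apply/eqP; ring.
Qed.

Definition level (x : grid -> R) n : R :=
  \sum_(i < (16 ^ n).+1) \sum_(j < (4 ^ n).+1)
    `|x (n, (val i, val j)) - x (parent (n, (val i, val j)))| ^+ 12.

Lemma level_ge0 x n : 0 <= level x n.
Proof. by do 2 (apply: sumr_ge0 => ? _); exact: exprn_ge0. Qed.

(** This sum dominates the twelfth power of the oscillation from the root over the whole grid; being
    linear in twelfth powers of increments, it can be integrated term by term. *)
Definition chain (x : grid -> R) : \bar R :=
  (\sum_(0 <= n <oo) (cw * cr ^+ n * level x n)%:E)%E.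

Let term_ge0 x n : 0 <= cw * cr ^+ n * level x n.
Proof. by rewrite mulr_ge0 ?level_ge0// mulr_ge0 ?exprn_ge0// ltW// ?cw_gt0 ?cr_gt0. Qed.

Lemma chain_ge0 x : (0 <= chain x)%E.
Proof. by apply: nneseries_ge0 => n _ _; rewrite lee_fin. Qed.

Lemma level_bound x q : in_grid q -> `|x q - x (parent q)| ^+ 12 <= level x q.1.
Proof.
case: q => [n [i j]] /andP[/= hi hj]; rewrite /level.
rewrite -ltnS in hi; rewrite -ltnS in hj.
rewrite (bigD1 (Ordinal hi))//= (bigD1 (Ordinal hj))//= -addrA lerDl addr_ge0//.
  by apply: sumr_ge0 => *; exact: exprn_ge0.
by do 2 (apply: sumr_ge0 => ? _); exact: exprn_ge0.
Qed.

Lemma chain_path x q : in_grid q -> exists d : nat -> R,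
  [/\ forall m, 0 <= d m, `|x q - x grid0| <= \sum_(m < q.1.+1) d m &
      forall m, (m <= q.1)%N -> d m ^+ 12 <= level x m].
Proof.
case: q => n [i j]; elim: n i j => [|n IH] i j hq /=.
  exists (fun=> `|x (0, (i, j))%N - x grid0|); split => //; first by rewrite big_ord1.
  by case=> // _; exact: (level_bound x hq).
have := in_grid_parent hq => /= /IH[d [d0 dx dl]].
exists (fun m => if m == n.+1 then `|x (n.+1, (i, j)) - x (parent (n.+1, (i, j)))| else d m).
split; first by move=> m; case: ifP.
- rewrite big_ord_recr /= eqxx.
  rewrite (eq_bigr (fun m : 'I_n.+1 => d m)); last first.
    by move=> m _; rewrite ifN// neq_ltn ltn_ord.
  apply: le_trans (lerD dx (lexx _)).
  apply: le_trans (ler_normD _ _); rewrite /= le_eqVlt; apply/orP; left; apply/eqP; congr (`|_|); ring.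
- move=> m; case: eqP => [-> _|/eqP mn lemn]; first exact: (level_bound x hq).
  by apply: dl; rewrite -ltnS ltn_neqAle mn.
Qed.

Lemma chain_bound x q : in_grid q -> ((`|x q - x grid0| ^+ 12)%:E <= chain x)%E.
Proof.
move=> /chain_path-/(_ x)[d [d0 dx dl]].
apply: (@le_trans _ _ (\sum_(0 <= n < q.1.+1) (cw * cr ^+ n * level x n)%:E)%E); last first.
  by apply: nneseries_lim_ge => n _; rewrite lee_fin.
rewrite sumEFin lee_fin big_mkord.
apply: (@le_trans _ _ ((\sum_(m < q.1.+1) d m) ^+ 12)).
  by rewrite lerXn2r// nnegrE ?sumr_ge0.
apply: le_trans (exp12_sum _ d0) _; apply: ler_sum => m _.
by rewrite ler_wpM2l ?dl ?mulr_ge0 ?exprn_ge0 ?(ltW cw_gt0) ?(ltW cr_gt0)// -ltnS.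
Qed.

Section expectation.
Context d (T : measurableType d) (P : {measure set T -> \bar R}).
Variable Y : T -> grid -> R.
Hypothesis mY : forall q, measurable_fun setT (fun w => Y w q).

Lemma measurable_level n : measurable_fun setT (fun w => level (Y w) n).
Proof.
apply: measurable_sum => i; apply: measurable_sum => j.
apply: measurable_funX; apply: measurableT_comp => //.
by apply: measurable_funB.
Qed.

Lemma measurable_chain : measurable_fun setT (fun w => chain (Y w)).
Proof.
apply: ge0_emeasurable_sum => n //.
  by move=> x _ _; rewrite lee_fin.
by move=> _; apply/measurable_EFinP; apply: measurable_funM => //; exact: measurable_level.
Qed.

(** Variances of order [4^-n] mean twelfth moments of order [4^(-6n) = 4096^-n]. Level [n] has at
    most [4 * 64^n] points, so with [cr <= 32] its term is at most [4 * cw * A / 2^n], and these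
    bounds add up to [8 * cw * A]. *)
Lemma expect_chain (A : R) : 0 <= A ->
  (forall q, in_grid q ->
    \int[P]_w (`|Y w q - Y w (parent q)| ^+ 12)%:E <= (A / 4096 ^+ q.1)%:E)%E ->
  (\int[P]_w chain (Y w) <= (8 * cw * A)%:E)%E.
Proof.
move=> A0 H; rewrite /chain integral_nneseries//; last 2 first.
- by move=> n; apply/measurable_EFinP; apply: measurable_funM => //; exact: measurable_level.
- by move=> n x _; rewrite lee_fin.
apply: le_trans (@epsilon_trick0 R _ xpredT _); last by rewrite !mulr_ge0// ltW// cw_gt0.
apply: lee_nneseries => n _; first by move=> _; apply: integral_ge0 => x _; rewrite lee_fin.
under eq_integral do rewrite EFinM.
have k0 : 0 <= cw * cr ^+ n by rewrite mulr_ge0 ?exprn_ge0// ltW// ?cw_gt0 ?cr_gt0.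
rewrite ge0_integralZl//; last 2 first.
- by apply/measurable_EFinP; exact: measurable_level.
- by move=> x _; rewrite lee_fin level_ge0.
have mt i j : measurable_fun setT (fun w => (`|Y w (n, (i, j)) - Y w (parent (n, (i, j)))| ^+ 12)%:E).
  by apply/measurable_EFinP; apply: measurable_funX; apply: measurableT_comp => //; apply: measurable_funB.
have -> : (\int[P]_w (level (Y w) n)%:E = \sum_(i < (16 ^ n).+1) \sum_(j < (4 ^ n).+1)
   \int[P]_w (`|Y w (n, (val i, val j)) - Y w (parent (n, (val i, val j)))| ^+ 12)%:E)%E.
  under eq_integral do rewrite /level -sumEFin.
  rewrite ge0_integral_sum//; last 2 first.
  - move=> i; under eq_fun do rewrite -sumEFin; apply: emeasurable_sum => j; exact: mt.
  - by move=> i x _; rewrite lee_fin; apply: sumr_ge0 => *; exact: exprn_ge0.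
  apply: eq_bigr => i _; under eq_integral do rewrite -sumEFin.
  by rewrite ge0_integral_sum.
apply: (@le_trans _ _ ((cw * cr ^+ n)%:E * ((16 ^ n).+1%:R * (4 ^ n).+1%:R * (A / 4096 ^+ n))%:E)%E).
  apply: lee_wpmul2l; first by rewrite lee_fin.
  apply: (@le_trans _ _ (\sum_(i < (16 ^ n).+1) \sum_(j < (4 ^ n).+1) (A / 4096 ^+ n)%:E)%E).
    do 2 (apply: lee_sum => ? _); apply: H.
    by rewrite /in_grid/= -ltnS ltn_ord -ltnS ltn_ord.
  by rewrite !sumEFin !big_const !iter_addr !card_ord !addr0 lee_fin -!mulrnA -mulrA !mulr_natl -mulrnA mulnC.
rewrite -EFinM lee_fin natrX exprS.
have -> : (4096 : R) ^+ n = 64 ^+ n * 64 ^+ n by rewrite -exprMn; congr (_ ^+ n); lra.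
have : ((16 ^ n).+1%:R * (4 ^ n).+1%:R : R) <= 4 * 64 ^+ n.
  rewrite -!natrM -natrX -natrM ler_nat (_ : 64 = 16 * 4)%N// expnMn.
  have := expn_gt0 16 n; have := expn_gt0 4 n; nia.
have := cr_le32; have := cr_gt0; have := cw_gt0.
set N := _ * _; move=> cw0 cr0 c32 hN.
have hc : cr ^+ n <= 32 ^+ n by rewrite lerXn2r ?nnegrE// ltW.
have -> : (64 : R) ^+ n = 2 ^+ n * 32 ^+ n by rewrite -exprMn; congr (_ ^+ n); lra.
have p2 : 0 < (2 : R) ^+ n by exact: exprn_gt0.
have p32 : 0 < (32 : R) ^+ n by exact: exprn_gt0.
have -> : 8 * cw * A / (2 * 2 ^+ n) = cw * 32 ^+ n * (4 * (2 ^+ n * 32 ^+ n) * (A / (2 ^+ n * 32 ^+ n * (2 ^+ n * 32 ^+ n)))).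
  by field; rewrite !gt_eqF.
have q0 : 0 <= A / (2 ^+ n * 32 ^+ n * (2 ^+ n * 32 ^+ n)).
  by rewrite divr_ge0// !mulr_ge0// ltW.
have hN' : N <= 4 * (2 ^+ n * 32 ^+ n).
  by rewrite -exprMn (_ : 2 * 32 = 64 :> R)//; lra.
apply: ler_pM => //.
- by rewrite mulr_ge0// mulr_ge0.
- by rewrite ler_wpM2l// ltW.
- by rewrite ler_wpM2r.
Qed.

End expectation.

End chaining.

(** * Volume of a random range *)

Section volumes.
Context (R : realType).
Local Notation mR := (measurableTypeR R).
Notation space6 := ((mR * (mR * mR)) * (mR * (mR * mR)))%type.
Notation leb6 := (@leb6 R).

Lemma set_fubini d1 d2 (T1 : measurableType d1) (T2 : measurableType d2)
    (m1 : {sigma_finite_measure set T1 -> \bar R})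
    (m2 : {sigma_finite_measure set T2 -> \bar R}) (G : set (T1 * T2)) : measurable G ->
  (\int[m1]_x m2 [set y | G (x, y)] = \int[m2]_y m1 [set x | G (x, y)])%E.
Proof.
move=> mG; have mE : forall A B, measurable A -> measurable B ->
    (m1 \x^ m2)%E (A `*` B) = (m1 A * m2 B)%E by move=> A B mA mB; exact: product_measure2E.
have := product_measure_unique mE mG.
rewrite /product_measure1 /product_measure2 /= => E.
transitivity (\int[m1]_x (m2 \o xsection G) x)%E.
  by apply: eq_integral => x _ /=; congr (m2 _); apply/seteqP; split => y /=; rewrite /xsection/= inE.
by rewrite E; apply: eq_integral => x _ /=; congr (m1 _); apply/seteqP; split => y /=; rewrite /ysection/= inE.
Qed.

Lemma measurable_slice1 d1 d2 (T1 : measurableType d1) (T2 : measurableType d2)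
    (m2 : {sigma_finite_measure set T2 -> \bar R}) (G : set (T1 * T2)) : measurable G ->
  measurable_fun setT (fun x => m2 [set y | G (x, y)]).
Proof.
move=> mG; rewrite (_ : (fun _ => _) = m2 \o xsection G); first exact: measurable_fun_xsection.
by apply/funext => x /=; congr (m2 _); apply/seteqP; split => y /=; rewrite /xsection/= inE.
Qed.

Lemma measurable_slice2 d1 d2 (T1 : measurableType d1) (T2 : measurableType d2)
    (m1 : {sigma_finite_measure set T1 -> \bar R}) (G : set (T1 * T2)) : measurable G ->
  measurable_fun setT (fun y => m1 [set x | G (x, y)]).
Proof.
move=> mG; rewrite (_ : (fun _ => _) = m1 \o ysection G); first exact: measurable_fun_ysection.
by apply/funext => x /=; congr (m1 _); apply/seteqP; split => y /=; rewrite /ysection/= inE.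
Qed.

Lemma measurable_slice d1 d2 (T1 : measurableType d1) (T2 : measurableType d2)
    (G : set (T1 * T2)) x : measurable G -> measurable [set y | G (x, y)].
Proof.
move=> mG; rewrite (_ : mkset _ = xsection G x); first exact: measurable_xsection.
by apply/seteqP; split => y /=; rewrite /xsection/= inE.
Qed.

Lemma prodm_fubini d1 d2 (T1 : measurableType d1) (T2 : measurableType d2)
    (m1 : {sigma_finite_measure set T1 -> \bar R})
    (m2 : {sigma_finite_measure set T2 -> \bar R}) (G : set (T1 * T2)) :
  (prodm m1 m2 G = \int[m1]_x m2 [set y | G (x, y)])%E.
Proof.
rewrite prodmE /product_measure1; apply: eq_integral => x _ /=; congr (m2 _).
by apply/seteqP; split => y /=; rewrite /xsection/= inE.
Qed.

Lemma dilation_set d (T : measurableType d) (mu : {measure set T -> \bar R}) phi (c : R) A :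
  dilation mu phi c -> measurable A -> mu A = (c%:E * mu (phi @^-1` A))%E.
Proof.
move=> [c0 mphi E] mA.
have mpA : measurable (phi @^-1` A) by rewrite -[X in measurable X]setTI; exact: mphi.
rewrite -[A in LHS]setIT -(integral_indic _ measurableT mA) E//; last first.
  by apply/measurable_EFinP; exact: measurable_indic.
rewrite -[phi @^-1` A]setIT -(integral_indic _ measurableT mpA).
by congr (_ * _)%E; apply: eq_integral => x _; rewrite !indicE; do 2 congr EFin.
Qed.

Lemma leb6_affine (a : R) (b : 'I_6 -> R) (A : set space6) : a != 0 -> measurable A ->
  leb6 A = ((`|a| ^+ 6)%:E *
    leb6 [set z | A (vec6 (fun j => (a * coord6 z j + b j)%R))])%E.
Proof.
move=> a0 mA; have := dilation_set (@dilation_leb6 R (fun=> a) b (fun=> a0)) mA.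
by rewrite prodr_const card_ord.
Qed.

Lemma measurable_box (b : 'I_6 -> R) (B : \bar R) :
  measurable ([set z | forall j, ((`|coord6 z j - b j| ^+ 12)%:E <= B)%E] : set space6).
Proof.
rewrite (_ : mkset _ = \bigcap_(j in [set: 'I_6]) [set z | ((`|coord6 z j - b j| ^+ 12)%:E <= B)%E]).
  apply: fin_bigcap_measurable => // j _; rewrite -[X in measurable X]setTI.
  apply: emeasurable_fun_infty_c => //.
  apply/measurable_EFinP; apply: measurable_funX; apply: measurableT_comp => //.
  by apply: measurable_funB => //; exact: measurable_coord6.
by apply/seteqP; split => z /= h j; [move=> _; exact: h|exact: (h j)].
Qed.

Lemma leb6_box (tau : R) (b : 'I_6 -> R) (B : \bar R) : 0 < tau -> (0 <= B)%E ->
  (leb6 [set z | forall j, ((`|coord6 z j - b j| ^+ 12)%:E <= B)%E] <=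
    64%:E * (tau%:E * B + (1 / (4 * tau))%:E))%E.
Proof.
move=> t0; case: B => [B| |]//; last first.
  by move=> _; rewrite mulry gtr0_sg// mul1e addye// mulry gtr0_sg// mul1e leey.
rewrite lee_fin => B0.
have [rho rho0 rhoB] : exists2 rho, 0 <= rho & rho ^+ 12 = B.
  have [->|Bn0] := eqVneq B 0; first by exists 0; rewrite // expr0n.
  have Bp : 0 < B by rewrite lt_neqAle eq_sym Bn0.
  by exists (expR (ln B / 12)); rewrite ?expR_ge0// -expRM_natl mulrC divfK// lnK.
have leE (x : R) : 0 <= x -> ((x ^+ 12)%:E <= B%:E)%E = (x <= rho).
  by move=> x0; rewrite lee_fin -rhoB ler_pXn2r.
have mS := measurable_box b B%:E.
rewrite (@leb6_affine 1 b _ (oner_neq0 _))// normr1 expr1n mul1e.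
rewrite (_ : mkset _ = [set z | forall j, `|coord6 z j| <= rho]); last first.
  by apply/seteqP; split => z /= h j; have := h j; rewrite coord_vec6 mul1r addrK leE.
rewrite leb6_cube// -[leRHS]/((64 * (tau * B + 1 / (4 * tau)))%:E) lee_fin -rhoB.
have -> : (2 * rho) ^+ 6 = 64 * rho ^+ 6 by ring.
rewrite ler_wpM2l// -subr_ge0.
have -> : tau * rho ^+ 12 + 1 / (4 * tau) - rho ^+ 6 = (2 * tau * rho ^+ 6 - 1) ^+ 2 / (4 * tau).
  by field; rewrite gt_eqF.
by rewrite divr_ge0 ?sqr_ge0// mulr_ge0// ltW.
Qed.

Section functionals.
Context (K : Type).
Implicit Types F : set (paths R K * space6).

(** The expected volume of the random set [F (Y, _)]. Written as an integral of probabilities over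
    [z], it visibly depends on the law of [Y] only. *)
Definition vol d (T : measurableType d) (P : {measure set T -> \bar R}) F
    (Y : T -> K -> R) : \bar R :=
  (\int[leb6]_z P [set w | F (Y w, z)])%E.

Lemma measurable_graph d (T : measurableType d) F (Y : T -> K -> R) : measurable F ->
  (forall k, measurable_fun setT (fun w => Y w k)) ->
  measurable [set p : T * space6 | F (Y p.1, p.2)].
Proof.
move=> mF mY; rewrite -[X in measurable X]setTI.
have mYp : measurable_fun setT (Y : T -> paths R K) by exact: measurable_paths.
have : measurable_fun setT (fun p : T * space6 => ((Y p.1 : paths R K), p.2)).
  apply: measurable_fun_pair; last exact: measurable_snd.
  exact: (measurableT_comp mYp measurable_fst).
by move=> /(_ measurableT _ mF).
Qed.

Lemma vol_fubini d (T : measurableType d) (P : {sigma_finite_measure set T -> \bar R}) F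
    (Y : T -> K -> R) : measurable F ->
  (forall k, measurable_fun setT (fun w => Y w k)) ->
  vol P F Y = (\int[P]_w leb6 [set z | F (Y w, z)])%E.
Proof.
by move=> mF mY; rewrite (set_fubini P leb6 (measurable_graph mF mY)).
Qed.

Lemma vol_prodm d (T : measurableType d) (P : {sigma_finite_measure set T -> \bar R}) F
    (Y : T -> K -> R) : measurable F ->
  (forall k, measurable_fun setT (fun w => Y w k)) ->
  vol P F Y = prodm P leb6 [set p : T * space6 | F (Y p.1, p.2)].
Proof.
move=> mF mY; apply: (etrans (vol_fubini P mF mY)).
by rewrite (prodm_fubini P leb6 [set p | F (Y p.1, p.2)]).
Qed.

Lemma measurable_vol d (T : measurableType d) F (Y : T -> K -> R) : measurable F ->
  (forall k, measurable_fun setT (fun w => Y w k)) ->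
  measurable_fun setT (fun w => leb6 [set z | F (Y w, z)]).
Proof. by move=> mF mY; exact: (measurable_slice1 leb6 (measurable_graph mF mY)). Qed.

Definition same_law d (T : measurableType d) (P : {measure set T -> \bar R})
    d' (T' : measurableType d') (P' : {measure set T' -> \bar R})
    (Y : T -> K -> R) (Y' : T' -> K -> R) :=
  forall A : set (paths R K), measurable A -> P (Y @^-1` A) = P' (Y' @^-1` A).

Lemma vol_law d (T : measurableType d) (P : {measure set T -> \bar R})
    d' (T' : measurableType d') (P' : {measure set T' -> \bar R})
    F (Y : T -> K -> R) (Y' : T' -> K -> R) : measurable F ->
  same_law P P' Y Y' -> vol P F Y = vol P' F Y'.
Proof.
move=> mF E; apply: eq_integral => z _.
apply: (E [set u | F (u, z)]).
rewrite (_ : mkset _ = ysection F z); first exact: measurable_ysection.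
by apply/seteqP; split => y /=; rewrite /ysection/= inE.
Qed.

End functionals.

(** The shift [b] may be random, because the change of variables is made path by path. *)
Lemma vol_affine K K' d (T : measurableType d) (P : {sigma_finite_measure set T -> \bar R})
    (F : set (paths R K * space6)) (F' : set (paths R K' * space6))
    (Y : T -> K -> R) (Y' : T -> K' -> R) (a : R) (b : T -> 'I_6 -> R) :
  a != 0 -> measurable F -> measurable F' ->
  (forall k, measurable_fun setT (fun w => Y w k)) ->
  (forall k, measurable_fun setT (fun w => Y' w k)) ->
  (forall w z, F (Y w, vec6 (fun j => a * coord6 z j + b w j)) <-> F' (Y' w, z)) ->
  vol P F Y = ((`|a| ^+ 6)%:E * vol P F' Y')%E.
Proof.
move=> a0 mF mF' mY mY' E.
rewrite !vol_fubini// -ge0_integralZl//; last first.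
  by apply: measurable_vol.
apply: eq_integral => w _.
have mS : measurable [set z | F (Y w, z)].
  exact: (measurable_slice w (measurable_graph mF mY)).
rewrite (leb6_affine (b w) a0 mS); congr (_ * leb6 _)%E.
by apply/seteqP; split => z /=; rewrite E.
Qed.

Section hits.
Local Notation K := ('I_6 * grid)%type.

Definition hit (e : R) : set (paths R K * space6) :=
  [set p | exists2 q, in_grid q & forall j, `|p.1 (j, q) - coord6 p.2 j| < e].

(** The point lies in the closure of the grid values, which for a continuous field is its range over
    the closed box. Only countably many coordinates enter, which makes the set measurable. *)
Definition adherent : set (paths R K * space6) := [set p | forall e, 0 < e -> hit e p].

Lemma measurable_hit e : measurable (hit e).
Proof.
have -> : hit e = \bigcup_(q in [set: grid]) (if in_grid q then
   \bigcap_(j in [set: 'I_6]) [set p : paths R K * space6 | `|p.1 (j, q) - coord6 p.2 j| < e]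
   else set0).
  apply/seteqP; split => p.
    by move=> [q hq h]; exists q => //; rewrite hq => j _; exact: h.
  by move=> [q _]; case: ifP => // hq h; exists q => // j; exact: h.
apply: countable_bigcupT_measurable; first exact: countableP.
move=> q; case: ifP => // _.
apply: fin_bigcap_measurable => // j _; rewrite -[X in measurable X]setTI.
have mf : measurable_fun setT (fun p : paths R K * space6 => `|p.1 (j, q) - coord6 p.2 j|).
  apply: measurableT_comp => //; apply: measurable_funB.
    exact: (measurableT_comp (measurable_coord (j, q)) measurable_fst).
  exact: (measurableT_comp (measurable_coord6 j) measurable_snd).
have := mf measurableT _ (measurable_itv `]-oo, e[).
by congr measurable; apply/seteqP; split => z /=; rewrite in_itv/=.
Qed.

Lemma adherentE : adherent = \bigcap_n hit n.+1%:R^-1.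
Proof.
apply/seteqP; split => p h; first by move=> n _; apply: h; rewrite invr_gt0.
move=> e e0.
pose n := Num.truncn e^-1.
have [q hq hj] := h n I; exists q => // j; apply: lt_le_trans (hj j) _.
by rewrite -[leRHS]invrK lef_pV2 ?posrE ?invr_gt0// ltW// truncnS_gt.
Qed.

Lemma measurable_adherent : measurable adherent.
Proof. by rewrite adherentE; apply: bigcapT_measurable => n; exact: measurable_hit. Qed.

Lemma adherent_affine (a : R) (b : 'I_6 -> R) (u : K -> R) z : a != 0 ->
  adherent (fun k => a * u k + b k.1, vec6 (fun j => a * coord6 z j + b j)) <->
  adherent (u, z).
Proof.
move=> a0; have na : 0 < `|a| by rewrite normr_gt0.
have E q j : `|a * u (j, q) + b j - (a * coord6 z j + b j)| = `|a| * `|u (j, q) - coord6 z j|.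
  by rewrite -normrM; congr (`|_|); ring.
split=> h e e0.
  have [|q hq hj] := h (`|a| * e); first exact: mulr_gt0.
  by exists q => // j; have := hj j; rewrite /= coord_vec6 E ltr_pM2l.
have [|q hq hj] := h (e / `|a|); first exact: divr_gt0.
by exists q => // j; rewrite /= coord_vec6 E -ltr_pdivlMl// mulrC; exact: hj.
Qed.

Lemma vol_adherent_affine d (T : measurableType d) (P : {sigma_finite_measure set T -> \bar R})
   (Y : T -> K -> R) (a : R) (b : T -> 'I_6 -> R) : a != 0 ->
  (forall k, measurable_fun setT (fun w => Y w k)) ->
  (forall j, measurable_fun setT (fun w => b w j)) ->
  vol P adherent (fun w k => a * Y w k + b w k.1) = ((`|a| ^+ 6)%:E * vol P adherent Y)%E.
Proof.
move=> a0 mY mb; apply: (vol_affine P (b := b)) => //.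
- exact: measurable_adherent.
- exact: measurable_adherent.
- by move=> k; apply: measurable_funD => //; exact: measurable_funM.
- by move=> w z; exact: adherent_affine.
Qed.

Definition component (u : K -> R) (j : 'I_6) : grid -> R := fun q => u (j, q).

Lemma hit_box (u : K -> R) z (e : R) : 0 < e -> hit e (u, z) -> forall j,
  ((`|coord6 z j - u (j, grid0)| ^+ 12)%:E <=
    (cw R)%:E * (chain (component u j) + (e ^+ 12)%:E))%E.
Proof.
move=> e0 [q hq hj] j; have {}hj := hj j.
have cb := chain_bound (component u j) hq.
apply: (@le_trans _ _ ((cw R)%:E * ((`|component u j q - component u j grid0| ^+ 12)%:E + (e ^+ 12)%:E))%E); last first.
  by apply: lee_wpmul2l; [rewrite lee_fin ltW// cw_gt0|exact: leeD].
rewrite -EFinD -EFinM lee_fin.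
set a := `|component u j q - _|.
have : `|coord6 z j - u (j, grid0)| <= e + a.
  rewrite /a /component; move: hj; rewrite /= distrC => hj.
  have := ler_distD (u (j, q)) (coord6 z j) (u (j, grid0)); lra.
move=> le1; apply: (@le_trans _ _ ((a + e) ^+ 12)).
  have ae0 : 0 <= a + e := addr_ge0 (normr_ge0 _) (ltW e0).
  rewrite [e + a]addrC in le1.
  exact: (lerXn2r 12 (normr_ge0 _) ae0 le1).
apply: (le_trans (exp12D (normr_ge0 _) (ltW e0))).
by rewrite mulrDr lerD2l ler_wpM2r ?exprn_ge0 ?(ltW e0)// cr_le_cw.
Qed.

End hits.

End volumes.

(** * Lévy's overlap argument *)

Lemma integral_zero_dom d (T : measurableType d) (R : realType)
    (mu : {measure set T -> \bar R}) (f g : T -> \bar R) :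
  measurable_fun setT f -> measurable_fun setT g ->
  (forall x, 0 <= f x)%E -> (forall x, 0 <= g x)%E -> (forall x, f x = 0%E -> g x = 0%E) ->
  (\int[mu]_x f x = 0 -> \int[mu]_x g x = 0)%E.
Proof.
move=> mf mg f0 g0 fg E0.
have {}E0 : (\int[mu]_x `|f x| = 0)%E.
  by rewrite -[RHS]E0; apply: eq_integral => x _; rewrite gee0_abs.
have [N [mN N0 sN]] := (ae_eq_integral_abs mu measurableT mf).1 E0.
have ae0 : ae_eq mu setT g (cst 0%E).
  exists N; split => // x /= nx; apply: sN => /= /(_ I) E; apply: nx => _; exact: fg.
by rewrite (ge0_ae_eq_integral measurableT mg _ _ _ ae0)// integral0.
Qed.

Lemma measureUI d (T : measurableType d) (R : realType)
    (mu : {measure set T -> \bar R}) (A B : set T) : measurable A -> measurable B ->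
  (mu (A `|` B) + mu (A `&` B) = mu A + mu B)%E.
Proof.
move=> mA mB; rewrite -(setDUK (@subsetUr _ A B)).
rewrite (_ : (A `|` B) `\` B = A `\` B); last first.
  by apply/seteqP; split => x /=; [move=> [[]]|move=> [? ?]; split=> //; left].
have mD : measurable (A `\` B) by exact: measurableD.
rewrite [X in (X + _)%E](_ : _ = mu B + mu (A `\` B))%E; last first.
  by rewrite measureU//; apply/seteqP; split => x //= [Bx [_ nB]].
by rewrite -addeA [RHS]addeC (measureDI mu mA mB).
Qed.

Lemma measure_le_sum d (T : measurableType d) (R : realType) (mu : {measure set T -> \bar R})
    (I : eqType) (s : seq I) (A B : set T) (G : I -> set T) :
  measurable A -> measurable B -> (forall i, measurable (G i)) ->
  A `<=` B `|` [set x | exists2 i, i \in s & G i x] ->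
  (mu A <= mu B + \sum_(i <- s) mu (G i))%E.
Proof.
move=> mA + mG; elim: s B => [|i s IH] B mB AB.
  rewrite big_nil adde0; apply: le_measure; rewrite ?inE//.
  by move=> x /AB[//|[]].
rewrite big_cons addeA; apply: (@le_trans _ _ (mu (B `|` G i) + \sum_(i <- s) mu (G i))%E).
  apply: IH; first exact: measurableU.
  move=> x /AB[Bx|[k]]; first by left; left.
  by rewrite inE => /predU1P[->|ks] Gk; [left; right|right; exists k].
by apply: leeD => //; exact: measureU2.
Qed.

(** The union of [G i0] and [G i1] counts their intersection once, the sum of their measures counts
    it twice. *)
Lemma measure_overlap d (T : measurableType d) (R : realType) (mu : {measure set T -> \bar R})
    (I : eqType) (i0 i1 : I) (s : seq I) (A : set T) (G : I -> set T) :
  measurable A -> (forall i, measurable (G i)) ->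
  A `<=` [set x | exists2 i, i \in [:: i0, i1 & s] & G i x] ->
  (mu A + mu (G i0 `&` G i1) <= \sum_(i <- [:: i0, i1 & s]) mu (G i))%E.
Proof.
move=> mA mG AG; rewrite !big_cons addeA -(measureUI mu (mG i0) (mG i1)).
rewrite -addeA (addeC (mu (G i0 `&` G i1))) addeA; apply: leeD; last exact: lexx.
apply: measure_le_sum => //; first exact: measurableU.
move=> x /AG[k]; rewrite !inE => /or3P[/eqP->|/eqP->|si] Gx; [by left; left|by left; right|].
by right; exists k.
Qed.

(** When the pieces share the mean of [a] exactly, nothing is left for [g]; finiteness of that mean
    allows it to be cancelled. *)
Lemma integral_overlap d (T : measurableType d) (R : realType) (mu : {measure set T -> \bar R})
    (I : eqType) (s : seq I) (a g : T -> \bar R) (h : I -> T -> \bar R) (k : R) :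
  measurable_fun setT a -> measurable_fun setT g -> (forall i, measurable_fun setT (h i)) ->
  (forall w, 0 <= a w)%E -> (forall w, 0 <= g w)%E -> (forall i w, 0 <= h i w)%E ->
  (forall w, a w + g w <= \sum_(i <- s) h i w)%E ->
  (forall i, i \in s -> \int[mu]_w h i w = k%:E * \int[mu]_w a w)%E ->
  (\int[mu]_w a w < +oo)%E -> (size s)%:R * k = 1 -> (\int[mu]_w g w = 0)%E.
Proof.
move=> ma mg mh a0 g0 h0 le hk fin_a sk.
have ia0 : (0 <= \int[mu]_w a w)%E by exact: integral_ge0.
have : (\int[mu]_w a w + \int[mu]_w g w <= \int[mu]_w a w)%E.
  rewrite -ge0_integralD//.
  apply: (@le_trans _ _ (\int[mu]_w \sum_(i <- s) h i w)%E).
    apply: ge0_le_integral => //.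
    - by move=> w _; exact: adde_ge0.
    - exact: emeasurable_funD.
    - by apply: emeasurable_sum => i.
  rewrite ge0_integral_sum// big_seq (eq_bigr (fun=> (k * fine (\int[mu]_w a w))%:E)%E); last first.
    by move=> i /hk->; rewrite EFinM fineK// ge0_fin_numE.
  rewrite -big_seq sumEFin big_const_seq count_predT iter_addr addr0 -mulr_natl mulrA sk mul1r.
  by rewrite fineK// ge0_fin_numE.
rewrite -[leRHS]adde0 leeD2lE ?ge0_fin_numE// => h1.
by apply/eqP; rewrite eq_le h1 /=; exact: integral_ge0.
Qed.

Definition subgrid (a b : nat) (q : grid) : grid :=
  (q.1.+1, (a * 16 ^ q.1 + q.2.1, b * 4 ^ q.1 + q.2.2))%N.

Definition revgrid (q : grid) : grid := (q.1, (16 ^ q.1 - q.2.1, q.2.2))%N.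

(** Indices outside the grid are sent to the root, so that fields and their laws can be indexed by
    all of [grid]. *)
Definition clampg (q : grid) : grid := if in_grid q then q else grid0.

Lemma in_clampg q : in_grid (clampg q). Proof. by rewrite /clampg; case: ifP. Qed.

Lemma clampgK q : in_grid q -> clampg q = q. Proof. by rewrite /clampg => ->. Qed.

Lemma in_revgrid q : in_grid q -> in_grid (revgrid q) && (revgrid (revgrid q) == q).
Proof.
case: q => n [i j]; rewrite /in_grid/revgrid/= => /andP[hi hj].
by rewrite leq_subr hj subKn//= eqxx.
Qed.

Lemma subgrid_cover n i j : in_grid (n.+1, (i, j)) -> exists a b q,
  [/\ (a < 16)%N, (b < 4)%N, in_grid q & subgrid a b q = (n.+1, (i, j))].
Proof.
rewrite /in_grid/= !expnS => /andP[hi hj].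
have cut m k N : (0 < m -> 0 < N -> k <= m * N -> exists a r, [/\ a < m, r <= N & a * N + r = k])%N.
  move=> m0 N0 kmN; have [kN|/negP kN] := boolP (k < m * N)%N.
    exists (k %/ N)%N, (k %% N)%N; split; first by rewrite ltn_divLR.
      by rewrite ltnW// ltn_mod.
    by rewrite -divn_eq.
  (* The far edge of the box: it is the end point of the last cell, of index [m - 1]. *)
  have -> : k = (m * N)%N by apply/eqP; rewrite eqn_leq kmN leqNgt; apply/negP.
  exists m.-1, N; split => //; first by rewrite prednK.
  by rewrite -mulSnr prednK.
have [a [r [a16 hr Er]]] := cut 16%N i (16 ^ n)%N isT (expn_gt0 _ _) hi.
have [b [s [b4 hs Es]]] := cut 4%N j (4 ^ n)%N isT (expn_gt0 _ _) hj.
by exists a, b, (n, (r, s)); rewrite /subgrid/= Er Es /in_grid/= hr hs.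
Qed.

(** Two subboxes that are consecutive in time stand in front, in the form that [measure_overlap]
    expects. *)
Lemma subgrid_list : exists s : seq (nat * nat), size [:: (0, 0)%N, (1, 0)%N & s] = 64%N /\
  forall p, (p \in [:: (0, 0)%N, (1, 0)%N & s]) = (p.1 < 16)%N && (p.2 < 4)%N.
Proof.
pose s0 : seq (nat * nat) := [seq (a, b) | a <- iota 0 16, b <- iota 0 4].
exists [seq p <- s0 | (p != (0, 0)%N) && (p != (1, 0)%N)]; split => // p.
rewrite in_cons [X in _ || X]in_cons mem_filter.
have -> : (p \in s0) = (p.1 < 16)%N && (p.2 < 4)%N.
  case: p => a b; apply/allpairsP/andP => [[[a' b'] /= [ha hb [-> ->]]]|[ha hb]].
    by move: ha hb; rewrite -[X in _ \in X -> _]/(iota 0 16) -[X in _ -> _ \in X -> _]/(iota 0 4) !mem_iota.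
  by exists (a, b); rewrite !mem_iota.
by have [->//|n0] := eqVneq p (0, 0)%N; have [->//|n1] := eqVneq p (1, 0)%N.
Qed.

Section levy.
Context (R : realType).
Local Notation mR := (measurableTypeR R).
Notation space6 := ((mR * (mR * mR)) * (mR * (mR * mR)))%type.
Notation leb6 := (@leb6 R).
Local Notation K := ('I_6 * grid)%type.
Local Notation K2 := ('I_6 * (bool * grid))%type.
Context d (T : measurableType d) (P : probability T R).

(** [hit_box] and [leb6_box] with [tau = 1] bound the volume linearly in the sum of the six
    chains. *)
Lemma vol_hit_finite (U : T -> K -> R) (A e : R) :
  (forall k, measurable_fun setT (fun w => U w k)) -> 0 < e ->
  (forall j, \int[P]_w chain (component (U w) j) <= A%:E)%E -> (vol P (hit e) U < +oo)%E.
Proof.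
move=> mU e0 HA; rewrite vol_fubini//; last exact: measurable_hit.
pose B w : \bar R := (\sum_j chain (component (U w) j))%E.
have mch j : measurable_fun setT (fun w => chain (component (U w) j)).
  by apply: measurable_chain => q; exact: mU.
have mB : measurable_fun setT B by apply: emeasurable_sum => j; exact: mch.
have B0 w : (0 <= B w)%E by apply: sume_ge0 => j _; exact: chain_ge0.
pose c := cw R.
have c0 : 0 < c by exact: cw_gt0.
have e12 : 0 <= e ^+ 12 by rewrite exprn_ge0// ltW.
apply: (@le_lt_trans _ _ (\int[P]_w ((64 * c)%:E * B w + (64 * (c * e ^+ 12 + 1 / 4))%:E))%E).
  apply: ge0_le_integral => //.
  - by apply: measurable_vol => //; exact: measurable_hit.
  - apply: emeasurable_funD => //; apply: emeasurable_funM => //.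
  - move=> w _.
    pose b j := U w (j, grid0).
    have B1 : (0 <= c%:E * (B w + (e ^+ 12)%:E))%E.
      by rewrite mule_ge0 ?lee_fin ?(ltW c0)// adde_ge0 ?lee_fin.
    apply: (@le_trans _ _ (leb6 [set z | forall j, ((`|coord6 z j - b j| ^+ 12)%:E <= c%:E * (B w + (e ^+ 12)%:E))%E])).
      apply: le_measure; rewrite ?inE.
      + exact: (measurable_slice w (measurable_graph (@measurable_hit R e) mU)).
      + exact: measurable_box.
      + move=> z /= hz j; apply: (le_trans (hit_box e0 hz j)).
        apply: lee_wpmul2l; first by rewrite lee_fin ltW.
        apply: leeD => //; rewrite /B (bigD1 j)//= leeDl// sume_ge0// => i _; exact: chain_ge0.
    apply: (le_trans (leb6_box b (ltr01 : 0 < (1:R)) B1)).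
    rewrite mul1e mulr1 [(c%:E * _)%E]ge0_muleDr ?lee_fin// -addeA -EFinM -EFinD.
    rewrite ge0_muleDr ?muleA ?mule_ge0 ?lee_fin ?(ltW c0)//.
    by rewrite addr_ge0// mulr_ge0// ltW.
rewrite ge0_integralD//; last 3 first.
- by move=> w _; apply: mule_ge0 => //; rewrite lee_fin mulr_ge0// ltW.
- by apply: emeasurable_funM.
- by move=> w _; rewrite lee_fin mulr_ge0// addr_ge0// mulr_ge0// ltW.
rewrite integral_cst// ge0_integralZl ?lee_fin ?mulr_ge0 ?(ltW c0)//.
have P1 : is_prob P := probability_setT P.
rewrite P1 mule1 ge0_integral_sum//; last by move=> j w _; exact: chain_ge0.
apply: lte_add_pinfty; last exact: ltry.
apply: lte_mul_pinfty => //; first by rewrite lee_fin mulr_ge0// ltW.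
apply: lte_sum_pinfty => j _; exact: (le_lt_trans (HA j) (ltry _)).
Qed.


(** Continuity from above of the product of [P] and [leb6], started from the finite volume of
    [hit 1]. *)
Lemma vol_hit_cvg (U : T -> K -> R) (A : R) :
  (forall k, measurable_fun setT (fun w => U w k)) ->
  (forall j, \int[P]_w chain (component (U w) j) <= A%:E)%E ->
  vol P (@adherent R) U = 0%E ->
  (fun n => vol P (hit n.+1%:R^-1) U) @ \oo --> 0%E.
Proof.
move=> mU HA E0.
pose m := prodm P leb6; pose G (F : set (paths R K * space6)) := [set p : T * space6 | F (U p.1, p.2)].
have mG F : measurable F -> measurable (G F) by move=> mF; exact: (measurable_graph mF mU).
have volE F : measurable F -> vol P F U = m (G F).
  by move=> mF; exact: vol_prodm.
have -> : (fun n => vol P (hit n.+1%:R^-1) U) = m \o (fun n => G (hit n.+1%:R^-1)).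
  by apply/funext => n /=; rewrite volE//; exact: measurable_hit.
have GI : \bigcap_n G (hit n.+1%:R^-1) = G (@adherent R).
  by rewrite adherentE; apply/seteqP; split.
rewrite -E0 volE; last exact: measurable_adherent.
rewrite -GI; apply: nonincreasing_cvg_mu.
- have e0 : 0 < 1%:R^-1 :> R by rewrite invr_gt0.
  by have := vol_hit_finite mU e0 HA; rewrite (volE _ (measurable_hit _)).
- by move=> n; apply: mG; exact: measurable_hit.
- by rewrite GI; apply: mG; exact: measurable_adherent.
- move=> n k nk; apply/subsetPset => p [q hq hj]; exists q => // j.
  by apply: (lt_le_trans (hj j)); rewrite lef_pV2 ?posrE// ler_nat.
Qed.

Definition sub_field (U : T -> K -> R) a b (w : T) (k : K) := U w (k.1, subgrid a b k.2).

Lemma adherent_revgrid (u : K -> R) z :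
  adherent (fun k => u (k.1, revgrid k.2), z) <-> adherent (u, z).
Proof.
split=> h e e0; have [q hq hj] := h e e0; have /andP[rq /eqP rrq] := in_revgrid hq.
  by exists (revgrid q).
by exists (revgrid q) => // j; rewrite /= rrq; exact: hj.
Qed.

(** The closure of a finite union is the union of the closures: if the point kept a positive
    distance from each of the 64 subboxes, it would keep one from the box. The hypothesis serves the
    points of level 0, because subgrids start at level 1. *)
Lemma adherent_cover (u : K -> R) z :
  (forall j i1 i2, u (j, (0, (i1, i2))) = u (j, (1, (16 * i1, 4 * i2))))%N ->
  adherent (u, z) -> exists a b : nat, [/\ (a < 16)%N, (b < 4)%N &
    adherent (fun k => u (k.1, subgrid a b k.2), z)].
Proof.
move=> ref h.
pose bad e (p : nat * nat) := ~ hit e (fun k => u (k.1, subgrid p.1 p.2 k.2), z).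
pose s : seq (nat * nat) := [seq (a, b) | a <- iota 0 16, b <- iota 0 4].
have [|no] := pselect (exists2 p, p \in s & adherent (fun k => u (k.1, subgrid p.1 p.2 k.2), z)).
  move=> [[a b] /allpairsP[[a' b'] [ha hb [-> ->]]] H].
  by rewrite !mem_iota in ha hb; exists a', b'; split.
have allbad (p : nat * nat) : p \in s -> exists2 e, 0 < e & bad e p.
  move=> ps; apply: contrapT => nb; apply: no; exists p => // e e0.
  by apply: contrapT => nh; apply: nb; exists e.
have [e e0 eb] : exists2 e, 0 < e & forall p, p \in s -> bad e p.
  elim: (s) allbad => [_|p l IH ab]; first by exists 1.
  have [e1 e10 b1] := ab p (mem_head _ _).
  have [|e2 e20 b2] := IH; first by move=> p' pl; apply: ab; rewrite inE pl orbT.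
  exists (Num.min e1 e2); first by rewrite lt_min e10.
  move=> p'; rewrite inE => /predU1P[->|pl] [q hq hj].
    by apply: b1; exists q => // j; apply: lt_le_trans (hj j) _; rewrite ge_min lexx.
  by apply: (b2 _ pl); exists q => // j; apply: lt_le_trans (hj j) _; rewrite ge_min lexx orbT.
exfalso; have [q hq hj] := h e e0.
have [q' [hq' Eq]] : exists q', in_grid q' /\ exists n i j, q' = (n.+1, (i, j)) /\
    forall j, u (j, q) = u (j, q').
  case: q hq hj => [[|n] [i j]] hq hj.
    exists (1, (16 * i, 4 * j))%N; split.
      by move: hq; rewrite /in_grid/= !expn1 !expn0 => /andP[? ?]; lia.
    by exists 0, (16 * i)%N, (4 * j)%N.
  by exists (n.+1, (i, j)); split=> //; exists n, i, j.
have [n [i [k [q'E uE]]]] := Eq; rewrite q'E in hq'.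
have [a [b [q0 [a16 b4 hq0 sE]]]] := subgrid_cover hq'.
apply: (eb (a, b)).
  by apply/allpairsP; exists (a, b); rewrite !mem_iota.
by exists q0 => // j; rewrite /= sE -q'E -uE; exact: hj.
Qed.

Definition pull (K' K'' : Type) (g : K' -> K'') (F : set (paths R K' * space6)) :
  set (paths R K'' * space6) := [set p | F (fun k => p.1 (g k), p.2)].

Lemma measurable_pull (K' K'' : Type) (g : K' -> K'') F :
  measurable F -> measurable (pull g F).
Proof.
move=> mF; apply: (@measurable_graph R K' _ (paths R K'') F (fun u k => u (g k))) => // k.
exact: measurable_coord.
Qed.


(** With [x] as the past, the two copies are independent and have the same probability [p] of lying
    in [C] given [x]. A vanishing integral of [p^2] forces [p = 0] almost everywhere. *)
Lemma square_zero (C : set (T * T)) : measurable C ->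
  prodm P (prodm P P) [set w | C (w.1, w.2.1) /\ C (w.1, w.2.2)] = 0%E ->
  prodm P (prodm P P) [set w | C (w.1, w.2.1)] = 0%E.
Proof.
move=> mC; rewrite !prodm_fubini /=.
have mCs x : measurable [set y | C (x, y)] by exact: measurable_slice.
have mP : measurable_fun setT (fun x => P [set y | C (x, y)]) by exact: measurable_slice1.
have E1 x : prodm P P [set y | C (x, y.1) /\ C (x, y.2)] =
    (P [set y | C (x, y)] * P [set y | C (x, y)])%E.
  rewrite -(product_measure1E P P (mCs x) (mCs x)) prodmE; congr product_measure1.
have E2 x : prodm P P [set y | C (x, y.1)] = P [set y | C (x, y)].
  transitivity (product_measure1 P P ([set y | C (x, y)] `*` setT)).
    by rewrite prodmE; congr product_measure1; apply/seteqP; split => y //= [].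
  by have P1 : is_prob P := probability_setT P; rewrite product_measure1E// P1 mule1.
under eq_integral do rewrite E1.
move=> E0; under eq_integral do rewrite E2.
apply: integral_zero_dom E0.
- exact: emeasurable_funM.
- exact: mP.
- by move=> x; exact: mule_ge0.
- by [].
- by move=> x /eqP; rewrite mule_eq0 orbb => /eqP.
Qed.

Lemma adherent_clamp (u : K -> R) z :
  adherent (fun k => u (k.1, clampg k.2), z) <-> adherent (u, z).
Proof.
by split=> h e e0; have [q hq hj] := h e e0; exists q => // j; move: (hj j); rewrite /= clampgK.
Qed.

Lemma eq_vol (K' K'' : Type) d' (T' : measurableType d') (P' : {measure set T' -> \bar R})
    (F : set (paths R K' * space6)) (F' : set (paths R K'' * space6)) Y Y' :
  (forall (w : T') z, F (Y w, z) <-> F' (Y' w, z)) -> vol P' F Y = vol P' F' Y'.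
Proof.
move=> E; apply: eq_integral => z _; congr (P' _).
by apply/seteqP; split => w /=; rewrite E.
Qed.

(** Increments from the common corner of the subboxes (0, 0) and (1, 0), doubled to undo the scaling
    by 1/2. The earlier subbox is run backwards in time, so that both sides start at the corner. *)
Definition two_sided (U : T -> K -> R) (w : T) (k : K2) : R :=
  2 * ((if k.2.1 then sub_field U 1 0 w (k.1, k.2.2)
        else sub_field U 0 0 w (k.1, revgrid k.2.2)) - sub_field U 1 0 w (k.1, grid0)).

(** Both sides share the past [w.1], and each side has a future of its own, independent of the
    other. *)
Definition split_field (S N : T -> K -> R) (w : T * (T * T)) (k : K2) : R :=
  S w.1 (k.1, k.2.2) + N (if k.2.1 then w.2.1 else w.2.2) (k.1, k.2.2).

(* By scaling, the 64 subboxes share the expected volume evenly, hence two of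
   them overlap in a negligible set. For two subboxes that are symmetric in time
   about their common corner, the overlap is, conditionally on the past [S], the
   integral of the square of the probability that one of them is hit. *)
Lemma levy_zero (U S N : T -> K -> R) (A : R) :
  (forall k, measurable_fun setT (fun w => U w k)) ->
  (forall k, measurable_fun setT (fun w => S w k)) ->
  (forall k, measurable_fun setT (fun w => N w k)) ->
  (forall j, \int[P]_w chain (component (U w) j) <= A%:E)%E ->
  (forall w j i1 i2, U w (j, (0, (i1, i2))) = U w (j, (1, (16 * i1, 4 * i2))))%N ->
  (forall a b, (a < 16)%N -> (b < 4)%N -> same_law P P
     (fun w k => sub_field U a b w (k.1, clampg k.2) - sub_field U a b w (k.1, grid0))
     (fun w k => 2^-1 * U w (k.1, clampg k.2))) ->
  same_law P (prodm P (prodm P P))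
    (fun w k => two_sided U w (k.1, (k.2.1, clampg k.2.2)))
    (fun w k => split_field S N w (k.1, (k.2.1, clampg k.2.2))) ->
  vol P (@adherent R) U = 0%E.
Proof.
move=> mU mS mN HA href Hsub Htwo.
pose lam := vol P (@adherent R) U.
have mad := @measurable_adherent R.
have lam0 : (0 <= lam)%E by exact: integral_ge0.
have lam_fin : (lam < +oo)%E.
  apply: le_lt_trans (vol_hit_finite mU (ltr01 : 0 < (1:R)) HA).
  have mh := @measurable_hit R 1.
  rewrite /lam (vol_fubini P mad mU).
  rewrite (vol_fubini P mh mU).
  apply: ge0_le_integral; first exact: measurableT.
  - by move=> w _; exact: measure_ge0.
  - exact: (measurable_vol mad mU).
  - exact: (measurable_vol mh mU).
  - move=> w _; apply: le_measure; rewrite ?inE.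
    + exact: (measurable_slice w (measurable_graph mad mU)).
    + exact: (measurable_slice w (measurable_graph mh mU)).
    + by move=> z /= h; exact: h.
have msub a b k : measurable_fun setT (fun w => sub_field U a b w k) by exact: mU.
pose Ab (p : nat * nat) := pull (fun k : K => (k.1, subgrid p.1 p.2 k.2)) (@adherent R).
have mAb p : measurable (Ab p) by exact: measurable_pull.
(* A subbox is a copy of the box at scale 1/2 up to a random shift, which gives the factor
   [2^-6 = 1/64]. *)
have volA a b : (a < 16)%N -> (b < 4)%N -> vol P (Ab (a, b)) U = (64^-1%:E * lam)%E.
  move=> a16 b4; pose V w k := sub_field U a b w k - sub_field U a b w (k.1, grid0).
  have mV k : measurable_fun setT (fun w => V w k) by exact: measurable_funB.
  have E1 := @vol_adherent_affine R _ _ P V 1 (fun w j => sub_field U a b w (j, grid0))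
    (oner_neq0 _) mV (fun j => msub a b (j, grid0)).
  have E2 := @vol_adherent_affine R _ _ P U 2^-1 (fun w j => 0) _ mU (fun=> measurable_cst _).
  transitivity (vol P (@adherent R) V).
    rewrite -[RHS]mul1e -[1%E in RHS](_ : (`|1| ^+ 6)%:E = _); last by rewrite normr1 expr1n.
    rewrite -E1; transitivity (vol P (@adherent R) (sub_field U a b)) => //.
    congr vol; apply/funext => w; apply/funext => k.
    by rewrite /V mul1r subrK.
  rewrite -(eq_vol P (F := @adherent R) (fun w z => adherent_clamp (V w) z)).
  rewrite (vol_law mad (Hsub a b a16 b4)).
  rewrite (eq_vol P (F := @adherent R) (fun w z => adherent_clamp (fun k => 2^-1 * U w k) z)).
  transitivity (vol P (@adherent R) (fun w k => 2^-1 * U w k + 0)).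
    by congr vol; apply/funext => w; apply/funext => k; rewrite addr0.
  rewrite E2 ?invr_neq0//; congr (_%:E * _)%E.
  by rewrite ger0_norm// exprVn; congr (_^-1); ring.
pose F2 := Ab (0, 0)%N `&` Ab (1, 0)%N.
have mF2 : measurable F2 by exact: measurableI.
have I0 : vol P F2 U = 0%E.
  have [s [szs ss]] := subgrid_list.
  have cover w : [set z | adherent (U w, z)] `<=`
      [set z | exists2 p, p \in [:: (0, 0)%N, (1, 0)%N & s] & [set z | Ab p (U w, z)] z].
    move=> z /= /(adherent_cover (href w)) [a [b [a16 b4 h]]].
    by exists (a, b) => //; rewrite ss a16.
  have key w := measure_overlap leb6 (measurable_slice w (measurable_graph mad mU))
     (fun p => measurable_slice w (measurable_graph (mAb p) mU)) (cover w).
  rewrite (vol_fubini P mF2 mU).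
  apply: (integral_overlap (h := fun p w => leb6 [set z | Ab p (U w, z)]) (k := 64^-1)
    (measurable_vol mad mU) (measurable_vol mF2 mU) (fun p => measurable_vol (mAb p) mU) _ _ _ key).
  - by move=> w; exact: measure_ge0.
  - by move=> w; exact: measure_ge0.
  - by move=> p w; exact: measure_ge0.
  - move=> [a b]; rewrite ss => /andP[a16 b4]; have := volA a b a16 b4.
    by rewrite /lam (vol_fubini P mad mU) (vol_fubini P (mAb (a, b)) mU).
  - by rewrite -(vol_fubini P mad mU).
  - by rewrite szs divff// pnatr_eq0.
have mY2 k : measurable_fun setT (fun w => two_sided U w k).
  by apply: measurable_funM => //; apply: measurable_funB => //; case: (k.2.1).
have mY2' k : measurable_fun setT (fun w => split_field S N w k).
  have m1 : measurable_fun setT (fun w : T * (T * T) => w.1) by exact: measurable_fst.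
  apply: measurable_funD; first exact: (measurableT_comp (mS _) m1).
  case: k.2.1; apply: (measurableT_comp (mN (k.1, k.2.2))).
    exact: (measurableT_comp measurable_fst measurable_snd).
  exact: (measurableT_comp measurable_snd measurable_snd).
pose side b : set (paths R K2 * space6) := pull (fun k : K => (k.1, (b, k.2))) (@adherent R).
have mside b : measurable (side b) by exact: measurable_pull.
pose F3 := side true `&` side false.
have mF3 : measurable F3 by exact: measurableI.
have h2 : (2^-1 : R) != 0 by rewrite invr_neq0.
pose base w (j : 'I_6) := sub_field U 1 0 w (j, grid0).
have sideE w z b : side b (two_sided U w, z) <->
    adherent (fun k => if b then sub_field U 1 0 w k else sub_field U 0 0 w (k.1, revgrid k.2),
      vec6 (fun j => 2^-1 * coord6 z j + base w j)).
  apply: (iff_trans (iff_sym (adherent_affine (base w) (fun k => two_sided U w (k.1, (b, k.2))) z h2))).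
  rewrite (_ : (fun k : K => 2^-1 * _ + _) = (fun k : K => if b then sub_field U 1 0 w k
     else sub_field U 0 0 w (k.1, revgrid k.2)))//.
  by apply/funext => -[j q]; rewrite /two_sided /base /= mulKf// subrK.
(* In the coordinates of [two_sided], a point of the overlap is one to which both sides adhere. *)
have E3 : vol P F3 (two_sided U) = 0%E.
  have : vol P F2 U = ((`|2^-1| ^+ 6)%:E * vol P F3 (two_sided U))%E.
    apply: (vol_affine P (b := base) h2 mF2 mF3 mU mY2) => w z; rewrite /F3 /setI /= !sideE.
    rewrite (adherent_revgrid (sub_field U 0 0 w)).
    by split => -[h h']; split.
  rewrite I0 => /esym/eqP; rewrite mule_eq0 eqe expf_eq0/= normr_eq0 (negbTE h2)/=.
  by move/eqP.
(* Under the law of [split_field], the probability that both sides reach a given [z] is the mean of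
   a square, and [square_zero] passes to one side. *)
have E4 : vol P (side true) (two_sided U) = 0%E.
  have sideC b (u : K2 -> R) z : side b (fun k => u (k.1, (k.2.1, clampg k.2.2)), z) <-> side b (u, z).
    exact: (adherent_clamp (fun k => u (k.1, (b, k.2)))).
  have F3C (u : K2 -> R) z : F3 (fun k => u (k.1, (k.2.1, clampg k.2.2)), z) <-> F3 (u, z).
    by split => -[h1 h2']; split; apply/sideC.
  rewrite -(eq_vol P (F := side true) (fun w z => sideC true (two_sided U w) z)) (vol_law (mside true) Htwo).
  rewrite (eq_vol (prodm P (prodm P P)) (F := side true) (fun w z => sideC true (split_field S N w) z)).
  rewrite -(eq_vol P (F := F3) (fun w z => F3C (two_sided U w) z)) (vol_law mF3 Htwo) in E3.
  rewrite (eq_vol (prodm P (prodm P P)) (F := F3) (fun w z => F3C (split_field S N w) z)) in E3.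
  have m3 := measurable_slice2 (prodm P (prodm P P)) (measurable_graph mF3 mY2').
  have m3' := measurable_slice2 (prodm P (prodm P P)) (measurable_graph (mside true) mY2').
  apply: (integral_zero_dom m3 m3' _ _ _ E3).
  - by move=> z; exact: measure_ge0.
  - by move=> z; exact: measure_ge0.
  move=> z; pose C : set (T * T) := [set p | adherent (fun k => S p.1 k + N p.2 k, z)].
  have mC : measurable C.
    have mY (k : K) : measurable_fun setT (fun p : T * T => S p.1 k + N p.2 k).
      apply: measurable_funD; first exact: (measurableT_comp (mS _) measurable_fst).
      exact: (measurableT_comp (mN _) measurable_snd).
    have mp := measurable_graph mad mY.
    rewrite (_ : C = ysection [set p : (T * T) * space6 | adherent ((fun k => S p.1.1 k + N p.1.2 k), p.2)] z).
      exact: (measurable_ysection z mp).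
    by apply/seteqP; split => p; rewrite /ysection/= inE.
  exact: (square_zero mC).
have : vol P (Ab (1, 0)%N) U = ((`|2^-1| ^+ 6)%:E * vol P (side true) (two_sided U))%E.
  by apply: (vol_affine P (b := base) h2 (mAb (1, 0)%N) (mside true) mU mY2) => w z; rewrite sideE.
rewrite E4 mule0 volA// => /eqP; rewrite mule_eq0 eqe invr_eq0 (_ : (64 == 0 :> R) = false) /=.
  by move/eqP.
by apply/negbTE; rewrite pnatr_eq0.
Qed.

End levy.

(** * The heat kernel in space-time *)

Section weight.
Context (R : realType).
Local Notation leb := (@lebesgue_measure R).

Lemma measurable_inv : measurable_fun setT (fun x : R => x^-1).
Proof.
rewrite (_ : (fun _ => _) = (fun x : R => x * (x ^+ 2) `^ (-1))).
  apply: measurable_funM => //; apply: (measurableT_comp (measurable_powR _)) => //.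
apply/funext => x; have [->|x0] := eqVneq x 0; first by rewrite invr0 mul0r.
by rewrite powRN powRr1 ?sqr_ge0// expr2 invfM mulrA divff// mul1r.
Qed.

Lemma measurable_sqrtr : measurable_fun setT (@Num.sqrt R).
Proof. by apply: continuous_measurable_fun; exact: sqrt_continuous. Qed.

(* zero on the negative half-line, where [Num.sqrt] vanishes *)
Definition weight (s : R) : R := (Num.sqrt s * (1 + s))^-1.

Lemma measurable_weight : measurable_fun setT weight.
Proof.
apply: (measurableT_comp measurable_inv); apply: measurable_funM.
  exact: measurable_sqrtr.
exact: measurable_funD.
Qed.

Lemma weight_le0 s : s <= 0 -> weight s = 0.
Proof. by move=> s0; rewrite /weight ler0_sqrtr// mul0r invr0. Qed.

Lemma weight_ge0 s : 0 <= weight s.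
Proof.
have [/weight_le0->//|s0] := leP s 0.
by rewrite invr_ge0 mulr_ge0// addr_ge0// ltW.
Qed.

Let F (x : R) := 2 * atan (Num.sqrt x).

Let dF (x : R) : 0 < x -> is_derive x 1 F (weight x).
Proof.
move=> x0; have dq := is_derive1_sqrt x0.
apply: is_derive_eq; rewrite /weight sqr_sqrtr ?ltW// /GRing.scale/=.
have sx : Num.sqrt x != 0 by rewrite gt_eqF// sqrtr_gt0.
have s1 : 1 + x != 0 by rewrite gt_eqF// addr_gt0.
by field; rewrite sx s1.
Qed.

(** On the positive half-line [weight] is the derivative of [2 * atan (sqrt x)]. It has the
    singularity [s^(-1/2)] of the heat kernel at 0 but decays like [s^(-3/2)], as differences of
    kernels do. *)
Lemma integral_weight : (\int[leb]_x (weight x)%:E <= (2 * pi)%:E)%E.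
Proof.
pose I n := `[(n.+1%:R^-1 : R), n.+2%:R]%classic.
have Ele n : (\int[leb]_(x in I n) (weight x)%:E <= (2 * pi)%:E)%E.
  have ab : n.+1%:R^-1 < n.+2%:R :> R.
    by rewrite (@le_lt_trans _ _ 1)// ?invf_le1 ?ler1n ?ltr1n.
  have n0 : 0 < n.+1%:R^-1 :> R by rewrite invr_gt0.
  have pos (x : R) : n.+1%:R^-1 <= x -> 0 < x by move=> h; exact: lt_le_trans h.
  rewrite (@continuous_FTC2 _ _ F)//.
  - rewrite -EFinB lee_fin /F.
    have := atan_ltpi2 (Num.sqrt n.+2%:R : R); have := atan_gtNpi2 (Num.sqrt (n.+1%:R^-1) : R).
    by lra.
  - apply: continuous_in_subspaceT => x; rewrite inE/= in_itv/= => /andP[/pos x0 _].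
    apply: cvgV; first by rewrite gt_eqF// mulr_gt0 ?sqrtr_gt0// addr_gt0.
    by apply: cvgM; [exact: sqrt_continuous|apply: cvgD; [exact: cvg_cst|exact: cvg_id]].
  - have cF (x : R) : 0 < x -> F x @[x --> x] --> F x.
      move=> /dF d; apply: differentiable_continuous; apply/derivable1_diffP; exact: ex_derive.
    split.
    + by move=> x; rewrite in_itv/= => /andP[/ltW/pos/dF d _]; exact: ex_derive.
    + by apply: cvg_at_right_filter; apply: cF.
    + by apply: cvg_at_left_filter; apply: cF; rewrite (lt_trans n0 ab).
  - move=> x; rewrite in_itv/= => /andP[/ltW/pos/dF d _].
    by rewrite derive1E; apply: derive_val.
have mw : measurable_fun setT (fun x => (weight x)%:E) by apply/measurable_EFinP; exact: measurable_weight.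
have ndI : nondecreasing_seq I.
  move=> m n mn; apply/subsetPset => x; rewrite /I/= !in_itv/= => /andP[h1 h2].
  by rewrite (le_trans _ h1) ?(le_trans h2) ?ler_nat ?lef_pV2 ?posrE ?ler_nat.
have L := @ge0_nondecreasing_set_cvg_integral _ (measurableTypeR R) R I (fun x => (weight x)%:E) leb ndI
   (fun n => measurable_itv _) (fun n => measurable_funTS mw) (fun n x _ => weight_ge0 x).
have UI : \bigcup_n I n = `]0, +oo[%classic.
  apply/seteqP; split => x /=.
    by move=> [n _]; rewrite /I/= !in_itv/= andbT => /andP[h _]; apply: lt_le_trans h; rewrite invr_gt0.
  rewrite in_itv/= andbT => x0.
  exists (maxn (Num.truncn x) (Num.truncn x^-1)) => //; rewrite /I/= in_itv/=; apply/andP; split.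
    rewrite -[leRHS]invrK lef_pV2 ?posrE ?invr_gt0//.
    by rewrite ltW// (lt_le_trans (truncnS_gt _))// ler_nat ltnS leq_maxr.
  by rewrite ltW// (lt_le_trans (truncnS_gt x))// ler_nat ltnS ltnW// ltnS leq_maxl.
rewrite UI in L.
have -> : (\int[leb]_x (weight x)%:E = \int[leb]_(x in (`]0%R, +oo[%classic : set R)) (weight x)%:E)%E.
  rewrite [RHS]integral_mkcond; apply: eq_integral => x _.
  rewrite patchE; case: ifPn => //; rewrite notin_setE/= in_itv/= andbT => /negP.
  by rewrite -leNgt => /weight_le0->.
apply: (cvge_le (f := fun n => (\int[leb]_(x in I n) (weight x)%:E)%E) _ L).
by apply: nearW.
Qed.

End weight.

Section heat.
Context (R : realType).
Local Notation leb := (@lebesgue_measure R).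
Local Notation G := (@heat_kernel R).
Local Notation weight := (@weight R).

Lemma heat_le0 t x : t <= 0 -> G t x = 0.
Proof.
move=> t0; rewrite /heat_kernel ler0_sqrtr ?invr0 ?mul0r//.
by rewrite mulr_ge0_le0// mulr_ge0// pi_ge0.
Qed.

Lemma heat_ge0 t x : 0 <= G t x.
Proof. by rewrite mulr_ge0 ?invr_ge0 ?sqrtr_ge0 ?expR_ge0. Qed.

Lemma heatN t x : G t (- x) = G t x.
Proof. by rewrite /heat_kernel sqrrN. Qed.

Lemma heat_scale (r t x : R) : 0 < r -> G (r ^+ 4 * t) (r ^+ 2 * x) = r ^- 2 * G t x.
Proof.
move=> r0; have [t0|t0] := leP t 0.
  by rewrite !heat_le0 ?mulr0// mulr_ge0_le0// exprn_ge0// ltW.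
rewrite /heat_kernel.
have -> : 4 * pi * (r ^+ 4 * t) = (r ^+ 2) ^+ 2 * (4 * pi * t) by ring.
rewrite sqrtrM ?sqr_ge0// sqrtr_sqr ger0_norm ?sqr_ge0// invfM -[LHS]mulrA; congr (_ * (_ * expR (- _))).
by field; rewrite !gt_eqF.
Qed.

Lemma measurable_heat d (T : measurableType d) (f g : T -> R) :
  measurable_fun setT f -> measurable_fun setT g ->
  measurable_fun setT (fun w => G (f w) (g w)).
Proof.
move=> mf mg; have mi (h : T -> R) : measurable_fun setT h -> measurable_fun setT (fun w : T => (h w)^-1).
  by move=> mh; exact: (measurableT_comp (@measurable_inv R) mh).
have mc c : measurable_fun setT (fun w : T => c * f w) by exact: measurable_funM.
apply: measurable_funM.
  by apply: mi; apply: (measurableT_comp (@measurable_sqrtr R)); exact: mc.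
apply: (measurableT_comp (@measurable_expR R)); apply: measurable_funN.
by apply: measurable_funM; [exact: measurable_funX|apply: mi; exact: mc].
Qed.

(** Completing the square: as a function of [y], the product is [G (a + b) (x - x')] times the
    normal density of mean [m] and variance [s^2]. *)
Lemma heat_semigroup (a b x x' : R) : 0 < a -> 0 < b ->
  (\int[leb]_y (G a (x - y) * G b (x' - y))%:E = (G (a + b) (x - x'))%:E)%E.
Proof.
move=> a0 b0; have ab0 : 0 < a + b by exact: addr_gt0.
pose s := Num.sqrt (2 * a * b / (a + b)).
have s2 : s ^+ 2 = 2 * a * b / (a + b).
  by rewrite sqr_sqrtr// divr_ge0 ?(ltW ab0)// !mulr_ge0 ?ltW.
have sn0 : s != 0 by rewrite -sqrf_eq0 s2 mulf_neq0 ?invr_neq0 ?gt_eqF// !mulr_gt0.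
pose m := (b * x + a * x') / (a + b).
have E y : G a (x - y) * G b (x' - y) = G (a + b) (x - x') * normal_pdf m s y.
  rewrite /normal_pdf (negbTE sn0) /normal_peak /normal_fun /heat_kernel.
  have pi0 := pi_gt0 R.
  rewrite mulrACA [RHS]mulrACA -!expRD; congr (_ * expR _).
    rewrite -!invfM -!sqrtrM ?mulr_ge0 ?(ltW pi0) ?ltW//; congr ((Num.sqrt _)^-1).
    by rewrite s2 mulr2n; field; rewrite gt_eqF.
  have an : a != 0 by rewrite gt_eqF.
  have bn : b != 0 by rewrite gt_eqF.
  have abn : a + b != 0 by rewrite gt_eqF.
  rewrite s2 -[_ *+ 2]mulr_natr /m; field.
  by rewrite bn an abn.
under eq_integral do rewrite E EFinM.
rewrite ge0_integralZl//.
- by rewrite integral_normal_pdf mule1.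
- by apply/measurable_EFinP; exact: measurable_normal_pdf.
- by move=> y _; rewrite lee_fin normal_pdf_ge0.
- by rewrite lee_fin heat_ge0.
Qed.

Lemma heat0E t : 0 < t -> G t 0 <= (Num.sqrt t)^-1.
Proof.
move=> t0; rewrite /heat_kernel expr0n/= mul0r oppr0 expR0 mulr1.
rewrite lef_pV2 ?posrE ?sqrtr_gt0 ?mulr_gt0 ?pi_gt0//.
rewrite ler_wsqrtr// ler_peMl ?(ltW t0)//; have := pi_ge2 R; lra.
Qed.

(** Up to a factor at most 1, the difference multiplied by [sqrt s] is at most 1, and multiplied by
    [sqrt s * s] at most [(s' - s) + x^2]. The second bound is the cancellation that gives
    integrability at infinity. *)
Lemma heat_diff (s s' x : R) : 0 < s -> s <= s' ->
  `|G s 0 - G s' x| <= (1 + (s' - s) + x ^+ 2) * weight s.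
Proof.
move=> s0 ss'; have s'0 : 0 < s' by exact: lt_le_trans ss'.
pose c : R := (Num.sqrt (4 * pi))^-1.
have c4 : 0 <= 4 * pi :> R by rewrite mulr_ge0// pi_ge0.
have c0 : 0 < c by rewrite invr_gt0 sqrtr_gt0 mulr_gt0// pi_gt0.
have c1 : c <= 1.
  rewrite invf_le1 ?sqrtr_gt0 ?mulr_gt0 ?pi_gt0// -[X in X <= _]sqrtr1 ler_wsqrtr//.
  have := pi_ge2 R; lra.
pose u := Num.sqrt s; pose u' := Num.sqrt s'.
have u0 : 0 < u by rewrite sqrtr_gt0.
have u'0 : 0 < u' by rewrite sqrtr_gt0.
have uu' : u <= u' by rewrite ler_wsqrtr.
have us : u ^+ 2 = s by rewrite sqr_sqrtr ?ltW.
have us' : u' ^+ 2 = s' by rewrite sqr_sqrtr ?ltW.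
pose e := expR (- (x ^+ 2 / (4 * s'))).
have GE : G s 0 = c / u.
  by rewrite /heat_kernel expr0n/= mul0r oppr0 expR0 mulr1 sqrtrM// invfM.
have GE' : G s' x = c / u' * e by rewrite /heat_kernel sqrtrM// invfM.
have e0 : 0 < e by exact: expR_gt0.
have e1 : e <= 1 by rewrite expR_le1 oppr_le0 divr_ge0 ?sqr_ge0// mulr_ge0// ltW.
have eb : 1 - x ^+ 2 / (4 * s') <= e by have := expR_ge1Dx (- (x ^+ 2 / (4 * s'))); rewrite -/e; lra.
have iu : u'^-1 <= u^-1 by rewrite lef_pV2 ?posrE.
have iu'0 : 0 < u'^-1 by rewrite invr_gt0.
have d0 : 0 <= u^-1 - u'^-1 * e by rewrite subr_ge0 (le_trans _ iu)// ler_piMr// ltW.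
rewrite GE GE' -mulrA -mulrBr normrM (gtr0_norm c0) (ger0_norm d0).
apply: (@le_trans _ _ (u^-1 - u'^-1 * e)); first by rewrite ler_piMl.
rewrite /weight -/u; have s1 : 0 < 1 + s by rewrite addr_gt0.
rewrite ler_pdivlMr ?mulr_gt0//.
have D1 : (u^-1 - u'^-1 * e) * u <= 1.
  by rewrite mulrBl mulVf ?gt_eqF// lerBlDr lerDl !mulr_ge0// ltW.
have D2 : (u^-1 - u'^-1 * e) * (u * s) <= (s' - s) + x ^+ 2.
  have h1 : u'^-1 * (1 - x ^+ 2 / (4 * s')) <= u'^-1 * e by rewrite ler_wpM2l// ltW.
  have us0 : 0 <= u * s by rewrite mulr_ge0// ltW.
  apply: (@le_trans _ _ ((u^-1 - u'^-1 * (1 - x ^+ 2 / (4 * s'))) * (u * s))).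
    by rewrite ler_wpM2r//; lra.
  have -> : (u^-1 - u'^-1 * (1 - x ^+ 2 / (4 * s'))) * (u * s) =
     s * (u' - u) / u' + (u / u') * (s / s') * (x ^+ 2 / 4).
    by field; rewrite !gt_eqF.
  apply: lerD.
    rewrite ler_pdivrMr// -us -us' -subr_ge0.
    have -> : (u' ^+ 2 - u ^+ 2) * u' - u ^+ 2 * (u' - u) = (u' - u) * (u' ^+ 2 + u * u' - u ^+ 2) by ring.
    rewrite mulr_ge0 ?subr_ge0//.
    have : u * u <= u * u' by rewrite ler_wpM2l// ltW.
    have := sqr_ge0 u'; rewrite !expr2; lra.
  apply: (@le_trans _ _ (1 * (x ^+ 2 / 4))); last by have := sqr_ge0 x; lra.
  rewrite ler_wpM2r ?divr_ge0 ?sqr_ge0//.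
  by rewrite mulr_ile1 ?divr_ge0 ?(ltW u0) ?(ltW u'0) ?(ltW s0) ?(ltW s'0)// ler_pdivrMr// mul1r.
by have -> : (u^-1 - u'^-1 * e) * (u * (1 + s)) = (u^-1 - u'^-1 * e) * u + (u^-1 - u'^-1 * e) * (u * s);
  [ring|lra].
Qed.

Lemma heat0_weight s h : 0 < s <= h -> G s 0 <= (1 + h) * weight s.
Proof.
move=> /andP[s0 sh]; apply: (le_trans (heat0E s0)).
have u0 : 0 < Num.sqrt s by rewrite sqrtr_gt0.
rewrite /weight ler_pdivlMr ?mulr_gt0 ?addr_gt0// mulrA mulVf ?gt_eqF// mul1r lerD2l//.
Qed.

End heat.

(** * Inner products of square-integrable functions *)

Lemma Rintegral_dilation (R : realType) d (T : measurableType d)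
    (mu : {measure set T -> \bar R}) (phi : T -> T) (c : R) (f : T -> R) :
  dilation mu phi c -> 0 < c -> mu.-integrable setT (EFin \o f) ->
  mu.-integrable setT (EFin \o (f \o phi)) /\
  \int[mu]_x f x = c * \int[mu]_x f (phi x).
Proof.
move=> [_ mphi E] c0 iF.
have mf : measurable_fun setT (EFin \o f) by exact: measurable_int iF.
have mfphi : measurable_fun setT (EFin \o (f \o phi)) by exact: (measurableT_comp mf mphi).
have En (g : T -> \bar R) : measurable_fun setT g -> (forall x, 0 <= g x)%E ->
  (\int[mu]_x g x = c%:E * \int[mu]_x g (phi x))%E by move=> mg g0; exact: E.
have iphi : mu.-integrable setT (EFin \o (f \o phi)).
  apply/integrableP; split => //.
  move/integrableP : iF => [_]; rewrite En; last 2 first.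
  - by apply: measurableT_comp.
  - by move=> x.
  rewrite (_ : (fun x => `|(EFin \o f) (phi x)|%E) = (fun x => `|(EFin \o (f \o phi)) x|%E))//.
  case: (\int[mu]_x _)%E => [r _||_]; [exact: ltry| |by []].
  by rewrite mulry gtr0_sg// mul1e.
split => //; rewrite /Rintegral.
rewrite [in LHS]integralE [in RHS]integralE.
have pE : (\int[mu]_x (EFin \o f)^\+ x = c%:E * \int[mu]_x (EFin \o (f \o phi))^\+ x)%E.
  rewrite (En _ (measurable_funepos mf) (funepos_ge0 _)); congr (_ * _)%E.
  by apply: eq_integral => x _; rewrite funepos.unlock.
have nE : (\int[mu]_x (EFin \o f)^\- x = c%:E * \int[mu]_x (EFin \o (f \o phi))^\- x)%E.
  rewrite (En _ (measurable_funeneg mf) (funeneg_ge0 _)); congr (_ * _)%E.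
  by apply: eq_integral => x _; rewrite funeneg.unlock.
have fp := integrable_pos_fin_num measurableT iphi.
have fn := integrable_neg_fin_num measurableT iphi.
rewrite pE nE -muleBr//; last exact: fin_num_adde_defr.
by rewrite fineM// fin_numB fp fn.
Qed.

Section L2.
Context (R : realType) d (T : measurableType d) (mu : {measure set T -> \bar R}).
Implicit Types f g h : T -> R.

Definition L2 f := measurable_fun setT f /\
  mu.-integrable setT (EFin \o (fun z => f z ^+ 2)).

Definition ip f g : R := \int[mu]_z (f z * g z).

Lemma integrable_prod f g : L2 f -> L2 g ->
  mu.-integrable setT (EFin \o (fun z => f z * g z)).
Proof.
move=> [mf if_] [mg ig].
apply: (@le_integrable _ _ _ mu setT measurableT _ ((EFin \o (fun z => f z ^+ 2)%R) \+ (EFin \o (fun z => g z ^+ 2)%R))%E).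
- by apply/measurable_EFinP; exact: measurable_funM.
- move=> z _ /=; rewrite lee_fin [leRHS]ger0_norm ?addr_ge0 ?sqr_ge0//.
  rewrite normrM -(real_normK (num_real (f z))) -(real_normK (num_real (g z))).
  have := sqr_ge0 (`|f z| - `|g z|); have := normr_ge0 (f z); have := normr_ge0 (g z).
  move: `|f z| `|g z| => a b a0 b0; rewrite sqrrB -mulr_natr; have := mulr_ge0 a0 b0; lra.
- exact: integrableD.
Qed.

Lemma ipC f g : ip f g = ip g f.
Proof. by apply: eq_Rintegral => z _; rewrite mulrC. Qed.

Lemma L2D f g : L2 f -> L2 g -> L2 (fun z => f z + g z).
Proof.
move=> Lf Lg; have [[mf if_] [mg ig]] := (Lf, Lg); split; first exact: measurable_funD.
have i2 := integrable_prod Lf Lg.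
have := integrableD measurableT (integrableD measurableT if_ ig) (integrableZl measurableT 2 i2).
apply: eq_integrable => // z _ /=; rewrite -!EFinM -!EFinD; congr EFin; ring.
Qed.

Lemma L2Z a f : L2 f -> L2 (fun z => a * f z).
Proof.
move=> [mf if_]; split; first exact: measurable_funM.
have := integrableZl measurableT (a ^+ 2) if_.
by apply: eq_integrable => // z _ /=; rewrite -!EFinM; congr EFin; ring.
Qed.

Lemma L2B f g : L2 f -> L2 g -> L2 (fun z => f z - g z).
Proof.
move=> Lf Lg; have := L2D Lf (L2Z (-1) Lg).
by congr L2; apply/funext => z; rewrite mulN1r.
Qed.

Lemma L2_le f g : L2 g -> measurable_fun setT f -> (forall z, `|f z| <= `|g z|) -> L2 f.
Proof.
move=> [mg ig] mf fg; split => //; apply: le_integrable ig => //.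
- by apply/measurable_EFinP; exact: measurable_funX.
- by move=> z _ /=; rewrite lee_fin !normrX lerXn2r ?nnegrE.
Qed.

Lemma ipZl a f g : L2 f -> L2 g -> ip (fun z => a * f z) g = a * ip f g.
Proof.
move=> Lf Lg; rewrite /ip -(RintegralZl a measurableT (integrable_prod Lf Lg)).
by apply: eq_Rintegral => z _; rewrite mulrA.
Qed.

Lemma ipDl f g h : L2 f -> L2 g -> L2 h -> ip (fun z => f z + g z) h = ip f h + ip g h.
Proof.
move=> Lf Lg Lh.
rewrite /ip -(RintegralD measurableT (integrable_prod Lf Lh) (integrable_prod Lg Lh)).
by apply: eq_Rintegral => z _; rewrite mulrDl.
Qed.

Lemma ipBl f g h : L2 f -> L2 g -> L2 h -> ip (fun z => f z - g z) h = ip f h - ip g h.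
Proof.
move=> Lf Lg Lh.
rewrite /ip -(RintegralB measurableT (integrable_prod Lf Lh) (integrable_prod Lg Lh)).
by apply: eq_Rintegral => z _; rewrite mulrBl.
Qed.

Lemma ipZr a f g : L2 f -> L2 g -> ip f (fun z => a * g z) = a * ip f g.
Proof. by move=> Lf Lg; rewrite ipC ipZl// ipC. Qed.

Lemma ipDr f g h : L2 f -> L2 g -> L2 h -> ip h (fun z => f z + g z) = ip h f + ip h g.
Proof. by move=> Lf Lg Lh; rewrite ipC ipDl// !(ipC h). Qed.

Lemma ipBr f g h : L2 f -> L2 g -> L2 h -> ip h (fun z => f z - g z) = ip h f - ip h g.
Proof. by move=> Lf Lg Lh; rewrite ipC ipBl// !(ipC h). Qed.

Lemma ip_ge0 f : 0 <= ip f f.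
Proof. by apply: Rintegral_ge0 => z _; rewrite -expr2 sqr_ge0. Qed.

Lemma L2_ereal f : L2 f -> (\int[mu]_z (f z ^+ 2)%:E = (ip f f)%:E)%E.
Proof.
by move=> [mf if_]; rewrite /ip /Rintegral fineK//; exact: integrable_fin_num.
Qed.

Lemma ip_polar f g : L2 f -> L2 g ->
  ip f g = (ip f f + ip g g - ip (fun z => f z - g z) (fun z => f z - g z)) / 2.
Proof.
move=> Lf Lg; have Lfg := L2B Lf Lg.
by rewrite ipBl// !ipBr// (ipC g f); field.
Qed.

Lemma ip_cauchy f g : L2 f -> L2 g -> ip f g ^+ 2 <= ip f f * ip g g.
Proof.
move=> Lf Lg.
have Q s : 0 <= ip f f + 2 * s * ip f g + s ^+ 2 * ip g g.
  have := ip_ge0 (fun z => f z + s * g z).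
  have Lsg := L2Z s Lg; have Lfs := L2D Lf Lsg.
  rewrite ipDl// !ipDr// !ipZl// !ipZr// (ipC g f).
  by congr (0 <= _); ring.
have := ip_ge0 f; have := ip_ge0 g; move: Q; set A := ip f f; set B := ip f g; set N := ip g g.
move=> Q; rewrite le_eqVlt => /predU1P[N0|N0] A0.
  have [->|B0] := eqVneq B 0; first by rewrite expr0n/= mulr_ge0// -N0.
  (* For [N = 0] the quadratic form is affine in [s] and takes the value -1 at this point unless
     [B = 0]. *)
  have := Q (- (A + 1) / (2 * B)); rewrite -N0 mulr0 addr0.
  have -> : A + 2 * (- (A + 1) / (2 * B)) * B = -1 by field.
  by rewrite ler0N1.
have := Q (- B / N).
have -> : A + 2 * (- B / N) * B + (- B / N) ^+ 2 * N = (A * N - B ^+ 2) / N by field; rewrite gt_eqF.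
by rewrite pmulr_lge0 ?invr_gt0// subr_ge0.
Qed.

Lemma ip_le f g : L2 g -> measurable_fun setT f ->
  (forall z, `|f z| <= `|g z|) -> ip f f <= ip g g.
Proof.
move=> Lg mf fg; have Lf := L2_le Lg mf fg; apply: le_Rintegral => //.
- exact: integrable_prod.
- exact: integrable_prod.
by move=> z _; rewrite -!expr2 -[_ ^+ 2]real_normK ?num_real// -[leRHS]real_normK ?num_real// lerXn2r ?nnegrE.
Qed.

Lemma L2_dilation phi c f : dilation mu phi c -> 0 < c -> L2 f -> L2 (f \o phi).
Proof.
move=> D c0 [mf if_]; split; first by have [_ mphi _] := D; exact: (measurableT_comp mf mphi).
by have [+ _] := Rintegral_dilation D c0 if_.
Qed.

Lemma ip_dilation phi c f g : dilation mu phi c -> 0 < c -> L2 f -> L2 g ->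
  ip f g = c * ip (f \o phi) (g \o phi).
Proof.
by move=> D c0 Lf Lg; have [_] := Rintegral_dilation D c0 (integrable_prod Lf Lg).
Qed.

End L2.

(** * Increments of the heat kernel *)

Section kernel.
Context (R : realType).
Local Notation leb := (@lebesgue_measure R).
Local Notation mu := (@leb2 R).
Local Notation G := (@heat_kernel R).
Local Notation weight := (@weight R).

Definition kern (p : R * R) : plane R -> R := fun z => G (p.1 - z.1) (p.2 - z.2).

Lemma kern_ge0 p z : 0 <= kern p z. Proof. exact: heat_ge0. Qed.

Lemma kern_le0 p z : p.1 <= z.1 -> kern p z = 0.
Proof. by move=> h; rewrite /kern heat_le0// subr_le0. Qed.

Lemma measurable_kern p : measurable_fun [set: plane R] (kern p).
Proof.
apply: measurable_heat.
  by apply: measurable_funB => //; exact: measurable_fst.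
by apply: measurable_funB => //; exact: measurable_snd.
Qed.

Lemma dilation_plane (a b c e : R) : a != 0 -> c != 0 ->
  dilation mu (fun z : plane R => (a * z.1 + b, c * z.2 + e)) (`|a| * `|c|).
Proof. by move=> a0 c0; exact: (dilation_prod (dilation_lebesgue b a0) (dilation_lebesgue e c0)). Qed.

Lemma integral_plane (f : plane R -> \bar R) : measurable_fun setT f -> (forall z, 0 <= f z)%E ->
  (\int[mu]_z f z = \int[leb]_r \int[leb]_y f (r, y))%E.
Proof. by move=> mf f0; rewrite (fubini_tonelli1 f mf f0). Qed.

Let mky p (r : R) : measurable_fun setT (fun y : R => kern p (r, y)).
Proof.
exact: (measurable_heat (measurable_cst (p.1 - r)) (measurable_funB (measurable_cst p.2) (@measurable_id _ _ setT))).
Qed.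

Lemma kern_mul_integral p q (r : R) :
  (\int[leb]_y (kern p (r, y) * kern q (r, y))%:E =
   (if (r < p.1) && (r < q.1) then G (p.1 + q.1 - 2 * r) (p.2 - q.2) else 0)%:E)%E.
Proof.
case: ifPn => [/andP[rp rq]|].
  rewrite -[LHS]/(\int[leb]_y (G (p.1 - r) (p.2 - y) * G (q.1 - r) (q.2 - y))%:E)%E.
  rewrite heat_semigroup ?subr_gt0//.
  by congr (_%:E); congr (G _ _); ring.
rewrite negb_and -!leNgt => h.
under eq_integral => y _.
  rewrite (_ : kern p (r, y) * kern q (r, y) = 0); last first.
    by case/orP: h => h; [rewrite kern_le0// mul0r|rewrite (kern_le0 (p := q))// mulr0].
  over.
by rewrite integral0.
Qed.

Lemma kern_sq_integral p (r : R) :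
  (\int[leb]_y (kern p (r, y) ^+ 2)%:E = (G (2 * (p.1 - r)) 0)%:E)%E.
Proof.
under eq_integral do rewrite expr2.
rewrite kern_mul_integral andbb subrr; case: ifPn => [_|].
  by congr (_%:E); congr (G _ _); ring.
by rewrite -leNgt => h; rewrite heat_le0//; move: h; rewrite -subr_le0; lra.
Qed.

(* [weight (2 * (q.1 - r))] takes care of the times [r] between [p.1] and [q.1]. *)
Lemma kern_diff_slice p q (r : R) : p.1 <= q.1 ->
  (\int[leb]_y ((kern p (r, y) - kern q (r, y)) ^+ 2)%:E <=
    ((3 * (1 + (q.1 - p.1) + (q.1 - p.1) + (p.2 - q.2) ^+ 2) * weight (2 * (p.1 - r))) +
     (1 + 2 * (q.1 - p.1)) * weight (2 * (q.1 - r)))%:E)%E.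
Proof.
move=> pq.
have mk2 k : measurable_fun setT (fun y : R => (kern k (r, y) ^+ 2)%:E).
  by apply/measurable_EFinP; exact: (measurable_funX 2 (mky k r)).
have E : (\int[leb]_y ((kern p (r, y) - kern q (r, y)) ^+ 2)%:E +
    (2 * (if (r < p.1) && (r < q.1) then G (p.1 + q.1 - 2 * r) (p.2 - q.2) else 0))%:E =
    (G (2 * (p.1 - r)) 0 + G (2 * (q.1 - r)) 0)%:E)%E.
  rewrite [X in (_ + X)%E]EFinM -kern_mul_integral -ge0_integralZl//; last 2 first.
  - by apply/measurable_EFinP; exact: (measurable_funM (mky p r) (mky q r)).
  - by move=> y _; rewrite lee_fin mulr_ge0 ?kern_ge0.
  rewrite [RHS]EFinD -(kern_sq_integral p r) -(kern_sq_integral q r) -!ge0_integralD//; last 8 first.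
  - by move=> y _; rewrite lee_fin sqr_ge0.
  - exact: mk2.
  - by move=> y _; rewrite lee_fin sqr_ge0.
  - exact: mk2.
  - by move=> y _; rewrite lee_fin sqr_ge0.
  - by apply/measurable_EFinP; exact: (measurable_funX 2 (measurable_funB (mky p r) (mky q r))).
  - by move=> y _; rewrite mule_ge0// lee_fin mulr_ge0 ?kern_ge0.
  - by apply: measurable_funeM; apply/measurable_EFinP; exact: (measurable_funM (mky p r) (mky q r)).
  by apply: eq_integral => y _; rewrite -EFinM -!EFinD; congr (_%:E); ring.
have {}E : (\int[leb]_y ((kern p (r, y) - kern q (r, y)) ^+ 2)%:E =
    (G (2 * (p.1 - r)) 0 + G (2 * (q.1 - r)) 0 -
    (2 * (if (r < p.1) && (r < q.1) then G (p.1 + q.1 - 2 * r) (p.2 - q.2) else 0)))%:E)%E.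
  by rewrite EFinB -E addeK.
rewrite E lee_fin; have w1 := weight_ge0 (2 * (p.1 - r)); have w2 := weight_ge0 (2 * (q.1 - r)).
have d0 : 0 <= q.1 - p.1 by rewrite subr_ge0.
have x0 := sqr_ge0 (p.2 - q.2).
have t1 : 0 <= (1 + 2 * (q.1 - p.1)) * weight (2 * (q.1 - r)).
  by rewrite mulr_ge0// addr_ge0// mulr_ge0.
have [rp|rp] := ltP r p.1; last first.
  rewrite /= mulr0 subr0 heat_le0 ?add0r; last by lra.
  apply: (@le_trans _ _ ((1 + 2 * (q.1 - p.1)) * weight (2 * (q.1 - r)))); last first.
    by rewrite lerDr mulr_ge0// mulr_ge0// addr_ge0// addr_ge0// addr_ge0.
  have [rq|rq] := ltP r q.1; last by rewrite heat_le0//; lra.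
  by apply: heat0_weight; lra.
have rq : r < q.1 by exact: lt_le_trans pq.
rewrite rq /=.
have h1 : `|G (2 * (p.1 - r)) 0 - G (p.1 + q.1 - 2 * r) (p.2 - q.2)| <=
   (1 + (q.1 - p.1) + (p.2 - q.2) ^+ 2) * weight (2 * (p.1 - r)).
  apply: le_trans (heat_diff _ _ _) _; [lra|lra|].
  by have -> : p.1 + q.1 - 2 * r - 2 * (p.1 - r) = q.1 - p.1 by ring.
have h2 : `|G (2 * (p.1 - r)) 0 - G (2 * (q.1 - r)) 0| <=
   (1 + 2 * (q.1 - p.1) + 0 ^+ 2) * weight (2 * (p.1 - r)).
  apply: le_trans (heat_diff _ _ _) _; [lra|lra|].
  by have -> : 2 * (q.1 - r) - 2 * (p.1 - r) = 2 * (q.1 - p.1) by ring.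
have h1' := le_trans (ler_norm _) h1.
move: h2; rewrite ler_norml => /andP[h2 _].
rewrite expr0n/= addr0 in h2.
move: h1' h2 w1 t1 x0 d0; set W := weight _; set X := (_ ^+ 2); set D := q.1 - p.1.
set A := G _ _; set B := G _ _; set C := G _ _; set Z := (_ * weight _) => h1' h2 w1 t1 x0 d0.
have xw : 0 <= X * W by exact: mulr_ge0.
have dw : 0 <= D * W by exact: mulr_ge0.
by lra.
Qed.

Lemma weight_shift_fin (c : R) : (\int[leb]_r (weight (2 * (c - r)))%:E < +oo)%E.
Proof.
have mw : measurable_fun setT (fun x => (weight x)%:E) by apply/measurable_EFinP; exact: measurable_weight.
have w0 x : (0 <= (weight x)%:E)%E by rewrite lee_fin weight_ge0.
have n2 : -2 != 0 :> R by rewrite oppr_eq0.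
have := @integral_weight R; rewrite (ge0_integral_affine (2 * c) n2 mw w0).
rewrite (_ : (fun x => (weight (-2 * x + 2 * c))%:E) = (fun r => (weight (2 * (c - r)))%:E)); last first.
  by apply/funext => r; congr (weight _)%:E; ring.
case: (\int[leb]_r _)%E => [x _||_]; [exact: ltry| |by []].
by rewrite mulry gtr0_sg ?normr_gt0// mul1e.
Qed.

Let mkdiff p q : measurable_fun [set: plane R] (fun z => kern p z - kern q z).
Proof. exact: (measurable_funB (measurable_kern p) (measurable_kern q)). Qed.

(** For a single kernel the slices [G (2 * (p.1 - r)) 0] decay only like [|r|^(-1/2)] in the remote
    past. For a difference, [kern_diff_slice] gives a majorant integrable in [r]. *)
Lemma L2_kern p q : L2 mu (fun z => kern p z - kern q z).
Proof.
have sym k l : L2 mu (fun z => kern k z - kern l z) -> L2 mu (fun z => kern l z - kern k z).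
  move=> /(L2Z (-1)); congr L2; apply/funext => z; ring.
wlog pq : p q / p.1 <= q.1.
  by move=> H; have [/H//|/ltW/H/sym] := leP p.1 q.1.
have m2 : measurable_fun setT (fun z : plane R => ((kern p z - kern q z) ^+ 2)%:E).
  by apply/measurable_EFinP; exact: (measurable_funX 2 (mkdiff p q)).
split; first exact: mkdiff.
apply/integrableP; split; first exact: m2.
rewrite (_ : (fun x => _) = (fun z : plane R => ((kern p z - kern q z) ^+ 2)%:E)); last first.
  by apply/funext => z /=; rewrite ger0_norm ?sqr_ge0.
rewrite integral_plane//; last by move=> z; rewrite lee_fin sqr_ge0.
pose c1 := 3 * (1 + (q.1 - p.1) + (q.1 - p.1) + (p.2 - q.2) ^+ 2).
pose c2 := 1 + 2 * (q.1 - p.1).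
have d0 : 0 <= q.1 - p.1 by rewrite subr_ge0.
have c10 : 0 <= c1 by rewrite mulr_ge0// addr_ge0 ?sqr_ge0// addr_ge0// addr_ge0.
have c20 : 0 <= c2 by rewrite addr_ge0// mulr_ge0.
have mw k : measurable_fun setT (fun r : R => (weight (2 * (k - r)))%:E).
  apply/measurable_EFinP; apply: (measurableT_comp (@measurable_weight R)).
  by apply: measurable_funM => //; exact: measurable_funB.
have w0 k (r : R) : (0 <= (weight (2 * (k - r)))%:E)%E by rewrite lee_fin weight_ge0.
apply: (@le_lt_trans _ _ (\int[leb]_r (c1%:E * (weight (2 * (p.1 - r)))%:E +
   c2%:E * (weight (2 * (q.1 - r)))%:E))%E).
  apply: ge0_le_integral; first exact: measurableT.
  - by move=> r _; apply: integral_ge0 => y _; rewrite lee_fin sqr_ge0.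
  - by apply: (measurable_fun_fubini_tonelli_F _ m2) => z; rewrite lee_fin sqr_ge0.
  - by apply: emeasurable_funD; apply: measurable_funeM; exact: mw.
  - move=> r _; apply: (le_trans (kern_diff_slice r pq)).
    by rewrite -/c1 -/c2 EFinD !EFinM.
rewrite ge0_integralD//; last 4 first.
- by move=> r _; rewrite mule_ge0// lee_fin.
- by apply: measurable_funeM; exact: mw.
- by move=> r _; rewrite mule_ge0// lee_fin.
- by apply: measurable_funeM; exact: mw.
rewrite !ge0_integralZl//; [|exact: mw..].
by apply: lte_add_pinfty; apply: lte_mul_pinfty => //; exact: weight_shift_fin.
Qed.

Lemma kern_dilate (r : R) (b p z : R * R) : 0 < r ->
  kern (b.1 + r ^+ 4 * p.1, b.2 + r ^+ 2 * p.2) (r ^+ 4 * z.1 + b.1, r ^+ 2 * z.2 + b.2) =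
  r ^- 2 * kern p z.
Proof.
move=> r0; rewrite /kern -(heat_scale _ _ r0) /=; congr (G _ _); ring.
Qed.

Definition zoom (r : R) (b p : R * R) : R * R := (b.1 + r ^+ 4 * p.1, b.2 + r ^+ 2 * p.2).

(** The plane is dilated by [r^4 * r^2] and each kernel contributes [r^-2], in all
    [r^6 * r^-4 = r^2]: the field itself scales by [r]. *)
Lemma ip_kern_scale (r : R) (b p p' q q' : R * R) : 0 < r ->
  ip mu (fun z => kern (zoom r b p) z - kern (zoom r b p') z)
        (fun z => kern (zoom r b q) z - kern (zoom r b q') z) =
  r ^+ 2 * ip mu (fun z => kern p z - kern p' z) (fun z => kern q z - kern q' z).
Proof.
move=> r0; have r4 : r ^+ 4 != 0 by rewrite expf_neq0// gt_eqF.
have r2 : r ^+ 2 != 0 by rewrite expf_neq0// gt_eqF.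
have D := dilation_plane b.1 b.2 r4 r2.
have c0 : 0 < `|r ^+ 4| * `|r ^+ 2| by rewrite mulr_gt0// normr_gt0.
rewrite (ip_dilation D c0 (L2_kern _ _) (L2_kern _ _)).
rewrite (_ : _ \o _ = fun z => r ^- 2 * (kern p z - kern p' z)); last first.
  by apply/funext => z /=; rewrite !kern_dilate// mulrBr.
rewrite (_ : (fun z => kern (zoom r b q) z - _) \o _ = fun z => r ^- 2 * (kern q z - kern q' z)); last first.
  by apply/funext => z /=; rewrite !kern_dilate// mulrBr.
have Lp := L2_kern p p'; have Lq := L2_kern q q'.
rewrite ipZl ?ipZr//; last exact: L2Z.
rewrite !ger0_norm ?exprn_ge0 ?(ltW r0)// !mulrA; congr (_ * _).
by field; rewrite gt_eqF.
Qed.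

(** Translating time by [- p.1 - q.1] and reflecting space about the midpoint of [p.2] and [q.2]
    turns the kernel at the reversed [p] into the one at [q], and conversely. Increments of the
    string are therefore invariant in law under time reversal. *)
Lemma ip_kern_reverse (p q : R * R) :
  ip mu (fun z => kern (- p.1, p.2) z - kern (- q.1, q.2) z)
        (fun z => kern (- p.1, p.2) z - kern (- q.1, q.2) z) =
  ip mu (fun z => kern p z - kern q z) (fun z => kern p z - kern q z).
Proof.
have n1 : -1 != 0 :> R by rewrite oppr_eq0.
have D := dilation_plane (- p.1 - q.1) (p.2 + q.2) (oner_neq0 R) n1.
have c0 : 0 < `|1 : R| * `|-1 : R| by rewrite normrN normr1 mulr1.
rewrite (ip_dilation D c0 (L2_kern _ _) (L2_kern _ _)) normrN normr1 mulr1 mul1r.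
apply: eq_Rintegral => z _ /=.
have E1 : kern (- p.1, p.2) (1 * z.1 + (- p.1 - q.1), -1 * z.2 + (p.2 + q.2)) = kern q z.
  by rewrite /kern /= -[RHS]heatN; congr (G _ _); ring.
have E2 : kern (- q.1, q.2) (1 * z.1 + (- p.1 - q.1), -1 * z.2 + (p.2 + q.2)) = kern p z.
  by rewrite /kern /= -[RHS]heatN; congr (G _ _); ring.
rewrite E1 E2; ring.
Qed.

Lemma ip_kern_reverse0 (p q : R * R) :
  ip mu (fun z => kern (- p.1, p.2) z - kern (0, 0) z)
        (fun z => kern (- q.1, q.2) z - kern (0, 0) z) =
  ip mu (fun z => kern p z - kern (0, 0) z) (fun z => kern q z - kern (0, 0) z).
Proof.
have E0 a b : (fun z => (kern a z - kern (0, 0) z) - (kern b z - kern (0, 0) z)) = (fun z => kern a z - kern b z).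
  by apply/funext => z; ring.
rewrite (ip_polar (L2_kern (- p.1, p.2) (0, 0)) (L2_kern (- q.1, q.2) (0, 0))).
rewrite (ip_polar (L2_kern p (0, 0)) (L2_kern q (0, 0))).
rewrite !E0 ip_kern_reverse.
have := ip_kern_reverse p (0, 0); have := ip_kern_reverse q (0, 0).
by rewrite /= oppr0 => -> ->.
Qed.

End kernel.

(** * Reflection in time *)

Section reflection.
Context (R : realType).
Local Notation leb := (@lebesgue_measure R).
Local Notation mu := (@leb2 R).
Local Notation G := (@heat_kernel R).
Local Notation weight := (@weight R).
Implicit Types p q : R * R.

Definition kern0 p : plane R -> R := fun z => kern p z - kern (0, 0) z.

Definition past p : plane R -> R := fun z => if z.1 < 0 then kern0 p z else 0.

Definition future p : plane R -> R := fun z => if z.1 < 0 then 0 else kern0 p z.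

Lemma L2_kern0 p : L2 mu (kern0 p). Proof. exact: L2_kern. Qed.

Lemma measurable_before (c : R) (f g : plane R -> R) : measurable_fun setT f -> measurable_fun setT g ->
  measurable_fun setT (fun z : plane R => if z.1 < c then f z else g z).
Proof.
move=> mf mg; apply: measurable_fun_ifT => //.
by apply: measurable_fun_ltr => //; exact: measurable_fst.
Qed.

Lemma L2_past p : L2 mu (past p).
Proof.
apply: (L2_le (L2_kern0 p)).
  by apply: measurable_before; [exact: (L2_kern0 p).1|exact: measurable_cst].
by move=> z; rewrite /past; case: ifP => // _; rewrite normr0.
Qed.

Lemma L2_future p : L2 mu (future p).
Proof.
apply: (L2_le (L2_kern0 p)).
  by apply: measurable_before; [exact: measurable_cst|exact: (L2_kern0 p).1].
by move=> z; rewrite /future; case: ifP => // _; rewrite normr0.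
Qed.

Lemma ip_past_future p q :
  ip mu (past p) (past q) + ip mu (future p) (future q) = ip mu (kern0 p) (kern0 q).
Proof.
have [Lp Lq] := (L2_past p, L2_past q); have [Fp Fq] := (L2_future p, L2_future q).
rewrite /ip -(RintegralD measurableT (integrable_prod Lp Lq) (integrable_prod Fp Fq)).
by apply: eq_Rintegral => z _; rewrite /past /future; case: ifP => _; rewrite mul0r ?addr0 ?add0r.
Qed.

Section drift.
Variables (t s x y : R).
Hypotheses (t0 : 0 <= t) (s0 : 0 <= s).

Let a (r : R) := G (t + s - 2 * r) (x - y) - G (s - 2 * r) y.
Let A (r : R) := if r < 0 then a r else 0.

Let mA : measurable_fun setT A.
Proof.
have maff c : measurable_fun setT (fun r : R => c - 2 * r).
  by apply: measurable_funB => //; exact: measurable_funM.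
apply: measurable_fun_ifT; last exact: measurable_cst.
  exact: measurable_fun_ltr.
apply: measurable_funB.
  exact: (measurable_heat (maff (t + s)) (measurable_cst (x - y))).
exact: (measurable_heat (maff s) (measurable_cst y)).
Qed.

Let iA : leb.-integrable setT (EFin \o A).
Proof.
pose C := (1 + t + (x - y) ^+ 2) + (1 + y ^+ 2).
have C0 : 0 <= C by rewrite !addr_ge0 ?sqr_ge0.
have bnd (r : R) : `|A r| <= C * weight (2 * (s / 2 - r)).
  rewrite /A; have [r0|_] := ltP r 0; last by rewrite normr0 mulr_ge0// weight_ge0.
  have -> : 2 * (s / 2 - r) = s - 2 * r by field.
  have sr : 0 < s - 2 * r by rewrite subr_gt0; apply: lt_le_trans s0; rewrite pmulr_rlt0.
  have tsr : s - 2 * r <= t + s - 2 * r by rewrite lerD2r lerDr.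
  have h1 := heat_diff (x - y) sr tsr; have h2 := heat_diff y sr (lexx _).
  rewrite (_ : t + s - 2 * r - (s - 2 * r) = t) in h1; last by ring.
  rewrite subrr addr0 in h2.
  rewrite /C mulrDl; apply: le_trans (lerD h1 h2).
  rewrite [X in _ <= X + _]distrC; apply: le_trans (ler_normD _ _).
  by rewrite /a le_eqVlt; apply/orP; left; apply/eqP; congr (`|_|); ring.
apply/integrableP; split; first exact/measurable_EFinP.
apply: (@le_lt_trans _ _ (\int[leb]_r (C%:E * (weight (2 * (s / 2 - r)))%:E))%E).
  apply: ge0_le_integral; first exact: measurableT.
  - by move=> r _; exact: abse_ge0.
  - by apply: measurableT_comp => //; exact/measurable_EFinP.
  - apply: measurable_funeM; apply/measurable_EFinP; apply: (measurableT_comp (@measurable_weight R)).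
    by apply: measurable_funM => //; exact: measurable_funB.
  - by move=> r _; rewrite /= -EFinM lee_fin bnd.
rewrite ge0_integralZl//.
- by apply: lte_mul_pinfty => //; exact: weight_shift_fin.
- apply/measurable_EFinP; apply: (measurableT_comp (@measurable_weight R)).
  by apply: measurable_funM => //; exact: measurable_funB.
- by move=> r _; rewrite lee_fin weight_ge0.
Qed.

(** By the semigroup property the slice at time [r] integrates to [A (r + s) - A r] with [A]
    integrable over the line, and translation invariance makes the total vanish. *)
Lemma ip_past_drift :
  ip mu (past (t, x)) (fun z => kern (- s, y) z - kern (s, y) z) = 0.
Proof.
have iF := integrable_prod (L2_past (t, x)) (L2_kern (- s, y) (s, y)).
have ik p q (r : R) : leb.-integrable setT (EFin \o (fun w : R => kern p (r, w) * kern q (r, w))).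
  have mk k : measurable_fun setT (fun w : R => kern k (r, w)).
    exact: (measurableT_comp (measurable_kern k) (pair1_measurable r)).
  apply/integrableP; split; first by apply/measurable_EFinP; exact: (measurable_funM (mk p) (mk q)).
  under eq_integral => w _.
    rewrite (_ : `| (EFin \o _) w |%E = (kern p (r, w) * kern q (r, w))%:E); last first.
      by rewrite /= ger0_norm// mulr_ge0// kern_ge0.
    over.
  by rewrite kern_mul_integral ltry.
have slice (r : R) : (\int[leb]_w (past (t, x) (r, w) * (kern (- s, y) (r, w) - kern (s, y) (r, w)))%:E =
    (A (1 * r + s) - A r)%:E)%E.
  rewrite /A mul1r /past /=; have [r0|r0] := ltP r 0; last first.
    rewrite ifN ?subr0; last by rewrite -leNgt addr_ge0.
    by under eq_integral do rewrite mul0r; rewrite integral0.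
  have I := ik; have kk p q := kern_mul_integral p q r.
  pose f p q (w : R) := kern p (r, w) * kern q (r, w).
  transitivity (\int[leb]_w (((f (t, x) (- s, y) w)%:E - (f (t, x) (s, y) w)%:E) +
      ((f (0, 0) (s, y) w)%:E - (f (0, 0) (- s, y) w)%:E)))%E.
    by apply: eq_integral => w _; rewrite -!EFinB -EFinD /f /kern0; congr EFin; ring.
  have i1 := integrableB measurableT (ik (t, x) (- s, y) r) (ik (t, x) (s, y) r).
  have i2 := integrableB measurableT (ik (0, 0) (s, y) r) (ik (0, 0) (- s, y) r).
  rewrite (integralD measurableT i1 i2).
  rewrite (integralB measurableT (ik (t, x) (- s, y) r) (ik (t, x) (s, y) r)).
  rewrite (integralB measurableT (ik (0, 0) (s, y) r) (ik (0, 0) (- s, y) r)).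
  rewrite /= !kk /=.
  have rt : r < t by exact: lt_le_trans r0 t0.
  have rs : r < s by exact: lt_le_trans r0 s0.
  rewrite r0 rt rs /= -!EFinB -EFinD; congr EFin.
  rewrite /a !sub0r !heatN !add0r.
  have -> : (r < - s) = (r + s < 0) by rewrite -subr_gt0 -[RHS]subr_gt0; congr (0 < _); ring.
  have -> : t + s - 2 * (r + s) = t - s - 2 * r by ring.
  have -> : s - 2 * (r + s) = - s - 2 * r by ring.
  by case: ifP => _; ring.
rewrite /ip /Rintegral.
rewrite -(integral12_prod_meas1 iF) /fubini_F /=.
under eq_integral do rewrite slice.
have D := dilation_lebesgue s (oner_neq0 R).
have c0 : 0 < `|1 : R| by rewrite normr1.
have [iA' EA] := Rintegral_dilation D c0 iA.
have := RintegralB measurableT iA' iA; rewrite /Rintegral /= => ->.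
move: EA; rewrite /Rintegral normr1 mul1r => <-; exact: subrr.
Qed.

End drift.

(** Against a point before time 0 only the past part of [kern0 p] counts, and [ip_past_drift] moves
    that point to the reflected time after 0. The string on the two sides of time 0 is thus
    correlated exactly like two fields with a common past and independent futures. *)
Lemma ip_reflection p q : 0 <= p.1 -> 0 <= q.1 ->
  ip mu (kern0 p) (kern0 (- q.1, q.2)) = ip mu (past p) (past q).
Proof.
case: p => t x; case: q => s y /= t0 s0.
have Lp := L2_past (t, x).
have E1 : ip mu (kern0 (t, x)) (kern0 (- s, y)) = ip mu (past (t, x)) (kern0 (- s, y)).
  apply: eq_Rintegral => z _; rewrite /past; case: ltP => // z0.
  rewrite [kern0 (- s, y) z](_ : _ = 0) ?mulr0//.
  by rewrite /kern0 !kern_le0 ?subr0//= (le_trans _ z0)// oppr_le0.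
have E2 : ip mu (past (t, x)) (past (s, y)) = ip mu (past (t, x)) (kern0 (s, y)).
  by apply: eq_Rintegral => z _; rewrite /past; case: ltP => // z0; rewrite !mul0r.
rewrite E1 E2; apply/eqP; rewrite -subr_eq0 -ipBr//; [|exact: L2_kern0..].
rewrite (_ : (fun z => _) = (fun z => kern (- s, y) z - kern (s, y) z)).
  by rewrite ip_past_drift.
by apply/funext => z; rewrite /kern0; ring.
Qed.

End reflection.

(** * Fields driven by white noise *)

Section quad.
Context (R : realType) (K : Type).

Definition quad (C : K -> K -> R) (s : seq (R * K)) : R :=
  \sum_(p <- s) \sum_(q <- s) p.1 * q.1 * C p.2 q.2.

Lemma ip_lin d (T : measurableType d) (P : {measure set T -> \bar R}) (Y : T -> K -> R) s :
  (forall k, L2 P (fun w => Y w k)) -> L2 P (fun w => lin s (Y w)) /\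
  forall g, L2 P g -> ip P (fun w => lin s (Y w)) g = \sum_(p <- s) p.1 * ip P (fun w => Y w p.2) g.
Proof.
move=> LY; elim: s => [|[a k] s [IL IH]].
  have -> : (fun w => lin [::] (Y w)) = fun=> 0 by apply/funext => w; rewrite /lin big_nil.
  split=> [|g Lg].
    split; first exact: measurable_cst.
    by under eq_fun do rewrite expr0n/=; exact: integrable0.
  rewrite big_nil /ip /Rintegral; under eq_integral do rewrite mul0r.
  by rewrite integral0.
have E : (fun w => lin ((a, k) :: s) (Y w)) = fun w => a * Y w k + lin s (Y w).
  by apply/funext => w; rewrite /lin big_cons.
rewrite E; have La := L2Z a (LY k); split; first exact: L2D.
by move=> g Lg; rewrite ipDl// ipZl// IH// big_cons.
Qed.

Lemma ip_lin_quad d (T : measurableType d) (P : {measure set T -> \bar R}) (Y : T -> K -> R) s :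
  (forall k, L2 P (fun w => Y w k)) ->
  ip P (fun w => lin s (Y w)) (fun w => lin s (Y w)) =
  quad (fun k l => ip P (fun w => Y w k) (fun w => Y w l)) s.
Proof.
move=> LY; have [Ls E] := ip_lin s LY; rewrite E//; apply: eq_bigr => p _.
rewrite ipC E// mulr_sumr; apply: eq_bigr => q _.
by rewrite (ipC _ (fun w => Y w p.2)) mulrA.
Qed.

Lemma eq_quad (C C' : K -> K -> R) s : (forall k l, C k l = C' k l) -> quad C s = quad C' s.
Proof. by move=> E; do 2 (apply: eq_bigr => ? _); rewrite E. Qed.

End quad.

Section as_prob.
Context (R : realType) d (T : measurableType d) (m : {measure set T -> \bar R}) (m1 : is_prob m).

Definition as_prob : set T -> \bar R := let _ := m1 in m.

HB.instance Definition _ := Measure.copy as_prob m.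
HB.instance Definition _ := @Measure_isProbability.Build _ _ R as_prob m1.

End as_prob.

Section gaussian_field.
Context (R : realType).

(** A centred Gaussian field with covariance [C], described by the characteristic functions of its
    finite linear combinations; this form composes with [has_cf_prod] and feeds [law_unique]. *)
Definition gfield K d (T : measurableType d) (P : {measure set T -> \bar R}) (Y : T -> K -> R)
    (C : K -> K -> R) :=
  (forall k, measurable_fun setT (fun w => Y w k)) /\
  forall s, has_cf P (fun w => lin s (Y w)) (expR (- (quad C s / (2 * gauss_moment R 2)))).

Lemma gfield_law K d d' (T : measurableType d) (T' : measurableType d') (P : probability T R)
    (P' : {measure set T' -> \bar R}) (Y : T -> K -> R) (Y' : T' -> K -> R) C C' :
  is_prob P' -> gfield P Y C -> gfield P' Y' C' -> (forall k l, C k l = C' k l) ->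
  same_law P P' Y Y'.
Proof.
move=> P'1 [mY cY] [mY' cY'] E.
pose Q : probability T' R := as_prob P'1.
apply: (@law_unique R _ _ P _ _ Q K Y Y' mY mY') => s c.
have [_ /(_ c)[-> _]] := cY s; have [_ /(_ c)[H _]] := cY' s.
by rewrite -(eq_quad s E) in H; rewrite -H.
Qed.

Lemma gfield_ae K d (T : measurableType d) (P : {measure set T -> \bar R}) (Y Y' : T -> K -> R) C :
  (forall k, measurable_fun setT (fun w => Y' w k)) ->
  (forall k, {ae P, forall w, Y w k = Y' w k}) -> gfield P Y C -> gfield P Y' C.
Proof.
move=> mY' ae [mY cY]; split=> // s.
have mlin : measurable_fun setT (fun w => lin s (Y' w)).
  by apply: measurable_sum => p; exact: measurable_funM.
have [ml cl] := cY s; split => // c.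
have aes : {ae P, forall w, lin s (Y w) = lin s (Y' w)}.
  elim: (s) => [|[a k] l IH]; first by apply: nearW => w; rewrite /lin !big_nil.
  move: (ae k) IH; apply: filterS2 => w e1 e2.
  by rewrite /lin !big_cons /= e1; congr (_ + _).
have E (g : R -> R) : measurable_fun setT g ->
   \int[P]_w g (c + lin s (Y w)) = \int[P]_w g (c + lin s (Y' w)).
  move=> mg; rewrite /Rintegral; congr fine; apply: ae_eq_integral => //.
  - by apply/measurable_EFinP; apply: (measurableT_comp mg); exact: measurable_funD.
  - by apply/measurable_EFinP; apply: (measurableT_comp mg); exact: measurable_funD.
  - by move: aes; apply: filterS => w -> _.
have [c1 c2] := cl c.
by rewrite -(E cos (@measurable_cosR R)) -(E sin (@measurable_sinR R)).
Qed.

Lemma gfield_cov K d (T : measurableType d) (P : {measure set T -> \bar R}) (Y : T -> K -> R) C C' :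
  (forall k l, C k l = C' k l) -> gfield P Y C -> gfield P Y C'.
Proof. by move=> E [mY cY]; split=> // s; rewrite -(eq_quad s E). Qed.

End gaussian_field.

Section noise.
Context (R : realType).
Local Notation mu := (@leb2 R).

(* Folding the negative times onto the times after [T] carries the
   square-integrable functions supported in the past of [T] isometrically into
   those of the half-plane, so that the noise can be tested against them. *)
Definition fold_time (T : R) (f : R * R -> R) : R * R -> R :=
  fun z => if z.1 <= T then f z else f (T - z.1, z.2).

Definition past_L2 (T : R) (f : R * R -> R) := L2 mu f /\ forall z, T < z.1 -> f z = 0.

Lemma measurable_fold (T : R) (f : plane R -> R) : measurable_fun setT f ->
  measurable_fun setT (fold_time T f : plane R -> R).
Proof.
move=> mf; apply: measurable_fun_ifT => //.
  apply: measurable_fun_ler; first exact: measurable_fst.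
  exact: measurable_cst.
apply: (measurableT_comp mf); apply: measurable_fun_pair; last exact: measurable_snd.
by apply: measurable_funB => //; exact: measurable_fst.
Qed.

Lemma measurable_halfplane : measurable (@halfplane R).
Proof.
have := @measurable_fst _ _ (measurableTypeR R) (measurableTypeR R) measurableT _ (measurable_itv `[0, +oo[).
by congr measurable; apply/seteqP; split => z /=; rewrite in_itv/= andbT// => -[].
Qed.

(** The product splits into the times from 0 on and the negative times; [r -> T - r] carries the
    latter onto the times after [T], where [f] and [g] vanish. *)
Lemma integral_fold (T : R) f g : 0 <= T -> past_L2 T f -> past_L2 T g ->
  mu.-integrable (@halfplane R) (EFin \o (fun z => fold_time T f z * fold_time T g z)) /\
  (\int[mu]_(z in @halfplane R) (fold_time T f z * fold_time T g z)%:E = (ip mu f g)%:E)%E.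
Proof.
move=> T0 [Lf f0] [Lg g0]; have ifg := integrable_prod Lf Lg.
have mfg : measurable_fun [set: plane R] (fun z => f z * g z) := measurable_funM Lf.1 Lg.1.
pose h1 (z : plane R) := if z.1 < 0 then 0 else f z * g z.
pose h2 (z : plane R) := if z.1 < 0 then f z * g z else 0.
have i1 : mu.-integrable setT (EFin \o h1).
  apply: le_integrable ifg => //.
    by apply/measurable_EFinP; exact: (measurable_before 0 (measurable_cst _) mfg).
  by move=> z _ /=; rewrite /h1; case: ifP => // _; rewrite normr0 lee_fin.
have i2 : mu.-integrable setT (EFin \o h2).
  apply: le_integrable ifg => //.
    by apply/measurable_EFinP; exact: (measurable_before 0 mfg (measurable_cst _)).
  by move=> z _ /=; rewrite /h2; case: ifP => // _; rewrite normr0 lee_fin.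
have n1 : -1 != 0 :> R by rewrite oppr_eq0.
have D := dilation_plane T 0 n1 (oner_neq0 R).
have c0 : 0 < `|-1 : R| * `|1 : R| by rewrite normrN normr1 mulr1.
have [i2' E2] := Rintegral_dilation D c0 i2.
have split z : ((fun z => fold_time T f z * fold_time T g z) \_ (@halfplane R)) z =
    h1 z + h2 (-1 * z.1 + T, 1 * z.2 + 0).
  rewrite patchE /h1 /h2 /fold_time /= mulN1r mul1r addr0 [- z.1 + T]addrC.
  case: ifPn; rewrite ?notin_setE ?inE /halfplane /= => hz.
    rewrite ltNge hz /= subr_lt0 leNgt; case: ltP => zT //=; last by rewrite addr0.
    by rewrite (f0 z zT) mul0r add0r.
  by move/negP: hz; rewrite -ltNge => hz; rewrite hz ifN ?addr0// -leNgt subr_ge0 (le_trans (ltW hz)).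
have iH : mu.-integrable setT (EFin \o ((fun z => fold_time T f z * fold_time T g z) \_ (@halfplane R))).
  have := integrableD measurableT i1 i2'.
  by apply: eq_integrable => // z _ /=; rewrite split EFinD.
split.
  by rewrite (integrable_mkcond _ measurable_halfplane) restrict_EFin.
rewrite integral_mkcond restrict_EFin.
have fin := integrable_fin_num measurableT iH.
rewrite -[LHS]fineK//; congr EFin.
transitivity (\int[mu]_z (h1 z + h2 (-1 * z.1 + T, 1 * z.2 + 0))).
  by apply: eq_Rintegral => z _; exact: split.
rewrite (RintegralD measurableT i1 i2').
move: E2; rewrite normrN normr1 mulr1 mul1r /= => <-.
rewrite -(RintegralD measurableT i1 i2); apply: eq_Rintegral => z _.
by rewrite /h1 /h2; case: ifP => _; rewrite ?addr0 ?add0r.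
Qed.

Context d (Omega : measurableType d) (P : probability Omega R).
Variable W : 'I_6 -> (R * R -> R) -> {RV P >-> R}.
Hypothesis HW : white_noise W.
Variable T : R.
Hypothesis T0 : 0 <= T.

Definition wn (j : 'I_6) (f : R * R -> R) (w : Omega) : R := W j (fold_time T f) w.

Lemma square_integrable_fold f : past_L2 T f -> square_integrable (fold_time T f).
Proof.
move=> pf; split; first by apply: measurable_funTS; exact: measurable_fold pf.1.1.
have [+ _] := integral_fold T0 pf pf.
by apply: eq_integrable => //; exact: measurable_halfplane.
Qed.

Lemma measurable_wn j f : measurable_fun setT (wn j f).
Proof. exact: measurable_funPT. Qed.

Lemma wn_cov l j f g : past_L2 T f -> past_L2 T g ->
  (\int[P]_w (wn l f w * wn j g w)%:E = ((l == j)%:R * ip mu f g)%:E)%E.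
Proof.
move=> pf pg; have [_ H] := HW.
have := H l j _ _ (square_integrable_fold pf) (square_integrable_fold pg).
rewrite expectation.unlock => ->.
by have [_ ->] := integral_fold T0 pf pg; rewrite EFinM.
Qed.

Lemma L2_wn j f : past_L2 T f -> L2 P (wn j f).
Proof.
move=> pf; split; first exact: measurable_wn.
apply/integrableP; split; first by apply/measurable_EFinP; exact: (measurable_funX 2 (measurable_wn j f)).
under eq_integral => w _.
  rewrite (_ : `| (EFin \o _) w |%E = (wn j f w * wn j f w)%:E); last first.
    by rewrite /= ger0_norm ?sqr_ge0// expr2.
  over.
by rewrite wn_cov// ltry.
Qed.

Lemma ip_wn l j f g : past_L2 T f -> past_L2 T g ->
  ip P (wn l f) (wn j g) = (l == j)%:R * ip mu f g.
Proof. by move=> pf pg; rewrite /ip /Rintegral wn_cov. Qed.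

Section field.
Variables (K : Type) (j : K -> 'I_6) (phi : K -> R * R -> R).
Hypothesis Hphi : forall k, past_L2 T (phi k).

Let Y w k := wn (j k) (phi k) w.

Lemma wn_centered s : centered_gaussian P (fun w => lin s (Y w)).
Proof.
have [H _] := HW.
have := H (size s) (fun i => j (tnth (in_tuple s) i).2) (fun i => fold_time T (phi (tnth (in_tuple s) i).2))
   (fun i => (tnth (in_tuple s) i).1) (fun i => square_integrable_fold (Hphi _)).
by congr (centered_gaussian P _); apply/funext => w; rewrite /lin [RHS]big_tnth.
Qed.

Lemma wn_field : gfield P Y (fun k l => (j k == j l)%:R * ip mu (phi k) (phi l)).
Proof.
have LY k : L2 P (fun w => Y w k) by exact: L2_wn.
split=> [k|s]; first exact: measurable_wn.
split; first by have [+ _] := wn_centered s.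
move=> c; have := cg_cf (wn_centered s) c; rewrite /=.
rewrite (L2_ereal (ip_lin s LY).1) /= (ip_lin_quad s LY).
by rewrite (eq_quad (C' := fun k l => (j k == j l)%:R * ip mu (phi k) (phi l)))// => k l; exact: ip_wn.
Qed.

End field.

Lemma wn_moment12 j f : past_L2 T f ->
  (\int[P]_w (wn j f w ^+ 12)%:E =
    (gauss_moment R 12 / gauss_moment R 2 ^+ 6 * ip mu f f ^+ 6)%:E)%E.
Proof.
move=> pf; have := wn_centered (fun=> j) (fun _ : unit => pf) [:: (1, tt)].
rewrite (_ : (fun w => lin _ _) = wn j f); last first.
  by apply/funext => w; rewrite /lin big_seq1 /= mul1r.
move/cg_moment12 ->; rewrite (L2_ereal (L2_wn j pf)) /=.
by rewrite ip_wn// eqxx mul1r.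
Qed.

(** The difference of the two sides has second moment 0 by the covariance formula, so that linearity
    holds almost surely. *)
Lemma wn_aeB j f g (a : R) : past_L2 T f -> past_L2 T g ->
  past_L2 T (fun z => a * (f z - g z)) /\
  {ae P, forall w, wn j (fun z => a * (f z - g z)) w = a * (wn j f w - wn j g w)}.
Proof.
move=> pf pg; have Lfg := L2Z a (L2B pf.1 pg.1).
have ph : past_L2 T (fun z => a * (f z - g z)).
  by split => // z zT; rewrite pf.2// pg.2// subrr mulr0.
split => //.
have Lf := L2_wn j pf; have Lg := L2_wn j pg; have Lh := L2_wn j ph.
have LD := L2Z a (L2B Lf Lg); have LX := L2B Lh LD.
pose D w := wn j (fun z => a * (f z - g z)) w - a * (wn j f w - wn j g w).
have D0 : (\int[P]_w (D w ^+ 2)%:E = 0)%E.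
  rewrite (L2_ereal LX); congr EFin.
  rewrite (ipBl Lh LD LX) !(ipBr Lh LD)// !ipZl ?ipZr//; [|exact: L2B..].
  rewrite (ipBr Lf Lg Lh) (ipBl Lf Lg Lh) (ipBl Lf Lg (L2B Lf Lg)) (ipBr Lf Lg Lf) (ipBr Lf Lg Lg).
  rewrite !ip_wn// !eqxx !mul1r.
  have [Lf2 Lg2] := (pf.1, pg.1); have Lfg2 := L2B Lf2 Lg2.
  rewrite !ipZl ?ipZr// !(ipBl Lf2 Lg2)// !(ipBr Lf2 Lg2)//.
  ring.
have mD : measurable_fun setT (fun w => (D w ^+ 2)%:E).
  by apply/measurable_EFinP; exact: (measurable_funX 2 LX.1).
have {}D0 : (\int[P]_w `|(D w ^+ 2)%:E| = 0)%E.
  by rewrite -[RHS]D0; apply: eq_integral => w _; rewrite gee0_abs// lee_fin sqr_ge0.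
have := (ae_eq_integral_abs P measurableT mD).1 D0.
apply: filterS => w /= /(_ I) [] /eqP; rewrite sqrf_eq0 subr_eq0 => /eqP ->.
by [].
Qed.

End noise.

(** * The stationary string *)

Section positions.
Context (R : realType).
Implicit Types q : grid.

Lemma zoom1 (p : R * R) : zoom 1 (0, 0) p = p.
Proof. by case: p => t x; rewrite /zoom !expr1n !mul1r !add0r. Qed.

Lemma grid_pos0 : grid_pos R grid0 = (0, 0).
Proof. by rewrite /grid_pos/= !mul0r. Qed.

Lemma grid_pos_bound q : in_grid q -> 0 <= (grid_pos R q).1 <= 1 /\ 0 <= (grid_pos R q).2 <= 1.
Proof.
move=> /andP[h1 h2]; rewrite /grid_pos /= !divr_ge0 ?exprn_ge0//=.
by rewrite !ler_pdivrMr ?exprn_gt0// !mul1r -!natrX !ler_nat.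
Qed.

Lemma half4 : (2^-1 : R) ^+ 4 = 16^-1. Proof. by rewrite exprVn; congr (_^-1); ring. Qed.
Lemma half2 : (2^-1 : R) ^+ 2 = 4^-1. Proof. by rewrite exprVn; congr (_^-1); ring. Qed.

Lemma grid_pos_subgrid a b q :
  grid_pos R (subgrid a b q) = zoom 2^-1 (a%:R / 16, b%:R / 4) (grid_pos R q).
Proof.
case: q => n [i j]; rewrite /grid_pos /zoom /= half4 half2 !natrD !natrM !natrX !exprS.
have h1 : (16 : R) ^+ n != 0 by rewrite expf_neq0.
have h2 : (4 : R) ^+ n != 0 by rewrite expf_neq0.
by congr (_, _); field.
Qed.

Lemma in_subgrid a b q : (a < 16)%N -> (b < 4)%N -> in_grid q -> in_grid (subgrid a b q).
Proof.
case: q => n [i j]; rewrite /in_grid /subgrid /= !expnS => a16 b4 /andP[hi hj].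
by apply/andP; split; nia.
Qed.

(** Subbox (0, 0) run backwards is, at half the scale, the time reflection of the unit box about the
    corner shared with subbox (1, 0). *)
Lemma grid_pos_revgrid q : in_grid q ->
  grid_pos R (subgrid 0 0 (revgrid q)) = zoom 2^-1 (1%:R / 16, 0%:R / 4) (- (grid_pos R q).1, (grid_pos R q).2).
Proof.
case: q => n [i j] /andP[/= hi hj]; rewrite /grid_pos /zoom /= half4 half2 !mul0n !add0n !exprS natrB// natrX.
have h1 : (16 : R) ^+ n != 0 by rewrite expf_neq0.
have h2 : (4 : R) ^+ n != 0 by rewrite expf_neq0.
by congr (_, _); field.
Qed.

Lemma grid_pos_parent q : in_grid q -> exists a b, [/\ (a < 16)%N, (b < 4)%N &
  grid_pos R q = zoom (2^-1 ^+ q.1) (grid_pos R (parent q)) (a%:R, b%:R)].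
Proof.
case: q => -[|n] [i j] hq.
  move: (hq); rewrite /in_grid/= => /andP[hi hj]; exists i, j; split; [lia|lia|].
  by rewrite expr0 grid_pos0 zoom1 /grid_pos /= !divr1.
exists (i %% 16)%N, (j %% 4)%N; split; [by rewrite ltn_mod|by rewrite ltn_mod|].
rewrite /grid_pos /zoom /= -!exprM ![(n.+1 * _)%N]mulnC !exprM half4 half2 !exprVn.
have h1 : (16 : R) ^+ n != 0 by rewrite expf_neq0.
have h2 : (4 : R) ^+ n != 0 by rewrite expf_neq0.
rewrite {1}(divn_eq i 16) {1}(divn_eq j 4) !natrD !natrM !exprS.
by congr (_, _); field.
Qed.

Lemma zoom_zoom (r r' : R) b b' p : zoom r b (zoom r' b' p) = zoom (r * r') (zoom r b b') p.
Proof. by rewrite /zoom /=; congr (_, _); ring. Qed.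

End positions.

Section string.
Context (R : realType) d (Omega : measurableType d) (P : probability Omega R).
Variable W : 'I_6 -> (R * R -> R) -> {RV P >-> R}.
Hypothesis HW : white_noise W.
Local Notation mu := (@leb2 R).
Local Notation K := ('I_6 * grid)%type.
Local Notation K2 := ('I_6 * (bool * grid))%type.
Local Notation wn1 := (wn W 1).

(* The stationary solution with unit coefficient, pinned at the origin; unlike
   the solution started at time 0 it is exactly self-similar. *)
Definition string (w : Omega) (k : K) : R := wn1 k.1 (kern0 (grid_pos R (clampg k.2))) w.

Lemma past_L2_kern0 (T : R) (p : R * R) : 0 <= T -> p.1 <= T -> past_L2 T (kern0 p).
Proof.
move=> T0 pT; split; first exact: L2_kern0.
by move=> z zT; rewrite /kern0 !kern_le0 ?subrr ?(ltW (le_lt_trans _ zT)).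
Qed.

Let pk q : past_L2 1 (kern0 (grid_pos R (clampg q))).
Proof.
by apply: past_L2_kern0 => //; have [/andP[]] := @grid_pos_bound R _ (in_clampg q).
Qed.

Lemma measurable_string k : measurable_fun setT (fun w => string w k).
Proof. exact: measurable_wn. Qed.

Lemma string_refine w j i1 i2 :
  string w (j, (0, (i1, i2)))%N = string w (j, (1, (16 * i1, 4 * i2)))%N.
Proof.
rewrite /string /=; congr (wn1 j (kern0 _) w); rewrite /clampg /in_grid /= !expn0 !expn1.
have -> : (16 * i1 <= 16)%N && (4 * i2 <= 4)%N = (i1 <= 1)%N && (i2 <= 1)%N by lia.
by case: ifP => // _; rewrite /grid_pos/= !natrM; congr (_, _); field.
Qed.

(** After zooming, every increment from parent to child is one of these 64 increments from the
    origin; their sum is a single bound valid at all levels. *)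
Definition string_var : R :=
  \sum_(a < 16) \sum_(b < 4) ip mu (kern0 (a%:R, b%:R)) (kern0 (a%:R, b%:R)).

Lemma ip_kern_parent (r : R) (c : R * R) q : 0 < r -> in_grid q ->
  ip mu (fun z => kern (zoom r c (grid_pos R q)) z - kern (zoom r c (grid_pos R (parent q))) z)
    (fun z => kern (zoom r c (grid_pos R q)) z - kern (zoom r c (grid_pos R (parent q))) z) <=
  r ^+ 2 * (string_var / 4 ^+ q.1).
Proof.
move=> r0 hq; have [a [b [a16 b4 E]]] := grid_pos_parent R hq.
set p := parent q in E *.
have Ep : grid_pos R p = zoom (2^-1 ^+ q.1) (grid_pos R p) (0, 0).
  by case: (grid_pos R p) => t x; rewrite /zoom/= !mulr0 !addr0.
rewrite ip_kern_scale// ler_wpM2l ?sqr_ge0//.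
rewrite (_ : (fun z => kern (grid_pos R q) z - kern (grid_pos R p) z) =
   (fun z => kern (zoom (2^-1 ^+ q.1) (grid_pos R p) (a%:R, b%:R)) z -
             kern (zoom (2^-1 ^+ q.1) (grid_pos R p) (0, 0)) z)); last by rewrite -E -Ep.
rewrite ip_kern_scale ?exprn_gt0 ?invr_gt0//.
rewrite -exprM mulnC exprM half2 exprVn mulrC ler_wpM2r ?invr_ge0 ?exprn_ge0//.
rewrite /string_var (bigD1 (Ordinal a16))//= (bigD1 (Ordinal b4))//= -addrA lerDl addr_ge0//.
  by apply: sumr_ge0 => *; exact: ip_ge0.
by do 2 (apply: sumr_ge0 => ? _); exact: ip_ge0.
Qed.

Lemma string_var_ge0 : 0 <= string_var.
Proof. by do 2 (apply: sumr_ge0 => ? _); exact: ip_ge0. Qed.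

Definition moment_ratio : R := gauss_moment R 12 / gauss_moment R 2 ^+ 6.

Lemma moment_ratio_ge0 : 0 <= moment_ratio.
Proof.
rewrite divr_ge0 ?exprn_ge0 ?(ltW (gauss_moment2_gt0 R))//.
by apply: Rintegral_ge0 => z _; rewrite mulr_ge0 ?normal_pdf_ge0// exprn_even_ge0.
Qed.

(** The twelfth moment of a centred Gaussian variable is a constant times the sixth power of its
    variance, and [(A / 4^n)^6 = A^6 / 4096^n] is the rate that [expect_chain] asks for. *)
Lemma wn_chain (T A : R) j (Y : Omega -> grid -> R) (phi : grid -> R * R -> R) : 0 <= T -> 0 <= A ->
  (forall q, measurable_fun setT (fun w => Y w q)) -> (forall q, past_L2 T (phi q)) ->
  (forall q, {ae P, forall w, Y w q = wn W T j (phi q) w}) ->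
  (forall q, in_grid q -> ip mu (fun z => phi q z - phi (parent q) z) (fun z => phi q z - phi (parent q) z) <=
     A / 4 ^+ q.1) ->
  (\int[P]_w chain (Y w) <= (8 * cw R * (moment_ratio * A ^+ 6))%:E)%E.
Proof.
move=> T0 A0 mY pphi aeY hA; apply: expect_chain => //.
  by rewrite mulr_ge0 ?moment_ratio_ge0 ?exprn_ge0.
move=> q hq; have [pa ae] := wn_aeB HW T0 j 1 (pphi q) (pphi (parent q)).
rewrite (ae_eq_integral (fun w => ((wn W T j (fun z => 1 * (phi q z - phi (parent q) z)) w) ^+ 12)%:E))//; last 3 first.
- by apply/measurable_EFinP; apply: measurable_funX; apply: measurableT_comp => //; exact: measurable_funB.
- by apply/measurable_EFinP; apply: measurable_funX; exact: measurable_wn.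
- move: ae (aeY q) (aeY (parent q)); apply: filterS3 => w E Eq Ep _ /=; congr EFin.
  by rewrite E mul1r Eq Ep -normrX ger0_norm// exprn_even_ge0.
rewrite (wn_moment12 HW T0 j pa) lee_fin -/moment_ratio -mulrA ler_wpM2l ?moment_ratio_ge0//.
have -> : (4096 : R) ^+ q.1 = (4 ^+ q.1) ^+ 6.
  by rewrite -exprM mulnC exprM; congr (_ ^+ _); ring.
rewrite -exprVn -exprMn lerXn2r ?nnegrE ?ip_ge0//.
  by rewrite mulr_ge0// invr_ge0 exprn_ge0.
apply: le_trans (hA q hq); rewrite le_eqVlt; apply/orP; left; apply/eqP.
by apply: eq_Rintegral => z _; rewrite !mul1r.
Qed.

Lemma string_chain j :
  (\int[P]_w chain (component (string w) j) <= (8 * cw R * (moment_ratio * string_var ^+ 6))%:E)%E.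
Proof.
apply: (wn_chain (j := j) (phi := fun q => kern0 (grid_pos R (clampg q))) ler01 string_var_ge0).
- by move=> q; exact: measurable_string.
- exact: pk.
- by move=> q; exact: aeW.
move=> q hq; have := @ip_kern_parent 1 (0, 0) q ltr01 hq; rewrite !zoom1 expr1n mul1r; apply: le_trans.
rewrite (clampgK hq) (clampgK (in_grid_parent hq)) le_eqVlt; apply/orP; left; apply/eqP.
by apply: eq_Rintegral => z _; rewrite /kern0; ring.
Qed.

Lemma string_field :
  gfield P string (fun k l => (k.1 == l.1)%:R *
    ip mu (kern0 (grid_pos R (clampg k.2))) (kern0 (grid_pos R (clampg l.2)))).
Proof.
exact: (wn_field HW (ler01 : 0 <= (1:R)) (fun k : K => k.1) (phi := fun k => kern0 (grid_pos R (clampg k.2))) (fun k => pk k.2)).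
Qed.

Lemma sub_string_field a b : (a < 16)%N -> (b < 4)%N ->
  gfield P (fun w k => sub_field string a b w (k.1, clampg k.2) - sub_field string a b w (k.1, grid0))
   (fun k l => (k.1 == l.1)%:R * (4^-1 *
    ip mu (kern0 (grid_pos R (clampg k.2))) (kern0 (grid_pos R (clampg l.2))))).
Proof.
move=> a16 b4.
pose phi (k : K) : R * R -> R := fun z => 1 * (kern0 (grid_pos R (clampg (subgrid a b (clampg k.2)))) z -
   kern0 (grid_pos R (clampg (subgrid a b grid0))) z).
have ae k := wn_aeB HW (ler01 : 0 <= (1:R)) k.1 1 (pk (subgrid a b (clampg k.2))) (pk (subgrid a b grid0)).
have F := wn_field HW (ler01 : 0 <= (1:R)) (fun k : K => k.1) (phi := phi) (fun k => (ae k).1).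
apply: (gfield_cov _ (gfield_ae _ _ F)).
- move=> k l; congr (_ * _).
  have E (k' : K) : phi k' = fun z =>
      kern (zoom 2^-1 (a%:R / 16, b%:R / 4) (grid_pos R (clampg k'.2))) z -
      kern (zoom 2^-1 (a%:R / 16, b%:R / 4) (0, 0)) z.
    apply/funext => z; rewrite /phi (clampgK (in_subgrid a16 b4 (in_clampg k'.2))) (clampgK (in_subgrid a16 b4 (isT : in_grid grid0))).
    by rewrite !grid_pos_subgrid grid_pos0 /kern0; ring.
  by rewrite !E ip_kern_scale ?invr_gt0// half2.
- by move=> k; apply: measurable_funB; exact: measurable_string.
- move=> k; move: (ae k).2; apply: filterS => w ->; rewrite mul1r; exact: erefl.
Qed.

Lemma scaled_string_field :
  gfield P (fun w k => 2^-1 * string w (k.1, clampg k.2))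
   (fun k l => (k.1 == l.1)%:R * (4^-1 *
    ip mu (kern0 (grid_pos R (clampg k.2))) (kern0 (grid_pos R (clampg l.2))))).
Proof.
pose phi (k : K) : R * R -> R := fun z => 2^-1 * (kern0 (grid_pos R (clampg k.2)) z -
   kern0 (0, 0) z).
have p0 : past_L2 1 (@kern0 R (0, 0)) by exact: past_L2_kern0.
have z0 : @kern0 R (0, 0) = (fun=> 0) by apply/funext => z; rewrite /kern0 subrr.
have ae k := wn_aeB HW (ler01 : 0 <= (1:R)) k.1 2^-1 (pk k.2) p0.
have ae0 k := wn_aeB HW (ler01 : 0 <= (1:R)) k 1 p0 p0.
have F := wn_field HW (ler01 : 0 <= (1:R)) (fun k : K => k.1) (phi := phi) (fun k => (ae k).1).
apply: (gfield_cov _ (gfield_ae _ _ F)).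
- move=> k l; congr (_ * _).
  have E (k' : K) : phi k' = fun z => 2^-1 * kern0 (grid_pos R (clampg k'.2)) z.
    by apply/funext => z; rewrite /phi z0 subr0.
  rewrite !E ipZl ?ipZr//; try exact: L2_kern0; last by apply: L2Z; exact: L2_kern0.
  by rewrite mulrA -expr2 half2.
- by move=> k; apply: measurable_funM => //; exact: measurable_string.
- move=> k; move: (ae k).2 (ae0 k.1).2; apply: filterS2 => w -> E0.
  have E1 : wn1 k.1 (kern0 (0, 0)) w = 0.
    rewrite (_ : (fun z => _) = kern0 (0, 0)) in E0; last by apply/funext => z; rewrite z0 subrr mulr0.
    by move: E0; rewrite subrr mulr0.
  rewrite E1 subr0 -[string w (k.1, clampg k.2)]/(wn1 k.1 (kern0 (grid_pos R (clampg (clampg k.2)))) w).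
  by rewrite (clampgK (in_clampg k.2)).
Qed.

(** On one side the covariance is that of the string, by scaling and, for the earlier subbox, by
    time reversal; between opposite sides [ip_reflection] leaves the past part only. *)
Lemma two_sided_string_field :
  gfield P (fun w k => two_sided string w (k.1, (k.2.1, clampg k.2.2)))
   (fun k l : K2 => (k.1 == l.1)%:R *
     (ip mu (past (grid_pos R (clampg k.2.2))) (past (grid_pos R (clampg l.2.2))) +
      (k.2.1 == l.2.1)%:R *
      ip mu (future (grid_pos R (clampg k.2.2))) (future (grid_pos R (clampg l.2.2))))).
Proof.
pose sg (k : K2) : grid := if k.2.1 then subgrid 1 0 (clampg k.2.2) else subgrid 0 0 (revgrid (clampg k.2.2)).
have in_sg k : in_grid (sg k).
  rewrite /sg; case: ifP => _; apply: in_subgrid => //; first exact: in_clampg.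
  by have /andP[] := in_revgrid (in_clampg k.2.2).
have in_s0 : in_grid (subgrid 1 0 grid0) by [].
pose phi (k : K2) : R * R -> R := fun z => 2 * (kern0 (grid_pos R (clampg (sg k))) z -
   kern0 (grid_pos R (clampg (subgrid 1 0 grid0))) z).
have ae k := wn_aeB HW (ler01 : 0 <= (1:R)) k.1 2 (pk (sg k)) (pk (subgrid 1 0 grid0)).
have F := wn_field HW (ler01 : 0 <= (1:R)) (fun k : K2 => k.1) (phi := phi) (fun k => (ae k).1).
apply: (gfield_cov _ (gfield_ae _ _ F)).
- move=> k l; congr (_ * _).
  pose b0 : R * R := (1%:R / 16, 0%:R / 4).
  pose ps (k' : K2) : R * R := let p := grid_pos R (clampg k'.2.2) in
    if k'.2.1 then p else (- p.1, p.2).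
  have Eps k' : grid_pos R (sg k') = zoom 2^-1 b0 (ps k').
    rewrite /sg /ps; case: ifP => _; first exact: grid_pos_subgrid.
    by rewrite grid_pos_revgrid ?in_clampg.
  have E (k' : K2) : phi k' = fun z => 2 * (kern (zoom 2^-1 b0 (ps k')) z - kern (zoom 2^-1 b0 (0, 0)) z).
    apply/funext => z; rewrite /phi !clampgK// Eps grid_pos_subgrid grid_pos0 /kern0 -/b0; ring.
  rewrite !E ipZl ?ipZr//; try exact: L2_kern; last by apply: L2Z; exact: L2_kern.
  rewrite ip_kern_scale ?invr_gt0// half2 !mulrA.
  have -> : 2 * 2 * 4^-1 = 1 :> R by field.
  rewrite mul1r -/(kern0 (ps k)) -/(kern0 (ps l)) /ps.
  have pos (k' : K2) : 0 <= (grid_pos R (clampg k'.2.2)).1.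
    by have [/andP[]] := @grid_pos_bound R _ (in_clampg k'.2.2).
  move: (pos k) (pos l).
  move: (grid_pos R (clampg k.2.2)) (grid_pos R (clampg l.2.2)) => p p' p0 p0'.
  case: k.2.1; case: l.2.1 => /=.
  + by rewrite mul1r ip_past_future.
  + by rewrite mul0r addr0 ip_reflection.
  + by rewrite mul0r addr0 ipC ip_reflection// ipC.
  + by rewrite mul1r ip_past_future; exact: ip_kern_reverse0.
- move=> k; apply: measurable_funM => //; apply: measurable_funB; last exact: measurable_string.
  by case: k.2.1; exact: measurable_string.
- move=> k; move: (ae k).2; apply: filterS => w ->.
  by rewrite /two_sided /sub_field /string /sg /=; case: k.2.1.
Qed.

Let S (w : Omega) (k : K) := wn1 k.1 (past (grid_pos R (clampg k.2))) w.
Let N (w : Omega) (k : K) := wn1 k.1 (future (grid_pos R (clampg k.2))) w.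

(** A linear combination is sorted into its past terms and the future terms of each side, which live
    on independent factors; the quadratic forms then add up to the covariance of
    [two_sided_string_field]. *)
Lemma split_string_field :
  gfield (prodm P (prodm P P)) (fun w k => split_field S N w (k.1, (k.2.1, clampg k.2.2)))
   (fun k l : K2 => (k.1 == l.1)%:R *
     (ip mu (past (grid_pos R (clampg k.2.2))) (past (grid_pos R (clampg l.2.2))) +
      (k.2.1 == l.2.1)%:R *
      ip mu (future (grid_pos R (clampg k.2.2))) (future (grid_pos R (clampg l.2.2))))).
Proof.
have ppast q : past_L2 1 (past (grid_pos R (clampg q))).
  split; first exact: L2_past.
  by move=> z z1; rewrite /past; case: ifP => // _; exact: (pk q).2.
have pfut q : past_L2 1 (future (grid_pos R (clampg q))).
  split; first exact: L2_future.
  by move=> z z1; rewrite /future; case: ifP => // _; exact: (pk q).2.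
have [mS cS] := wn_field HW (ler01 : 0 <= (1:R)) (fun k : K => k.1) (phi := fun k => past (grid_pos R (clampg k.2))) (fun k => ppast k.2).
have [mN cN] := wn_field HW (ler01 : 0 <= (1:R)) (fun k : K => k.1) (phi := fun k => future (grid_pos R (clampg k.2))) (fun k => pfut k.2).
have P1 : is_prob P by exact: probability_setT.
split.
  move=> [j [b q]]; rewrite /split_field /=.
  apply: measurable_funD; first exact: (measurableT_comp (mS _) measurable_fst).
  case: b; apply: (measurableT_comp (mN _)).
    exact: (measurableT_comp measurable_fst measurable_snd).
  exact: (measurableT_comp measurable_snd measurable_snd).
move=> s.
pose sS : seq (R * K) := [seq (p.1, (p.2.1, p.2.2.2)) | p <- s].
pose sN b : seq (R * K) := [seq (p.1, (p.2.1, p.2.2.2)) | p <- s & p.2.2.1 == b].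
have H := has_cf_prod P1 (is_prob_prod P1 P1) (cS sS) (has_cf_prod P1 P1 (cN (sN true)) (cN (sN false))).
rewrite -!expRD -!opprD -!mulrDl in H.
set f := fun _ => _ in H; set g := fun _ => _.
have -> : g = f.
  apply/funext => w; rewrite /f /g /lin /sS /sN !big_map !big_filter /split_field /S /N.
  rewrite [X in _ + (X + _)]big_mkcond [X in _ + (_ + X)]big_mkcond -!big_split /=.
  apply: eq_bigr => -[a [j [b q]]] _ /=; rewrite (clampgK (in_clampg q)).
  by case: b => /=; rewrite ?addr0 ?add0r mulrDr.
have eq_sum (x y : R) : x = y -> has_cf (prodm P (prodm P P)) f (expR (- (x / (2 * gauss_moment R 2)))) ->
    has_cf (prodm P (prodm P P)) f (expR (- (y / (2 * gauss_moment R 2)))) by move=> ->.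
apply: (eq_sum _ _ _ H).
rewrite /quad /sS /sN !big_map !big_filter.
rewrite [X in _ + (X + _)]big_mkcond [X in _ + (_ + X)]big_mkcond -!big_split /=.
apply: eq_bigr => -[a [j [b q]]] _ /=.
rewrite !big_map !big_filter.
have -> (F : R * K2 -> R) : (if b == true then \sum_(p <- s | p.2.2.1 == true) F p else 0) +
     (if b == false then \sum_(p <- s | p.2.2.1 == false) F p else 0) = \sum_(p <- s | p.2.2.1 == b) F p.
  by case: b; rewrite /= ?addr0 ?add0r.
rewrite [X in _ + X]big_mkcond -big_split; apply: eq_bigr => -[a' [j' [b' q']]] _ /=.
by rewrite [b' == b]eq_sym; case: (b == b'); rewrite /= ?mul1r ?mul0r ?addr0; ring.
Qed.

Lemma string_vol_zero : vol P (@adherent R) string = 0%E.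
Proof.
have P1 : is_prob P by exact: probability_setT.
have P3 : is_prob (prodm P (prodm P P)) := is_prob_prod P1 (is_prob_prod P1 P1).
apply: (@levy_zero R _ _ P string S N (8 * cw R * (moment_ratio * string_var ^+ 6))).
- exact: measurable_string.
- by move=> k; exact: measurable_wn.
- by move=> k; exact: measurable_wn.
- exact: string_chain.
- exact: string_refine.
- move=> a b a16 b4.
  exact: (gfield_law P1 (sub_string_field a16 b4) scaled_string_field).
- exact: (gfield_law P3 two_sided_string_field split_string_field).
Qed.

Lemma string_vol_hit : (fun n => vol P (hit n.+1%:R^-1) string) @ \oo --> 0%E.
Proof. exact: (vol_hit_cvg measurable_string string_chain string_vol_zero). Qed.

End string.

(** * Perturbed strings *)

Section chain_order.
Context (R : realType).
Implicit Types x y : grid -> R.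

Lemma chain_add x y : (chain (fun q => x q + y q)%R <= (cw R)%:E * (chain x + chain y))%E.
Proof.
have c0 := cw_gt0 R.
have t0 u n : 0 <= cw R * cr R ^+ n * level u n.
  by rewrite mulr_ge0 ?level_ge0// mulr_ge0 ?exprn_ge0// ltW// cr_gt0.
rewrite /chain -nneseriesD//; [|by move=> n _; rewrite lee_fin..].
rewrite -nneseriesZl//; last by move=> n _; rewrite -EFinD lee_fin addr_ge0.
apply: lee_nneseries => n _; first by move=> _; rewrite lee_fin.
rewrite -EFinD -EFinM lee_fin -mulrDr mulrCA ler_wpM2l//.
  by rewrite mulr_ge0 ?exprn_ge0// ltW// cr_gt0.
rewrite /level mulrDr !mulr_sumr -big_split; apply: ler_sum => i _.
rewrite !mulr_sumr -big_split; apply: ler_sum => j _ /=.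
set q := (n, _); rewrite -mulrDr.
apply: (@le_trans _ _ ((`|x q - x (parent q)| + `|y q - y (parent q)|) ^+ 12)).
  rewrite lerXn2r ?nnegrE ?addr_ge0//; apply: le_trans (ler_normD _ _).
  by rewrite le_eqVlt; apply/orP; left; apply/eqP; congr (`|_|); ring.
apply: (le_trans (exp12D _ _)) => //.
by rewrite mulrDr lerD2l ler_wpM2r ?exprn_ge0// cr_le_cw.
Qed.

Lemma chain_le x y : (forall q, in_grid q -> `|x q - x (parent q)| <= `|y q - y (parent q)|) ->
  (chain x <= chain y)%E.
Proof.
move=> h; apply: lee_nneseries => n _.
  move=> _; rewrite lee_fin mulr_ge0 ?level_ge0// mulr_ge0 ?exprn_ge0// ltW// ?cw_gt0 ?cr_gt0//.
rewrite lee_fin ler_wpM2l//.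
  by rewrite mulr_ge0 ?exprn_ge0// ltW// ?cw_gt0 ?cr_gt0.
do 2 (apply: ler_sum => ? _); rewrite lerXn2r ?nnegrE// h//.
by rewrite /in_grid/= -ltnS ltn_ord -ltnS ltn_ord.
Qed.

Lemma le_exp12 (a b : R) : 0 <= a -> 0 <= b -> (a ^+ 12 <= b ^+ 12) = (a <= b).
Proof. by move=> a0 b0; rewrite ler_pXn2r. Qed.

(** Simplifies the constants left by one use of [hit_box] and two of [chain_add]. *)
Lemma cubic_bound (c : R) (a b : \bar R) : 1 <= c -> (0 <= a)%E -> (0 <= b)%E ->
  (c%:E * (c%:E * (a + c%:E * (b + 1)) + 1) <= (c ^+ 3)%:E * (a + b + 2%:E))%E.
Proof.
move=> c1; have c0 : 0 < c by exact: lt_le_trans c1.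
have c3 : 0 < c ^+ 3 by exact: exprn_gt0.
case: a => [a| |]//; last first.
  move=> _ b0; have -> : (+oo + b + 2%:E = +oo :> \bar R)%E by case: b b0.
  by rewrite [leRHS]gt0_muley ?lte_fin// leey.
rewrite lee_fin => a0; case: b => [b| |]//; last first.
  move=> _; have -> : (a%:E + +oo + 2%:E = +oo :> \bar R)%E by [].
  by rewrite [leRHS]gt0_muley ?lte_fin// leey.
rewrite lee_fin => b0; rewrite -[leLHS]/((c * (c * (a + c * (b + 1)) + 1))%:E) -[leRHS]/((c ^+ 3 * (a + b + 2))%:E) lee_fin.
have i1 : 0 <= a * c ^+ 2 * (c - 1) by rewrite mulr_ge0 ?subr_ge0// mulr_ge0 ?sqr_ge0.
have i2 : 0 <= c * (c ^+ 2 - 1) by rewrite mulr_ge0 ?(ltW c0)// subr_ge0 exprn_ege1.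
rewrite -subr_ge0.
have -> : c ^+ 3 * (a + b + 2) - c * (c * (a + c * (b + 1)) + 1) =
  a * c ^+ 2 * (c - 1) + c * (c ^+ 2 - 1) by ring.
exact: addr_ge0.
Qed.

End chain_order.

Lemma integral_linear_bound (R : realType) d (T : measurableType d) (P : probability T R)
    (f h x y : T -> \bar R) (k c1 c2 c3 c4 a b : R) :
  measurable_fun setT f -> measurable_fun setT h -> measurable_fun setT x -> measurable_fun setT y ->
  (forall w, 0 <= f w)%E -> (forall w, 0 <= h w)%E -> (forall w, 0 <= x w)%E -> (forall w, 0 <= y w)%E ->
  0 <= k -> 0 <= c1 -> 0 <= c2 -> 0 <= c3 -> 0 <= c4 ->
  (forall w, f w <= k%:E * (h w + (c1%:E * (c2%:E * (c3%:E * (x w + y w + 2%:E))) + c4%:E * y w)))%E ->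
  (\int[P]_w x w <= a%:E)%E -> (\int[P]_w y w <= b%:E)%E ->
  (\int[P]_w f w <= k%:E * (\int[P]_w h w + (c1 * (c2 * (c3 * (a + b + 2))) + c4 * b)%:E))%E.
Proof.
move=> mf mh mx my f0 h0 x0 y0 k0 c10 c20 c30 c40 fle xa yb.
have E1 := fun z (Hz : forall w, (0 <= z w)%E) (mz : measurable_fun setT z) (c : R) (Hc : 0 <= c) =>
  ge0_integralZl_EFin P measurableT (fun w _ => Hz w) mz Hc.
have mxy : measurable_fun setT (fun w => x w + y w)%E by exact: emeasurable_funD.
have mxy2 : measurable_fun setT (fun w => x w + y w + 2%:E)%E by exact: emeasurable_funD.
have xy0 w : (0 <= x w + y w)%E by exact: adde_ge0.
have xy20 w : (0 <= x w + y w + 2%:E)%E by apply: adde_ge0.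
have m1 : measurable_fun setT (fun w => c3%:E * (x w + y w + 2%:E))%E by exact: measurable_funeM.
have p1 w : (0 <= c3%:E * (x w + y w + 2%:E))%E by apply: mule_ge0.
have m2 : measurable_fun setT (fun w => c2%:E * (c3%:E * (x w + y w + 2%:E)))%E by exact: measurable_funeM.
have p2 w : (0 <= c2%:E * (c3%:E * (x w + y w + 2%:E)))%E by apply: mule_ge0.
have m3 : measurable_fun setT (fun w => c1%:E * (c2%:E * (c3%:E * (x w + y w + 2%:E))))%E by exact: measurable_funeM.
have p3 w : (0 <= c1%:E * (c2%:E * (c3%:E * (x w + y w + 2%:E))))%E by apply: mule_ge0.
have m4 : measurable_fun setT (fun w => c4%:E * y w)%E by exact: measurable_funeM.
have p4 w : (0 <= c4%:E * y w)%E by apply: mule_ge0.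
have m5 := emeasurable_funD m3 m4.
have p5 w := adde_ge0 (p3 w) (p4 w).
have m6 := emeasurable_funD mh m5.
have p6 w := adde_ge0 (h0 w) (p5 w).
apply: (@le_trans _ _ (\int[P]_w (k%:E * (h w + (c1%:E * (c2%:E * (c3%:E * (x w + y w + 2%:E))) + c4%:E * y w))))%E).
  by apply: ge0_le_integral => //; exact: measurable_funeM.
rewrite E1//; apply: lee_wpmul2l; first by rewrite lee_fin.
rewrite ge0_integralD//; apply: leeD => //.
rewrite ge0_integralD// [leRHS]EFinD; apply: leeD; last by rewrite E1// EFinM lee_wpmul2l ?lee_fin.
rewrite E1//; rewrite EFinM; apply: lee_wpmul2l; first by rewrite lee_fin.
rewrite E1//; rewrite EFinM; apply: lee_wpmul2l; first by rewrite lee_fin.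
rewrite E1//; rewrite EFinM; apply: lee_wpmul2l; first by rewrite lee_fin.
have e2 : (\int[P]_w 2%:E = 2%:E :> \bar R)%E.
  have := integral_cst P (@measurableT _ T) (2%:E : \bar R).
  by rewrite [X in (_ = _ * X)%E]probability_setT mule1.
rewrite ge0_integralD//.
rewrite e2 ge0_integralD// !EFinD; apply: leeD => //; exact: leeD.
Qed.

(* In a box of scale [s] the field [V] is, up to the error [e], a copy of [u];
   [c] runs over the values of the noise tested against the plateau and [g] is
   the slowly varying loading of [V] on them. *)
Section local_bound.
Context (R : realType) d (T : measurableType d) (P : probability T R).
Local Notation mR := (measurableTypeR R).
Notation space6 := ((mR * (mR * mR)) * (mR * (mR * mR)))%type.
Notation leb6 := (@leb6 R).
Local Notation K := ('I_6 * grid)%type.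
Variables (V u e : T -> K -> R) (g : 'I_6 -> grid -> R) (s : 'I_6 -> R) (z0 : space6).
Variables (M smin smax gmin eps tau : R) (A_u A_e : R).
Hypotheses (mV : forall k, measurable_fun setT (fun w => V w k))
  (mu : forall k, measurable_fun setT (fun w => u w k))
  (me : forall k, measurable_fun setT (fun w => e w k)).
Hypotheses (smin0 : 0 < smin) (s_min : forall j, smin <= s j) (s_max : forall j, s j <= smax).
Hypotheses (gmin0 : 0 < gmin) (g_min : forall j, gmin <= g j grid0).
Hypotheses (eps0 : 0 < eps) (eps1 : eps <= 1) (tau0 : 0 < tau) (M0 : 0 <= M).
Hypothesis VE : forall w j q, in_grid q ->
  V w (j, q) = V w (j, grid0) + s j * (u w (j, q) - u w (j, grid0) + e w (j, q)).
Hypothesis e_origin : forall w j, e w (j, grid0) = 0.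
Hypothesis chain_u : forall j, (\int[P]_w chain (component (u w) j) <= A_u%:E)%E.
Hypothesis chain_e : forall j, (\int[P]_w chain (component (e w) j) <= A_e%:E)%E.
Hypothesis chain_g : forall j, (chain (fun q => M / s j * g j q)%R <= ((eps / 4) ^+ 12)%:E)%E.

Let c0 : 0 < cw R := cw_gt0 R.

Definition hit_set (w : T) : set space6 :=
  [set c | (forall j, `|coord6 c j| <= M) /\
    adherent (fun k => V w k + coord6 c k.1 * g k.1 k.2, z0)].

(** Dividing by the amplitude [s j] turns the event that [V], shifted by [c], reaches [z0] into the
    event that a perturbed copy of [u] reaches [y w c]. The map is affine in [c], so that volumes of
    sets of [c] and of targets are comparable. *)
Let y (w : T) (c : space6) : space6 :=
  vec6 (fun j => - (g j grid0 / s j) * coord6 c j + ((coord6 z0 j - V w (j, grid0)) / s j + u w (j, grid0))).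

Let Xu w : \bar R := \big[+%E/0%E]_j chain (component (u w) j).
Let Xe w : \bar R := \big[+%E/0%E]_j chain (component (e w) j).

Let s0 j : 0 < s j. Proof. exact: lt_le_trans (s_min j). Qed.

Let u' w c (k : K) := u w k + (e w k + coord6 c k.1 * (g k.1 k.2 - g k.1 grid0) / s k.1).

Let hit_y w c : hit_set w c -> forall r, 0 < r -> hit r (u' w c, y w c).
Proof.
move=> [cM had] r r0; have rs : 0 < r * smin by exact: mulr_gt0.
have [q hq hj] := had _ rs; exists q => // j; have := hj j; rewrite /= /y coord_vec6 /u' /=.
rewrite VE// => h; rewrite -(ltr_pM2r (s0 j)).
apply: lt_le_trans (ler_wpM2l (ltW r0) (s_min j)); apply: le_lt_trans h.
have sn : s j != 0 by rewrite gt_eqF.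
have nE a : `|a| * s j = `|a * s j| by rewrite normrM (gtr0_norm (s0 j)).
rewrite nE le_eqVlt; apply/orP; left; apply/eqP; congr (`|_|).
by field.
Qed.

Let eg_small c j q : (forall j, `|coord6 c j| <= M) -> in_grid q ->
  `|coord6 c j * (g j q - g j grid0) / s j| <= eps / 4.
Proof.
move=> cM hq; have e4 : 0 <= eps / 4 by rewrite divr_ge0// ltW.
have := le_trans (chain_bound (fun q => M / s j * g j q) hq) (chain_g j).
rewrite lee_fin le_exp12//; apply: le_trans.
have -> : M / s j * g j q - M / s j * g j grid0 = M * ((g j q - g j grid0) / s j).
  by field; rewrite gt_eqF.
rewrite -mulrA !normrM; apply: ler_wpM2r; first exact: mulr_ge0.
by rewrite (ger0_norm M0).
Qed.

(** Half of [eps] is spent on the approach to the target, and a quarter on each of the two errors: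
    the field [e] and the variation of the loading. *)
Let hit_good w c : hit_set w c ->
  (forall j, (chain (component (e w) j) <= ((eps / 4) ^+ 12)%:E)%E) -> hit eps (u w, y w c).
Proof.
move=> hc he; have [cM _] := hc.
have e2 : 0 < eps / 2 by rewrite divr_gt0.
have [q hq hj] := hit_y hc e2; exists q => // j; move: (hj j); rewrite /= /u' /= => h.
have e4 : 0 <= eps / 4 by rewrite divr_ge0// ltW.
have := le_trans (chain_bound (component (e w) j) hq) (he j).
rewrite /component e_origin subr0 lee_fin le_exp12// => h1.
have h2 := eg_small j cM hq.
move: h h1 h2; set a := e w _; set b := coord6 c j * _ / _; set z := coord6 _ j; set x := u w _.
move=> h h1 h2.
have -> : x - z = (x + (a + b) - z) - (a + b) by ring.
apply: (le_lt_trans (ler_normB _ _)).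
have := ler_normD a b; lra.
Qed.

Let B w : \bar R := ((cw R ^+ 3)%:E * (Xu w + Xe w + 2%:E))%E.

(** Even when the error field is large, the target lies in a box about the root value whose size is
    linear in the chains. *)
Let hit_bad w c : hit_set w c -> forall j,
  ((`|coord6 (y w c) j - u w (j, grid0)| ^+ 12)%:E <= B w)%E.
Proof.
move=> hc j; have [cM _] := hc.
have := hit_box ltr01 (hit_y hc ltr01) j.
rewrite {1}/u' /= e_origin add0r subrr mulr0 mul0r addr0 expr1n; move/le_trans; apply.
have h1 := chain_add (component (u w) j) (fun q => e w (j, q) + coord6 c j * (g j q - g j grid0) / s j).
have h2 := chain_add (component (e w) j) (fun q => coord6 c j * (g j q - g j grid0) / s j).
have h3 : (chain (fun q => coord6 c j * (g j q - g j grid0) / s j)%R <= 1)%E.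
  apply: (@le_trans _ _ (chain (fun q => M / s j * g j q)%R)).
    apply: chain_le => q hq.
    have -> : coord6 c j * (g j q - g j grid0) / s j - coord6 c j * (g j (parent q) - g j grid0) / s j =
      coord6 c j * ((g j q - g j (parent q)) / s j) by ring.
    have -> : M / s j * g j q - M / s j * g j (parent q) = M * ((g j q - g j (parent q)) / s j) by ring.
    by rewrite !normrM; apply: ler_wpM2r; [exact: mulr_ge0|rewrite (ger0_norm M0)].
  apply: (le_trans (chain_g j)); rewrite lee_fin exprn_ile1//.
    by rewrite divr_ge0// ltW.
  by rewrite ler_pdivrMr//; have := eps1; lra.
have hu : (chain (component (u w) j) <= Xu w)%E.
  by rewrite /Xu (bigD1 j)//= leeDl// sume_ge0// => i _; exact: chain_ge0.
have he : (chain (component (e w) j) <= Xe w)%E.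
  by rewrite /Xe (bigD1 j)//= leeDl// sume_ge0// => i _; exact: chain_ge0.
have c1 : 1 <= cw R by rewrite /cw exprn_ege1//; lra.
have Xu0 : (0 <= Xu w)%E by apply: sume_ge0 => i _; exact: chain_ge0.
have Xe0 : (0 <= Xe w)%E by apply: sume_ge0 => i _; exact: chain_ge0.
have h4 : (chain (component (u' w c) j) <= (cw R)%:E * (Xu w + (cw R)%:E * (Xe w + 1)))%E.
  apply: (le_trans h1); apply: lee_wpmul2l; first by rewrite lee_fin ltW.
  apply: leeD => //; apply: (le_trans h2); apply: lee_wpmul2l; first by rewrite lee_fin ltW.
  exact: leeD.
apply: (@le_trans _ _ ((cw R)%:E * ((cw R)%:E * (Xu w + (cw R)%:E * (Xe w + 1)) + 1))%E).
  by apply: lee_wpmul2l; [rewrite lee_fin ltW|exact: leeD].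
exact: cubic_bound.
Qed.

Let kfac := (smax / gmin) ^+ 6.

Let leb6_y w (S : set space6) : measurable S ->
  (leb6 [set c | S (y w c)] <= kfac%:E * leb6 S)%E.
Proof.
move=> mS.
have smax0 : 0 < smax := lt_le_trans (s0 ord0) (s_max ord0).
have g0 j : 0 < g j grid0 := lt_le_trans gmin0 (g_min j).
pose a j := - (g j grid0 / s j).
have a0 j : a j != 0 by rewrite oppr_eq0 mulf_neq0 ?invr_neq0// gt_eqF.
rewrite (dilation_set (dilation_leb6 (fun j => (coord6 z0 j - V w (j, grid0)) / s j + u w (j, grid0)) a0) mS).
have p0 : 0 < \prod_j `|a j| by apply: prodr_gt0 => j _; rewrite normr_gt0.
have k1 : 1 <= kfac * \prod_j `|a j|.
  have -> : kfac = \prod_(j < 6) (smax / gmin) by rewrite prodr_const card_ord.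
  rewrite -big_split /=; apply: (big_ind (fun x : R => 1 <= x)) => [//|? ?|j _]; first exact: mulr_ege1.
  rewrite normrN (gtr0_norm (divr_gt0 (g0 j) (s0 j))).
  have -> : smax / gmin * (g j grid0 / s j) = (smax / s j) * (g j grid0 / gmin).
    by field; rewrite !gt_eqF.
  by rewrite mulr_ege1// ler_pdivlMr// mul1r ?g_min ?s_max.
rewrite muleA -EFinM -[leLHS]mul1e; apply: lee_wpmul2r; first exact: measure_ge0.
by rewrite lee_fin.
Qed.

Let Xu0 w : (0 <= Xu w)%E. Proof. by apply: sume_ge0 => i _; exact: chain_ge0. Qed.
Let Xe0 w : (0 <= Xe w)%E. Proof. by apply: sume_ge0 => i _; exact: chain_ge0. Qed.

Let t := (eps / 4) ^+ 12.

Let t0 : 0 < t. Proof. by rewrite exprn_gt0// divr_gt0. Qed.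

Let bound w : \bar R :=
  (leb6 [set z | hit eps (u w, z)] +
   (64%:E * (tau%:E * B w) + (64 * (1 / (4 * tau)) / t)%:E * Xe w))%E.

Let B0 w : (0 <= B w)%E.
Proof. by rewrite mule_ge0 ?lee_fin ?exprn_ge0 ?(ltW c0)// !adde_ge0. Qed.

Let measurable_hit_set_graph : measurable [set p : T * space6 | hit_set p.1 p.2].
Proof.
have -> : [set p : T * space6 | hit_set p.1 p.2] =
   (setT `*` [set c | forall j, `|coord6 c j| <= M]) `&`
   [set p | adherent (fun k => V p.1 k + coord6 p.2 k.1 * g k.1 k.2, z0)].
  by apply/seteqP; split => -[w c] /=; [move=> [? ?]|move=> [[_ ?] ?]].
apply: measurableI.
  apply: measurableX; first exact: measurableT.
  rewrite (_ : mkset _ = \bigcap_(j in [set: 'I_6]) [set c | `|coord6 c j| <= M]).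
    apply: fin_bigcap_measurable => // j _; rewrite -[X in measurable X]setTI.
    have mf : measurable_fun setT (fun c : space6 => `|coord6 c j|).
      by apply: measurableT_comp => //; exact: measurable_coord6.
    have := mf measurableT _ (measurable_itv `]-oo, M]).
    by congr measurable; apply/seteqP; split => c /=; rewrite in_itv/=.
  by apply/seteqP; split => c /= h j; [move=> _; exact: h|exact: (h j)].
have mY (k : K) : measurable_fun setT (fun p : T * space6 => V p.1 k + coord6 p.2 k.1 * g k.1 k.2).
  apply: measurable_funD; first exact: (measurableT_comp (mV k) measurable_fst).
  apply: measurable_funM; last exact: measurable_cst.
  exact: (measurableT_comp (measurable_coord6 k.1) measurable_snd).
have mp := measurable_graph (@measurable_adherent R) mY.
rewrite (_ : mkset _ = ysection [set p : (T * space6) * space6 |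
   adherent ((fun k => V p.1.1 k + coord6 p.1.2 k.1 * g k.1 k.2), p.2)] z0).
  exact: (measurable_ysection z0 mp).
by apply/seteqP; split => p; rewrite /ysection/= inE.
Qed.

Lemma measurable_hit_set w : measurable (hit_set w).
Proof. exact: (measurable_slice w measurable_hit_set_graph). Qed.

Lemma measurable_vol_hit_set : measurable_fun setT (fun w => leb6 (hit_set w)).
Proof. exact: (measurable_slice1 leb6 measurable_hit_set_graph). Qed.

Let pointwise w : (leb6 (hit_set w) <= kfac%:E * bound w)%E.
Proof.
have mh := measurable_slice w (measurable_graph (@measurable_hit R eps) mu).
have k0 : (0 <= kfac%:E)%E.
  by rewrite lee_fin exprn_ge0// divr_ge0 ?(ltW gmin0)// (le_trans (ltW (s0 ord0))).
have lemeas (S : set space6) : measurable S -> (forall c, hit_set w c -> S (y w c)) ->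
    (leb6 (hit_set w) <= kfac%:E * leb6 S)%E.
  move=> mS sub; apply: le_trans (leb6_y w mS); apply: le_measure; rewrite ?inE.
  - exact: measurable_hit_set.
  - rewrite -[X in measurable X]setTI.
    have my : measurable_fun setT (y w).
      apply: measurable_vec6 => j; apply: measurable_funD => //; apply: measurable_funM => //.
      exact: measurable_coord6.
    exact: my.
  - exact: sub.
have r0 : 0 <= 64 * (1 / (4 * tau)) by rewrite mulr_ge0// divr_ge0// mulr_ge0// ltW.
have second0 : (0 <= 64%:E * (tau%:E * B w))%E.
  apply: mule_ge0; first by rewrite lee_fin.
  by apply: mule_ge0; [rewrite lee_fin ltW|exact: B0].
have third0 : (0 <= (64 * (1 / (4 * tau)) / t)%:E * Xe w)%E.
  by rewrite mule_ge0// lee_fin divr_ge0// ltW.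
have [good|] := pselect (forall j, (chain (component (e w) j) <= t%:E)%E).
  apply: (le_trans (lemeas _ mh (fun c hc => hit_good hc good))).
  by apply: lee_wpmul2l => //; rewrite leeDl// adde_ge0.
(* Some error chain exceeds [t], so [Xe / t >= 1]. Multiplying the constant term of [leb6_box] by
   this ratio, as in Markov's inequality, gives it a small mean when the error is small. *)
move=> /existsNP[j /negP]; rewrite -ltNge => tj.
apply: (le_trans (lemeas _ (measurable_box _ _) (fun c hc => hit_bad hc))).
apply: lee_wpmul2l => //; apply: (le_trans (leb6_box _ tau0 (B0 w))).
apply: (@le_trans _ _ (64%:E * (tau%:E * B w) + (64 * (1 / (4 * tau)) / t)%:E * Xe w)%E); last first.
  by rewrite leeDr// measure_ge0.
rewrite ge0_muleDr; [|by apply: mule_ge0; [rewrite lee_fin ltW|exact: B0]|by rewrite lee_fin divr_ge0// mulr_ge0// ltW].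
apply: leeD => //; set r := 64 * (1 / (4 * tau)).
have -> : ((r / t)%:E * Xe w = r%:E * (t^-1%:E * Xe w))%E by rewrite muleA -EFinM.
rewrite -[(_ * (1 / _)%:E)%E]/(r%:E) -[leLHS]mule1; apply: lee_wpmul2l; first by rewrite lee_fin.
have tn : (t%:E * t^-1%:E = 1)%E by rewrite -EFinM mulfV ?gt_eqF.
rewrite -tn muleC; apply: lee_wpmul2l; first by rewrite lee_fin invr_ge0 ltW.
apply: (le_trans (ltW tj)); rewrite /Xe (bigD1 j)//= leeDl// sume_ge0// => i _; exact: chain_ge0.
Qed.

Lemma local_bound : (\int[P]_w leb6 (hit_set w) <=
  ((smax / gmin) ^+ 6)%:E * (vol P (hit eps) u +
   (64 * (tau * (cw R ^+ 3 * (6 * A_u + 6 * A_e + 2))) +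
    64 * (1 / (4 * tau)) / (eps / 4) ^+ 12 * (6 * A_e))%:E))%E.
Proof.
have mchu j : measurable_fun setT (fun w => chain (component (u w) j)).
  by apply: measurable_chain => q; exact: mu.
have mche j : measurable_fun setT (fun w => chain (component (e w) j)).
  by apply: measurable_chain => q; exact: me.
have mXu : measurable_fun setT Xu by apply: emeasurable_sum => j; exact: mchu.
have mXe : measurable_fun setT Xe by apply: emeasurable_sum => j; exact: mche.
have mB : measurable_fun setT B.
  apply: measurable_funeM; apply: emeasurable_funD; last exact: measurable_cst.
  exact: emeasurable_funD.
have mh : measurable_fun setT (fun w => leb6 [set z | hit eps (u w, z)]).
  exact: (measurable_slice1 leb6 (measurable_graph (@measurable_hit R eps) mu)).
have iX (x : T -> K -> R) A : (forall j, measurable_fun setT (fun w => chain (component (x w) j))) ->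
    (forall j, (\int[P]_w chain (component (x w) j) <= A%:E)%E) ->
    (\int[P]_w (\big[+%E/0%E]_j chain (component (x w) j)) <= (6 * A)%:E)%E.
  move=> mx hx; rewrite ge0_integral_sum//; last by move=> j w _; exact: chain_ge0.
  apply: (@le_trans _ _ (\sum_(j < 6) A%:E)%E); first exact: lee_sum.
  by rewrite sumEFin sumr_const card_ord mulr_natl.
have iu := iX u A_u mchu chain_u; have ie := iX e A_e mche chain_e.
have r0 : 0 <= 64 * (1 / (4 * tau)) / t by rewrite divr_ge0 ?(ltW t0)// mulr_ge0// divr_ge0// mulr_ge0// ltW.
rewrite (vol_fubini P (@measurable_hit R eps) mu).
apply: (@integral_linear_bound _ _ _ P _ _ Xu Xe).
- exact: measurable_vol_hit_set.
- exact: mh.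
- exact: mXu.
- exact: mXe.
- by move=> w; exact: measure_ge0.
- by move=> w; exact: measure_ge0.
- exact: Xu0.
- exact: Xe0.
- by rewrite exprn_ge0// divr_ge0 ?(ltW gmin0)// (le_trans (ltW (s0 ord0))).
- exact: ler0n.
- exact: ltW.
- by rewrite exprn_ge0// ltW.
- exact: r0.
- exact: pointwise.
- exact: iu.
- exact: ie.
Qed.

End local_bound.

(** * Continuous functions on the plane *)

Section continuous_plane.
Context (R : realType).

Lemma continuous_plane_ball (f : R * R -> R) x w : {for x, continuous f} -> 0 < w ->
  exists2 e : R, 0 < e & forall z : R * R, `|z.1 - x.1| < e -> `|z.2 - x.2| < e -> `|f z - f x| < w.
Proof.
move=> cf w0; have /cvgrPdist_lt/(_ _ w0)[[A B] /= [/nbhs_ballP[e /= e0 he] /nbhs_ballP[e' /= e0' he']] h] := cf.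
exists (Num.min e e'); first by rewrite lt_min e0.
move=> z; rewrite !lt_min => /andP[h1 _] /andP[_ h2]; rewrite distrC; apply: (h z); split.
  by apply: he; rewrite /ball/= distrC.
by apply: he'; rewrite /ball/= distrC.
Qed.

(** The plane carries the product sigma-algebra, so an open set is written as a countable union of
    boxes with rational centres and sizes. *)
Lemma measurable_continuous_plane (f : R * R -> R) : continuous f ->
  measurable_fun setT (f : plane R -> R).
Proof.
move=> cf; apply: (measurability _ (RGenOInfty.measurableE R)) => /= _ [_ [a ->]] <-.
rewrite setTI preimage_itvoy.
pose box (p q e : rat) : set (plane R) := [set z | `|z.1 - ratr p| < ratr e /\ `|z.2 - ratr q| < ratr e].
have mbox p q e : measurable (box p q e).
  rewrite (_ : box p q e = [set x | `|x - ratr p| < ratr e] `*` [set x | `|x - ratr q| < ratr e])%classic.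
    have mb (r : R) : measurable ([set x | `|x - r| < ratr e] : set (measurableTypeR R)).
      rewrite (_ : mkset _ = ball r (ratr e)); first exact: measurable_ball.
      by apply/seteqP; split => x; rewrite /ball/= distrC.
    exact: measurableX.
  by apply/seteqP; split.
rewrite (_ : mkset _ = \bigcup_(p : rat) \bigcup_(q : rat) \bigcup_(e : rat)
   (if `[< box p q e `<=` [set z | a < f z] >] then box p q e else set0)).
  do 3 (apply: bigcupT_measurable_rat => ?).
  by case: ifP => _; [exact: mbox|exact: measurable0].
apply/seteqP; split => z /=; last first.
  by move=> [p _ [q _ [e _]]]; case: ifPn => // /asboolP h hz; exact: h.
rewrite -subr_gt0 => az; have [e e0 he] := continuous_plane_ball (cf z) az.
have e4 : 0 < e / 4 by rewrite divr_gt0.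
have hr (x : R) : exists p : rat, `|x - ratr p| < e / 4.
  have [p] := @rat_in_itvoo R (x - e / 4) (x + e / 4) ltac:(lra).
  by rewrite in_itv/= => hp; exists p; rewrite ltr_norml; lra.
have [p hp] := hr z.1; have [q hq] := hr z.2.
have [k] := @rat_in_itvoo R (e / 4) (e / 2) ltac:(lra); rewrite in_itv/= => /andP[k1 k2].
exists p => //; exists q => //; exists k => //.
case: ifPn => [_|/negP]; first by split; apply: lt_trans k1.
case; apply/asboolP => y [y1 y2] /=.
have h (x x' x'' : R) : `|x' - x''| < ratr k -> `|x - x''| < e / 4 -> `|x' - x| < e.
  move=> h1 h2; have := ler_distD x'' x' x; rewrite [`|x'' - x|]distrC => h3; lra.
have := he y (h _ _ _ y1 hp) (h _ _ _ y2 hq); rewrite ltr_norml; lra.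
Qed.

(** Only [p] is confined to the compact box and [z] may leave it, whence the covering argument over
    [p] in place of uniform continuity on a compact set. *)
Lemma uniform_modulus (f : R * R -> R) (a b : R) (omega : R) : continuous f -> 0 < omega ->
  exists2 delta : R, 0 < delta & forall p z : R * R, a <= p.1 <= a + 1 -> b <= p.2 <= b + 1 ->
    `|z.1 - p.1| <= delta -> `|z.2 - p.2| <= delta -> `|f z - f p| <= omega.
Proof.
move=> cf o0.
have cK := compact_setX (@segment_compact R a (a + 1)) (@segment_compact R b (b + 1)).
move/compact_near_coveringP : cK => cK.
pose Q (delta : R) (p : R * R) := forall z : R * R, `|z.1 - p.1| <= delta -> `|z.2 - p.2| <= delta ->
   `|f z - f p| <= omega.
have /cK : forall x, (`[a, a + 1] `*` `[b, b + 1])%classic x ->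
    \forall x' \near x & i \near (0 : R)^'+, Q i x'.
  move=> x _; have o2 : 0 < omega / 2 by rewrite divr_gt0.
  have [e e0 he] := continuous_plane_ball (cf x) o2.
  exists (ball x (e / 2), [set i | i < e / 2]).
    split => /=; first by apply: nbhsx_ballx; rewrite divr_gt0.
    by apply: nbhs_right_lt; rewrite divr_gt0.
  case=> p i /= [[p1 p2] ie] z z1 z2.
  move: p1 p2; rewrite /ball/= => p1 p2.
  have h1 : `|f p - f x| < omega / 2.
    by apply: he; rewrite distrC; [apply: (lt_le_trans p1)|apply: (lt_le_trans p2)]; lra.
  have h2 : `|f z - f x| < omega / 2.
    apply: he.
      have := ler_distD p.1 z.1 x.1; rewrite [`|p.1 - x.1|]distrC; lra.
    have := ler_distD p.2 z.2 x.2; rewrite [`|p.2 - x.2|]distrC; lra.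
  have := ler_distD (f x) (f z) (f p); rewrite [`|f x - f p|]distrC; lra.
move=> H; near (0 : R)^'+ => delta; exists delta; first by near: delta; exact: nbhs_right_gt.
have hd : (`[a, a + 1] `*` `[b, b + 1])%classic `<=` Q delta by near: delta; exact: H.
by move=> p z p1 p2; apply: hd; split; rewrite /= in_itv.
Unshelve. all: by end_near. Qed.

End continuous_plane.

(** * Localisation of increments and freezing of the coefficient *)

Section tails.
Context (R : realType).
Local Notation mu := (@leb2 R).

Definition far (L : R) (p : R * R) (f : plane R -> R) : plane R -> R :=
  fun z => if (L < `|z.1 - p.1|) || (L < `|z.2 - p.2|) then f z else 0.

Lemma far_le L p f z : `|far L p f z| <= `|f z|.
Proof. by rewrite /far; case: ifP => // _; rewrite normr0. Qed.

Lemma measurable_far L p f : measurable_fun setT f -> measurable_fun setT (far L p f).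
Proof.
move=> mf; apply: measurable_fun_ifT => //.
apply: measurable_or; apply: measurable_fun_ltr => //; apply: measurableT_comp => //;
  exact: measurable_funB.
Qed.

Lemma L2_far L p f : L2 mu f -> L2 mu (far L p f).
Proof. by move=> Lf; apply: (L2_le Lf); [exact: measurable_far Lf.1|exact: far_le]. Qed.

Lemma ip_far_cvg f : L2 mu f ->
  (fun n => ip mu (far n%:R (0, 0) f) (far n%:R (0, 0) f)) @ \oo --> (0 : R).
Proof.
move=> Lf; pose F n z := ((far n%:R (0, 0) f z) ^+ 2)%:E.
have mF n : measurable_fun setT (F n).
  by apply/measurable_EFinP; apply: measurable_funX; exact: measurable_far Lf.1.
have cF : {ae mu, forall z, setT z -> F ^~ z @ \oo --> (0%:E : \bar R)}.
  apply: aeW => z _; apply: cvg_near_cst; near=> n.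
  have h : `|z.1| + `|z.2| <= n%:R by near: n; exact: nbhs_infty_ger.
  rewrite /F /far !subr0 ifF ?expr0n//; apply/negbTE.
  by rewrite negb_or -!leNgt; apply/andP; split; apply: le_trans h; rewrite ?lerDl ?lerDr.
have bF : {ae mu, forall z n, setT z -> (`|F n z| <= (EFin \o (fun z => f z ^+ 2)%R) z)%E}.
  apply: aeW => z n _; rewrite /F /= lee_fin ger0_norm ?sqr_ge0//.
  by rewrite -[leRHS]real_normK ?num_real// -[leLHS]real_normK ?num_real// lerXn2r ?nnegrE// far_le.
have [_ _] := @dominated_convergence _ _ _ mu setT measurableT F (fun=> 0%:E) _ mF (measurable_cst _) cF Lf.2 bF.
rewrite integral0 => /fine_cvg h.
apply: cvg_trans h; apply: near_eq_cvg; apply: nearW => n.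
by rewrite /= /F (L2_ereal (L2_far _ _ Lf)).
Unshelve. all: by end_near. Qed.

(** The far mass of the 64 normalised increments; after zooming it controls the far part of every
    increment from parent to child. *)
Definition tail_mass (L : R) : R :=
  \sum_(a < 16) \sum_(b < 4) ip mu (far L (0, 0) (kern0 (a%:R, b%:R))) (far L (0, 0) (kern0 (a%:R, b%:R))).

Lemma tail_mass_ge0 L : 0 <= tail_mass L.
Proof. by do 2 (apply: sumr_ge0 => ? _); exact: ip_ge0. Qed.

Lemma tail_mass_small (theta : R) : 0 < theta -> exists2 L : R, 0 < L & tail_mass L <= theta.
Proof.
move=> t0.
have : (fun n => tail_mass n%:R) @ \oo --> (0 : R).
  rewrite (_ : 0 = \sum_(a < 16) \sum_(b < 4) 0 :> R); last by rewrite !big1.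
  by apply: cvg_big => [x|a _]; [exact: add_continuous|apply: cvg_big => [x|b _]; [exact: add_continuous|exact: ip_far_cvg (L2_kern0 _)]].
move=> /cvgrPdist_le/(_ _ t0)[N _ /(_ N.+1 (leqnSn N))].
rewrite sub0r normrN (ger0_norm (tail_mass_ge0 _)) => h.
by exists N.+1%:R.
Qed.

End tails.

Section perturbation.
Context (R : realType).
Local Notation mu := (@leb2 R).

Definition in_box (B p : R * R) := (B.1 <= p.1 <= B.1 + 1) && (B.2 <= p.2 <= B.2 + 1).

Definition edge (r : R) (p : R * R) (q : grid) : plane R -> R :=
  fun z => kern (zoom r p (grid_pos R q)) z - kern (zoom r p (grid_pos R (parent q))) z.

Lemma L2_edge r p q : L2 mu (edge r p q). Proof. exact: L2_kern. Qed.

Lemma ip_edge r p q : 0 < r -> in_grid q ->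
  ip mu (edge r p q) (edge r p q) <= r ^+ 2 / 4 ^+ q.1 * string_var R.
Proof. by move=> r0 hq; apply: (le_trans (ip_kern_parent _ r0 hq)); rewrite mulrA mulrAC. Qed.

(** The parent lies within [r^2 <= delta / 2] of [p], and at scale [rho <= r] a normalised distance
    [L] is at most [L * r^2 <= delta / 2]. Points farther than [delta] from [p] are therefore, after
    zooming, farther than [L] from the origin. *)
Lemma ip_far_edge (delta r L : R) p q : 0 < r <= 1 -> in_grid q -> r ^+ 2 <= delta / 2 ->
  L * r ^+ 2 <= delta / 2 -> 0 <= L ->
  ip mu (far delta p (edge r p q)) (far delta p (edge r p q)) <= r ^+ 2 / 4 ^+ q.1 * tail_mass L.
Proof.
move=> /andP[r0 r1] hq rd Ld L0; have [a [b [a16 b4 E]]] := grid_pos_parent R hq.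
have [/andP[s0 s1] /andP[t0 t1]] := @grid_pos_bound R _ (in_grid_parent hq).
pose rho := r * 2^-1 ^+ q.1; have h2 : (0 : R) < 2^-1 ^+ q.1 by rewrite exprn_gt0 ?invr_gt0.
have rho0 : 0 < rho by rewrite mulr_gt0.
have rhor : rho <= r by rewrite ler_piMr ?(ltW r0)// exprn_ile1// ?invr_ge0// invf_le1// ler1n.
pose p' := zoom r p (grid_pos R (parent q)).
have Ep' : p' = zoom rho p' (0, 0) by rewrite /zoom !mulr0 !addr0; case: p'.
have Ee : edge r p q = fun z => kern (zoom rho p' (a%:R, b%:R)) z - kern (zoom rho p' (0, 0)) z.
  by rewrite /edge -Ep' E zoom_zoom.
have r4n : rho ^+ 4 != 0 by rewrite expf_neq0// gt_eqF.
have r2n : rho ^+ 2 != 0 by rewrite expf_neq0// gt_eqF.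
have D := dilation_plane p'.1 p'.2 r4n r2n.
have c0 : 0 < `|rho ^+ 4| * `|rho ^+ 2| by rewrite mulr_gt0// normr_gt0.
have Lf : L2 mu (far delta p (edge r p q)) by exact/L2_far/L2_edge.
rewrite (ip_dilation D c0 Lf Lf).
have K0 := L2_kern0 ((a%:R : R), (b%:R : R)).
have Lt := L2_far L (0, 0) K0.
have Lg := L2Z (rho ^- 2) Lt.
have r4 : 0 < rho ^+ 4 by exact: exprn_gt0.
have r2 : 0 < rho ^+ 2 by exact: exprn_gt0.
have rr2 : 0 < r ^+ 2 by exact: exprn_gt0.
have rho2 : rho ^+ 2 <= r ^+ 2 by rewrite lerXn2r ?nnegrE// ltW.
have rho4 : rho ^+ 4 <= r ^+ 2.
  rewrite (_ : rho ^+ 4 = rho ^+ 2 * rho ^+ 2); last by ring.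
  apply: le_trans rho2; rewrite ler_piMr ?(ltW r2)// exprn_ile1 ?(ltW rho0)//; exact: le_trans r1.
have pp1 : `|p'.1 - p.1| <= r ^+ 2.
  rewrite /p' /zoom /fst addrAC subrr add0r ger0_norm; last by rewrite mulr_ge0// exprn_ge0// ltW.
  rewrite (_ : r ^+ 4 = r ^+ 2 * r ^+ 2); last by ring.
  rewrite -mulrA ler_piMr ?(ltW rr2)//; apply: mulr_ile1 => //; first exact: ltW.
  by rewrite exprn_ile1// ltW.
have pp2 : `|p'.2 - p.2| <= r ^+ 2.
  rewrite /p' /zoom /snd addrAC subrr add0r ger0_norm; last by rewrite mulr_ge0// ltW.
  by rewrite ler_piMr// ltW.
apply: (@le_trans _ _ (`|rho ^+ 4| * `|rho ^+ 2| * ip mu (fun z => rho ^- 2 * far L (0, 0) (kern0 (a%:R, b%:R)) z)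
  (fun z => rho ^- 2 * far L (0, 0) (kern0 (a%:R, b%:R)) z))).
  rewrite ler_wpM2l ?(ltW c0)//; apply: ip_le => //; first exact: (L2_dilation D c0 Lf).1.
  move=> z /=; rewrite {1}/far; case: ifPn => [h|_]; last by rewrite normr0.
  rewrite /far ifT.
    by rewrite Ee !kern_dilate// -mulrBr.
  rewrite !subr0; case/orP: h => /= h; apply/orP; [left|right].
    have h1 : delta / 2 < `|rho ^+ 4 * z.1|.
      have := ler_normD (rho ^+ 4 * z.1) (p'.1 - p.1); rewrite addrA; lra.
    move: h1; rewrite normrM (gtr0_norm r4) => h1.
    rewrite -(ltr_pM2l r4); apply: le_lt_trans h1; apply: le_trans Ld.
    by rewrite mulrC ler_wpM2l.
  have h1 : delta / 2 < `|rho ^+ 2 * z.2|.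
    have := ler_normD (rho ^+ 2 * z.2) (p'.2 - p.2); rewrite addrA; lra.
  move: h1; rewrite normrM (gtr0_norm r2) => h1.
  rewrite -(ltr_pM2l r2); apply: le_lt_trans h1; apply: le_trans Ld.
  by rewrite mulrC ler_wpM2l.
rewrite ipZl// ipZr// (gtr0_norm r4) (gtr0_norm r2).
have -> : forall x : R, rho ^+ 4 * rho ^+ 2 * (rho ^- 2 * (rho ^- 2 * x)) = rho ^+ 2 * x.
  by move=> x; field; rewrite gt_eqF.
have -> : rho ^+ 2 = r ^+ 2 / 4 ^+ q.1 by rewrite exprMn -exprM mulnC exprM half2 exprVn.
rewrite ler_wpM2l ?divr_ge0 ?exprn_ge0 ?(ltW r0)//.
rewrite /tail_mass (bigD1 (Ordinal a16))//= (bigD1 (Ordinal b4))//= -addrA lerDl addr_ge0//.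
  by apply: sumr_ge0 => *; exact: ip_ge0.
by do 2 (apply: sumr_ge0 => ? _); exact: ip_ge0.
Qed.

Lemma ip_le_add (f g h : plane R -> R) : L2 mu g -> L2 mu h -> measurable_fun setT f ->
  (forall z, `|f z| <= `|g z| \/ `|f z| <= `|h z|) -> ip mu f f <= ip mu g g + ip mu h h.
Proof.
move=> Lg Lh mf fgh.
have sq (x y : R) : `|x| <= `|y| -> x * x <= y * y.
  by move=> xy; rewrite -!expr2 -[_ ^+ 2]real_normK ?num_real// -[leRHS]real_normK ?num_real// lerXn2r ?nnegrE.
have fle z : f z * f z <= g z * g z + h z * h z.
  case: (fgh z) => /sq fz; apply: (le_trans fz); rewrite ?lerDl ?lerDr -expr2 sqr_ge0//.
have igg := integrable_prod Lg Lg; have ihh := integrable_prod Lh Lh.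
rewrite /ip -RintegralD//; apply: le_Rintegral => //; last first.
  by have := integrableD measurableT igg ihh; apply: eq_integrable => // z _.
have := integrableD measurableT igg ihh; apply: le_integrable => //.
  by apply/measurable_EFinP; exact: measurable_funM.
move=> z _; rewrite /= lee_fin [`|f z * _|]ger0_norm -?expr2 ?sqr_ge0//.
by rewrite ger0_norm ?addr_ge0 ?sqr_ge0//; exact: fle.
Qed.

Definition forward (sigma : R * R -> R) : R * R -> R := fun z => if 0 <= z.1 then sigma z else 0.

Lemma measurable_forward sigma : continuous sigma -> measurable_fun setT (forward sigma : plane R -> R).
Proof.
move=> cs; rewrite (_ : forward sigma = fun z => if z.1 < 0 then 0 else sigma z).
  by apply: measurable_before; [exact: measurable_cst|exact: measurable_continuous_plane].
by apply/funext => z; rewrite /forward; case: ltP.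
Qed.

(* At the scale [r] around [p], replacing [sigma] by its value at [p] costs at
   most a fraction [theta] of the variance of an increment, and the noise of the
   first half of the time before the box contributes no more than that. *)
Definition frozen (sigma : R * R -> R) (B : R * R) (theta r : R) (p : R * R) := forall q, in_grid q ->
  ip mu (fun z => edge r p q z * (forward sigma z - sigma p))
        (fun z => edge r p q z * (forward sigma z - sigma p)) <= r ^+ 2 / 4 ^+ q.1 * theta /\
  ip mu (fun z => if z.1 <= B.1 / 2 then edge r p q z else 0)
        (fun z => if z.1 <= B.1 / 2 then edge r p q z else 0) <= r ^+ 2 / 4 ^+ q.1 * theta.

(** Within [delta] of [p] the coefficient differs from [sigma p] by at most [omega]; farther away
    the difference is at most [C], and the increment has small mass there. Times up to [B.1 / 2] are
    farther than [delta] from the box, so that the second bound also concerns far mass. *)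
Lemma perturbation_small (sigma : R * R -> R) (B : R * R) (C theta : R) :
  continuous sigma -> 0 < B.1 -> 0 < theta ->
  (forall z, 0 <= z.1 <= B.1 + 1 -> 0 <= sigma z <= C) ->
  exists2 r0 : R, 0 < r0 & forall r p, 0 < r <= r0 -> in_box B p -> p.1 + r ^+ 4 <= B.1 + 1 ->
    frozen sigma B theta r p.
Proof.
move=> cs B0 t0 sC.
have C0 : 0 <= C.
  have := sC (0, 0); rewrite /= lexx (addr_ge0 (ltW B0) ler01) => /(_ isT)/andP[h1 h2].
  exact: le_trans h2.
pose omega := Num.min 1 (theta / (2 * (string_var R + 1))).
have v1 : 0 < string_var R + 1 by rewrite ltr_wpDl ?string_var_ge0.
have o0 : 0 < omega by rewrite lt_min ltr01 divr_gt0// mulr_gt0.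
have osv : omega ^+ 2 * string_var R <= theta / 2.
  apply: (@le_trans _ _ (omega * string_var R)).
    by rewrite ler_wpM2r ?string_var_ge0// expr2 ler_piMr ?(ltW o0)// ge_min lexx.
  have : omega <= theta / (2 * (string_var R + 1)) by rewrite ge_min lexx orbT.
  rewrite ler_pdivlMr ?mulr_gt0// => h; rewrite ler_pdivlMr//; apply: le_trans h.
  have := string_var_ge0 R; nra.
have [delta1 d10 hd1] := uniform_modulus B.1 B.2 cs o0.
pose delta := Num.min delta1 (B.1 / 4).
have d0 : 0 < delta by rewrite lt_min d10 divr_gt0.
have dd1 : delta <= delta1 by rewrite ge_min lexx.
have dB : delta <= B.1 / 4 by rewrite ge_min lexx orbT.
have C1 : 0 < 2 * (C ^+ 2 + 1) by rewrite mulr_gt0// ltr_wpDl// sqr_ge0.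
have [L L0 hL] := tail_mass_small (divr_gt0 t0 C1).
have T0 := tail_mass_ge0 L.
have tL : C ^+ 2 * tail_mass L <= theta / 2 /\ tail_mass L <= theta.
  move: hL; rewrite ler_pdivlMr// => hL; rewrite ler_pdivlMr//; have := sqr_ge0 C; split; nra.
pose r0 := Num.min 1 (Num.min (delta / 2) (delta / (2 * L))).
exists r0; first by rewrite !lt_min ltr01 !divr_gt0// mulr_gt0.
move=> r p /andP[r_0]; rewrite !le_min => /andP[r1 /andP[rd rL]] Bp pT q hq.
have rr : r ^+ 2 <= r by rewrite expr2 ler_piMr// ltW.
have F := @ip_far_edge delta r L p q _ hq (le_trans rr rd) _ (ltW L0).
have {}F : ip mu (far delta p (edge r p q)) (far delta p (edge r p q)) <= r ^+ 2 / 4 ^+ q.1 * tail_mass L.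
  apply: F; first by rewrite r_0.
  move: rL; rewrite ler_pdivlMr ?mulr_gt0// => rL; rewrite ler_pdivlMr//.
  by apply: le_trans rL; rewrite [L * _]mulrC -mulrA [L * 2]mulrC ler_wpM2r// ltW// mulr_gt0.
have c0 : 0 <= r ^+ 2 / 4 ^+ q.1 by rewrite divr_ge0 ?exprn_ge0 ?ltW.
have Le := L2_edge r p q; have Lfe := L2_far delta p Le.
have /andP[/andP[p1 p1'] /andP[p2 p2']] := Bp.
have edge0 z : B.1 + 1 < z.1 -> edge r p q z = 0.
  have [/andP[s0 s1] _] := @grid_pos_bound R _ hq.
  have [/andP[s0' s1'] _] := @grid_pos_bound R _ (in_grid_parent hq).
  have r4 : 0 <= r ^+ 4 by rewrite exprn_ge0 ?ltW.
  move=> hz; rewrite /edge !kern_le0 ?subrr//; apply: le_trans (ltW hz); apply: le_trans pT;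
    by rewrite /zoom/= lerD2l ler_piMr.
split.
  apply: (@le_trans _ _ (ip mu (fun z => omega * edge r p q z) (fun z => omega * edge r p q z) +
     ip mu (fun z => C * far delta p (edge r p q) z) (fun z => C * far delta p (edge r p q) z))).
    apply: ip_le_add; [exact: L2Z|exact: L2Z| |].
      apply: measurable_funM; first exact: Le.1.
      by apply: measurable_funB; [exact: measurable_forward|exact: measurable_cst].
    move=> z; have [z1|z1] := ltP (B.1 + 1) z.1.
      by rewrite edge0// mul0r normr0; left.
    have sp : 0 <= sigma p <= C by apply: sC; rewrite p1' (le_trans (ltW B0)).
    have fz : 0 <= forward sigma z <= C.
      by rewrite /forward; case: ifP => h; [apply: sC; rewrite h|rewrite lexx].
    have [h|h0] := boolP ((delta < `|z.1 - p.1|) || (delta < `|z.2 - p.2|)); [right|left].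
      rewrite /far h !normrM mulrC ler_wpM2r// (ger0_norm C0) ler_norml; lra.
    move: h0; rewrite negb_or -!leNgt => /andP[h1 h2].
    rewrite !normrM mulrC ler_wpM2r// (gtr0_norm o0) /forward ifT.
      apply: hd1; [by rewrite p1|by rewrite p2|exact: le_trans dd1|exact: le_trans dd1].
    move: h1; rewrite ler_norml; lra.
  rewrite !ipZl ?ipZr//; [|exact: L2Z..].
  have := ip_edge p r_0 hq; move: F osv tL.
  set x := ip mu (edge r p q) _; set y := ip mu (far _ _ _) _; set k := r ^+ 2 / _ in c0 *.
  move=> F osv [tL _] xk.
  apply: (@le_trans _ _ (omega ^+ 2 * (k * string_var R) + C ^+ 2 * (k * tail_mass L))).
    by rewrite [omega * _]mulrA [C * _]mulrA -!expr2; apply: lerD; rewrite ler_wpM2l ?sqr_ge0.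
  nra.
apply: (@le_trans _ _ (ip mu (far delta p (edge r p q)) (far delta p (edge r p q)))).
  apply: ip_le => //.
    by apply: measurable_fun_ifT; [apply: measurable_fun_ler => //; exact: measurable_fst|exact: Le.1|exact: measurable_cst].
  move=> z; case: ifP => hz; last by rewrite normr0.
  rewrite /far ifT//; apply/orP; left; rewrite distrC ger0_norm; lra.
by apply: (le_trans F); rewrite ler_wpM2l//; exact: tL.2.
Qed.

End perturbation.

(** * The solution in a box *)

Section mild.
Context (R : realType).
Local Notation mu := (@leb2 R).
Local Notation G := (@heat_kernel R).

Lemma mildE (sigma : R * R -> R) (p : R * R) :
  mild_integrand sigma p.1 p.2 = fun z => kern p z * forward sigma z.
Proof.
apply/funext => z; rewrite /mild_integrand /forward; have [z0|_] /= := leP 0 z.1; last by rewrite mulr0.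
by case: leP => // h; rewrite kern_le0 ?mul0r// ltW.
Qed.

Lemma forward_lt0 (sigma : R * R -> R) (z : R * R) : z.1 < 0 -> forward sigma z = 0.
Proof. by rewrite /forward leNgt => ->. Qed.

Lemma kern_norm (p z : R * R) : `|kern p z| = kern p z.
Proof. by rewrite ger0_norm// kern_ge0. Qed.

Variables (sigma : R * R -> R) (T c C : R).
Hypotheses (cs : continuous sigma) (c0 : 0 < c) (T0 : 0 <= T)
  (sC : forall z, 0 <= z.1 <= T -> c <= sigma z <= C).

Let C0 : 0 < C.
Proof. by have /andP[h1 h2] := sC (z := (0, 0)) (introT andP (conj (lexx _) T0)); apply: lt_le_trans h2; exact: lt_le_trans h1. Qed.

Lemma kern_forward_le (p z : R * R) : p.1 <= T -> kern p z * `|forward sigma z| <= C * kern p z.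
Proof.
move=> pT; have [h|h] := leP p.1 z.1; first by rewrite kern_le0// mul0r mulr0.
rewrite mulrC ler_wpM2r ?kern_ge0// /forward; case: ifP => z0; last by rewrite normr0 ltW.
have /andP[h1 h2] := sC (z := z) (introT andP (conj z0 (ltW (lt_le_trans h pT)))).
by rewrite ger0_norm// (le_trans (ltW c0)).
Qed.

Lemma past_L2_mild (p : R * R) : p.1 <= T -> past_L2 T (mild_integrand sigma p.1 p.2).
Proof.
move=> pT; rewrite mildE; split; last by move=> z Tz; rewrite kern_le0 ?mul0r// (le_trans pT)// ltW.
apply: (L2_le (L2Z C (L2_kern p (0, p.2)))).
  by apply: measurable_funM; [exact: measurable_kern|exact: measurable_forward].
move=> z; have [z0|z0] := leP 0 z.1; last first.
  by rewrite (forward_lt0 _ z0) mulr0 normr0.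
rewrite [kern (0, p.2) z]kern_le0// subr0 [leLHS]normrM [leRHS]normrM (gtr0_norm C0).
have := kern_forward_le z pT; rewrite -{1 2}(kern_norm p z); exact.
Qed.

(** The integrand vanishes outside the times from 0 to [T], so that [wn] gives back the noise at the
    unfolded integrand of [continuous_mild_solution]. *)
Lemma fold_mild (p : R * R) : p.1 <= T ->
  fold_time T (mild_integrand sigma p.1 p.2) = mild_integrand sigma p.1 p.2.
Proof.
move=> pT; apply/funext => z; rewrite /fold_time; case: leP => // h.
rewrite mildE /forward /= leNgt subr_lt0 h /= mulr0 kern_le0 ?mul0r//.
by rewrite (le_trans pT)// ltW.
Qed.

End mild.

(** * The early test function and its correlation with the solution *)

Section plateau.
Context (R : realType).
Local Notation mu := (@leb2 R).
Local Notation leb := (@lebesgue_measure R).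
Variable t0 : R.
Hypothesis t0_gt0 : 0 < t0.

Let rect : set (plane R) := `[0, t0 / 2]%classic `*` `[0, 1]%classic.

Let mrect : measurable rect.
Proof. by apply: measurableX; exact: measurable_itv. Qed.

Let mu_rect : mu rect = (t0 / 2)%:E.
Proof.
apply: (etrans (prodmX (m1 := leb) (m2 := leb) (a := t0 / 2) (b := 1) _ _ _ _)); last by rewrite mulr1.
- exact: measurable_itv.
- exact: measurable_itv.
- by apply: (etrans (lebesgue_measure_itv `[0, t0 / 2])); rewrite /= lte_fin divr_gt0// oppr0 adde0.
- by apply: (etrans (lebesgue_measure_itv `[0, 1])); rewrite /= lte_fin ltr01 oppr0 adde0.
Qed.

Let L2_rect : L2 mu (\1_rect : plane R -> R).
Proof.
split; first exact: measurable_indic.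
rewrite (_ : _ \o _ = EFin \o \1_rect).
  apply/integrableP; split; first by apply/measurable_EFinP; exact: measurable_indic.
  rewrite (eq_integral (EFin \o \1_rect)) => [|z _]; last by rewrite /= ger0_norm.
  by rewrite integral_indic// setIT mu_rect ltry.
by apply/funext => z /=; rewrite indicE; case: (_ \in _); rewrite ?expr1n ?expr0n.
Qed.

(** The rectangle has area [t0 / 2], so this height gives the plateau the squared norm [kappa], and
    the noise tested against it is standard normal. *)
Definition plateau_height : R := Num.sqrt (2 * gauss_moment R 2 / t0).

Definition plateau : plane R -> R := fun z => plateau_height * \1_rect z.

Lemma plateau_height_gt0 : 0 < plateau_height.
Proof. by rewrite sqrtr_gt0 divr_gt0// mulr_gt0// gauss_moment2_gt0. Qed.

Lemma measurable_plateau : measurable_fun setT plateau.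
Proof. by apply: measurable_funM; [exact: measurable_cst|exact: measurable_indic]. Qed.

Lemma plateauE z : plateau z = if [&& 0 <= z.1, z.1 <= t0 / 2, 0 <= z.2 & z.2 <= 1] then plateau_height else 0.
Proof.
rewrite /plateau indicE; have -> : (z \in rect) = [&& 0 <= z.1, z.1 <= t0 / 2, 0 <= z.2 & z.2 <= 1].
  apply/idP/idP; first by rewrite inE /rect /= !in_itv/= => -[/andP[-> ->] /andP[-> ->]].
  by case/and4P => h1 h2 h3 h4; rewrite inE /rect; split; rewrite /= in_itv/= ?h1 ?h2 ?h3 ?h4.
by case: ifP => _; rewrite ?mulr1 ?mulr0.
Qed.

Lemma L2_plateau : L2 mu plateau. Proof. exact: (L2Z plateau_height L2_rect). Qed.

Lemma ip_plateau : ip mu plateau plateau = gauss_moment R 2.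
Proof.
rewrite /plateau (ipZl plateau_height L2_rect L2_plateau) (ipZr plateau_height L2_rect L2_rect) mulrA -expr2.
have -> : ip mu \1_rect \1_rect = t0 / 2.
  rewrite -[LHS]/(fine (ip mu \1_rect \1_rect)%:E) -(L2_ereal L2_rect).
  rewrite (eq_integral (EFin \o \1_rect)) => [|z _]; last first.
    by rewrite /= indicE; case: (_ \in _); rewrite ?expr1n ?expr0n.
  by rewrite integral_indic// setIT mu_rect.
rewrite sqr_sqrtr; last by rewrite divr_ge0 ?mulr_ge0 ?(ltW (gauss_moment2_gt0 R))// ltW.
by field; rewrite gt_eqF.
Qed.

Lemma past_L2_plateau T : t0 <= T -> past_L2 T plateau.
Proof.
move=> tT; split; first exact: L2_plateau.
move=> z Tz; rewrite plateauE ifF//; apply/negbTE; rewrite !negb_and -!ltNge.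
apply/orP; right; apply/orP; left; move: t0_gt0; lra.
Qed.

End plateau.

Section loading.
Context (R : realType).
Local Notation mu := (@leb2 R).
Local Notation G := (@heat_kernel R).
Variables (sigma : R * R -> R) (B : R * R) (c C : R).
Hypotheses (cs : continuous sigma) (B0 : 0 < B.1) (c0 : 0 < c)
  (sC : forall z, 0 <= z.1 <= B.1 + 1 -> c <= sigma z <= C).
Local Notation T := (B.1 + 1).
Local Notation kappa := (gauss_moment R 2).

Let T0 : 0 <= T. Proof. by rewrite addr_ge0// ltW. Qed.
Let kappa0 : 0 < kappa := gauss_moment2_gt0 R.
Let C0 : 0 < C.
Proof. by have /andP[h1 h2] := sC (z := (0, 0)) (introT andP (conj (lexx _) T0)); apply: lt_le_trans h2; exact: lt_le_trans h1. Qed.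

Let pm p : p.1 <= T -> past_L2 T (mild_integrand sigma p.1 p.2).
Proof. by move=> pT; exact: (@past_L2_mild R sigma T c C cs c0 T0 sC p pT). Qed.

Let early (z : R * R) : 0 <= z.1 -> z.1 <= B.1 / 2 -> c <= sigma z <= C.
Proof. by move=> z0 zB; apply: sC; rewrite z0 (le_trans zB)//; have := B0; lra. Qed.

(* the correlation of the solution at [p] with the noise tested against the plateau *)
Definition loading (p : R * R) : R := ip mu (mild_integrand sigma p.1 p.2) (plateau B.1) / kappa.

(** A lower bound of the kernel for time lags between [B.1 / 2] and [T] and spatial distances up to
    [|B.2| + 2]. *)
Definition kern_min : R := (Num.sqrt (4 * pi * T))^-1 * expR (- ((`|B.2| + 2) ^+ 2 / (2 * B.1))).

Lemma kern_min_gt0 : 0 < kern_min.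
Proof. by rewrite mulr_gt0 ?expR_gt0// invr_gt0 sqrtr_gt0 !mulr_gt0 ?pi_gt0// ltr_wpDl// ltW. Qed.

Lemma kern_lower p z : in_box B p -> 0 <= z.1 <= B.1 / 2 -> 0 <= z.2 <= 1 -> kern_min <= kern p z.
Proof.
move=> /andP[/andP[p1 p1'] /andP[p2 p2']] /andP[z1 z1'] /andP[z2 z2'].
rewrite /kern /heat_kernel /kern_min; have pi0 := pi_gt0 R.
have d0 : B.1 / 2 <= p.1 - z.1 by move: B0; lra.
have d1 : 0 < p.1 - z.1 by apply: lt_le_trans d0; rewrite divr_gt0.
apply: ler_pM; [by rewrite invr_ge0 sqrtr_ge0|exact: expR_ge0| |].
  rewrite lef_pV2 ?posrE ?sqrtr_gt0 ?mulr_gt0//; last by rewrite ltr_wpDl// ltW.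
  by rewrite ler_wsqrtr// ler_wpM2l ?mulr_ge0 ?(ltW pi0)//; lra.
rewrite ler_expR lerN2; apply: ler_pM; [exact: sqr_ge0|by rewrite invr_ge0 mulr_ge0// ltW| |].
  rewrite -[leLHS]real_normK ?num_real// lerXn2r ?nnegrE ?addr_ge0//.
  have := ler_norm B.2; have := ler_norm (- B.2); rewrite normrN ler_norml; lra.
by rewrite lef_pV2 ?posrE ?mulr_gt0//; lra.
Qed.

Definition loading_min : R := c * kern_min / plateau_height B.1.

Lemma loading_min_gt0 : 0 < loading_min.
Proof. by rewrite divr_gt0 ?(mulr_gt0 c0 kern_min_gt0) ?(plateau_height_gt0 B0). Qed.

(** On the support of the plateau the mild integrand is at least [c * kern_min], that is
    [loading_min] times the plateau, whose squared norm is [kappa]. *)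
Lemma loading_lower p : in_box B p -> loading_min <= loading p.
Proof.
move=> Bp; have pT : p.1 <= T by case/andP: Bp => /andP[].
have Lb := L2_plateau B0; have bh := plateau_height_gt0 B0.
rewrite ler_pdivlMr// -(ip_plateau B0) -(ipZl loading_min Lb Lb).
apply: le_Rintegral => //.
- exact: integrable_prod (L2Z _ Lb) Lb.
- exact: integrable_prod (pm pT).1 Lb.
move=> z _; rewrite plateauE; case: ifP => [/and4P[z1 z1' z2 z2']|_]; last by rewrite !mulr0.
rewrite ler_wpM2r ?(ltW bh)// mildE /loading_min mulfVK ?gt_eqF// mulrC /forward z1.
have /andP[s1 s2] := early z1 z1'.
by apply: ler_pM => //; [exact/ltW/kern_min_gt0|exact: ltW|apply: kern_lower => //; rewrite ?z1 ?z2].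
Qed.

(** The plateau sees an increment only at times up to [B.1 / 2], so Cauchy-Schwarz bounds the
    variation of the loading by that early part, the one controlled in [frozen]. *)
Lemma loading_edge theta r p q :
  (zoom r p (grid_pos R q)).1 <= T -> (zoom r p (grid_pos R (parent q))).1 <= T ->
  ip mu (fun z => if z.1 <= B.1 / 2 then edge r p q z else 0)
        (fun z => if z.1 <= B.1 / 2 then edge r p q z else 0) <= theta ->
  (loading (zoom r p (grid_pos R q)) - loading (zoom r p (grid_pos R (parent q)))) ^+ 2 <=
    C ^+ 2 / kappa * theta.
Proof.
move=> qT pT hth; have Lb := L2_plateau B0; have Le := L2_edge r p q.
set f := (X in ip mu X X) in hth.
have mf : measurable_fun setT f.
  by apply: measurable_fun_ifT; [apply: measurable_fun_ler => //; exact: measurable_fst|exact: Le.1|exact: measurable_cst].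
have Lf : L2 mu f.
  by apply: (L2_le Le) => // z; rewrite /f; case: ifP => // _; rewrite normr0.
pose h : plane R -> R := fun z => forward sigma z * plateau B.1 z.
have mh : measurable_fun setT h.
  by apply: measurable_funM; [exact: measurable_forward|exact: measurable_plateau].
have hle z : `|h z| <= `|C * plateau B.1 z|.
  rewrite /h plateauE; case: ifP => [/and4P[z1 z1' _ _]|_]; last by rewrite !mulr0.
  rewrite !normrM ler_wpM2r// /forward z1.
  have /andP[s1 s2] := early z1 z1'.
  by rewrite !ger0_norm ?(ltW C0)// (le_trans (ltW c0)).
have Lh : L2 mu h := L2_le (L2Z C Lb) mh hle.
rewrite /loading -mulrBl -ipBl//; [|exact: (pm qT).1|exact: (pm pT).1].
have -> : ip mu (fun z => mild_integrand sigma (zoom r p (grid_pos R q)).1 (zoom r p (grid_pos R q)).2 z -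
    mild_integrand sigma (zoom r p (grid_pos R (parent q))).1 (zoom r p (grid_pos R (parent q))).2 z)
  (plateau B.1) = ip mu f h.
  apply: eq_Rintegral => z _; rewrite !mildE /f /h plateauE /edge.
  case: ifP => [/and4P[z1 -> _ _]|_]; last by rewrite !mulr0.
  by ring.
have hh : ip mu h h <= C ^+ 2 * kappa.
  apply: (le_trans (ip_le (L2Z C Lb) mh hle)).
  by rewrite (ipZl C Lb (L2Z C Lb)) (ipZr C Lb Lb) ip_plateau// mulrA -expr2.
rewrite expr_div_n ler_pdivrMr ?exprn_gt0//; apply: (le_trans (ip_cauchy Lf Lh)).
have -> : C ^+ 2 / kappa * theta * kappa ^+ 2 = theta * (C ^+ 2 * kappa) by field; rewrite gt_eqF.
by apply: ler_pM => //; exact: ip_ge0.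
Qed.

End loading.

(** * Subdivision of a box into cells *)

Section subdivision.
Context (R : realType).
Local Notation mR := (measurableTypeR R).
Local Notation space6 := ((mR * (mR * mR)) * (mR * (mR * mR)))%type.
Local Notation K := ('I_6 * grid)%type.

Definition subg (m a b : nat) (q : grid) : grid :=
  ((q.1 + m)%N, (a * 16 ^ q.1 + q.2.1, b * 4 ^ q.1 + q.2.2)%N).

Lemma subg_subgrid m a b a' b' q :
  subg m a b (subgrid a' b' q) = subg m.+1 (16 * a + a') (4 * b + b') q.
Proof.
case: q => n [i j]; rewrite /subg /subgrid /= !expnS addSnnS; congr (_, (_, _)); nia.
Qed.

Lemma grid_pos_subg m a b q :
  grid_pos R (subg m a b q) = zoom (2^-1 ^+ m) (a%:R / 16 ^+ m, b%:R / 4 ^+ m) (grid_pos R q).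
Proof.
case: q => n [i j]; rewrite /grid_pos /zoom /= -!exprM ![(m * _)%N]mulnC !exprM half4 half2.
rewrite !natrD !natrM !natrX !exprD !exprVn.
have h1 : (16 : R) ^+ n != 0 by rewrite expf_neq0.
have h2 : (4 : R) ^+ n != 0 by rewrite expf_neq0.
have h3 : (16 : R) ^+ m != 0 by rewrite expf_neq0.
have h4 : (4 : R) ^+ m != 0 by rewrite expf_neq0.
by congr (_, _); field; apply/andP; split.
Qed.

Lemma in_subg m a b q : (a < 16 ^ m)%N -> (b < 4 ^ m)%N -> in_grid q -> in_grid (subg m a b q).
Proof.
case: q => n [i j]; rewrite /in_grid /subg /= !expnD => am bm /andP[hi hj].
by apply/andP; split; nia.
Qed.

Lemma grid_pos_refine n i j :
  grid_pos R (clampg (n, (i, j))) = grid_pos R (clampg (n.+1, (16 * i, 4 * j)))%N.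
Proof.
rewrite /clampg /in_grid /= !expnS !leq_mul2l /=; case: ifP => // _.
rewrite /grid_pos /= !natrM !exprS; congr (_, _); field; exact: expf_neq0.
Qed.

(** [adherent_cover] is iterated [m] times. Level 0 of a cell is level [m] of the box, so the
    refinement hypothesis is required at every level. *)
Lemma adherent_subg m (u : K -> R) (z : space6) :
  (forall j n i1 i2, u (j, (n, (i1, i2))) = u (j, (n.+1, (16 * i1, 4 * i2))))%N ->
  adherent (u, z) -> exists a b : nat, [/\ (a < 16 ^ m)%N, (b < 4 ^ m)%N &
    adherent (fun k => u (k.1, subg m a b k.2), z)].
Proof.
move=> ref hu; elim: m => [|m [a [b [am bm hab]]]].
  exists 0%N, 0%N; split => //; move: hu; congr adherent; congr (_, _); apply/funext => -[j [n [i1 i2]]].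
  by rewrite /subg /= addn0 !mul0n !add0n.
have [|a' [b' [a16 b4 h]]] := adherent_cover _ hab.
  by move=> j i1 i2; rewrite /subg /= ref; congr (u (j, (_, (_, _)))); lia.
exists (16 * a + a')%N, (4 * b + b')%N; rewrite !expnS; split; [lia|lia|].
by move: h; congr adherent; congr (_, _); apply/funext => k /=; rewrite subg_subgrid.
Qed.

End subdivision.

Section points.
Context (R : realType).
Implicit Types (r : R) (p B : R * R).

Definition pt r p q := zoom r p (grid_pos R (clampg q)).

Lemma in_box_pt r B p q : 0 <= r -> in_box B p -> p.1 + r ^+ 4 <= B.1 + 1 -> p.2 + r ^+ 2 <= B.2 + 1 ->
  in_box B (pt r p q).
Proof.
move=> r0 /andP[/andP[b1 b1'] /andP[b2 b2']] p1 p2.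
have [/andP[s0 s1] /andP[t0 t1]] := @grid_pos_bound R _ (in_clampg q).
have r4 : 0 <= r ^+ 4 by rewrite exprn_ge0.
have r2 : 0 <= r ^+ 2 by rewrite exprn_ge0.
have a1 := mulr_ge0 r4 s0; have a2 := mulr_ge0 r2 t0.
have a3 := ler_wpM2l r4 s1; have a4 := ler_wpM2l r2 t1.
rewrite !mulr1 in a3 a4.
rewrite /in_box -[(pt r p q).1]/(p.1 + r ^+ 4 * (grid_pos R (clampg q)).1) -[(pt r p q).2]/(p.2 + r ^+ 2 * (grid_pos R (clampg q)).2).
by apply/andP; split; apply/andP; split; lra.
Qed.

Lemma in_box_pt1 B q : in_box B (pt 1 B q).
Proof. by apply: in_box_pt; rewrite ?expr1n// /in_box !lexx !lerDl ler01. Qed.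

End points.

Section local_scale.
Context (R : realType) d (Omega : measurableType d) (P : probability Omega R).
Local Notation mR := (measurableTypeR R).
Local Notation space6 := ((mR * (mR * mR)) * (mR * (mR * mR)))%type.
Local Notation leb6 := (@leb6 R).
Local Notation mu := (@leb2 R).
Local Notation K := ('I_6 * grid)%type.
Variable W : 'I_6 -> (R * R -> R) -> {RV P >-> R}.
Hypothesis HW : white_noise W.
Variables (sigma : 'I_6 -> R * R -> R) (B : R * R) (c C : R).
Hypotheses (cs : forall j, continuous (sigma j)) (B0 : 0 < B.1) (c0 : 0 < c)
  (sC : forall j z, 0 <= z.1 <= B.1 + 1 -> c <= sigma j z <= C).
Local Notation T := (B.1 + 1).
Local Notation kappa := (gauss_moment R 2).
Local Notation wnT := (wn W T).
Local Notation mild j p := (mild_integrand (sigma j) (p : R * R).1 (p : R * R).2).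
Local Notation load j := (loading (sigma j) B).

(* a version, continuous or not, of the solution on the box *)
Variable X : Omega -> 'I_6 -> R * R -> R.
Hypotheses (mX : forall j p, measurable_fun setT (fun w => X w j p))
  (aeX : forall j p, in_box B p -> {ae P, forall w, X w j p = wnT j (mild j p) w}).

Let T0 : 0 <= T. Proof. by rewrite addr_ge0// ltW. Qed.
Let C0 : 0 < C.
Proof. by have /andP[h1 h2] := sC ord0 (z := (0, 0)) (introT andP (conj (lexx _) T0)); apply: lt_le_trans h2; exact: lt_le_trans h1. Qed.
Let kappa0 : 0 < kappa := gauss_moment2_gt0 R.

Let pm j (p : R * R) : p.1 <= T -> past_L2 T (mild j p).
Proof. by move=> pT; exact: (@past_L2_mild R (sigma j) T c C (@cs j) c0 T0 (@sC j) p pT). Qed.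

Section scale.
Variables (r : R) (p : R * R) (theta : R).
Hypotheses (r0 : 0 < r) (theta0 : 0 <= theta).
Hypotheses (Bp : in_box B p) (p1 : p.1 + r ^+ 4 <= B.1 + 1) (p2 : p.2 + r ^+ 2 <= B.2 + 1).
Hypothesis small : forall j, frozen (sigma j) B theta r p.

Local Notation pt := (pt r p).

Let pt0 : pt grid0 = p.
Proof. by rewrite /pt /clampg /= grid_pos0 /zoom /= !mulr0 !addr0; case: (p). Qed.

Let box_pt q : in_box B (pt q).
Proof. exact: in_box_pt (ltW r0) Bp p1 p2. Qed.

Let ptT q : (pt q).1 <= T. Proof. by case/andP: (box_pt q) => /andP[]. Qed.

Let s j := sigma j p * r.

Let sp j : c <= sigma j p <= C.
Proof. by apply: sC; case/andP: Bp => /andP[h ->] _; rewrite (le_trans (ltW B0)). Qed.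
Let sp0 j : 0 < sigma j p. Proof. by case/andP: (sp j) => h _; exact: lt_le_trans h. Qed.

Definition loc_sol w (k : K) := X w k.1 (pt k.2).
Definition loc_load j q := load j (pt q).
Let fu q : R * R -> R := fun z => r^-1 * (kern (pt q) z - kern p z).
(** A copy in law of the string, built near [p] at scale [r] from the same noise as the solution:
    the comparison is a coupling. *)
Definition loc_string w (k : K) := wnT k.1 (fu k.2) w.
(** Defined as the remainder, so that the decomposition assumed in [local_bound] holds for every
    outcome. *)
Definition loc_err w (k : K) := (loc_sol w k - loc_sol w (k.1, grid0)) / s k.1 -
  (loc_string w k - loc_string w (k.1, grid0)).

Let pfu q : past_L2 T (fu q).
Proof.
split; first exact: (L2Z r^-1 (L2_kern _ _)).
move=> z Tz; rewrite /fu !kern_le0 ?subrr ?mulr0// (ltW (le_lt_trans _ Tz))//.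
by case/andP: Bp => /andP[].
Qed.

Lemma measurable_loc_sol k : measurable_fun setT (fun w => loc_sol w k).
Proof. exact: mX. Qed.

Lemma measurable_loc_string k : measurable_fun setT (fun w => loc_string w k).
Proof. exact: measurable_wn. Qed.

Lemma measurable_loc_err k : measurable_fun setT (fun w => loc_err w k).
Proof.
apply: measurable_funB; last by apply: measurable_funB; exact: measurable_loc_string.
by apply: measurable_funM; [apply: measurable_funB; exact: mX|exact: measurable_cst].
Qed.

Let edgeE q : in_grid q -> (fun z => kern (pt q) z - kern (pt (parent q)) z) = edge r p q.
Proof. by move=> hq; rewrite /pt (clampgK hq) (clampgK (in_grid_parent hq)). Qed.

Lemma loc_string_chain j : (\int[P]_w chain (component (loc_string w) j) <=
  (8 * cw R * (moment_ratio R * string_var R ^+ 6))%:E)%E.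
Proof.
apply: (wn_chain HW (j := j) (phi := fu) T0 (string_var_ge0 R)).
- by move=> q; exact: measurable_loc_string.
- exact: pfu.
- by move=> q; exact: aeW.
move=> q hq; have Le := L2_edge r p q.
have -> : (fun z => fu q z - fu (parent q) z) = fun z => r^-1 * edge r p q z.
  by apply/funext => z; rewrite -(edgeE hq) /fu; ring.
rewrite (ipZl _ Le (L2Z _ Le)) (ipZr _ Le Le).
rewrite mulrA -expr2 exprVn ler_pdivrMl ?exprn_gt0//.
by apply: (le_trans (ip_edge p r0 hq)); rewrite mulrAC -mulrA.
Qed.

Let fs j q : R * R -> R := fun z => (s j)^-1 * (mild j (pt q) z - mild j (pt grid0) z).

(** The integrand of an error increment is the edge times the deviation of [forward (sigma j)] from
    [sigma j p], over [s j]; [frozen] bounds its variance. *)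
Lemma loc_err_chain j : (\int[P]_w chain (component (loc_err w) j) <=
  (8 * cw R * (moment_ratio R * (theta / c ^+ 2) ^+ 6))%:E)%E.
Proof.
pose fd q : R * R -> R := fun z => 1 * (fu q z - fu grid0 z).
pose phi q : R * R -> R := fun z => 1 * (fs j q z - fd q z).
(* Linearity of the noise holds only almost surely, so the error is identified with a single Wiener
   integral in three steps. *)
have as_ q := wn_aeB HW T0 j (s j)^-1 (pm j (ptT q)) (pm j (ptT grid0)).
have ad q := wn_aeB HW T0 j 1 (pfu q) (pfu grid0).
have aa q := wn_aeB HW T0 j 1 (as_ q).1 (ad q).1.
apply: (wn_chain HW (j := j) (phi := phi) T0).
- by rewrite divr_ge0// exprn_ge0// ltW.
- by move=> q; exact: measurable_loc_err.
- by move=> q; exact: (aa q).1.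
- move=> q; move: (aeX j (box_pt q)); apply: filter_app.
  move: (aeX j (box_pt grid0)); apply: filter_app.
  move: (aa q).2 (as_ q).2 (ad q).2; apply: filterS3 => w E1 E2 E3 E4 E5.
  rewrite E1 E2 E3 /component /loc_err /loc_sol /loc_string /=  E4 E5 !mul1r mulrC; exact: erefl.
move=> q hq; have [h _] := small j hq.
have sn : sigma j p != 0 by rewrite gt_eqF.
have -> : (fun z => phi q z - phi (parent q) z) = fun z => (s j)^-1 * (edge r p q z * (forward (sigma j) z - sigma j p)).
  apply/funext => z; rewrite -(edgeE hq) /phi /fs /fd /fu !mildE /s; field.
  by rewrite sn gt_eqF.
have mD : measurable_fun setT (fun z : plane R => edge r p q z * (forward (sigma j) z - sigma j p)).
  apply: measurable_funM; first exact: (L2_edge r p q).1.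
  by apply: measurable_funB; [exact: measurable_forward|exact: measurable_cst].
have Le := L2_edge r p q; have [q1 q2] := (ptT q, ptT (parent q)).
have LD : L2 mu (fun z => edge r p q z * (forward (sigma j) z - sigma j p)).
  have := L2B (L2B (pm j q1).1 (pm j q2).1) (L2Z (sigma j p) Le).
  by congr L2; apply/funext => z; rewrite -(edgeE hq) !mildE; ring.
rewrite (ipZl _ LD (L2Z _ LD)) (ipZr _ LD LD).
have s0 : 0 < s j by rewrite mulr_gt0.
rewrite mulrA -expr2 exprVn ler_pdivrMl ?exprn_gt0//; apply: (le_trans h).
have -> : s j ^+ 2 * (theta / c ^+ 2 / 4 ^+ q.1) = r ^+ 2 / 4 ^+ q.1 * theta * (sigma j p ^+ 2 / c ^+ 2).
  rewrite /s; field; rewrite (gt_eqF c0) /=; exact: expf_neq0.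
rewrite ler_peMr//; first by rewrite mulr_ge0// divr_ge0 ?exprn_ge0// ltW.
rewrite ler_pdivlMr ?exprn_gt0// mul1r lerXn2r ?nnegrE ?(ltW c0) ?(ltW (sp0 j))//.
by case/andP: (sp j).
Qed.

(** The loading is deterministic; read as a constant random field, it comes under [expect_chain]. *)
Lemma loc_load_chain j (M : R) : (chain (fun q => M / s j * loc_load j q)%R <=
  (8 * cw R * (M ^+ 2 * C ^+ 2 * theta / (c ^+ 2 * kappa)) ^+ 6)%:E)%E.
Proof.
set A := M ^+ 2 * C ^+ 2 * theta / (c ^+ 2 * kappa).
have A0 : 0 <= A.
  by apply: divr_ge0; [apply: mulr_ge0 theta0; apply: mulr_ge0; exact: sqr_ge0|
    apply: mulr_ge0; [exact: sqr_ge0|exact/ltW/gauss_moment2_gt0]].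
have c2 : 0 < c ^+ 2 by exact: exprn_gt0.
have s0 : 0 < s j by rewrite mulr_gt0.
have icst (x : \bar R) : (\int[P]_w x = x)%E.
  by have := integral_cst P (@measurableT _ Omega) x; rewrite [X in (_ = _ * X)%E]probability_setT mule1.
rewrite -[leLHS]icst; apply: (@expect_chain R _ _ P (fun _ q => M / s j * loc_load j q)).
- by move=> q; exact: measurable_cst.
- exact: exprn_ge0.
move=> q hq; rewrite icst lee_fin -mulrBr.
have [_ h] := small j hq.
have h1 := ptT q; have h2 := ptT (parent q).
rewrite /pt (clampgK hq) in h1; rewrite /pt (clampgK (in_grid_parent hq)) in h2.
have := loading_edge (@cs j) B0 c0 (@sC j) h1 h2 h.
rewrite /loc_load /pt (clampgK hq) (clampgK (in_grid_parent hq)).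
set x := loading _ _ _ - loading _ _ _ => hx.
have -> : (4096 : R) ^+ q.1 = (4 ^+ q.1) ^+ 6.
  by rewrite -exprM mulnC exprM; congr (_ ^+ _); ring.
rewrite -exprVn -exprMn (exprM _ 2 6) -normrX ger0_norm ?sqr_ge0//.
have n4 : 0 < (4 : R) ^+ q.1 by exact: exprn_gt0.
apply: lerXn2r; [exact: sqr_ge0|by rewrite nnegrE mulr_ge0// invr_ge0 ltW|rewrite exprMn].
apply: (@le_trans _ _ ((M / s j) ^+ 2 * (C ^+ 2 / kappa * (r ^+ 2 / 4 ^+ q.1 * theta)))).
  by rewrite ler_wpM2l ?sqr_ge0.
have -> : (M / s j) ^+ 2 * (C ^+ 2 / kappa * (r ^+ 2 / 4 ^+ q.1 * theta)) =
   A / 4 ^+ q.1 * (c ^+ 2 / sigma j p ^+ 2).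
  by rewrite /s /A; field; rewrite !gt_eqF.
rewrite ler_piMr//; first by rewrite divr_ge0// ltW.
rewrite ler_pdivrMr ?exprn_gt0// mul1r lerXn2r ?nnegrE ?(ltW c0) ?(ltW (sp0 j))//.
by case/andP: (sp j).
Qed.

Lemma loc_string_vol eps : vol P (@hit R eps) loc_string = vol P (@hit R eps) (string W).
Proof.
apply: vol_law; first exact: measurable_hit.
have F1 := wn_field HW T0 (fun k : K => k.1) (phi := fun k => fu k.2) (fun k => pfu k.2).
apply: (gfield_law (probability_setT P) F1 (string_field HW)) => k l; congr (_ * _).
have LE q := L2_kern (pt q) p.
rewrite (ipZl _ (LE _) (L2Z _ (LE _))) (ipZr _ (LE _) (LE _)).
have E q : (fun z : plane R => kern (pt q) z - kern p z) =
    fun z => kern (zoom r p (grid_pos R (clampg q))) z - kern (zoom r p (0, 0)) z.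
  by rewrite (_ : zoom r p (0, 0) = p)// -[RHS]pt0 /pt (_ : clampg grid0 = grid0)// grid_pos0.
rewrite !E ip_kern_scale//.
by rewrite mulrA -expr2 exprVn mulKf ?expf_neq0 ?gt_eqF.
Qed.

Lemma loc_bound (z0 : space6) (M eps tau : R) : 0 <= M -> 0 < eps -> eps <= 1 -> 0 < tau ->
  8 * cw R * (M ^+ 2 * C ^+ 2 * theta / (c ^+ 2 * kappa)) ^+ 6 <= (eps / 4) ^+ 12 ->
  (\int[P]_w leb6 (hit_set loc_sol loc_load z0 M w) <=
  ((C * r / loading_min B c) ^+ 6)%:E * (vol P (hit eps) (string W) +
   (64 * (tau * (cw R ^+ 3 * (6 * (8 * cw R * (moment_ratio R * string_var R ^+ 6)) +
      6 * (8 * cw R * (moment_ratio R * (theta / c ^+ 2) ^+ 6)) + 2))) +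
    64 * (1 / (4 * tau)) / (eps / 4) ^+ 12 * (6 * (8 * cw R * (moment_ratio R * (theta / c ^+ 2) ^+ 6))))%:E))%E.
Proof.
move=> M0 e0 e1 tau0 hload; rewrite -loc_string_vol.
apply: (@local_bound R _ _ P loc_sol loc_string loc_err loc_load s z0 M (c * r) (C * r)).
- exact: measurable_loc_sol.
- exact: measurable_loc_string.
- exact: measurable_loc_err.
- exact: mulr_gt0.
- by move=> j; rewrite ler_wpM2r ?(ltW r0)//; case/andP: (sp j).
- by move=> j; rewrite ler_wpM2r ?(ltW r0)//; case/andP: (sp j).
- exact: loading_min_gt0.
- by move=> j; rewrite /loc_load pt0; exact: (loading_lower (@cs j) B0 c0 (@sC j) Bp).
- exact: e0.
- exact: e1.
- exact: tau0.
- exact: M0.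
- move=> w j q hq; rewrite /loc_err /=; have sn : s j != 0 by rewrite mulf_neq0 ?gt_eqF.
  by rewrite /=; field.
- by move=> w j; rewrite /loc_err /= !subrr mul0r subr0.
- exact: loc_string_chain.
- exact: loc_err_chain.
- by move=> j; apply: (le_trans (loc_load_chain j M)); rewrite lee_fin.
Qed.

End scale.
End local_scale.

Section thresholds.
Context (R : realType).

Lemma finite_threshold n (Q : 'I_n -> R -> Prop) :
  (forall j, exists2 r0 : R, 0 < r0 & forall r, 0 < r <= r0 -> Q j r) ->
  exists2 r0 : R, 0 < r0 & forall r, 0 < r <= r0 -> forall j, Q j r.
Proof.
move=> h; have /choice[r0 hr0] : forall j, exists r0 : R, 0 < r0 /\ forall r, 0 < r <= r0 -> Q j r.
  by move=> j; have [r0 ? ?] := h j; exists r0.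
exists (\big[Num.min/1]_j r0 j).
  by apply: (big_ind (fun x => 0 < x)) => // [x y x0 y0|j _]; [rewrite lt_min x0|exact: (hr0 j).1].
move=> r /andP[r_0 rle] j; apply: (hr0 j).2; rewrite r_0 /=; apply: (le_trans rle).
exact: bigmin_le_cond.
Qed.

Lemma small_power (a b e : R) : 0 <= a -> 0 <= b -> 0 < e ->
  exists2 t : R, 0 < t & forall t', 0 < t' <= t -> a * (b * t') ^+ 6 <= e.
Proof.
move=> a0 b0 e0; have k0 : 0 <= a * b ^+ 6 by rewrite mulr_ge0 ?exprn_ge0.
have k1 : 0 < a * b ^+ 6 + 1 by rewrite ltr_wpDl.
exists (Num.min 1 (e / (a * b ^+ 6 + 1))); first by rewrite lt_min ltr01 divr_gt0.
move=> t /andP[t0]; rewrite le_min ler_pdivlMr// => /andP[t1 te].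
rewrite exprMn mulrA; apply: (@le_trans _ _ (a * b ^+ 6 * t)).
  by rewrite ler_wpM2l// exprS ler_piMr ?(ltW t0)// exprn_ile1 ?(ltW t0).
by apply: le_trans te; rewrite mulrC ler_wpM2l ?(ltW t0)// lerDl.
Qed.

End thresholds.

Section negligible_targets.
Context (R : realType) d (Omega : measurableType d) (P : probability Omega R).
Local Notation mR := (measurableTypeR R).
Local Notation space6 := ((mR * (mR * mR)) * (mR * (mR * mR)))%type.
Local Notation leb6 := (@leb6 R).
Local Notation mu := (@leb2 R).
Local Notation K := ('I_6 * grid)%type.
Variable W : 'I_6 -> (R * R -> R) -> {RV P >-> R}.
Hypothesis HW : white_noise W.
Variables (sigma : 'I_6 -> R * R -> R) (B : R * R) (c C : R).
Hypotheses (cs : forall j, continuous (sigma j)) (B0 : 0 < B.1) (c0 : 0 < c)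
  (sC : forall j z, 0 <= z.1 <= B.1 + 1 -> c <= sigma j z <= C).
Local Notation T := (B.1 + 1).
Local Notation kappa := (gauss_moment R 2).
Local Notation mild j p := (mild_integrand (sigma j) (p : R * R).1 (p : R * R).2).
Local Notation load j := (loading (sigma j) B).
Variable X : Omega -> 'I_6 -> R * R -> R.
Hypotheses (mX : forall j p, measurable_fun setT (fun w => X w j p))
  (aeX : forall j p, in_box B p -> {ae P, forall w, X w j p = wn W T j (mild j p) w}).
Variable (z0 : space6).

Local Notation V := (loc_sol X 1 B).
Local Notation g := (loc_load sigma B 1 B).

Let T0 : 0 <= T. Proof. by rewrite addr_ge0// ltW. Qed.
Let C0 : 0 < C.
Proof. by have /andP[h1 h2] := @sC ord0 (0, 0) (introT andP (conj (lexx _) T0)); apply: lt_le_trans h2; exact: lt_le_trans h1. Qed.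

Let corner m (ab : nat * nat) : R * R := zoom 1 B (ab.1%:R / 16 ^+ m, ab.2%:R / 4 ^+ m).
Let scale m : R := 2^-1 ^+ m.
Let cells m : seq (nat * nat) := [seq (a, b) | a <- iota 0 (16 ^ m), b <- iota 0 (4 ^ m)].

Let scale0 m : 0 < scale m. Proof. by rewrite exprn_gt0// invr_gt0. Qed.
Let scale4 m : scale m ^+ 4 = 16 ^- m.
Proof. by rewrite /scale -exprM mulnC exprM half4 exprVn. Qed.
Let scale2 m : scale m ^+ 2 = 4 ^- m.
Proof. by rewrite /scale -exprM mulnC exprM half2 exprVn. Qed.

Let in_cells m ab : (ab \in cells m) = (ab.1 < 16 ^ m)%N && (ab.2 < 4 ^ m)%N.
Proof.
apply/allpairsP/andP => [[q [h1 h2 ->]]|[h1 h2]].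
  by move: h1 h2; rewrite !mem_iota.
by exists ab; rewrite !mem_iota; split => //; case: (ab).
Qed.

Let sub_cover m M w c' : hit_set V g z0 M w c' -> exists2 ab, ab \in cells m &
  hit_set (loc_sol X (scale m) (corner m ab)) (loc_load sigma B (scale m) (corner m ab)) z0 M w c'.
Proof.
move=> [cM ad].
have [|a [b [am bm]]] := @adherent_subg R m _ _ _ ad.
  move=> j n i1 i2; rewrite /loc_sol /loc_load /pt /=; by rewrite (grid_pos_refine R n i1 i2).
move=> h0; have h := (adherent_clamp _ _).2 h0; exists (a, b); first by rewrite in_cells am.
split; first exact: cM.
move: h; set F := (X in adherent (X, _) -> _).
suff -> : (fun k : K => loc_sol X (scale m) (corner m (a, b)) w k +
    coord6 c' k.1 * loc_load sigma B (scale m) (corner m (a, b)) k.1 k.2) = F by move=> h; exact: h.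
apply/funext => k; rewrite /F {F}.
rewrite /loc_sol /loc_load /pt /= (clampgK (in_subg am bm (in_clampg k.2))) grid_pos_subg.
by rewrite zoom_zoom mul1r.
Qed.

(** There are [16^m * 4^m] cells, and each contributes the factor [scale^6 = 16^-m * 4^-m]: they
    cancel, and the bound depends on [m] only through the admissible [theta]. *)
Lemma cells_bound (theta : R) m M eps tau : 0 <= theta ->
  (forall j p, in_box B p -> p.1 + scale m ^+ 4 <= B.1 + 1 -> frozen (sigma j) B theta (scale m) p) ->
  0 <= M -> 0 < eps -> eps <= 1 -> 0 < tau ->
  8 * cw R * (M ^+ 2 * C ^+ 2 * theta / (c ^+ 2 * kappa)) ^+ 6 <= (eps / 4) ^+ 12 ->
  (\int[P]_w leb6 (hit_set V g z0 M w) <=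
  ((C / loading_min B c) ^+ 6)%:E * (vol P (hit eps) (string W) +
   (64 * (tau * (cw R ^+ 3 * (6 * (8 * cw R * (moment_ratio R * string_var R ^+ 6)) +
      6 * (8 * cw R * (moment_ratio R * (theta / c ^+ 2) ^+ 6)) + 2))) +
    64 * (1 / (4 * tau)) / (eps / 4) ^+ 12 * (6 * (8 * cw R * (moment_ratio R * (theta / c ^+ 2) ^+ 6))))%:E))%E.
Proof.
move=> theta0 small M0 e0 e1 tau0 hload; set bnd := (X in (_ <= _ * X)%E).
pose H ab w := leb6 (hit_set (loc_sol X (scale m) (corner m ab)) (loc_load sigma B (scale m) (corner m ab)) z0 M w).
have mH ab : measurable_fun setT (H ab).
  by apply: measurable_vol_hit_set => k; exact: (measurable_loc_sol mX).
have H0 ab w : (0 <= H ab w)%E by exact: measure_ge0.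
apply: (@le_trans _ _ (\int[P]_w \sum_(ab <- cells m) H ab w)%E).
  apply: ge0_le_integral.
  - exact: measurableT.
  - by move=> w _; exact: measure_ge0.
  - by apply: measurable_vol_hit_set => k; exact: (measurable_loc_sol mX).
  - by apply: emeasurable_sum => ab; exact: mH.
  - move=> w _; have := @measure_le_sum _ _ R leb6 _ (cells m) (hit_set V g z0 M w) set0
      (fun ab => hit_set (loc_sol X (scale m) (corner m ab)) (loc_load sigma B (scale m) (corner m ab)) z0 M w).
    rewrite measure0 add0e; apply.
    + by apply: measurable_hit_set => k; exact: (measurable_loc_sol mX).
    + exact: measurable0.
    + by move=> ab; apply: measurable_hit_set => k; exact: (measurable_loc_sol mX).
    + by move=> c' /(@sub_cover m) h; right; exact: h.
rewrite ge0_integral_sum; [|exact: measurableT|by move=> ab; exact: mH|by move=> ab w _; exact: H0].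
have one ab : ab \in cells m -> (\int[P]_w H ab w <= ((C * scale m / loading_min B c) ^+ 6)%:E * bnd)%E.
  rewrite in_cells => /andP[am bm].
  have n16 : 0 < (16 : R) ^+ m by exact: exprn_gt0.
  have n4 : 0 < (4 : R) ^+ m by exact: exprn_gt0.
  have frac (k n : nat) : (k < n)%N -> (k%:R : R) / n%:R + n%:R^-1 <= 1.
    move=> kn; rewrite -[X in _ + X]mul1r -mulrDl ler_pdivrMr ?ltr0n ?(leq_ltn_trans _ kn)//.
    by rewrite mul1r natr1 ler_nat.
  have a1 : (ab.1%:R : R) / 16 ^+ m + 16 ^- m <= 1.
    by have := frac _ _ am; rewrite natrX.
  have b1 : (ab.2%:R : R) / 4 ^+ m + 4 ^- m <= 1.
    by have := frac _ _ bm; rewrite natrX.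
  have a0 : 0 <= (ab.1%:R : R) / 16 ^+ m by rewrite divr_ge0// ltW.
  have b0 : 0 <= (ab.2%:R : R) / 4 ^+ m by rewrite divr_ge0// ltW.
  have i16 : 0 < (16 : R) ^- m by rewrite invr_gt0.
  have i4 : 0 < (4 : R) ^- m by rewrite invr_gt0.
  have bx : in_box B (corner m ab).
    by rewrite /in_box /corner /zoom !expr1n !mul1r /=; apply/andP; split; apply/andP; split; lra.
  have h1 : (corner m ab).1 + scale m ^+ 4 <= B.1 + 1.
    by rewrite scale4 /corner /zoom !expr1n !mul1r /=; lra.
  have h2 : (corner m ab).2 + scale m ^+ 2 <= B.2 + 1.
    by rewrite scale2 /corner /zoom !expr1n !mul1r /=; lra.
  exact: (loc_bound HW cs B0 c0 sC mX aeX (scale0 m) theta0 bx h1 h2 (fun j => small j _ bx h1) z0 M0 e0 e1 tau0 hload).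
apply: (@le_trans _ _ (\sum_(ab <- cells m) ((C * scale m / loading_min B c) ^+ 6)%:E * bnd)%E).
  by rewrite big_seq [leRHS]big_seq; apply: lee_sum => ab; exact: one.
have g0 := loading_min_gt0 B0 c0.
rewrite -ge0_sume_distrl; last first.
  move=> ab _; rewrite lee_fin; apply: exprn_ge0; apply: divr_ge0; last exact: ltW.
  by apply: mulr_ge0; exact: ltW.
rewrite sumEFin big_const_seq count_predT iter_addr_0 size_allpairs !size_iota.
have -> : (C * scale m / loading_min B c) ^+ 6 *+ (16 ^ m * 4 ^ m) = (C / loading_min B c) ^+ 6.
  rewrite -mulr_natr natrM !natrX.
  have -> : (C * scale m / loading_min B c) ^+ 6 = (C / loading_min B c) ^+ 6 * (scale m ^+ 4 * scale m ^+ 2).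
    by field; rewrite gt_eqF.
  by rewrite scale4 scale2; field; rewrite !expf_neq0 ?gt_eqF.
exact: lexx.
Qed.

(** The order of the choices matters: [eps] makes the neighbourhood of the range of the string
    small, [tau] then balances the chains of the string, [theta] is small against the constants
    produced by both, and [m] comes last, so that the cells are small enough for [theta]. *)
Lemma hit_null M : 0 <= M -> (\int[P]_w leb6 (hit_set V g z0 M w) = 0)%E.
Proof.
move=> M0; apply/eqP; rewrite eq_le; apply/andP; split; last first.
  by apply: integral_ge0 => w _; exact: measure_ge0.
apply/lee_addgt0Pr => e e0; rewrite add0e.
have g0 := loading_min_gt0 B0 c0; set k := (C / loading_min B c) ^+ 6.
have k0 : 0 < k by rewrite exprn_gt0// divr_gt0.
(* A third of the budget for each of the three terms: the volume, the term in [tau], and the large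
   errors. *)
pose eta := e / (3 * k); have eta0 : 0 < eta by rewrite divr_gt0// mulr_gt0.
have [n hn] : exists n, (vol P (hit n.+1%:R^-1) (string W) <= eta%:E)%E.
  have /fine_cvgP[fin cv] := string_vol_hit HW.
  have /cvgrPdist_le/(_ _ eta0) h := cv.
  near \oo => n; exists n.
  have fn : vol P (hit n.+1%:R^-1) (string W) \is a fin_num by near: n.
  have : `|0 - fine (vol P (hit n.+1%:R^-1) (string W))| <= eta by near: n; exact: h.
  by rewrite sub0r normrN -{2}(fineK fn) lee_fin; apply: le_trans; exact: ler_norm.
pose eps : R := n.+1%:R^-1; have eps0 : 0 < eps by rewrite invr_gt0.
have eps1 : eps <= 1 by rewrite invf_le1// ler1n.
have cw0 := cw_gt0 R; have mr0 := moment_ratio_ge0 R; have sv0 := string_var_ge0 R.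
pose Au := 8 * cw R * (moment_ratio R * string_var R ^+ 6).
have Au0 : 0 <= Au by exact: (mulr_ge0 (mulr_ge0 (ler0n _ 8) (ltW cw0)) (mulr_ge0 mr0 (exprn_ge0 6 sv0))).
pose den := 64 * (cw R ^+ 3 * (6 * Au + 8)).
have den0 : 0 < den by rewrite !mulr_gt0 ?exprn_gt0// ltr_wpDl// mulr_ge0.
pose tau := eta / den; have tau0 : 0 < tau by rewrite divr_gt0.
pose D := 64 * (1 / (4 * tau)) / (eps / 4) ^+ 12 * 6.
have e12 : 0 < (eps / 4) ^+ 12 by rewrite exprn_gt0// divr_gt0.
have p4 : 0 < (4 : R) by [].
have p64 : 0 < (64 : R) by [].
have p6 : 0 < (6 : R) by [].
have D0 : 0 < D by exact: (mulr_gt0 (divr_gt0 (mulr_gt0 p64 (divr_gt0 ltr01 (mulr_gt0 p4 tau0))) e12) p6).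
pose K1 := 8 * cw R * moment_ratio R.
have K10 : 0 <= K1 by exact: (mulr_ge0 (mulr_ge0 (ler0n _ 8) (ltW cw0)) mr0).
have K20 : 0 <= M ^+ 2 * C ^+ 2 / (c ^+ 2 * kappa).
  by rewrite divr_ge0 ?mulr_ge0 ?sqr_ge0// ltW// gauss_moment2_gt0.
have ic0 : 0 <= (c ^+ 2)^-1 by rewrite invr_ge0 sqr_ge0.
(* The bound 1/3 keeps [6 * Ae + 2] below the 8 in [den]; the bound [eta / D] serves the term of the
   large errors. *)
have m0 : 0 < Num.min (1/3) (eta / D) by rewrite lt_min divr_gt0//= divr_gt0.
have [t1 t10 ht1] := small_power K10 ic0 m0.
have cw8 : 0 <= 8 * cw R by rewrite mulr_ge0// ltW.
have [t2 t20 ht2] := small_power cw8 K20 e12.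
pose theta := Num.min t1 t2; have theta0 : 0 < theta by rewrite lt_min t10.
have l1 : theta <= t1 by rewrite /theta ge_min lexx.
have l2 : theta <= t2 by rewrite /theta ge_min lexx orbT.
have {ht1} hA := ht1 theta (introT andP (conj theta0 l1)).
have {ht2} hL := ht2 theta (introT andP (conj theta0 l2)).
pose Q j r := forall p, in_box B p -> p.1 + r ^+ 4 <= B.1 + 1 -> frozen (sigma j) B theta r p.
have [r0 r00 hr0] : exists2 r0 : R, 0 < r0 & forall r, 0 < r <= r0 -> forall j, Q j r.
  apply: finite_threshold => j.
  have sC' z : 0 <= z.1 <= B.1 + 1 -> 0 <= sigma j z <= C.
    by move=> hz; have /andP[h ->] := @sC j z hz; rewrite (le_trans (ltW c0) h).
  have [r0 r00 h] := perturbation_small (@cs j) B0 theta0 sC'.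
  by exists r0 => // r rr p *; exact: h.
have [m hm] : exists m, scale m <= r0.
  pose m := (Num.truncn r0^-1).+1; exists m.
  rewrite /scale exprVn -[leRHS]invrK lef_pV2 ?posrE ?exprn_gt0 ?invr_gt0//.
  apply: (@le_trans _ _ m%:R); first exact/ltW/truncnS_gt.
  by rewrite -natrX ler_nat ltnW// ltn_expl.
have hQ := hr0 (scale m) (introT andP (conj (scale0 m) hm)).
have hL' : 8 * cw R * (M ^+ 2 * C ^+ 2 * theta / (c ^+ 2 * kappa)) ^+ 6 <= (eps / 4) ^+ 12.
  by rewrite (_ : M ^+ 2 * C ^+ 2 * theta / _ = M ^+ 2 * C ^+ 2 / (c ^+ 2 * kappa) * theta)//; ring.
apply: (le_trans (cells_bound (m := m) (ltW theta0) hQ M0 eps0 eps1 tau0 hL')).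
rewrite -/Au.
set Ae := 8 * cw R * (moment_ratio R * (theta / c ^+ 2) ^+ 6).
have {hA} hA : Ae <= Num.min (1/3) (eta / D).
  by rewrite /Ae mulrA -/K1 mulrC [theta / _]mulrC mulrC.
have [hA1 hA2] : Ae <= 1/3 /\ Ae <= eta / D by move: hA; rewrite le_min => /andP[].
have E1 : 64 * (tau * (cw R ^+ 3 * (6 * Au + 6 * Ae + 2))) <= eta.
  have -> : eta = 64 * (tau * (cw R ^+ 3 * (6 * Au + 8))).
    by rewrite /tau /den; field; rewrite !gt_eqF// ltr_wpDl// mulr_ge0.
  rewrite ler_wpM2l// ler_wpM2l ?(ltW tau0)// ler_wpM2l ?exprn_ge0 ?(ltW cw0)//; lra.
have E2 : 64 * (1 / (4 * tau)) / (eps / 4) ^+ 12 * (6 * Ae) <= eta.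
  by move: hA2; rewrite (ler_pdivlMr _ _ D0) /D; apply: le_trans; rewrite le_eqVlt; apply/orP; left; apply/eqP; ring.
have -> : e = k * (eta + (eta + eta)) by rewrite /eta; field; rewrite gt_eqF.
rewrite [leRHS]EFinM; apply: lee_wpmul2l; first by rewrite lee_fin ltW.
rewrite [leRHS]EFinD; apply: leeD => //; rewrite lee_fin; exact: lerD.
Unshelve. all: by end_near. Qed.

End negligible_targets.

(** * Decoupling *)

Section almost_sure_linearity.
Context (R : realType) d (Omega : measurableType d) (P : probability Omega R).
Variable W : 'I_6 -> (R * R -> R) -> {RV P >-> R}.
Hypothesis HW : white_noise W.
Variable T : R.
Hypothesis T0 : 0 <= T.
Local Notation mu := (@leb2 R).

Lemma past_L2_0 : past_L2 T (fun=> 0 : R).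
Proof.
split => //; split; first exact: measurable_cst.
by rewrite (_ : _ \o _ = cst 0%E); [exact: integrable0|apply/funext => z; rewrite /= expr0n].
Qed.

Lemma wn_ae0 j : {ae P, forall w, wn W T j (fun=> 0) w = 0}.
Proof.
have [_] := wn_aeB HW T0 j 0 past_L2_0 past_L2_0.
rewrite (_ : (fun z : R * R => 0 * (0 - 0)) = fun=> 0); last by apply/funext => z; rewrite mul0r.
by apply: filterS => w; rewrite mul0r.
Qed.

Lemma past_L2Z a f : past_L2 T f -> past_L2 T (fun z => a * f z).
Proof. by move=> [Lf f0]; split; [exact: L2Z|move=> z /f0 ->; rewrite mulr0]. Qed.

Lemma past_L2B f g : past_L2 T f -> past_L2 T g -> past_L2 T (fun z => f z - g z).
Proof.
by move=> [Lf f0] [Lg g0]; split; [exact: L2B|move=> z zT; rewrite f0// g0// subr0].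
Qed.

Lemma wn_ae_sub_scale j f h a : past_L2 T f -> past_L2 T h ->
  {ae P, forall w, wn W T j (fun z => f z - a * h z) w = wn W T j f w - a * wn W T j h w}.
Proof.
move=> pf ph; have [_ e1] := wn_aeB HW T0 j a ph past_L2_0.
have [_ e2] := wn_aeB HW T0 j 1 pf (past_L2Z a ph).
move: e1; rewrite (_ : (fun z => a * (h z - 0)) = fun z => a * h z); last by apply/funext => z; rewrite subr0.
move: e2; rewrite (_ : (fun z => 1 * (f z - a * h z)) = fun z => f z - a * h z); last by apply/funext => z; rewrite mul1r.
move=> e2 e1; move: e1 e2 (wn_ae0 j); apply: filterS3 => w -> -> ->.
by rewrite mul1r subr0.
Qed.

End almost_sure_linearity.

Section decoupling.
Context (R : realType) d (Omega : measurableType d) (P : probability Omega R).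
Local Notation mR := (measurableTypeR R).
Local Notation space6 := ((mR * (mR * mR)) * (mR * (mR * mR)))%type.
Local Notation leb6 := (@leb6 R).
Local Notation normal6 := (@normal6 R).
Local Notation mu := (@leb2 R).
Local Notation K := ('I_6 * grid)%type.
Local Notation K' := ('I_6 + K)%type.
Variable W : 'I_6 -> (R * R -> R) -> {RV P >-> R}.
Hypothesis HW : white_noise W.
Variables (sigma : 'I_6 -> R * R -> R) (B : R * R) (c C : R).
Hypotheses (cs : forall j, continuous (sigma j)) (B0 : 0 < B.1) (c0 : 0 < c)
  (sC : forall j z, 0 <= z.1 <= B.1 + 1 -> c <= sigma j z <= C).
Local Notation T := (B.1 + 1).
Local Notation kappa := (gauss_moment R 2).
Local Notation mild j p := (mild_integrand (sigma j) (p : R * R).1 (p : R * R).2).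
Local Notation load j := (loading (sigma j) B).
Local Notation h := (plateau B.1).
Variable (z0 : space6).

Let T0 : 0 <= T. Proof. by rewrite addr_ge0// ltW. Qed.

Let pm j (p : R * R) : p.1 <= T -> past_L2 T (mild j p).
Proof. by move=> pT; exact: (@past_L2_mild R (sigma j) T c C (@cs j) c0 T0 (@sC j) p pT). Qed.

Let ph : past_L2 T h.
Proof. by apply: past_L2_plateau => //; rewrite lerDl. Qed.

(* the part of the solution at [p] that is independent of the noise tested against the plateau *)
Let resid j (p : R * R) : R * R -> R := fun z => mild j p z - load j p * h z.

(** A version of the solution for which the decomposition into the residual and the loading times
    the tested noise holds for every outcome. *)
Let X w j p : R := wn W T j (resid j p) w + load j p * wn W T j h w.

Let mX j p : measurable_fun setT (fun w => X w j p).
Proof.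
apply: measurable_funD; first exact: measurable_wn.
by apply: measurable_funM; [exact: measurable_cst|exact: measurable_wn].
Qed.

Let boxT p : in_box B p -> p.1 <= T. Proof. by case/andP => /andP[]. Qed.

Let aeX j p : in_box B p -> {ae P, forall w, X w j p = wn W T j (mild j p) w}.
Proof.
move=> /boxT pT; have := wn_ae_sub_scale HW T0 j (load j p) (pm j pT) ph.
by apply: filterS => w; rewrite /X /resid => ->; rewrite subrK.
Qed.

Local Notation V := (loc_sol X 1 B).
Local Notation g := (loc_load sigma B 1 B).

Let target w : set space6 := [set c' | adherent (fun k => V w k + coord6 c' k.1 * g k.1 k.2, z0)].

Let mV k : measurable_fun setT (fun w => V w k). Proof. exact: (measurable_loc_sol mX). Qed.

Let target_cover w : target w = \bigcup_n hit_set V g z0 n%:R w.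
Proof.
apply/seteqP; split => [c' hc|c' [n _ [_ hc]]]; last exact: hc.
pose M := \sum_j `|coord6 c' j|.
exists (Num.truncn M).+1 => //; split => // j.
apply: le_trans (ltW (truncnS_gt M)).
by rewrite /M (bigD1 j)//= lerDl sumr_ge0.
Qed.

Let mtarget w : measurable (target w).
Proof. by rewrite target_cover; apply: bigcup_measurable => n _; exact: measurable_hit_set. Qed.

Let target_null : {ae P, forall w, leb6 (target w) = 0%E}.
Proof.
have : {ae P, forall w, forall n, leb6 (hit_set V g z0 n%:R w) = 0%E}.
  apply/ae_foralln => n.
  have mvol : measurable_fun setT (fun w => leb6 (hit_set V g z0 n%:R w)) by exact: measurable_vol_hit_set.
  have [H _] := ae_eq_integral_abs P measurableT mvol.
  have : ae_eq P setT (fun w => leb6 (hit_set V g z0 n%:R w)) (cst 0%E).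
    apply: H; rewrite -[RHS](hit_null HW cs B0 c0 sC mX aeX z0 (ler0n R n)).
    by apply: eq_integral => w _; rewrite gee0_abs// measure_ge0.
  by apply: filterS => w; exact.
apply: filterS => w hw; rewrite target_cover; apply: measure_negligible.
  by apply: bigcup_measurable => n _; exact: measurable_hit_set.
apply: negligible_bigcup => n; apply/negligibleP; last exact: hw.
exact: measurable_hit_set.
Qed.

Let jj (l : K') : 'I_6 := match l with inl j => j | inr k => k.1 end.
Let phi (l : K') : R * R -> R :=
  match l with inl j => h | inr k => resid k.1 (pt 1 B k.2) end.
Let Y w l := wn W T (jj l) (phi l) w.

Let presid j q : past_L2 T (resid j (pt 1 B q)).
Proof. by apply: past_L2B; [apply: pm; apply: boxT; exact: in_box_pt1|exact: past_L2Z]. Qed.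

Let pphi l : past_L2 T (phi l).
Proof. by case: l => [j|k]; [exact: ph|exact: presid]. Qed.

Let VE w k : V w k = Y w (inr k) + g k.1 k.2 * Y w (inl k.1).
Proof. exact: erefl. Qed.

(** The loading is the projection coefficient on the plateau, so the residual is orthogonal to
    it. *)
Let ip_resid j q : ip mu (resid j (pt 1 B q)) h = 0.
Proof.
have k0 := gauss_moment2_gt0 R; have Lh := L2_plateau B0; have Lm := (pm j (boxT (in_box_pt1 B q))).1.
rewrite /resid (ipBl Lm (L2Z _ Lh) Lh) (ipZl _ Lh Lh) ip_plateau// /loading mulfVK ?gt_eqF//.
exact: subrr.
Qed.

Let b (l : K') (j : 'I_6) : R := match l with inl i => (i == j)%:R | inr _ => 0 end.
Let Y0 w (l : K') : R := match l with inl _ => 0 | inr k => Y w (inr k) end.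
(** On an enlarged space, the tested noise is replaced by normal coordinates independent of the
    residuals. *)
Let Y' (z : space6 * Omega) (l : K') : R := \sum_j b l j * coord6 z.1 j + Y0 z.2 l.
Let phi0 (l : K') : R * R -> R := match l with inl j => fun=> 0 | inr k => phi l end.

Let C0 (l l' : K') : R := (jj l == jj l')%:R * ip mu (phi0 l) (phi0 l').
Let C' (l l' : K') : R := \sum_j b l j * b l' j * kappa + C0 l l'.

Let field0 : gfield P Y0 C0.
Proof.
have p0 l : past_L2 T (phi0 l) by case: l => [j|k]; [exact: past_L2_0|exact: pphi].
apply: (gfield_ae _ _ (wn_field HW T0 jj p0)).
  by case=> [j|k]; [exact: measurable_cst|exact: measurable_wn].
case=> [j|k]; first by have := wn_ae0 HW T0 j.
by apply: aeW.
Qed.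

Let field' : gfield (prodm normal6 P) Y' C'.
Proof.
split.
  move=> l; apply: measurable_funD.
    apply: measurable_sum => j; apply: measurable_funM; first exact: measurable_cst.
    exact: (measurableT_comp (measurable_coord6 j) measurable_fst).
  exact: (measurableT_comp (field0.1 l) measurable_snd).
move=> s; pose a j := \sum_(p <- s) p.1 * b p.2 j.
have swap (x : 'I_6 -> R) : \sum_j a j * x j = \sum_(p <- s) p.1 * \sum_j b p.2 j * x j.
  under eq_bigr => j _ do rewrite /a mulr_suml.
  by rewrite exchange_big; apply: eq_bigr => p _; rewrite mulr_sumr; apply: eq_bigr => j _; rewrite mulrA.
have := has_cf_prod (is_prob_normal6 R) (probability_setT P) (has_cf_normal6 a) (field0.2 s).
have -> : (fun z : space6 * Omega => \sum_j a j * coord6 z.1 j + lin s (Y0 z.2)) = fun z => lin s (Y' z).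
  apply/funext => z; rewrite /lin /Y'; under [RHS]eq_bigr => p _ do rewrite mulrDr.
  rewrite big_split; congr (_ + _).
  exact: swap.
rewrite -expRD; congr (has_cf _ _ (expR _)).
have k0 := gauss_moment2_gt0 R.
have -> : quad C' s = (\sum_j a j ^+ 2) * kappa + quad C0 s.
  rewrite /quad /C'; under eq_bigr => p _ do under eq_bigr => q _ do rewrite mulrDr.
  under eq_bigr => p _ do rewrite big_split.
  rewrite big_split; congr (_ + _) => /=.
  under eq_bigr => p _ do under eq_bigr => q _ do rewrite mulr_sumr.
  under eq_bigr => p _ do rewrite exchange_big.
  rewrite exchange_big mulr_suml; apply: eq_bigr => j _.
  rewrite expr2 /a mulr_suml mulr_suml; apply: eq_bigr => p _.
  rewrite mulr_sumr mulr_suml; apply: eq_bigr => q _; ring.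
by field; rewrite gt_eqF.
Qed.

Let ip0l f : ip mu (fun=> 0) f = 0.
Proof.
transitivity (\int[mu]_z (0 : R)); last by rewrite /Rintegral integral0.
by apply: eq_Rintegral => z _; rewrite mul0r.
Qed.

Let covE l l' : (jj l == jj l')%:R * ip mu (phi l) (phi l') = C' l l'.
Proof.
rewrite /C' /C0; case: l => [j|k]; case: l' => [j'|k'] /=.
- rewrite ip0l mulr0 addr0 (ip_plateau B0) -mulr_suml; congr (_ * _).
  rewrite (bigD1 j)//= eqxx mul1r big1 ?addr0 1?eq_sym// => i /negbTE ij.
  by rewrite [j == i]eq_sym ij mul0r.
- by rewrite ipC ip_resid ip0l !mulr0 big1 ?add0r// => i _; rewrite mulr0 mul0r.
- by rewrite ip_resid [ip mu _ (fun=> 0)]ipC ip0l !mulr0 big1 ?add0r// => i _; rewrite mul0r mul0r.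
- by rewrite big1 ?add0r// => i _; rewrite mul0r mul0r.
Qed.

Let shifted : set (paths R K' * space6) :=
  [set p | adherent (fun k => p.1 (inr k) + p.1 (inl k.1) * g k.1 k.2, p.2)].

Let measurable_shifted : measurable shifted.
Proof.
apply: (@measurable_graph R K _ (paths R K') (@adherent R)
  (fun u k => u (inr k) + u (inl k.1) * g k.1 k.2)); first exact: measurable_adherent.
move=> k; apply: measurable_funD; first exact: measurable_coord.
by apply: measurable_funM; [exact: measurable_coord|exact: measurable_cst].
Qed.

Let mS : measurable [set u : paths R K' | shifted (u, z0)].
Proof.
rewrite (_ : mkset _ = ysection shifted z0); last by apply/seteqP; split => u; rewrite /ysection/= inE.
exact: measurable_ysection.
Qed.

Let graph : set (space6 * Omega) := [set p | shifted (Y' p, z0)].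

Let mgraph : measurable graph.
Proof.
have mY' : measurable_fun setT (Y' : space6 * Omega -> paths R K') by apply: measurable_paths => l; exact: field'.1.
have := mY' measurableT _ mS; rewrite setTI; exact.
Qed.

(** Replacing the tested noise by [z] amounts to adding [c] times the loading to [V], with [c] equal
    to [z] minus the tested noise. The values of [z] to be avoided thus form a translate of
    [target]. *)
Let graphE p : graph p <-> target p.2 (vec6 (fun j => 1 * coord6 p.1 j + - Y p.2 (inl j))).
Proof.
rewrite /graph /shifted /target /=.
suff -> : (fun k => Y' p (inr k) + Y' p (inl k.1) * g k.1 k.2) =
  fun k => V p.2 k + coord6 (vec6 (fun j => 1 * coord6 p.1 j + - Y p.2 (inl j))) k.1 * g k.1 k.2 by [].
apply/funext => k; rewrite coord_vec6 VE /Y' /Y0 big1 => [|j _]; last by rewrite mul0r.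
rewrite (bigD1 k.1)//= eqxx mulr1n big1 => [|j]; first by ring.
by rewrite eq_sym => /negbTE ->; rewrite mul0r.
Qed.

(** By Fubini: for almost every outcome the normal vectors to be avoided form a translate of a
    Lebesgue null set, which the normal law does not charge. *)
Let decoupled_misses : P [set w | adherent (V w, z0)] = 0%E.
Proof.
have L : same_law P (prodm normal6 P) Y Y'.
  apply: (gfield_law _ (wn_field HW T0 jj pphi) field' covE).
  exact: is_prob_prod (is_prob_normal6 R) (probability_setT P).
have E := L _ mS.
have -> : [set w | adherent (V w, z0)] = Y @^-1` [set u : paths R K' | shifted (u, z0)].
  rewrite /preimage /shifted /=; apply/seteqP; split => w /=;
    (suff -> : (fun k => Y w (inr k) + Y w (inl k.1) * g k.1 k.2) = V w by []);
    by apply/funext => k; rewrite VE mulrC.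
rewrite E -[LHS]/(prodm normal6 P graph) prodm_fubini (set_fubini normal6 P mgraph).
have mslice w : measurable [set z | graph (z, w)].
  rewrite (_ : mkset _ = ysection graph w); last by apply/seteqP; split => u; rewrite /ysection/= inE.
  exact: measurable_ysection.
rewrite (ae_eq_integral (fun=> 0%E)); [by rewrite integral0|exact: measurableT| |exact: measurable_cst|].
  exact: measurable_slice2 mgraph.
move: target_null; apply: filterS => w hw _; apply: normal6_null_dominates; first exact: mslice.
move: hw; rewrite (leb6_affine (fun j => - Y w (inl j)) (oner_neq0 R) (mtarget w)).
rewrite normr1 expr1n mul1e => hw; rewrite -[RHS]hw; congr (leb6 _).
by apply/seteqP; split => z /=; [move=> /graphE|move=> ?; apply/graphE].
Qed.

(** Adherence involves countably many values, at which the two versions agree almost surely. *)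
Lemma solution_misses (v : Omega -> K -> R) : (forall k, measurable_fun setT (fun w => v w k)) ->
  (forall k, {ae P, forall w, v w k = wn W T k.1 (mild k.1 (pt 1 B k.2)) w}) ->
  P [set w | adherent (v w, z0)] = 0%E.
Proof.
move=> mv aev.
have aeall : {ae P, forall w, forall n, forall k : K, unpickle n = Some k -> v w k = V w k}.
  apply/ae_foralln => n; case: (unpickle n) => [k|]; last by apply: aeW => w k.
  move: (aev k) (aeX k.1 (in_box_pt1 B k.2)); apply: filterS2 => w e1 e2 _ [<-].
  by rewrite e1 /loc_sol e2.
have mA (y : Omega -> K -> R) : (forall k, measurable_fun setT (fun w => y w k)) ->
    measurable [set w | adherent (y w, z0)].
  move=> my; have := measurable_graph (@measurable_adherent R) my => mg.
  rewrite (_ : mkset _ = ysection [set p : Omega * space6 | adherent (y p.1, p.2)] z0); last first.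
    by apply/seteqP; split => u; rewrite /ysection/= inE.
  exact: measurable_ysection.
apply: measure_negligible; first exact: mA.
have : P.-negligible [set w | adherent (V w, z0)] by apply/negligibleP; [exact: mA|exact: decoupled_misses].
move=> nV; apply: negligibleS (negligibleU nV aeall) => w /= hw.
have [e|] := pselect (forall n k, unpickle n = Some k -> v w k = V w k); [left|by right].
suff <- : v w = V w by exact: hw.
by apply/funext => k; apply: (e (pickle k)); exact: pickleK.
Qed.

End decoupling.

(** * From grid values to points of space-time *)

Lemma measure_bigcup_countable0 (R : realType) d (T : measurableType d) (mu : {measure set T -> \bar R})
    (I : countType) (F : I -> set T) :
  (forall i, measurable (F i)) -> (forall i, mu (F i) = 0%E) -> mu (\bigcup_i F i) = 0%E.
Proof.
move=> mF F0; pose G n := if @unpickle I n is Some i then F i else set0.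
have mG n : measurable (G n) by rewrite /G; case: unpickle => [i|]; [exact: mF|exact: measurable0].
have -> : \bigcup_i F i = \bigcup_n G n.
  apply/seteqP; split => x [i _ Fi]; first by exists (pickle i) => //; rewrite /G pickleK.
  by move: Fi; rewrite /G; case: unpickle => // k Fk; exists k.
apply: measure_negligible; first exact: bigcupT_measurable.
apply: negligible_bigcup => n; apply/negligibleP => //.
by rewrite /G; case: unpickle => [i|]; [exact: F0|exact: measure0].
Qed.

Section level_sets.
Context (R : realType).
Local Notation mR := (measurableTypeR R).
Local Notation space6 := ((mR * (mR * mR)) * (mR * (mR * mR)))%type.
Local Notation K := ('I_6 * grid)%type.

Lemma grid_dense (B p : R * R) (e : R) : in_box B p -> 0 < e -> exists2 q, in_grid q &
  `|(pt 1 B q).1 - p.1| < e /\ `|(pt 1 B q).2 - p.2| < e.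
Proof.
move=> /andP[/andP[p1 p1'] /andP[p2 p2']] e0.
have near_multiple (N : nat) (y : R) : (0 < N)%N -> 0 <= y <= 1 -> e^-1 < N%:R ->
    exists2 i : nat, (i <= N)%N & `|i%:R / N%:R - y| < e.
  move=> N0 /andP[y0 y1] eN; have N0' : 0 < (N%:R : R) by rewrite ltr0n.
  have yN : 0 <= y * N%:R by rewrite mulr_ge0// ltW.
  have /andP[h1 h2] := truncn_itv yN.
  exists (Num.truncn (y * N%:R)).
    by rewrite -(ler_nat R); apply: (le_trans h1); rewrite ler_piMl// ltW.
  have h3 : (Num.truncn (y * N%:R))%:R / N%:R <= y by rewrite ler_pdivrMr.
  have h4 : y < (Num.truncn (y * N%:R))%:R / N%:R + N%:R^-1.
    by rewrite -[X in _ + X]mul1r -mulrDl natr1 ltr_pdivlMr.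
  have h5 : N%:R^-1 < e by rewrite invf_plt// posrE.
  rewrite ler0_norm ?subr_le0//; lra.
pose n := (Num.truncn e^-1).+1.
have en (b : nat) : (1 < b)%N -> e^-1 < (b ^ n)%:R.
  move=> b1; apply: lt_trans (truncnS_gt _) _; rewrite ltr_nat; exact: ltn_expl.
have [i i1 i2] := @near_multiple (16 ^ n)%N (p.1 - B.1) (expn_gt0 16 n) ltac:(apply/andP; split; lra) (en 16%N isT).
have [j j1 j2] := @near_multiple (4 ^ n)%N (p.2 - B.2) (expn_gt0 4 n) ltac:(apply/andP; split; lra) (en 4%N isT).
have hq : in_grid (n, (i, j)) by rewrite /in_grid /= i1.
exists (n, (i, j)) => //; rewrite /pt (clampgK hq) /zoom /grid_pos /= !expr1n !mul1r.
rewrite !natrX in i2 j2; split.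
  by move: i2; congr (`|_| < _); ring.
by move: j2; congr (`|_| < _); ring.
Qed.

Variable f : R * R -> 'rV[R]_6.
Hypothesis cf : {within [set z : R * R | 0 <= z.1], continuous f}.

Lemma coord_continuous_at (p : R * R) j : 0 < p.1 -> {for p, continuous (fun q => f q ord0 j)}.
Proof.
move=> p0.
have oA : open [set z : R * R | 0 < z.1].
  rewrite (_ : mkset _ = fst @^-1` [set x : R | 0 < x]); last by [].
  by apply: open_comp => [z _|]; [exact: cvg_fst|exact: open_gt].
have sub : [set z : R * R | 0 < z.1] `<=` [set z | 0 <= z.1] by move=> z /= /ltW.
have := continuous_subspaceW sub cf; rewrite continuous_open_subspace// => /(_ p).
rewrite inE => /(_ p0) cp.
apply: (@continuous_comp _ _ _ f (fun M : 'rV[R]_6 => M ord0 j)) => //.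
exact: coord_continuous.
Qed.

(** Values attained in the box are limits of grid values by density. Conversely, if [z] is not
    attained, compactness of the closed box gives a uniform distance from [z], which excludes
    adherence. *)
Lemma adherent_level (B : R * R) (z : 'rV[R]_6) : 0 < B.1 ->
  adherent (fun k => f (pt 1 B k.2) ord0 k.1, vec6 (z ord0)) <->
  exists2 p, in_box B p & f p = z.
Proof.
move=> B0; split; last first.
  move=> [p Bp fp] e e0; have p0 : 0 < p.1 by case/andP: Bp => /andP[h _] _; exact: lt_le_trans h.
  have [r r0 hr] := @finite_threshold R 6 (fun j r => forall q : R * R, `|q.1 - p.1| < r -> `|q.2 - p.2| < r ->
    `|f q ord0 j - f p ord0 j| < e) ltac:(move=> j; have [r r0 hr] := continuous_plane_ball (@coord_continuous_at _ j p0) e0;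
     exists r => // r' /andP[_ r'r] q h1 h2; apply: hr; [exact: lt_le_trans r'r|exact: lt_le_trans r'r]).
  have [q hq [q1 q2]] := grid_dense Bp r0.
  exists q => // j; rewrite /= coord_vec6 -fp; apply: (hr r) => //.
  by rewrite r0 lexx.
move=> ad; apply: contrapT => none.
have cK := compact_setX (@segment_compact R B.1 (B.1 + 1)) (@segment_compact R B.2 (B.2 + 1)).
move/compact_near_coveringP : cK => cK.
have boxE p : (`[B.1, (B.1 + 1)] `*` `[B.2, (B.2 + 1)])%classic p -> in_box B p.
  by move=> [/=]; rewrite !in_itv /in_box => -> ->.
pose Q (e : R) (p : R * R) := exists j, e <= `|f p ord0 j - z ord0 j|.
have /cK : forall x, (`[B.1, (B.1 + 1)] `*` `[B.2, (B.2 + 1)])%classic x ->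
    \forall x' \near x & i \near (0 : R)^'+, Q i x'.
  move=> x /boxE Bx; have p0 : 0 < x.1 by case/andP: Bx => /andP[h _] _; exact: lt_le_trans h.
  have [j hj] : exists j, f x ord0 j != z ord0 j.
    apply/existsP; rewrite -negb_forall; apply/negP => /forallP h; apply: none; exists x => //.
    by apply/rowP => j; exact/eqP.
  pose d := `|f x ord0 j - z ord0 j|; have d0 : 0 < d by rewrite normr_gt0 subr_eq0.
  have d2 : 0 < d / 2 by rewrite divr_gt0.
  have [e e0 he] := continuous_plane_ball (@coord_continuous_at _ j p0) d2.
  exists (ball x e, [set i | i < d / 2]).
    by split => /=; [exact: nbhsx_ballx|exact: nbhs_right_lt].
  case=> p i /= [[p1 p2] ie]; exists j; move: p1 p2; rewrite /ball/= => p1 p2.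
  have := he p; rewrite [`|p.1 - _|]distrC [`|p.2 - _|]distrC => /(_ p1 p2).
  have := ler_distD (f p ord0 j) (f x ord0 j) (z ord0 j).
  rewrite -/d [`|f x ord0 j - f p ord0 j|]distrC; lra.
move=> H; near (0 : R)^'+ => e.
have e0 : 0 < e by near: e; exact: nbhs_right_gt.
have hK : (`[B.1, (B.1 + 1)] `*` `[B.2, (B.2 + 1)])%classic `<=` Q e by near: e; exact: H.
have [q hq hj] := ad e e0.
have [|j] := hK (pt 1 B q).
  by have /andP[h1 h2] := in_box_pt1 B q; split; rewrite /= in_itv.
by have := hj j; rewrite /= coord_vec6 ltNge => /negbTE ->.
Unshelve. all: by end_near. Qed.

End level_sets.

Theorem corollary7p7 (R : realType) (d : measure_display)
    (Omega : measurableType d) (P : probability Omega R)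
    (W : 'I_6 -> (R * R -> R) -> {RV P >-> R})
    (sigma : 'I_6 -> R * R -> R)
    (v : Omega -> R * R -> 'rV[R]_6) :
  white_noise W ->
  (forall j, continuous (sigma j)) ->
  (forall j (T : R), 0 <= T -> exists c C : R,
     [/\ 0 < c, c < C & forall t x : R, 0 <= t <= T ->
         c <= sigma j (t, x) <= C]) ->
  (forall j, exists mu : complex_measure R,
     [/\ is_fourier_transform (sigma j) mu, compactly_supported mu &
         (cm_total_variation mu setT < +oo)%E]) ->
  continuous_mild_solution W sigma v ->
  forall z : 'rV[R]_6,
    P [set omega | exists t x : R, 0 < t /\ v omega (t, x) = z] = 0%E.
Proof.
move=> HW cs sb _ [vs cv] z.
(* Closed unit boxes with rational lower corner and [a > 0] cover the points of positive time; a
   positive [a] leaves room for the plateau before the box. *)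
pose B (a b : rat) : R * R := (ratr a, ratr b).
pose Y (a b : rat) w (k : 'I_6 * grid) : R := v w (pt 1 (B a b) k.2) ord0 k.1.
pose E a b : set Omega := if 0 < a then [set w | adherent (Y a b w, vec6 (z ord0))] else set0.
have ptT (a b : rat) q : 0 < a -> 0 <= (pt 1 (B a b) q).1 <= ratr a + 1.
  move=> a0; have /andP[/andP[h ->] _] := in_box_pt1 (B a b) q; rewrite andbT.
  by apply: le_trans h; rewrite /= ler0q ltW.
have mY a b k : 0 < a -> measurable_fun setT (fun w => Y a b w k).
  move=> /(ptT a b k.2) /andP[h _]; have := (vs _ (pt 1 (B a b) k.2).2 k.1 h).1.
  by rewrite -surjective_pairing.
have mE a b : measurable (E a b).
  rewrite /E; case: ifP => // a0.
  have mg := measurable_graph (@measurable_adherent R) (fun k => mY a b k a0).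
  rewrite (_ : mkset _ = ysection [set p | adherent (Y a b p.1, p.2)] (vec6 (z ord0))); last first.
    by apply/seteqP; split => u; rewrite /ysection/= inE.
  exact: measurable_ysection.
have PE a b : P (E a b) = 0%E.
  rewrite /E; case: ifP => [a0|_]; last exact: measure0.
  have a0' : 0 < (ratr a : R) by rewrite ltr0q.
  have T0 : 0 <= (ratr a : R) + 1 by rewrite addr_ge0// ltW.
  (* One lower bound for all six coefficients up to the end of the box; the common upper bound below
     is the sum of the six individual ones. *)
  have [c c0 hc] := @finite_threshold R 6 (fun j c => forall y : R * R, 0 <= y.1 <= ratr a + 1 -> c <= sigma j y)
    (fun j => ltac:(by have [c [C [c0 cC h]]] := sb j _ T0; exists c => // r /andP[_ rc] [t x] /= /(h t x) /andP[+ _]; exact: le_trans)).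
  have /choice[C hC] : forall j, exists C : R, 0 < C /\ forall y : R * R, 0 <= y.1 <= ratr a + 1 -> sigma j y <= C.
    move=> j; have [c' [C [c0' cC h]]] := sb j _ T0; exists C; split; first exact: lt_trans cC.
    by move=> [t x] /= /(h t x) /andP[].
  have sC j y : 0 <= y.1 <= (B a b).1 + 1 -> c <= sigma j y <= \sum_j C j.
    move=> hy; rewrite (hc c (introT andP (conj c0 (lexx c))) j y hy) /=.
    apply: (le_trans ((hC j).2 y hy)); rewrite (bigD1 j)//= lerDl sumr_ge0// => i _.
    exact/ltW/(hC i).1.
  apply: (solution_misses HW (B := B a b) cs a0' c0 sC); first by move=> k; exact: mY.
  move=> k; have /andP[h1 h2] := ptT a b k.2 a0.
  have := (vs _ (pt 1 (B a b) k.2).2 k.1 h1).2; apply: filterS => w.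
  by rewrite -surjective_pairing /Y /wn => ->; rewrite (fold_mild _ h2).
have -> : [set w | exists t x : R, 0 < t /\ v w (t, x) = z] = \bigcup_(a : rat) \bigcup_(b : rat) E a b.
  apply/seteqP; split => w /=.
    move=> [t [x [t0 vz]]].
    have [a] := @rat_in_itvoo R (Num.max 0 (t - 1)) t ltac:(rewrite gt_max t0; lra).
    rewrite in_itv/= gt_max => /andP[/andP[a0 a1] a2].
    have [b] := @rat_in_itvoo R (x - 1) x ltac:(lra); rewrite in_itv/= => /andP[b1 b2].
    exists a => //; exists b => //; rewrite ltr0q in a0; rewrite /E a0.
    apply/(adherent_level (cv w) z (B := B a b)); first by rewrite ltr0q.
    by exists (t, x) => //; rewrite /in_box /=; apply/andP; split; apply/andP; split; lra.
  move=> [a _ [b _]]; rewrite /E; case: ifP => // a0.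
  have a0' : 0 < (B a b).1 by rewrite ltr0q.
  move=> /(adherent_level (cv w) z a0')[[t x] /andP[/andP[h _] _] vz].
  by exists t, x; split => //; exact: lt_le_trans h.
apply: measure_bigcup_countable0 => a; first by apply: bigcupT_measurable_rat => b; exact: mE.
by apply: measure_bigcup_countable0 => b; [exact: mE|exact: PE].
Qed.
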